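(* Let $\Phi\in\mathcal S_{\mathcal L}+\mathcal W_{\mathcal L}$. Then 1. $U_\Phi=U_q$; 2. if $E=\mathbb R$, then $\sigma(u)$ tends to $\infty$ as $u$ approaches the boundary of $U_\Phi$; 3. if $E=\mathbb Z$, then $\sigma$ is bounded and continuous on the closure of $U_\Phi$.
   Context: **Height functions.** Fix $d\ge2$ and $E\in\{\mathbb Z,\mathbb R\}$ with Borel $\sigma$-algebra $\mathcal E$ and reference measure $\lambda$ (counting measure if $E=\mathbb Z$, Lebesgue measure if $E=\mathbb R$). $\Omega$ is the set of functions (height functions) $\phi:\mathbb Z^d\to E$. $\Lambda\subset\subset\mathbb Z^d$ means that $\Lambda$ is a finite subset; $\Pi_n=[0,n)^d\cap\mathbb Z^d$; $d_1$ is the graph metric of the square lattice. For $\Lambda\subset\mathbb Z^d$: $\mathcal F_\Lambda=\sigma(\phi(x):x\in\Lambda)$, $\mathcal F=\mathcal F_{\mathbb Z^d}$, $\mathcal F^\nabla_\Lambda=\sigma(\phi(y)-\phi(x):x,y\in\Lambda)$, $\mathcal F^\nabla=\mathcal F^\nabla_{\mathbb Z^d}$. $\mathcal L$ is a fixed full-rank sublattice of $\mathbb Z^d$, $\Theta=\{\theta_x:x\in\mathcal L\}$ with $\theta_x(y)=y+x$, and $(\theta\phi)(x)=\phi(\theta x)$. $\mathcal P_{\mathcal L}(\Omega,\mathcal F^\nabla)$ is the set of probability measures on $(\Omega,\mathcal F^\nabla)$ under which $\phi$ and $\theta\phi$ have the same distribution for all $\theta\in\Theta$. If all increments are $\mu$-integrable,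 the slope $S(\mu)\in(\mathbb R^d)^*$ is the unique linear functional with $S(\mu)(x)=\mu(\phi(x)-\phi(0))$ for $x\in\mathcal L$. **Potentials.** A periodic gradient potential is a family $\Phi=(\Phi_\Lambda)_{\Lambda\subset\subset\mathbb Z^d}$ of $\mathcal F^\nabla_\Lambda$-measurable functions $\Phi_\Lambda:\Omega\to\mathbb R\cup\{\infty\}$ with $\Phi_\Lambda\equiv0$ if $|\Lambda|\le1$ and $\Phi_{\theta\Lambda}(\phi)=\Phi_\Lambda(\theta\phi)$ for $\theta\in\Theta$. For $\Lambda\subset\subset\mathbb Z^d$ and $\Lambda\subset\Delta\subset\mathbb Z^d$ put $H^\Phi_{\Lambda,\Delta}=\sum_{\Gamma\subset\subset\mathbb Z^d,\,\Gamma\subset\Delta,\,\Gamma\cap\Lambda\ne\emptyset}\Phi_\Gamma$, $H_\Lambda=H_{\Lambda,\mathbb Z^d}$, $H^0_\Lambda=H_{\Lambda,\Lambda}$. **Local Lipschitz constraints.** An admissible graph is an $\mathcal L$-invariant edge set $\mathbb A$ on $\mathbb Z^d$ making $(\mathbb Z^d,\mathbb A)$ a connected graph of bounded degree. An admissible quasimetric is a function $q:\mathbb Z^d\times\mathbb Z^d\to\mathbb R$ with $q(x,x)=0$, $q(x,y)+q(y,x)>0$ for $x\neq y$, $q(x,z)\le q(x,y)+q(y,z)$, and $q(\theta x,\theta y)=q(x,y)$ for $\theta\in\Theta$. A local Lipschitz constraint is a pair $(\mathbb A,q)$ of such objects such that $p\le q$ for every admissible quasimetric $p$ with $p(x,y)\le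 q(x,y)$ for all $\{x,y\}\in\mathbb A$; without loss of generality $\mathbb A$ contains the edges of the square lattice. For sufficiently small $\varepsilon\ge0$, $q_\varepsilon$ is the largest admissible quasimetric with $q_\varepsilon(x,y)\le q(x,y)-\varepsilon$ for all $\{x,y\}\in\mathbb A$. A function $\phi$ on a subset of $\mathbb Z^d$ is $q$-Lipschitz if $\phi(y)-\phi(x)\le q(x,y)$ for all $x,y$ in it, and $q$-Lipschitz at $z$ if this holds for all $\{x,y\}\in\mathbb A$ containing $z$. $U_q$ is the interior of the set of $u\in(\mathbb R^d)^*$ such that $u|_{\mathcal L}$ is $q$-Lipschitz. **Strong interactions $\mathcal S_{\mathcal L}$.** Periodic gradient potentials $\Psi$ that are nonnegative, of finite range ($\Psi_\Lambda\equiv0$ when the $d_1$-diameter of $\Lambda$ exceeds some constant), Lipschitz (there is a local Lipschitz constraint $(\mathbb A,q)$, with $q$ integer-valued if $E=\mathbb Z$, such that $\Psi_\Lambda(\phi)=\infty$ iff $\Lambda=\{x,y\}\in\mathbb A$ and $\phi(y)-\phi(x)>q(x,y)$ for some $x,y$), and, if $E=\mathbb R$, locally bounded: for all small $\varepsilon>0$ there is $C_\varepsilon<\infty$ with $H^\Psi_{\{x\}}(\phi)\le C_\varepsilon$ for all $x$ and all $\phi\in\Omega$ that are $q_\varepsilon$-Lipschitz at $x$. **Weak interactions $\mathcal W_{\mathcal L}$.** Periodic gradient potentials $\Xi$ with $\|\Xi\|:=\sup_{x,\phi}\sum_{\Lambda\ni x}|\Xi_\Lambda(\phi)|<\infty$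 and with amenable lower exterior bound $e^-(\Lambda):=\sup_{\phi}\sum_{\Delta\subset\subset\mathbb Z^d,\ \Delta\cap\Lambda\neq\emptyset,\ \Delta\not\subset\Lambda}|\Xi_\Delta(\phi)|$. A function $f\ge0$ on finite subsets of $\mathbb Z^d$ is amenable if it is $\Theta$-invariant, $f(\Lambda\cup\Delta)\le f(\Lambda)+f(\Delta)$ for disjoint $\Lambda,\Delta$, and $f(\Lambda_n)=o(|\Lambda_n|)$ along every Van Hove sequence (finite $\Lambda_n$ with $|\Lambda_n|\to\infty$, $|\partial\Lambda_n|/|\Lambda_n|\to0$, $\partial\Lambda$ being the set of vertices adjacent to $\Lambda$). $\Phi\in\mathcal S_{\mathcal L}+\mathcal W_{\mathcal L}$ means $\Phi=\Psi+\Xi$ with $\Psi\in\mathcal S_{\mathcal L}$, $\Xi\in\mathcal W_{\mathcal L}$; such a decomposition is fixed and $(\mathbb A,q)$ is the local Lipschitz constraint of $\Psi$. **Free energy and surface tension.** Relative entropy: $\mathcal H(\mu|\nu)=\mu(\log\frac{d\mu}{d\nu})$ if $\mu\ll\nu$ and $\infty$ otherwise. $\lambda^{\Lambda-1}$ is the measure on $(\Omega,\mathcal F^\nabla_\Lambda)$ which, for any choice of $x\in\Lambda$, corresponds to $\lambda^{\Lambda\smallsetminus\{x\}}$ under $\phi\mapsto(\phi(y)-\phi(x))_{y\in\Lambda\smallsetminus\{x\}}$. $\mathcal H_\Lambda(\mu|\Phi):=\mathcal H(\mu|_{\mathcal F^\nabla_\Lambda}\,|\,\lambda^{\Lambda-1})+\mu(H^0_\Lambda)$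 (with $\infty-\infty=\infty$); specific free energy $\mathcal H(\mu|\Phi):=\lim_n n^{-d}\mathcal H_{\Pi_n}(\mu|\Phi)$; surface tension $\sigma(u):=\inf\{\mathcal H(\mu|\Phi):\mu\in\mathcal P_{\mathcal L}(\Omega,\mathcal F^\nabla),\ S(\mu)=u\}$, a convex function $(\mathbb R^d)^*\to\mathbb R\cup\{\infty\}$; $U_\Phi$ is the interior of $\{\sigma<\infty\}$. *)

(* Defs.v *)
From HB Require Import structures.
From mathcomp Require Import all_boot all_order all_algebra finmap.
From mathcomp Require Import all_classical all_reals all_analysis.
From mathcomp Require Import measurable_realfun.

Set Implicit Arguments.
Unset Strict Implicit.
Unset Printing Implicit Defensive.

Import Order.TTheory GRing.Theory Num.Theory.
Import numFieldNormedType.Exports.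

Local Open Scope classical_set_scope.
Local Open Scope ring_scope.

HB.instance Definition _ := isPointed.Build int 0.

HB.instance Definition _ := @isMeasurable.Build default_measure_display int
  discrete_measurable discrete_measurable0
  discrete_measurableC discrete_measurableU.

Section counting_int.
Variable R : realType.

Lemma sigma_finite_counting_int : sigma_finite [set: int] (@counting int R).
Proof.
exists (fun n : nat => [set x : int | (`|x| < n)%N]).
  by apply/esym; rewrite -subTset => x _; exists `|x|.+1%N => /=.
move=> n; split => //.
rewrite /counting asboolT ?ltry//.
apply: (@sub_finite_set _ _
  ((fun k : nat => k%:Z) @` `I_n `|` (fun k : nat => - k%:Z) @` `I_n)).
  move=> x /= xn; case: (ltP x 0) => x0.
    by right; exists `|x|%N => //=; rewrite ltz0_abs// opprK.
  by left; exists `|x|%N => //=; rewrite gez0_abs.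
by rewrite finite_setU; split; apply: finite_image; exact: finite_II.
Qed.

HB.instance Definition _ :=
  @Measure_isSigmaFinite.Build _ int R (@counting int R) sigma_finite_counting_int.

End counting_int.

(* The space E of height values: a measurable space with its reference measure
   lambda, its zero and subtraction, and its inclusion into the real line. *)
Record height_space (R : realType) := HeightSpace {
  hs_disp : measure_display ;
  hs_sort :> measurableType hs_disp ;
  hs_ref : {sigma_finite_measure set hs_sort -> \bar R} ;
  hs_incl : hs_sort -> R ;
  hs_zero : hs_sort ;
  hs_sub : hs_sort -> hs_sort -> hs_sort ;
  hs_subx0 : right_id hs_zero hs_sub ;
  hs_sub_measurable :
    measurable_fun [set: hs_sort * hs_sort] (fun p => hs_sub p.1 p.2) }.

Lemma subz_measurable :
  measurable_fun [set: int * int] (fun p : int * int => p.1 - p.2).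
Proof.
move=> _ Y _; rewrite setTI; apply: countable_measurable => [[a b]|].
  have -> : [set (a, b)] = [set a] `*` [set b].
    by apply/seteqP; split => [_ ->|[a0 b0] [/= -> ->]].
  exact: measurableX.
exact: countableP.
Qed.

Definition Zheights (R : realType) : height_space R :=
  @HeightSpace R _ int (@counting int R) intr 0 (fun a b => a - b)
    (@subr0 _) subz_measurable.

Lemma subR_measurable (R : realType) :
  measurable_fun [set: measurableTypeR R * measurableTypeR R]
    (fun p : measurableTypeR R * measurableTypeR R =>
       (p.1 : R) - p.2 : measurableTypeR R).
Proof.
apply: measurable_funB; [exact: measurable_fst|exact: measurable_snd].
Qed.

Definition Rheights (R : realType) : height_space R :=
  @HeightSpace R _ (measurableTypeR R) (@lebesgue_measure R) (fun a : R => a) (0 : R)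
    (fun a b : R => a - b) (@subr0 R) (@subR_measurable R).

Inductive height_kind := IntegerHeights | RealHeights.

Definition heights (R : realType) (k : height_kind) : height_space R :=
  match k with IntegerHeights => Zheights R | RealHeights => Rheights R end.

Section image_measure.
Context d d' (T : measurableType d) (T' : measurableType d') (R : realType).
Variables (m : {sigma_finite_measure set T -> \bar R}).
Variables (f : T -> T') (g : T' -> T).
Hypotheses (mf : measurable_fun [set: T] f) (mg : measurable_fun [set: T'] g).
Hypothesis fK : cancel f g.

(* The image of m under an injection f with measurable left inverse g. *)
Definition image_measure of measurable_fun [set: T] f &
  measurable_fun [set: T'] g & cancel f g := pushforward m f.

Local Notation im := (image_measure mf mg fK).

Let im0 : im set0 = 0%E.
Proof. by rewrite /image_measure /pushforward preimage_set0 measure0. Qed.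

Let im_ge0 A : (0 <= im A)%E. Proof. exact: measure_ge0. Qed.

Let im_sigma_additive : semi_sigma_additive im.
Proof. exact: (@measure_semi_sigma_additive _ _ _ (measure_function_pushforward__canonical__measure_function_Measure m mf)). Qed.

HB.instance Definition _ :=
  isMeasure.Build _ _ _ im im0 im_ge0 im_sigma_additive.

Let im_sigma_finite : sigma_finite [set: T'] im.
Proof.
have [F TF Foo] := sigma_finiteT m.
exists (fun n => g @^-1` F n); first by rewrite -preimage_bigcup -TF.
move=> n; have [mF Fn] := Foo n; split.
  by rewrite -[X in measurable X]setTI; exact: mg.
rewrite /image_measure /pushforward -comp_preimage.
by rewrite (_ : g \o f = id) ?preimage_id//; apply/funext => x /=; rewrite fK.
Qed.

HB.instance Definition _ := @Measure_isSigmaFinite.Build _ _ _ im im_sigma_finite.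

End image_measure.

Section sigma_finite_product.
Context d1 d2 (T1 : measurableType d1) (T2 : measurableType d2) (R : realType).
Variables (m1 : {sigma_finite_measure set T1 -> \bar R})
          (m2 : {sigma_finite_measure set T2 -> \bar R}).

(* An alias, because the sigma-finite instance of m1 \x m2 is only inferred
   when m1 and m2 are finite. *)
Definition sigma_product : set (T1 * T2) -> \bar R := (m1 \x m2)%E.

HB.instance Definition _ := Measure.copy sigma_product (m1 \x m2)%E.

HB.instance Definition _ := @Measure_isSigmaFinite.Build _ _ _ sigma_product
  (lebesgue_integral_fubini.product_measure_sigma_finite_subproof m1 m2).

End sigma_finite_product.

Section power_measure.
Context d (T : measurableType d) (R : realType).
Variable m : {sigma_finite_measure set T -> \bar R}.

Let tcons n (p : T * n.-tuple T) : n.+1.-tuple T := [the n.+1.-tuple T of p.1 :: p.2].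
Let tuncons n (t : n.+1.-tuple T) : T * n.-tuple T := (thead t, [tuple of behead t]).

Let mtcons n : measurable_fun [set: T * n.-tuple T] (@tcons n).
Proof. exact: measurable_cons. Qed.

Let mtuncons n : measurable_fun [set: n.+1.-tuple T] (@tuncons n).
Proof.
apply: measurable_fun_pair; [exact: measurable_tnth|exact: measurable_behead].
Qed.

Let tconsK n : cancel (@tcons n) (@tuncons n).
Proof. by move=> [x t]; congr pair; apply: val_inj. Qed.

(* The n-fold product measure on n-tuples *)
Fixpoint power_measure (n : nat) : {sigma_finite_measure set (n.-tuple T) -> \bar R} :=
  match n with
  | 0 => dirac ([tuple] : 0.-tuple T)
  | n'.+1 => image_measure (sigma_product m (power_measure n')) (@mtcons n') (@mtuncons n') (@tconsK n')
  end.

End power_measure.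

Definition site (d : nat) := 'rV[int]_d.

Section gradient_fields.
Context (R : realType) (E : height_space R) (d : nat).

Definition config := site d -> E.

(* phi(y) - phi(x), viewed as a real number *)
Definition increment (phi : config) (x y : site d) : R :=
  hs_incl (hs_sub (phi y) (phi x)).

Definition gradient_events (D : set (site d)) : set (set config) :=
  [set A | exists x y (B : set E), [/\ D x, D y, measurable B &
     A = [set phi : config | B (hs_sub (phi y) (phi x))]]].

(* Omega equipped with the sigma-algebra F^nabla_D *)
Definition gradT (D : set (site d)) := g_sigma_algebraType (gradient_events D).

Definition restrict (D : set (site d)) : gradT setT -> gradT D := fun phi => phi.

Lemma restrict_measurable D : measurable_fun [set: gradT setT] (restrict D).
Proof.
have := (@measurability _ _ (gradT setT) (gradT D) setT (restrict D) (gradient_events D) erefl).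
apply.
move=> _ [_ [x [y [B [Dx Dy mB ->]]]] <-]; rewrite setTI.
by apply: sub_sigma_algebra; exists x, y, B.
Qed.

HB.instance Definition _ D :=
  isMeasurableFun.Build _ _ _ _ (restrict D) (@restrict_measurable D).

Section reference.
Variable L : {fset site d}.

(* The base point x is the first element nth 0 L 0 of the enumeration of L:
   glue t vanishes at x (and outside L) and takes the values t on L minus x.
   The sets in F^nabla_L do not see the values outside L, and the resulting
   measure does not depend on the base point since hs_ref is translation
   invariant. *)
Definition glue (t : (#|` L|).-1.-tuple E) : gradT [set` L] :=
  fun y => nth (hs_zero E) (hs_zero E :: t) (index y L).

Definition unglue (phi : gradT [set` L]) : (#|` L|).-1.-tuple E :=
  [tuple hs_sub (phi (nth 0 L i.+1)) (phi (nth 0 L 0)) | i < (#|` L|).-1].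

Lemma glue_measurable : measurable_fun [set: (#|` L|).-1.-tuple E] glue.
Proof.
have := (@measurability _ _ _ (gradT [set` L]) setT glue (gradient_events [set` L]) erefl).
apply.
move=> _ [_ [x [y [B [Lx Ly mB ->]]]] <-].
have mcoord z : z \in L -> measurable_fun [set: (#|` L|).-1.-tuple E]
    (fun t => glue t z).
  rewrite /glue -[z \in L]/(z \in (L : seq _)) -index_mem => zL.
  move: zL; case: (index z L) => [|i] iL; first exact: measurable_cst.
  have iL' : (i < (#|` L|).-1)%N by rewrite -ltnS (ltn_predK iL).
  rewrite [X in measurable_fun _ X](_ : _ = fun t => tnth t (Ordinal iL')).
    exact: measurable_tnth.
  by apply/funext => t /=; rewrite (tnth_nth (hs_zero E)).
have := measurableT_comp (@hs_sub_measurable R E)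
  (measurable_fun_pair (mcoord _ Ly) (mcoord _ Lx)).
by move=> /(_ measurableT B mB).
Qed.

Lemma unglue_measurable : measurable_fun [set: gradT [set` L]] unglue.
Proof.
apply/measurable_fun_tnthP => i.
move=> _ B mB; rewrite setTI.
apply: sub_sigma_algebra.
have iL : (i.+1 < #|` L|)%N by rewrite -ltn_predRL; exact: ltn_ord.
exists (nth 0 L 0), (nth 0 L i.+1), B; split => //.
- by apply: mem_nth; apply: leq_trans iL.
- exact: mem_nth.
- by apply/seteqP; split => phi /=; rewrite tnth_mktuple.
Qed.

Lemma glueK : cancel glue unglue.
Proof.
move=> t; apply: eq_from_tnth => i; rewrite tnth_mktuple /glue.
have iL : (i.+1 < #|` L|)%N by rewrite -ltn_predRL; exact: ltn_ord.
rewrite !index_uniq ?fset_uniq ?(leq_trans _ iL)//= hs_subx0.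
by rewrite (tnth_nth (hs_zero E)).
Qed.

(* lambda^{L-1} *)
Definition gradient_reference : {sigma_finite_measure set (gradT [set` L]) -> \bar R} :=
  image_measure (power_measure (hs_ref E) (#|` L|).-1)
    glue_measurable unglue_measurable glueK.

End reference.
End gradient_fields.

Section lattice.
Context (R : realType) (d : nat).

Definition full_rank_sublattice (L : set (site d)) : Prop :=
  exists2 B : 'M[int]_d, \det B != 0 & L = [set z *m B | z in [set: 'rV[int]_d]].

(* The graph distance of the square lattice *)
Definition d1 (x y : site d) : nat := (\sum_(i < d) `|x 0%R i - y 0%R i|)%N.

Definition translate (x : site d) (Lambda : {fset site d}) : {fset site d} :=
  [fset (y + x)%R | y in Lambda]%fset.

(* fset_set is applied here and below to finite sets only, where it is the
   identity up to the representation of the set. *)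
Definition box (n : nat) : {fset site d} :=
  fset_set [set x : site d | forall i, 0 <= x 0 i < n%:Z].

Definition boundary (Lambda : {fset site d}) : {fset site d} :=
  fset_set [set y : site d |
    y \notin Lambda /\ exists2 x, x \in Lambda & d1 x y = 1%N].

Definition van_hove (Lambda : nat -> {fset site d}) : Prop :=
  (#|` Lambda n|)%N @[n --> \oo] --> \oo /\
  (#|` boundary (Lambda n)|%:R / #|` Lambda n|%:R : R) @[n --> \oo] --> 0.

Definition amenable (L : set (site d)) (f : {fset site d} -> \bar R) : Prop :=
  [/\ forall Lambda, (0 <= f Lambda)%E,
      forall x Lambda, L x -> f (translate x Lambda) = f Lambda,
      forall Lambda Delta, [disjoint Lambda & Delta]%fset ->
        (f (Lambda `|` Delta)%fset <= f Lambda + f Delta)%E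
    & forall Lambda, van_hove Lambda ->
        (f (Lambda n) * ((#|` Lambda n|%:R)^-1)%:E)%E @[n --> \oo] --> 0%E].

(* u(x), for u in the dual of R^d represented by a row vector *)
Definition pairing (u : 'rV[R]_d) (x : site d) : R :=
  \sum_(i < d) u 0 i * (x 0 i)%:~R.

(* An edge {x, y} is the two-element finite set [fset x; y]. *)
Definition admissible_graph (L : set (site d)) (A : set {fset site d}) : Prop :=
  [/\ forall e, A e -> #|` e| = 2%N,
      forall x e, L x -> A e -> A (translate x e),
      forall x y, exists2 s : seq (site d),
        path (fun a b => `[< A [fset a; b]%fset >]) x s & last x s = y
    & exists n : nat, forall x, exists2 N : {fset site d},
        (#|` N| <= n)%N & forall y, A [fset x; y]%fset -> y \in N].

Definition admissible_quasimetric (L : set (site d)) (q : site d -> site d -> R) :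
    Prop :=
  [/\ forall x, q x x = 0,
      forall x y, x != y -> 0 < q x y + q y x,
      forall x y z, q x z <= q x y + q y z
    & forall t x y, L t -> q (x + t) (y + t) = q x y].

Definition local_lipschitz_constraint (L : set (site d))
    (A : set {fset site d}) (q : site d -> site d -> R) : Prop :=
  [/\ admissible_graph L A, admissible_quasimetric L q
    & forall p, admissible_quasimetric L p ->
        (forall x y, A [fset x; y]%fset -> p x y <= q x y) ->
        forall x y, p x y <= q x y].

(* qe is the largest admissible quasimetric below q - eps on the edges. *)
Definition is_q_eps (L : set (site d)) (A : set {fset site d})
    (q : site d -> site d -> R) (eps : R) (qe : site d -> site d -> R) : Prop :=
  let below p := admissible_quasimetric L p /\
    forall x y, A [fset x; y]%fset -> p x y <= q x y - eps in
  below qe /\ forall p, below p -> forall x y, p x y <= qe x y.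

Definition U_q (L : set (site d)) (q : site d -> site d -> R) : set 'rV[R]_d :=
  [set u | forall x y, L x -> L y -> pairing u y - pairing u x <= q x y]°.

End lattice.

(* The integral of f with the convention oo - oo = oo; the subtraction in %dE
   is the one for which +oo - +oo = +oo. *)
Definition quasi_integral dT (T : measurableType dT) (R : realType)
    (mu : {measure set T -> \bar R}) (f : T -> \bar R) : \bar R :=
  ((\int[mu]_t f^\+ t)%E - (\int[mu]_t f^\- t)%E)%dE.

Definition relative_entropy dT (T : measurableType dT) (R : realType)
    (mu : probability T R) (nu : {sigma_finite_measure set T -> \bar R}) : \bar R :=
  if `[< mu `<< nu >]
  then quasi_integral mu (fun t => 
    lne (Radon_Nikodym (charge_of_finite_measure mu) nu t))
  else +oo%E.

Section potentials.
Context (R : realType) (k : height_kind) (d : nat).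
Let E := heights R k.
Implicit Types (L : set (site d)) (Lambda Delta Gamma : {fset site d}).

Definition potential := {fset site d} -> config E d -> \bar R.

Definition shift (x : site d) (phi : config E d) : config E d :=
  fun y => phi (y + x).

Definition periodic_gradient_potential L (Phi : potential) : Prop :=
  [/\ forall Lambda,
        measurable_fun [set: gradT E [set` Lambda]] (Phi Lambda),
      forall Lambda phi, Phi Lambda phi != -oo%E,
      forall Lambda phi, (#|` Lambda| <= 1)%N -> Phi Lambda phi = 0%E
    & forall x Lambda phi, L x ->
        Phi (translate x Lambda) phi = Phi Lambda (shift x phi)].

(* H_{Lambda,D}. The sum of the negative parts is finite for the potentials of
   interest, so that no indeterminate form arises. *)
Definition hamiltonian (Phi : potential) Lambda (D : set (site d))
    (phi : config E d) : \bar R :=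
  let I := [set Gamma : {fset site d} |
    [set` Gamma] `<=` D /\ (Gamma `&` Lambda)%fset != fset0] in
  (\esum_(Gamma in I) ((Phi ^~ phi)^\+ Gamma)%E -
   \esum_(Gamma in I) ((Phi ^~ phi)^\- Gamma)%E)%E.

Definition q_lipschitz_at (A : set {fset site d}) (q : site d -> site d -> R)
    (phi : config E d) (z : site d) : Prop :=
  forall x y, A [fset x; y]%fset -> z \in [fset x; y]%fset ->
    increment phi x y <= q x y.

Definition finite_range (Psi : potential) : Prop :=
  exists r : nat, forall Lambda,
    (exists x y, [/\ x \in Lambda, y \in Lambda & (r < d1 x y)%N]) ->
    forall phi, Psi Lambda phi = 0%E.

Definition lipschitz_potential (A : set {fset site d})
    (q : site d -> site d -> R) (Psi : potential) : Prop :=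
  forall Lambda phi, Psi Lambda phi = +oo%E <->
    exists x y, [/\ Lambda = [fset x; y]%fset, A [fset x; y]%fset
                  & q x y < increment phi x y].

Definition locally_bounded L (A : set {fset site d})
    (q : site d -> site d -> R) (Psi : potential) : Prop :=
  exists2 eps0 : R, 0 < eps0 & forall eps, 0 < eps < eps0 ->
    exists2 qe, is_q_eps L A q eps qe &
      exists C : R, forall x phi, q_lipschitz_at A qe phi x ->
        (hamiltonian Psi [fset x]%fset setT phi <= C%:E)%E.

Definition strong_interaction L (A : set {fset site d})
    (q : site d -> site d -> R) (Psi : potential) : Prop :=
  [/\ periodic_gradient_potential L Psi,
      forall Lambda phi, (0 <= Psi Lambda phi)%E,
      finite_range Psi,
      local_lipschitz_constraint L A q /\ lipschitz_potential A q Psi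
    & match k with
      | IntegerHeights => forall x y, q x y \is a Num.int
      | RealHeights => locally_bounded L A q Psi
      end].

Definition interaction_norm (Xi : potential) : \bar R :=
  ereal_sup [set h | exists x phi,
    h = \esum_(Lambda in [set Lambda : {fset site d} | x \in Lambda]) `|Xi Lambda phi|%E].

Definition lower_exterior_bound (Xi : potential) Lambda : \bar R :=
  ereal_sup [set h | exists phi,
    h = \esum_(Delta in [set Delta : {fset site d} | (Delta `&` Lambda)%fset != fset0 /\
                                     ~~ (Delta `<=` Lambda)%fset])
          `|Xi Delta phi|%E].

Definition weak_interaction L (Xi : potential) : Prop :=
  [/\ periodic_gradient_potential L Xi, (interaction_norm Xi < +oo)%E
    & amenable L (lower_exterior_bound Xi)].

(* Probability measures on (Omega, F^nabla) *)
Definition gradient_measure := probability (gradT E [set: site d]) R.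

Definition shift_invariant L (mu : gradient_measure) : Prop :=
  forall x (B : set (gradT E [set: site d])), L x -> measurable B ->
    mu (shift x @^-1` B) = mu B.

Definition has_slope L (mu : gradient_measure) (u : 'rV[R]_d) : Prop :=
  (forall x y, mu.-integrable setT (fun phi => (increment phi x y)%:E)) /\
  (forall x, L x -> (\int[mu]_phi (increment phi 0 x)%:E)%E = (pairing u x)%:E).

(* The addition in %dE is the one for which -oo + +oo = +oo. *)
Definition free_energy (Phi : potential) Lambda (mu : gradient_measure) : \bar R :=
  (relative_entropy (distribution mu (@restrict R E d [set` Lambda]))
                    (gradient_reference E Lambda) +
   quasi_integral mu (hamiltonian Phi Lambda [set` Lambda]))%dE.

Definition specific_free_energy (Phi : potential) (mu : gradient_measure) : \bar R :=
  limn (fun n => ((n%:R ^+ d)^-1)%:E * free_energy Phi (box d n) mu)%E.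

Definition surface_tension L (Phi : potential) (u : 'rV[R]_d) : \bar R :=
  ereal_inf [set h | exists mu : gradient_measure,
    [/\ shift_invariant L mu, has_slope L mu u & h = specific_free_energy Phi mu]].

Definition U_Phi L (Phi : potential) : set 'rV[R]_d :=
  [set u | (surface_tension L Phi u < +oo)%E]°.

End potentials.

(* Main.v *)
(* By superadditivity of entropy over disjoint volumes (up to the logarithm of the
   range of one joining increment) and amenability, the specific free energy is a
   limit which is bounded below by (H_box(mu) - err m) / m^d on each box of side m,
   with err m = o(m^d).  It is infinite unless mu is almost surely q-Lipschitz, in
   which case the slope lies in the closed set K of slopes u with u|L q-Lipschitz,
   whose interior is U_q.

   E = R: an interior slope u has a quasi-periodic height function g with
   increments at distance at least eta from q on all edges; g plus small independent
   uniform noise has finite specific free energy.  Near the boundary of K an edge is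
   almost frozen, so that its entropy, hence the free energy of a box, is large.

   E = Z: rounding g + U for a q-Lipschitz quasi-periodic g and a uniform U gives a
   measure of slope u, and a bound on the surface tension uniform over K.  The free
   energy of a box is a finite sum of terms x ln x + h x in the pattern
   probabilities.  Its convexity, together with K being a polyhedron, gives upper
   semicontinuity; its lower semicontinuity, together with compactness of the
   gradient laws of q-Lipschitz functions, gives lower semicontinuity. *)

Require Import Defs.
From HB Require Import structures.
From mathcomp Require Import all_boot all_order all_algebra finmap.
From mathcomp Require Import all_classical all_reals all_analysis.
From mathcomp Require Import measurable_realfun lra ring zify.

Set Implicit Arguments.
Unset Strict Implicit.
Unset Printing Implicit Defensive.

Import Order.TTheory GRing.Theory Num.Theory.
Import numFieldNormedType.Exports.

Local Open Scope classical_set_scope.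
Local Open Scope ring_scope.

(** * Quasi-integrals and relative entropy *)

(** Entropy enters through Gibbs' inequality: the entropy of a marginal is at least the mean
    logarithm of any subdensity, with equality for its density when there is one. Superadditivity,
    translation and the cost of a nearly frozen edge thus become choices of test densities. The
    convention oo - oo = oo is tamed by keeping to functions with integrable negative part.

    Only shifts by [L] preserve the laws, so bounds propagate along boxes whose side is a multiple
    of some [m0] with [m0] Z^d inside [L]. The maximality of [q] acts through one consequence: a
    function that obeys the constraint on the edges obeys it between all sites.

    All random fields are functions of a single uniform variable. Its binary digits, split again and
    again, give independent noise; it is the offset in the rounding of integer heights; and its
    position among nested cells realises a limit law. That last construction provides the
    compactness: along an ultrafilter the probabilities of all finite bit patterns converge at once,
    and the limits are consistent. *)

Lemma measurable_lne (R : realType) : measurable_fun [set: \bar R] (@lne R).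
Proof.
apply: (measurability _ (ErealGenOInfty.measurableE R)) => //.
move=> _ [_ [r ->] <-]; rewrite setTI.
have -> : (@lne R) @^-1` [set` Interval (BRight r%:E) +oo%O]%classic =
    [set` Interval (BRight (expR r)%:E) +oo%O]%classic.
  apply/seteqP; split => x /=; rewrite !in_itv /= !andbT.
    move=> rx; rewrite ltNge; apply/negP => xr.
    have [x0|x0] := leP x 0%E; first by rewrite le0_lneNy// in rx.
    move: rx; rewrite ltNge => /negP; apply.
    by rewrite -[leRHS](@expeRK R) lee_lne//= in_itv/= leey ?expR_ge0 ?andbT ?(ltW x0)// lee_fin expR_ge0.
  move=> rx; rewrite -[ltLHS](@expeRK R) lte_lne//= in_itv/= leey ?expeR_ge0//.
    by rewrite andbT lee_fin expR_ge0.
by rewrite andbT (le_trans _ (ltW rx))// lee_fin expR_ge0.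
exact: emeasurable_itv.
Qed.

(** The letters stand for the integrals of the positive parts ([A], [p], [q]) and negative parts
    ([N], [a], [b]) of f + g, f and g. Finiteness of the negative ones allows the equality of sums
    to be rearranged into differences. *)
Lemma quasi_integral_arith (R : realDomainType) (A N p q a b : \bar R) :
  (0 <= A -> 0 <= N -> 0 <= p -> 0 <= q -> 0 <= a -> 0 <= b ->
   a < +oo -> b < +oo -> N < +oo -> A + (a + b) = N + (p + q) ->
   A - N = p - a + (q - b))%E.
Proof.
case: A N p q a b => [A| |] [N| |] [p| |] [q| |] [a| |] [b| |] //= *.
by congr EFin; match goal with H : _ = _ |- _ => move: H end => -[] /(congr1 (fun x => x - a - b - N)); lra.
Qed.

Section quasi_integral.
Local Open Scope ereal_scope.
Context dT (T : measurableType dT) (R : realType) (mu : {measure set T -> \bar R}).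
Implicit Types f g : T -> \bar R.

Lemma le_quasi_integral f g : measurable_fun setT f -> measurable_fun setT g ->
  {ae mu, forall x, f x <= g x} -> quasi_integral mu f <= quasi_integral mu g.
Proof.
move=> mf mg fg; rewrite /quasi_integral; apply: DualAddTheoryRealDomain.lee_dB.
  apply: ae_ge0_le_integral => //; do ?exact: measurable_funepos.
  by apply: filterS fg => x fg _; rewrite !funeposE ge_max !le_max fg/= lexx orbT.
apply: ae_ge0_le_integral => //; do ?exact: measurable_funeneg.
by apply: filterS fg => x fg _; rewrite !funenegE ge_max !le_max leeN2 fg/= lexx orbT.
Qed.

Lemma eq_quasi_integral f g : measurable_fun setT f -> measurable_fun setT g ->
  {ae mu, forall x, f x = g x} -> quasi_integral mu f = quasi_integral mu g.
Proof.
move=> mf mg fg; apply/eqP; rewrite eq_le; apply/andP; split;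
  apply: le_quasi_integral => //; by apply: filterS fg => x ->.
Qed.

Lemma funeposneg_add (a b : \bar R) :
  maxe (a + b) 0 + (maxe (- a) 0 + maxe (- b) 0) =
  maxe (- (a + b)) 0 + (maxe a 0 + maxe b 0).
Proof.
have maxyl (x : \bar R) : maxe +oo x = +oo by rewrite /maxe; case: ifP => //; rewrite ltNge leey.
have maxNl : maxe -oo (0 : \bar R) = 0 by rewrite /maxe ltNyr.
have m0 (x : \bar R) : maxe x 0 != -oo by rewrite gt_eqF// (lt_le_trans (ltNyr 0%R))// le_max lexx orbT.
case: a b => [a| |] [b| |] //=; rewrite ?oppr0 -?EFinD -?EFinN ?addNye ?addeNy ?addye ?addey//=
  ?maxyl ?maxNl ?add0e ?adde0 ?addye ?addey //= ?m0//.
rewrite -!EFin_max -!EFinD; congr EFin.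
by rewrite /Num.max; repeat case: ifPn => ?; lra.
Qed.

Lemma maxN_subadd (a b : \bar R) :
  maxe (- (a + b)) 0 <= maxe (- a) 0 + maxe (- b) 0.
Proof.
have maxyl (x : \bar R) : maxe +oo x = +oo by rewrite /maxe; case: ifP => //; rewrite ltNge leey.
have maxNl : maxe -oo (0 : \bar R) = 0 by rewrite /maxe ltNyr.
have m0 (x : \bar R) : maxe x 0 != -oo by rewrite gt_eqF// (lt_le_trans (ltNyr 0%R))// le_max lexx orbT.
case: a b => [a| |] [b| |] //=; rewrite ?oppr0 -?EFinD -?EFinN ?addNye ?addeNy ?addye ?addey//=
  ?maxyl ?maxNl ?add0e ?adde0 ?addye ?addey //= ?m0//; rewrite ?le_max ?lexx ?orbT ?leey//.
rewrite -!EFin_max -!EFinD lee_fin.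
by rewrite /Num.max; repeat case: ifPn => ?; lra.
Qed.

(* The class of functions on which the convention oo - oo = oo is harmless. *)
Definition lower_integrable f :=
  measurable_fun setT f /\ \int[mu]_x f^\- x < +oo.

Lemma quasi_integralE f : lower_integrable f ->
  quasi_integral mu f = \int[mu]_x f^\+ x - \int[mu]_x f^\- x.
Proof.
move=> [mf]; rewrite /quasi_integral.
have : 0 <= \int[mu]_x f^\- x by exact: integral_ge0.
by case: (integral mu setT _^\-) => // r _ _; case: integral.
Qed.

Lemma quasi_integral_gtNy f : lower_integrable f -> -oo < quasi_integral mu f.
Proof.
move=> lf; rewrite quasi_integralE//; have [_] := lf.
have : 0 <= \int[mu]_x f^\- x by exact: integral_ge0.
have : 0 <= \int[mu]_x f^\+ x by exact: integral_ge0.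
by case: (integral mu setT _^\-) => // r; case: integral => //= s _ _ _; rewrite ltNyr.
Qed.

Lemma lower_integrableD f g : lower_integrable f -> lower_integrable g ->
  lower_integrable (f \+ g).
Proof.
move=> [mf f0] [mg g0]; split; first exact: emeasurable_funD.
apply: (@le_lt_trans _ _ (\int[mu]_x (f^\- x + g^\- x))).
  apply: ge0_le_integral => //; do ?exact: measurable_funeneg.
  - exact/measurable_funeneg/emeasurable_funD.
  - by apply: emeasurable_funD; exact: measurable_funeneg.
  - by move=> x _; rewrite !funenegE; exact: maxN_subadd.
rewrite ge0_integralD//; do ?exact: measurable_funeneg.
by rewrite lte_add_pinfty.
Qed.

Lemma quasi_integralD f g : lower_integrable f -> lower_integrable g ->
  quasi_integral mu (f \+ g) = quasi_integral mu f + quasi_integral mu g.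
Proof.
move=> lf lg; have lfg := lower_integrableD lf lg.
rewrite !quasi_integralE//.
have [mf f0] := lf; have [mg g0] := lg; have [mfg fg0] := lfg.
have : \int[mu]_x ((f \+ g)^\+ x + (f^\- x + g^\- x)) =
       \int[mu]_x ((f \+ g)^\- x + (f^\+ x + g^\+ x)).
  by apply: eq_integral => x _; rewrite !funeposE !funenegE; exact: funeposneg_add.
rewrite !ge0_integralD//; do ?[exact: measurable_funeneg|exact: measurable_funepos];
  do ?by [apply: emeasurable_funD; exact: measurable_funeneg
         |apply: emeasurable_funD; exact: measurable_funepos
         |move=> x _; rewrite adde_ge0].
by apply: quasi_integral_arith => //; exact: integral_ge0.
Qed.

Lemma lower_integrable_ge f g : measurable_fun setT f -> lower_integrable g ->
  {ae mu, forall x, g x <= f x} -> lower_integrable f.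
Proof.
move=> mf [mg g0] fg; split => //; apply: le_lt_trans g0.
apply: ae_ge0_le_integral => //; do ?exact: measurable_funeneg.
by apply: filterS fg => x fg _; rewrite !funenegE ge_max !le_max leeN2 fg/= lexx orbT.
Qed.

End quasi_integral.

Section quasi_integral_probability.
Local Open Scope ereal_scope.
Context dT (T : measurableType dT) (R : realType) (mu : probability T R).

Lemma lower_integrable_cst (c : R) : lower_integrable mu (cst c%:E).
Proof.
split; first exact: measurable_cst.
rewrite (_ : (cst c%:E)^\- = cst (Num.max (- c) 0)%R%:E); last first.
  by apply/funext => x; rewrite funenegE /= -EFin_max.
by rewrite integral_cst//= probability_setT mule1 ltry.
Qed.

Lemma quasi_integral_cst (c : R) : quasi_integral mu (cst c%:E) = c%:E.
Proof.
rewrite quasi_integralE; last exact: lower_integrable_cst.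
rewrite (_ : (cst c%:E)^\- = cst (Num.max (- c) 0)%R%:E); last first.
  by apply/funext => x; rewrite funenegE /= -EFin_max.
rewrite (_ : (cst c%:E)^\+ = cst (Num.max c 0)%R%:E); last first.
  by apply/funext => x; rewrite funeposE /= -EFin_max.
rewrite !integral_cst//= probability_setT !mule1 -EFinB; congr EFin.
by rewrite /Num.max; repeat case: ifPn => ?; lra.
Qed.

End quasi_integral_probability.

Section gibbs.
Local Open Scope ereal_scope.
Context dT (T : measurableType dT) (R : realType).
Variables (P : probability T R) (nu : {sigma_finite_measure set T -> \bar R}).
Hypothesis Pnu : P `<< nu.

Let s := Radon_Nikodym_SigmaFinite.f P nu.
Let f := Radon_Nikodym (charge_of_finite_measure P) nu.

Let s0 x : 0 <= s x. Proof. exact: Radon_Nikodym_SigmaFinite.f_ge0. Qed.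
Let sfin x : s x \is a fin_num. Proof. exact: Radon_Nikodym_SigmaFinite.f_fin_num. Qed.
Let ms : measurable_fun setT s.
Proof. exact: measurable_int (Radon_Nikodym_SigmaFinite.f_integrable Pnu). Qed.

Let mlne (g : T -> \bar R) : measurable_fun setT g -> measurable_fun setT (fun x => lne (g x)).
Proof. by move=> mg; apply: measurableT_comp => //; exact: measurable_lne. Qed.

Lemma ae_dominated (Q : T -> Prop) : {ae nu, forall x, Q x} -> {ae P, forall x, Q x}.
Proof.
move=> [N [mN N0 QN]]; exists N; split => //.
by move/null_content_dominatesP : Pnu; exact.
Qed.

Lemma ae_Radon_NikodymE : {ae P, forall x, f x = s x}.
Proof.
apply: ae_dominated.
have := @ae_eq_Radon_Nikodym_SigmaFinite _ _ _ P nu Pnu _ measurableT.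
by apply: filterS => x /(_ Logic.I); rewrite /f /s => ->.
Qed.

Lemma measurable_Radon_Nikodym : measurable_fun setT f.
Proof. by apply: measurable_int (Radon_Nikodym_integrable _); exact: Pnu. Qed.

Lemma relative_entropyE :
  relative_entropy P nu = quasi_integral P (fun x => lne (s x)).
Proof.
rewrite /relative_entropy asboolT//; apply: eq_quasi_integral.
- exact/mlne/measurable_Radon_Nikodym.
- exact: mlne.
- by apply: filterS ae_Radon_NikodymE => x /=; rewrite /f => ->.
Qed.

Lemma ae_density_gt0 : {ae P, forall x, 0 < s x}.
Proof.
exists (s @^-1` [set 0]); split.
- by rewrite -[X in measurable X]setTI; exact: ms.
- have mS : measurable (s @^-1` [set 0]) by rewrite -[X in measurable X]setTI; exact: ms.
  rewrite (Radon_Nikodym_SigmaFinite.f_integral Pnu)// integral0_eq// => x /= ->.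
- by move=> x /=; rewrite lt_neqAle s0 andbT => /negP; rewrite negbK => /eqP <-.
Qed.

(** This is [ln (b / a) <= b / a - 1] with the terms distributed so that both sides are sums of
    nonnegative extended reals, even when a logarithm is infinite. The factor [expR (- ln (fine a))]
    is the inverse of [a]. *)
Lemma gibbs_arith (a b : \bar R) : 0 < a -> a \is a fin_num -> 0 <= b ->
  maxe (lne b) 0 + maxe (- lne a) 0 + 1 <=
  maxe (- lne b) 0 + maxe (lne a) 0 + b * (expR (- ln (fine a)))%:E.
Proof.
case: a => // a; rewrite lte_fin => a0 _; rewrite lne_EFin//=.
have [maxyl maxyr] : (forall x : \bar R, maxe +oo x = +oo) /\ (forall x : \bar R, maxe x +oo = +oo).
  by split => x; apply/eqP; rewrite -leye_eq le_max lexx ?orbT.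
case: b => [b| |] // b0.
- move: b0; rewrite lee_fin le_eqVlt => /predU1P[<-|b0].
    rewrite (@le0_lneNy _ 0%:E)//= maxyl mul0e -EFin_max !addye//= ?leey//;
    by rewrite -EFin_max.
  rewrite expRN lnK ?posrE// lne_EFin// -!EFin_max -EFinM -!EFinD lee_fin.
  have : (ln b - ln a <= b / a - 1)%R.
    rewrite -ln_div ?posrE//.
    have := @le_ln1Dx R (b / a - 1)%R; rewrite addrCA subrr addr0; apply.
    by rewrite ltrBDl subrr divr_gt0.
  rewrite /Num.max; case: ifPn; case: ifPn; case: ifPn; case: ifPn; lra.
- rewrite gt0_mulye ?lte_fin ?expR_gt0//= maxyl.
  have -> : maxe -oo 0 = 0 :> \bar R by rewrite /maxe ltNyr.
  by rewrite add0e addey ?leey// -EFin_max.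
Qed.

Variable g : T -> \bar R.
Hypothesis mg : measurable_fun setT g.
Hypothesis g0 : forall x, 0 <= g x.
Hypothesis g1 : \int[nu]_x g x <= 1.
Hypothesis glow : lower_integrable P (fun x => lne (g x)).

Let w x := g x * (expR (- ln (fine (s x))))%:E.

Let w0 x : 0 <= w x.
Proof. by rewrite mule_ge0// lee_fin expR_ge0. Qed.

Let mw : measurable_fun setT w.
Proof.
apply: emeasurable_funM => //; apply/measurable_EFinP.
apply: measurableT_comp; first exact: measurable_expR.
apply: measurable_funN; apply: measurableT_comp; first exact: measurable_ln.
by apply: measurableT_comp => //; exact: fine_measurable.
Qed.

Let w1 : \int[P]_x w x <= 1.
Proof.
rewrite -(Radon_Nikodym_SigmaFinite.change_of_variables Pnu)//.
apply: le_trans g1; apply: ge0_le_integral => //.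
- by move=> x _; exact: mule_ge0.
- exact: emeasurable_funM.
(* Times the density, [w] gives back [g] where the density is positive and 0 elsewhere. *)
move=> x _; rewrite /w -muleA -[leRHS]mule1 lee_wpmul2l//.
rewrite -/s; move: (s0 x) (sfin x).
case: (s x) => //= r; rewrite lee_fin le_eqVlt => /predU1P[<- _|r0 _].
  by rewrite mule0 lee01.
by rewrite -EFinM expRN lnK ?posrE// mulVf ?gt_eqF// lexx.
Qed.

(** Where [lne (s x)] is negative, [gibbs_arith] bounds its negative part by that of [lne (g x)]
    plus the ratio [w], whose mean under [P] is at most 1. Once this makes all the negative parts
    integrable, the second claim is the integral of [gibbs_arith]. *)
Lemma gibbs : lower_integrable P (fun x => lne (s x)) /\
  quasi_integral P (fun x => lne (g x)) <= relative_entropy P nu.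
Proof.
have mg' := mlne mg; have ms' := mlne ms.
have key : {ae P, forall x, maxe (lne (g x)) 0 + maxe (- lne (s x)) 0 + 1 <=
  maxe (- lne (g x)) 0 + maxe (lne (s x)) 0 + w x}.
  by apply: filterS ae_density_gt0 => x sx; apply: gibbs_arith.
have low : lower_integrable P (fun x => lne (s x)).
  split => //; apply: (@le_lt_trans _ _ (\int[P]_x ((fun x => lne (g x))^\- x + w x))).
    apply: ae_ge0_le_integral => //.
    - exact: measurable_funeneg.
    - by move=> x _; rewrite adde_ge0.
    - by apply: emeasurable_funD => //; exact: measurable_funeneg.
    - apply: filterS key => x + _; rewrite !funenegE.
      have [sx _|sx] := leP (- lne (s x)) 0.
        by rewrite adde_ge0// le_max lexx orbT.
      have /max_idPr -> : lne (s x) <= 0 by rewrite -leeN2 oppe0 ltW.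
      rewrite adde0; apply: le_trans.
      have h : 0 <= maxe (lne (g x)) 0 by rewrite le_max lexx orbT.
      by rewrite -addeA -[leLHS]add0e leeD// -[leLHS]adde0 leeD.
  rewrite ge0_integralD//; last exact: measurable_funeneg.
  by apply: lte_add_pinfty; [case: glow|rewrite (le_lt_trans w1)// ltry].
split => //; rewrite relative_entropyE !quasi_integralE//.
have : \int[P]_x ((fun x => lne (g x))^\+ x + (fun x => lne (s x))^\- x + 1) <=
  \int[P]_x ((fun x => lne (g x))^\- x + (fun x => lne (s x))^\+ x + w x).
  apply: ae_ge0_le_integral => //.
  - by move=> x _; rewrite !adde_ge0.
  - by do ?[apply: emeasurable_funD => //]; [exact: measurable_funepos|exact: measurable_funeneg].
  - by move=> x _; rewrite !adde_ge0.
  - by do ?[apply: emeasurable_funD => //]; [exact: measurable_funeneg|exact: measurable_funepos].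
  - by apply: filterS key => x + _; rewrite !funenegE !funeposE.
rewrite !ge0_integralD//; do ?[exact: measurable_funeneg|exact: measurable_funepos];
  do ?[by move=> x _; rewrite adde_ge0];
  do ?[by apply: emeasurable_funD => //; exact: measurable_funeneg
      |by apply: emeasurable_funD => //; exact: measurable_funepos
      |by apply: emeasurable_funD => //; [exact: measurable_funepos|exact: measurable_funeneg]
      |by apply: emeasurable_funD => //; [exact: measurable_funeneg|exact: measurable_funepos]].
rewrite integral_cst//= probability_setT mul1e.
have [_] := low; have [_] := glow.
have : 0 <= \int[P]_x (fun x => lne (g x))^\- x by exact: integral_ge0.
have : 0 <= \int[P]_x (fun x => lne (g x))^\+ x by exact: integral_ge0.
have : 0 <= \int[P]_x (fun x => lne (s x))^\- x by exact: integral_ge0.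
have : 0 <= \int[P]_x (fun x => lne (s x))^\+ x by exact: integral_ge0.
have : 0 <= \int[P]_x w x by exact: integral_ge0.
move: w1.
move: (integral P setT (fun x => lne (g x))^\-) (integral P setT (fun x => lne (g x))^\+)
 (integral P setT (fun x => lne (s x))^\-) (integral P setT (fun x => lne (s x))^\+)
 (integral P setT w).
case=> [a| |] [b| |] [c| |] [e| |] [W| |] //=; rewrite ?leey// ?lee_fin; lra.
Qed.

End gibbs.

Section entropy_upper_bound.
Local Open Scope ereal_scope.
Context dT (T : measurableType dT) (R : realType).
Variables (P : probability T R) (nu : {sigma_finite_measure set T -> \bar R}).
Variable c : R.
Hypothesis c1 : (1 <= c)%R.
Hypothesis Pc : forall A, measurable A -> P A <= c%:E * nu A.

Lemma bounded_dominates : P `<< nu.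
Proof.
apply/null_content_dominatesP => A mA A0; apply/eqP; rewrite eq_le measure_ge0 andbT.
by have := Pc mA; rewrite A0 mule0.
Qed.

(** On the set [A] where the density exceeds [c], the integral of the excess is
    [P A - c * nu A <= 0]. Hence [A] is null, and the logarithm of the density is almost surely at
    most [ln c]. *)
Lemma relative_entropy_le : relative_entropy P nu <= (ln c)%:E.
Proof.
have Pnu := bounded_dominates.
have c0 : (0 < c)%R by rewrite (lt_le_trans _ c1).
rewrite relative_entropyE//.
set s := Radon_Nikodym_SigmaFinite.f P nu.
have ms : measurable_fun setT s.
  exact: measurable_int (Radon_Nikodym_SigmaFinite.f_integrable Pnu).
pose A := [set x | c%:E < s x].
have mA : measurable A.
  rewrite (_ : A = setT `&` [set x | (cst c%:E) x < s x]); last by rewrite setTI.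
  exact: emeasurable_fun_o_infty.
have PA : P A = 0.
  have PAE := Radon_Nikodym_SigmaFinite.f_integral Pnu mA.
  (* Needed for the subtraction: the density is above [c] on [A], so that [c * nu A <= P A <= 1]. *)
  have Afin : c%:E * nu A \is a fin_num.
    rewrite ge0_fin_numE; last by rewrite mule_ge0// lee_fin ltW.
    apply: (@le_lt_trans _ _ (P A)); last first.
      by rewrite (le_lt_trans (probability_le1 P mA))// ltry.
    rewrite PAE -integral_cst//; apply: ge0_le_integral => //.
    - by move=> x _; rewrite lee_fin ltW.
    - exact: measurable_funTS.
    - by move=> x; rewrite /A /= => /ltW.
  have h0 : \int[nu]_(x in A) (s x - c%:E) = 0.
    have : P A = \int[nu]_(x in A) (s x - c%:E) + c%:E * nu A.
      rewrite -integral_cst// -ge0_integralD//.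
      - by rewrite PAE; apply: eq_integral => x _; rewrite subeK.
      - by move=> x Ax; rewrite sube_ge0// ltW.
      - by apply: measurable_funTS; apply: emeasurable_funB.
      - by move=> x _; rewrite lee_fin ltW.
    have hge0 : 0 <= \int[nu]_(x in A) (s x - c%:E).
      by apply: integral_ge0 => x Ax; rewrite sube_ge0// ltW.
    move=> E; apply/eqP; rewrite eq_le hge0 andbT.
    by have := Pc mA; rewrite E -leeBrDr// subee.
  have /ae_eq_integral_abs : \int[nu]_(x in A) `|s x - c%:E| = 0.
    by rewrite -[RHS]h0; apply: eq_integral => x; rewrite inE => Ax; rewrite gee0_abs// sube_ge0// ltW.
  move=> /(_ mA) [|N [mN N0 AN]].
    by apply: measurable_funTS; apply: emeasurable_funB.
  have AN' : A `<=` N.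
    move=> x Ax; apply: AN => /= /(_ Ax) E.
    have : 0 < s x - c%:E by rewrite sube_gt0.
    by rewrite E ltxx.
  move/null_content_dominatesP : Pnu => /(_ _ mA); apply.
  by apply/eqP; rewrite eq_le measure_ge0 andbT -N0 le_measure// inE.
rewrite -[leRHS](quasi_integral_cst P); apply: le_quasi_integral => //.
  exact: measurableT_comp (@measurable_lne R) ms.
exists A; split => //= x; rewrite /A /= => h; rewrite ltNge; apply/negP => sc; apply: h.
have [s0|s0] := leP (s x) 0; first by rewrite le0_lneNy// leNye.
by rewrite -lne_EFin// lee_lne// in_itv/= leey ?ltW// lte_fin.
Qed.

End entropy_upper_bound.

(** * The reference measure as an iterated integral *)

Section iterated_integrals.
Local Open Scope ereal_scope.
Context (R : realType) (I : eqType) dE (E : measurableType dE).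

Definition coord_events : set (set (I -> E)) :=
  [set A | exists i (B : set E), measurable B /\ A = [set f | B (f i)]].

(** The product sigma-algebra, which sees the heights themselves. Integrating one height at a time
    produces functions that are measurable here but need not depend on increments alone. *)
Definition fieldT := g_sigma_algebraType coord_events.

Lemma measurable_coord i : measurable_fun [set: fieldT] (fun f : fieldT => f i).
Proof.
move=> _ B mB; rewrite setTI; apply: sub_sigma_algebra.
by exists i, B.
Qed.

Lemma measurable_to_field dT (T : measurableType dT) (h : T -> fieldT) :
  (forall i, measurable_fun setT (fun t => h t i)) -> measurable_fun setT h.
Proof.
move=> mh; apply: (@measurability _ _ T fieldT setT h coord_events erefl).
move=> _ [_ [i [B [mB ->]]] <-]; exact: mh.
Qed.

Definition upd (f : I -> E) (i : I) (t : E) : I -> E :=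
  fun j => if j == i then t else f j.

Lemma measurable_upd i :
  measurable_fun [set: fieldT * E] (fun p : fieldT * E => upd p.1 i p.2 : fieldT).
Proof.
apply: measurable_to_field => j; rewrite /upd; case: (j == i).
  exact: measurable_snd.
by apply: (measurableT_comp (measurable_coord j)); exact: measurable_fst.
Qed.

Lemma updC f i j t u : i != j -> upd (upd f i t) j u = upd (upd f j u) i t.
Proof.
move=> ij; apply/funext => x; rewrite /upd; case: eqP => [->|//].
by rewrite eq_sym (negbTE ij).
Qed.

Variable m : {sigma_finite_measure set E -> \bar R}.

(** The coordinates in [s] are integrated, the others keep the values of [f]. In this form Tonelli's
    theorem only has to exchange two adjacent coordinates, from which every reordering of the sites
    follows. *)
Fixpoint iter_int (s : seq I) (F : (I -> E) -> \bar R) (f : I -> E) : \bar R :=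
  if s is i :: s' then \int[m]_t iter_int s' F (upd f i t) else F f.

Definition nn_measurable (F : (I -> E) -> \bar R) :=
  measurable_fun [set: fieldT] (F : fieldT -> \bar R) /\ forall f, 0 <= F f.

Lemma iter_int_nn s F : nn_measurable F -> nn_measurable (iter_int s F).
Proof.
move=> mF; elim: s => [//|i s [ms s0]]; split => [|f]; last exact: integral_ge0.
pose G (p : fieldT * E) := iter_int s F (upd p.1 i p.2).
have mG : measurable_fun setT G by apply: (measurableT_comp ms); exact: measurable_upd.
exact: (@measurable_fun_fubini_tonelli_F _ _ _ _ _ m G mG (fun p => s0 _)).
Qed.

Lemma measurable_iter_int_upd s F i f : nn_measurable F ->
  measurable_fun setT (fun t => iter_int s F (upd f i t)).
Proof.
move=> mF; have [ms _] := iter_int_nn s mF; apply: (measurableT_comp ms).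
apply: measurable_to_field => j; rewrite /upd; case: (j == i) => //.
Qed.

Lemma iter_int_cat s1 s2 F f : iter_int (s1 ++ s2) F f = iter_int s1 (iter_int s2 F) f.
Proof. by elim: s1 f => //= i s IH f; apply: eq_integral => t _. Qed.

Lemma iter_int_swap i j s F f : nn_measurable F -> i != j ->
  iter_int [:: i, j & s] F f = iter_int [:: j, i & s] F f.
Proof.
move=> mF ij /=; have [ms s0] := iter_int_nn s mF.
pose G (p : E * E) := iter_int s F (upd (upd f i p.1) j p.2).
have mG : measurable_fun setT G.
  apply: (measurableT_comp ms); apply: measurable_to_field => x; rewrite /upd.
  case: (x == j); first exact: measurable_snd.
  case: (x == i); first exact: measurable_fst.
  exact: measurable_cst.
have := @fubini_tonelli _ _ _ _ _ m m G mG (fun p => s0 _).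
move=> ->; apply: eq_integral => u _; apply: eq_integral => t _.
by rewrite /G /= updC.
Qed.

Lemma iter_int_perm s s' F f : nn_measurable F -> uniq s -> perm_eq s s' ->
  iter_int s F f = iter_int s' F f.
Proof.
move=> mF; have mid s1 i s2 g : uniq (s1 ++ i :: s2) ->
    iter_int (s1 ++ i :: s2) F g = iter_int (i :: s1 ++ s2) F g.
  elim: s1 g => [//|j s1 IH] g /= /andP[js us].
  rewrite -[RHS]/(iter_int [:: i, j & s1 ++ s2] F g) iter_int_swap//; last first.
    by apply: contraNneq js => <-; rewrite mem_cat inE eqxx orbT.
  by apply: eq_integral => t _; exact: IH.
elim: s s' f => [|i s IH] s' f us ss'.
  by move: ss'; rewrite perm_sym => /perm_nilP ->.
have : i \in s' by rewrite -(perm_mem ss') inE eqxx.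
move: ss' => /[swap]; case/splitPr => s1 s2 ss'.
rewrite mid; last by rewrite -(perm_uniq ss').
have ss12 : perm_eq s (s1 ++ s2).
  by rewrite -(perm_cons i) (perm_trans ss')// perm_catC /= perm_cons perm_catC.
by apply: eq_integral => t _; apply: IH => //; case/andP: us.
Qed.

Lemma eq_iter_int s F f f' (D : pred I) :
  (forall g g', {in D, g =1 g'} -> F g = F g') ->
  {in D, forall i, i \notin s -> f i = f' i} ->
  iter_int s F f = iter_int s F f'.
Proof.
move=> FD; elim: s f f' => [|i s IH] f f' ff' /=.
  by apply: FD => i Di; exact: ff'.
apply: eq_integral => t _; apply: IH => j Dj js; rewrite /upd; case: eqP => // /eqP ji.
by apply: ff' => //; rewrite inE negb_or ji.
Qed.

Lemma iter_intZ s F G f : nn_measurable F -> (forall g, 0 <= G g) ->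
  (forall g i t, i \in s -> G (upd g i t) = G g) ->
  iter_int s (fun g => G g * F g) f = G f * iter_int s F f.
Proof.
move=> mF G0; elim: s f => [//|i s IH] f Gs /=.
under eq_integral => t _.
  rewrite IH; last by move=> g j u js; apply: Gs; rewrite inE js orbT.
  rewrite Gs ?inE ?eqxx//.
  over.
rewrite ge0_integralZl//; first exact: measurable_iter_int_upd.
by move=> t _; have [_] := iter_int_nn s mF.
Qed.

Definition override (s : seq I) (t : seq E) (f : I -> E) : I -> E :=
  fun y => nth (f y) t (index y s).

Lemma measurable_override s n f :
  measurable_fun setT (fun t : n.-tuple E => override s t f : fieldT).
Proof.
apply: measurable_to_field => j; rewrite /override.
have [js|js] := ltnP (index j s) n.
  rewrite (_ : (fun _ => _) = fun t : n.-tuple E => tnth t (Ordinal js)).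
    exact: measurable_tnth.
  by apply/funext => t; rewrite (tnth_nth (f j)).
rewrite (_ : (fun _ => _) = cst (f j)); first exact: measurable_cst.
by apply/funext => t; rewrite nth_default ?size_tuple.
Qed.

Lemma power_measureE n s F f : n = size s -> uniq s -> nn_measurable F ->
  \int[power_measure m n]_t F (override s t f) = iter_int s F f.
Proof.
move=> -> + [mF F0]; elim: s f => [|i s IH] f /=.
  move=> _; rewrite integral_dirac//; last first.
    by apply: (measurableT_comp mF); exact: (@measurable_override [::] 0).
  by rewrite diracT mul1e; congr F; apply/funext => y.
move=> /andP[is_ us].
transitivity (\int[sigma_product m (power_measure m (size s))]_p
   F (override (i :: s) (p.1 :: p.2) f)).
  apply: ge0_integral_pushforward => //.
    exact: measurable_cons.
  by apply: (measurableT_comp mF); exact: measurable_override.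
pose G (p : E * (size s).-tuple E) := F (override (i :: s) (p.1 :: p.2) f).
have mG : measurable_fun setT G.
  apply: (measurableT_comp mF).
  apply: (measurableT_comp (@measurable_override (i :: s) (size s).+1 f)).
  exact: measurable_cons.
have := @fubini_tonelli1 _ _ _ _ _ m (power_measure m (size s)) G mG (fun p => F0 _).
move=> ->; apply: eq_integral => t _; rewrite /fubini_F -IH//.
apply: eq_integral => u _; rewrite /G /=; congr F; apply/funext => y.
rewrite /override /upd /= eq_sym; case: eqP => [->|//].
by rewrite memNindex// [RHS]nth_default ?size_tuple.
Qed.

End iterated_integrals.

Lemma iter_int_reindex (R : realType) (I J : eqType) dE (E : measurableType dE)
    (m : {sigma_finite_measure set E -> \bar R}) (h : I -> J) s F (f : J -> E) :
  injective h ->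
  iter_int m [seq h i | i <- s] (fun g => F (g \o h)) f = iter_int m s F (f \o h).
Proof.
move=> hI; elim: s f => [//|i s IH] f /=; apply: eq_integral => t _.
rewrite IH; congr (iter_int _ _ _ _); apply/funext => j.
by rewrite /upd /= (inj_eq hI).
Qed.

Section heights_invariance.
Context (R : realType) (k : height_kind).
Notation E := (heights R k).

Lemma hs_subxx (a : E) : hs_sub a a = hs_zero E.
Proof. by move: a; case: k => a /=; rewrite subrr. Qed.

Lemma hs_subBB (a b c : E) : hs_sub (hs_sub a c) (hs_sub b c) = hs_sub a b.
Proof. by move: a b c; case: k => a b c /=; rewrite opprB addrA subrK. Qed.

Lemma hs_inclB (a b : E) : hs_incl (hs_sub a b) = hs_incl a - hs_incl b.
Proof. by move: a b; case: k => a b /=; rewrite ?intrB. Qed.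

Lemma measurable_hs_incl : measurable_fun [set: E] (@hs_incl R E).
Proof. by case: k => //= ; exact: measurable_id. Qed.

Lemma measurable_hs_sub dT (T : measurableType dT) (f g : T -> E) :
  measurable_fun setT f -> measurable_fun setT g ->
  measurable_fun setT (fun x => hs_sub (f x) (g x)).
Proof.
by move=> mf mg; apply: (measurableT_comp (@hs_sub_measurable R E) (measurable_fun_pair mf mg)).
Qed.

Lemma counting_bij (h g : int -> int) (A : set int) :
  cancel h g -> cancel g h -> @counting int R (h @^-1` A) = counting A.
Proof.
move=> hK gK; have -> : h @^-1` A = g @` A.
  apply/seteqP; split => [x Ax|_ [y Ay <-]] /=; last by rewrite gK.
  by exists (h x).
rewrite /counting; have [fA|fA] := pselect (finite_set A).
  rewrite !asboolT//; last exact: finite_image.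
  rewrite fset_set_image// card_imfset//=; exact: can_inj gK.
rewrite !asboolF// => fgA; apply: fA.
have := finite_image h fgA; congr finite_set; rewrite image_comp.
apply/seteqP; split => [_ [x Ax <-]|x Ax] /=; first by rewrite gK.
by exists x => //=; rewrite gK.
Qed.

Lemma hs_ref_sub (c : E) (A : set E) : measurable A ->
  pushforward (hs_ref E) (fun t => hs_sub t c) A = hs_ref E A.
Proof.
move: c A; case: k => /= c A mA.
  by apply: (@counting_bij (fun t => t - c) (fun t => t + c)) => x; rewrite ?subrK ?addrK.
have mh : measurable_fun [set: measurableTypeR R] (fun t : R => t - c : measurableTypeR R).
  exact: measurable_funB.
pose mu := measure_function_pushforward__canonical__measure_function_Measure
  (@lebesgue_measure R) mh.
apply/esym; apply: (@lebesgue_measure_unique R mu) => // _ [[a b]] _ <-.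
rewrite /mu /= /pushforward.
have -> : (fun t : R => t - c : measurableTypeR R) @^-1` `]a, b]%classic = `](a + c), (b + c)]%classic.
  by apply/seteqP; split => x /=; rewrite !in_itv/= ltrBrDr lerBlDr.
rewrite !lebesgue_measure_itv/= !lte_fin ltrD2r; case: ifP => // _.
by rewrite -!EFinB; congr EFin; ring.
Qed.

Lemma hs_ref_opp (A : set E) : measurable A ->
  pushforward (hs_ref E) (fun t => hs_sub (hs_zero E) t) A = hs_ref E A.
Proof.
move: A; case: k => /= A mA.
  by apply: (@counting_bij (fun t => 0 - t) (fun t => 0 - t)) => x; rewrite !sub0r opprK.
rewrite -[RHS](lebesgue_measureN mA) /pushforward; congr (lebesgue_measure _).
by apply/seteqP; split => x /=; rewrite sub0r.
Qed.

Lemma ge0_integral_hs_sub (c : E) (F : E -> \bar R) : measurable_fun setT F ->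
  (forall t, 0 <= F t)%E ->
  (\int[hs_ref E]_t F (hs_sub t c) = \int[hs_ref E]_t F t)%E.
Proof.
move=> mF F0.
have mh : measurable_fun [set: E] (fun t => hs_sub t c).
  by apply: measurable_hs_sub => //; exact: measurable_cst.
rewrite -[LHS]/(\int[hs_ref E]_t (F \o (fun t => hs_sub t c)) t)%E.
rewrite -[X in integral _ X _](preimage_setT (fun t => hs_sub t c)).
rewrite -(ge0_integral_pushforward mh)//.
apply: (@eq_measure_integral _ _ _ _ (hs_ref E) (measure_function_pushforward__canonical__measure_function_Measure (hs_ref E) mh)).
by move=> A mA _; exact: hs_ref_sub.
Qed.

Lemma ge0_integral_hs_opp (F : E -> \bar R) : measurable_fun setT F ->
  (forall t, 0 <= F t)%E ->
  (\int[hs_ref E]_t F (hs_sub (hs_zero E) t) = \int[hs_ref E]_t F t)%E.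
Proof.
move=> mF F0.
have mh : measurable_fun [set: E] (fun t => hs_sub (hs_zero E) t).
  by apply: measurable_hs_sub => //; exact: measurable_cst.
rewrite -[LHS]/(\int[hs_ref E]_t (F \o (fun t => hs_sub (hs_zero E) t)) t)%E.
rewrite -[X in integral _ X _](preimage_setT (fun t => hs_sub (hs_zero E) t)).
rewrite -(ge0_integral_pushforward mh)//.
apply: (@eq_measure_integral _ _ _ _ (hs_ref E) (measure_function_pushforward__canonical__measure_function_Measure (hs_ref E) mh)).
by move=> A mA _; exact: hs_ref_opp.
Qed.

End heights_invariance.

Section gradient_integrals.
Local Open Scope ereal_scope.
Context (R : realType) (k : height_kind) (d : nat).
Notation E := (heights R k).
Notation I := (site d).
Notation cfg := (config E d).
Notation lam := (hs_ref E).

Lemma measurable_field_grad (D : set I) :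
  measurable_fun [set: fieldT I E] (id : fieldT I E -> gradT E D).
Proof.
apply: (@measurability _ _ (fieldT I E) (gradT E D) setT id (gradient_events D) erefl).
move=> _ [_ [x [y [B [Dx Dy mB ->]]]] <-].
apply: (@measurable_hs_sub R k _ (fieldT I E) (fun f : fieldT I E => f y) (fun f : fieldT I E => f x)) => //;
  exact: measurable_coord.
Qed.

Definition same_grad (D : set I) (f g : cfg) :=
  forall x y, D x -> D y -> hs_sub (f y) (f x) = hs_sub (g y) (g x).

(** The sets that do not separate configurations with equal increments on [D] form a sigma-algebra
    containing the generators of [gradT E D]. *)
Lemma measurable_gradT_same (D : set I) (A : set (gradT E D)) (f g : cfg) :
  measurable A -> same_grad D f g -> A f -> A g.
Proof.
move=> mA; pose S := [set A : set cfg | forall f g, same_grad D f g -> A f <-> A g].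
suff /(_ A mA) SA : <<s @gradient_events R E d D >> `<=` S by move=> /SA [].
apply: smallest_sub.
  split => [|B SB|F SF] /=.
  - by move=> f' g' _.
  - move=> f' g' fg; have [h1 h2] := SB _ _ fg.
    by split => -[_ h]; split => // ?; apply: h; [exact: h2|exact: h1].
  - by move=> f' g' fg; split => -[i _ h]; exists i => //; have [h1 h2] := SF i _ _ fg; auto.
move=> _ [x [y [B [Dx Dy mB ->]]]] f' g' fg /=.
by rewrite (fg x y).
Qed.

Lemma measurable_fun_gradT_same (D : set I) (F : gradT E D -> \bar R) f g :
  measurable_fun setT F -> same_grad D f g -> F f = F g.
Proof.
move=> mF fg.
have mA : measurable (F @^-1` [set F f]) by rewrite -[X in measurable X]setTI; exact: mF.
by have := measurable_gradT_same mA fg erefl.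
Qed.

Definition grad_functional (D : set I) (F : cfg -> \bar R) :=
  nn_measurable F /\ forall f g, same_grad D f g -> F f = F g.

Lemma grad_functional_gradT (D : set I) (F : gradT E D -> \bar R) :
  measurable_fun setT F -> (forall f, 0 <= F f) -> grad_functional D F.
Proof.
move=> mF F0; split; last by move=> f g; exact: measurable_fun_gradT_same.
by split => //; apply: (measurableT_comp mF); exact: measurable_field_grad.
Qed.

(** Each integration absorbs the constant by translation invariance of the reference measure, and
    the remaining heights are read by [F] only through increments. *)
Lemma iter_int_shift s (F : cfg -> \bar R) D f c : grad_functional D F ->
  iter_int lam s F (fun x => hs_sub (f x) c) = iter_int lam s F f.
Proof.
move=> [mF FD]; elim: s f => [|i s IH] f /=.
  by apply: FD => x y Dx Dy; rewrite hs_subBB.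
rewrite -(@ge0_integral_hs_sub R k c); last 2 first.
- exact: measurable_iter_int_upd.
- by move=> t; have [_] := iter_int_nn lam s mF.
apply: eq_integral => t _; rewrite -[RHS]IH; congr iter_int; apply/funext => x.
by rewrite /upd; case: eqP.
Qed.

(** The head of [s] is the base point: it stays at height zero while the other sites are integrated.
    For the enumeration of a finite set this is integration against [gradient_reference], by
    [gradient_referenceE]. *)
Definition gint (s : seq I) (F : cfg -> \bar R) : \bar R :=
  iter_int lam (behead s) F (fun=> hs_zero E).

Lemma gint_cons x s F f : grad_functional [set` x :: s] F ->
  gint (x :: s) F = iter_int lam s F f.
Proof.
move=> FD; have [mF FE] := FD.
rewrite /gint /= -(@iter_int_shift s F _ f (f x) FD).
apply: (@eq_iter_int _ _ _ _ lam s F _ _ [in x :: s]).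
  by move=> g g' gg'; apply: FE => y z Dy Dz; rewrite !gg'.
by move=> y; rewrite inE => /predU1P[-> _|->//]; rewrite hs_subxx.
Qed.

(** The point is to change the base point from [v] to [v']. With [v] at zero and [v'] at height t,
    subtracting t everywhere puts [v'] at zero and [v] at -t; the reflection of the reference
    measure turns -t into t. *)
Lemma gint_perm s s' F : uniq s -> perm_eq s s' -> grad_functional [set` s] F ->
  gint s F = gint s' F.
Proof.
move=> us ss' FD; have [mF FE] := FD.
case: s s' us ss' FD FE => [|v s] [|v' s'] us ss' FD FE.
- by [].
- by move/perm_size : ss'.
- by move/perm_size : ss'.
rewrite {1 2}/gint /=; have [vv'|vv'] := eqVneq v v'.
  by subst v'; apply: iter_int_perm => //; [case/andP: us|rewrite -(perm_cons v)].
have v's : v' \in s.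
  by have := perm_mem ss' v'; rewrite !inE eqxx/= eq_sym (negbTE vv').
have sr := perm_to_rem v's.
have s'r : perm_eq s' (v :: rem v' s).
  rewrite -(perm_cons v') perm_sym (perm_trans _ ss')//.
  rewrite (perm_trans (y := [:: v, v' & rem v' s]))//; last by rewrite perm_cons perm_sym.
  by rewrite -[[:: v', v & _]]/([:: v'] ++ [:: v] ++ _) perm_catCA.
have [/andP[vs us'] us2] : (v \notin s) && uniq s /\ uniq (v' :: s').
  by split => //; rewrite -(perm_uniq ss').
rewrite (iter_int_perm lam _ mF _ sr)// (iter_int_perm lam _ mF _ s'r); last by case/andP: us2.
set r := rem v' s => /=.
rewrite -[RHS]ge0_integral_hs_opp; last 2 first.
- exact: measurable_iter_int_upd.
- by move=> t; have [_] := iter_int_nn lam r mF.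
apply: eq_integral => t _.
rewrite -(@iter_int_shift r F _ _ t FD).
apply: (@eq_iter_int _ _ _ _ lam r F _ _ [in v :: s]).
  by move=> g g' gg'; apply: FE => y z Dy Dz; rewrite !gg'.
move=> y ys yr; rewrite /upd.
have [->|yv'] := eqVneq y v'; first by rewrite hs_subxx eq_sym (negbTE vv').
have [//|yv] := eqVneq y v.
move: ys; rewrite inE (negbTE yv)/= => ys.
by move: yr; rewrite /r mem_rem_uniq// inE yv' ys.
Qed.

Lemma gradient_referenceE (L : {fset I}) (F : gradT E [set` L] -> \bar R) :
  measurable_fun setT F -> (forall f, 0 <= F f) ->
  \int[gradient_reference E L]_f F f = gint L F.
Proof.
move=> mF F0; have FD := grad_functional_gradT mF F0; have [mF' FE] := FD.
have us : uniq L := fset_uniq L.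
transitivity (\int[power_measure lam (#|` L|).-1]_t F (@Defs.glue R E d L t)).
  by apply: ge0_integral_pushforward => //; exact: glue_measurable.
rewrite /gint -(@power_measureE _ _ _ _ _ (#|` L|).-1) ?size_behead//; last by case: (L : seq I) us => //= ? ? /andP[].
apply: eq_integral => t _; apply: FE => x y Lx Ly.
suff h z : [set` L] z -> Defs.glue t z = override (behead L) t (fun=> hs_zero E) z by rewrite !h.
rewrite /= -[z \in L]/(z \in (L : seq _)) /Defs.glue /override => zs.
have : size (tval t) = size (behead L) by rewrite size_tuple size_behead.
move: (tval t) => {}t; move: us zs; case: (L : seq I) => [//|v s'] /= /andP[vs us']; rewrite inE.
rewrite [v == z]eq_sym; case: eqP => [-> _|//] st; rewrite memNindex// [RHS]nth_default//.
by rewrite st.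
Qed.

(** The reference measure of a union is the product of those of the two parts and of one joining
    increment. With base point [x] and the sites of [r] integrated innermost, the integral of [H]
    does not depend on the height of [y], and that of [g] does not depend on the height of [x]. *)
Lemma gint_prod (s r : seq I) x y (F H : cfg -> \bar R) (g : E -> \bar R) :
  uniq (s ++ r) -> x \in s -> y \in r ->
  grad_functional [set` s] F -> grad_functional [set` r] H ->
  measurable_fun setT g -> (forall t, 0 <= g t) ->
  gint (s ++ r) (fun f => F f * (g (hs_sub (f y) (f x)) * H f)) =
  gint s F * (\int[lam]_t g t * gint r H).
Proof.
move=> usr xs yr FD HD mg g0.
have [mF FE] := FD; have [mH HE] := HD.
set K := fun f : cfg => g (hs_sub (f y) (f x)).
have mK : nn_measurable K.
  split => [|f]; last exact: g0.
  by apply: (measurableT_comp mg); apply: measurable_hs_sub; exact: measurable_coord.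
have mM (A B : cfg -> \bar R) : nn_measurable A -> nn_measurable B ->
    nn_measurable (fun f => A f * B f).
  by move=> [mA A0] [mB B0]; split => [|f]; [exact: emeasurable_funM|exact: mule_ge0].
set G := fun f => _.
have nnm : nn_measurable G by apply: (mM) => //; exact: mM.
have sub z : (z \in s) || (z \in r) -> [set` s ++ r] z by rewrite /= mem_cat.
have GE : grad_functional [set` s ++ r] G.
  split => // f f' ff'; rewrite /G.
  rewrite (FE f f'); last by move=> a b /= a' b'; apply: ff'; apply: sub; rewrite ?a' ?b'.
  rewrite (HE f f'); last by move=> a b /= a' b'; apply: ff'; apply: sub; rewrite ?a' ?b' orbT.
  by rewrite (ff' x y)//; apply: sub; rewrite ?xs ?yr ?orbT.
have sr := perm_to_rem xs; have rr := perm_to_rem yr.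
set s' := rem x s in sr; set r' := rem y r in rr.
have [us [ur dsr]] : uniq s /\ uniq r /\ forall z, z \in s -> z \notin r.
  move: usr; rewrite cat_uniq => /and3P[-> /hasPn h ->]; split=> //; split => // z zs.
  by apply: contraL zs => /h.
rewrite (@gint_perm (s ++ r) ((x :: s') ++ (y :: r')))//; last exact: perm_cat.
rewrite (@gint_perm s (x :: s'))// (@gint_perm r (y :: r'))//.
have FD' : grad_functional [set` x :: s'] F.
  by rewrite (_ : [set` _] = [set` s])//; apply/seteqP; split => z /=; rewrite (perm_mem sr).
have HD' : grad_functional [set` y :: r'] H.
  by rewrite (_ : [set` _] = [set` r])//; apply/seteqP; split => z /=; rewrite (perm_mem rr).
have yr' : y \notin r' by move: ur; rewrite (perm_uniq rr) => /andP[].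
have xr : x \notin r by exact: dsr.
have Fupd h z t : z \in r -> F (upd h z t) = F h.
  move=> zr; apply: FE => a b /= aS bS; rewrite /upd.
  have [za|_] := eqVneq a z; first by have := dsr _ aS; rewrite za zr.
  by have [zb|//] := eqVneq b z; have := dsr _ bS; rewrite zb zr.
have r'r z : z \in r' -> z \in r by move=> zr'; rewrite (perm_mem rr) inE zr' orbT.
have Kupd h z t : z \in r' -> K (upd h z t) = K h.
  move=> zr'; rewrite /K /upd ifN; last by apply: contraNneq yr' => ->.
  by rewrite ifN//; apply: contraNneq xr => ->; exact: r'r.
rewrite {1}/gint /= iter_int_cat.
have inner f : iter_int lam (y :: r') G f = (\int[lam]_t g t * gint (y :: r') H) * F f.
  rewrite /G /=.
  under eq_integral => t _.
    rewrite iter_intZ; [|exact: mM|exact: mF.2|by move=> h z u /r'r; exact: Fupd].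
    rewrite Fupd ?yr// iter_intZ; [|exact: mH|exact: mK.2|exact: Kupd].
    rewrite -(@gint_cons y r' H (upd f y t) HD') /K /upd eqxx ifN; last by apply: contraNneq xr => ->.
    over.
  have mgs : measurable_fun setT (fun t => g (hs_sub t (f x))).
    by apply: (measurableT_comp mg); apply: measurable_hs_sub => //; exact: measurable_cst.
  have H0 : 0 <= gint (y :: r') H by have [_] := iter_int_nn lam r' mH; apply.
  rewrite (@ge0_integralZl _ _ _ _ _ measurableT (fun t => g (hs_sub t (f x)) * gint (y :: r') H));
    [|exact: emeasurable_funM|by move=> t _; rewrite mule_ge0|exact: mF.2].
  rewrite ge0_integralZr//.
  by rewrite (@ge0_integral_hs_sub R k (f x) g)// muleC.
have -> : iter_int lam (y :: r') G = fun f => (\int[lam]_t g t * gint (y :: r') H) * F f.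
  by apply/funext.
rewrite iter_intZ//; last by move=> f; rewrite mule_ge0 ?integral_ge0//; have [_] := iter_int_nn lam r' mH; apply.
by rewrite muleC.
Qed.

End gradient_integrals.

(** * Entropy of finite marginals *)

Section marginal_entropy.
Local Open Scope ereal_scope.
Context (R : realType) (k : height_kind) (d : nat).
Notation E := (heights R k).
Notation I := (site d).
Notation cfg := (config E d).
Notation lam := (hs_ref E).
Implicit Types (D L M : {fset I}) (mu : gradient_measure R k d).

Lemma measurable_gradT_incl (D D' : set I) : D `<=` D' ->
  measurable_fun [set: gradT E D'] (id : gradT E D' -> gradT E D).
Proof.
move=> DD'; apply: (@measurability _ _ (gradT E D') (gradT E D) setT id (gradient_events D) erefl).
move=> _ [_ [x [y [B [Dx Dy mB ->]]]] <-]; rewrite setTI preimage_id.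
by apply: sub_sigma_algebra; exists x, y, B; split => //; exact: DD'.
Qed.

Lemma measurable_fun_gradT_incl (D D' : set I) (F : cfg -> \bar R) : D `<=` D' ->
  measurable_fun [set: gradT E D] (F : gradT E D -> \bar R) ->
  measurable_fun [set: gradT E D'] (F : gradT E D' -> \bar R).
Proof. by move=> DD' mF; apply: (measurableT_comp mF); exact: measurable_gradT_incl. Qed.

Lemma measurable_hs_sub_gradT (D : set I) x y : D x -> D y ->
  measurable_fun [set: gradT E D] (fun f : gradT E D => hs_sub (f y) (f x)).
Proof.
move=> Dx Dy _ B mB; rewrite setTI; apply: sub_sigma_algebra.
by exists x, y, B.
Qed.

Definition marginal D mu : probability (gradT E [set` D]) R := distribution mu (@Defs.restrict R E d [set` D]).

Definition ent D mu : \bar R :=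
  relative_entropy (marginal D mu) (gradient_reference E D).

Lemma marginalE D mu (A : set (gradT E [set` D])) : marginal D mu A = mu A.
Proof. by []. Qed.

Lemma measurable_gradT_setT D (A : set cfg) :
  measurable (A : set (gradT E [set` D])) -> measurable (A : set (gradT E setT)).
Proof.
move=> mA; have := @measurable_gradT_incl [set` D] setT (fun _ _ => Logic.I) measurableT _ mA.
by rewrite setTI preimage_id.
Qed.

Lemma ge0_integral_marginal D mu (F : cfg -> \bar R) :
  measurable_fun [set: gradT E [set` D]] (F : gradT E [set` D] -> \bar R) ->
  (forall f, 0 <= F f) ->
  \int[marginal D mu]_f F f = \int[mu]_f F f.
Proof.
move=> mF F0.
exact: (@ge0_integral_pushforward _ _ _ _ _ _ (@Defs.restrict_measurable R E d [set` D]) mu setT F measurableT mF (fun y _ => F0 y)).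
Qed.

Lemma quasi_integral_marginal D mu (F : cfg -> \bar R) :
  measurable_fun [set: gradT E [set` D]] (F : gradT E [set` D] -> \bar R) ->
  quasi_integral (marginal D mu) F = quasi_integral mu F.
Proof.
move=> mF; rewrite /quasi_integral !(@ge0_integral_marginal D)//;
  [exact: measurable_funeneg|exact: measurable_funepos].
Qed.

Lemma lower_integrable_marginal D mu (F : cfg -> \bar R) :
  measurable_fun [set: gradT E [set` D]] (F : gradT E [set` D] -> \bar R) ->
  lower_integrable (marginal D mu) F <-> lower_integrable mu F.
Proof.
move=> mF; have mF' := @measurable_fun_gradT_incl _ setT _ (fun _ _ => Logic.I) mF.
rewrite /lower_integrable (@ge0_integral_marginal D)//; last exact: measurable_funeneg.
by split => -[].
Qed.

Definition subdensity D (g : cfg -> \bar R) :=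
  [/\ measurable_fun [set: gradT E [set` D]] (g : gradT E [set` D] -> \bar R),
      forall f, 0 <= g f & gint D g <= 1].

(* The densities of mu then have logarithms whose negative part is integrable. *)
Definition tame D mu :=
  exists2 g, subdensity D g & lower_integrable mu (fun f => lne (g f)).

Lemma gradient_reference_gint D (g : cfg -> \bar R) :
  measurable_fun [set: gradT E [set` D]] (g : gradT E [set` D] -> \bar R) ->
  (forall f, 0 <= g f) -> \int[gradient_reference E D]_f g f = gint D g.
Proof. exact: gradient_referenceE. Qed.

Lemma measurable_lne_comp dT (T : measurableType dT) (g : T -> \bar R) :
  measurable_fun setT g -> measurable_fun setT (fun f => lne (g f)).
Proof. by move=> mg; apply: measurableT_comp => //; exact: measurable_lne. Qed.

Lemma ent_ge D mu g : subdensity D g -> lower_integrable mu (fun f => lne (g f)) ->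
  quasi_integral mu (fun f => lne (g f)) <= ent D mu.
Proof.
move=> [mg g0 g1] glow; rewrite /ent.
have [dom|ndom] := pselect (marginal D mu `<< gradient_reference E D); last first.
  by rewrite /relative_entropy asboolF// leey.
have mlg := measurable_lne_comp mg.
rewrite -(@quasi_integral_marginal D)//; apply: (gibbs dom mg g0 _ _).2.
  by rewrite gradient_reference_gint.
exact/lower_integrable_marginal.
Qed.

Lemma ent_gtNy D mu : tame D mu -> -oo < ent D mu.
Proof.
by move=> [g gD glow]; apply: lt_le_trans (ent_ge gD glow); exact: quasi_integral_gtNy.
Qed.

(** Together with [ent_ge] this is a variational formula: the entropy is the largest mean logarithm
    of a subdensity, attained at the density of the marginal. *)
Lemma ent_density D mu : tame D mu -> marginal D mu `<< gradient_reference E D ->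
  exists2 g, subdensity D g & lower_integrable mu (fun f => lne (g f)) /\
    ent D mu = quasi_integral mu (fun f => lne (g f)).
Proof.
move=> [g [mg g0 g1] glow] dom.
pose s := Radon_Nikodym_SigmaFinite.f (marginal D mu) (gradient_reference E D).
have ms : measurable_fun [set: gradT E [set` D]] s.
  exact: measurable_int (Radon_Nikodym_SigmaFinite.f_integrable dom).
have s0 f : 0 <= s f by exact: Radon_Nikodym_SigmaFinite.f_ge0.
exists s; first split => //.
  rewrite -gradient_reference_gint//.
  rewrite -(Radon_Nikodym_SigmaFinite.f_integral dom)//.
  exact: probability_le1.
have mls := measurable_lne_comp ms.
split.
  apply/(@lower_integrable_marginal D) => //.
  apply: (gibbs dom mg g0 _ _).1; first by rewrite gradient_reference_gint.
  by apply/lower_integrable_marginal => //; exact: measurable_lne_comp.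
by rewrite /ent relative_entropyE// (@quasi_integral_marginal D).
Qed.

Lemma lne_mul (a b : \bar R) : 0 <= a -> 0 <= b -> lne (a * b) = lne a + lne b.
Proof.
rewrite le_eqVlt => /predU1P[<- b0|a0].
  by rewrite mul0e !(@le0_lneNy _ 0)// addNye.
rewrite le_eqVlt => /predU1P[<-|b0]; first by rewrite mule0 !(@le0_lneNy _ 0)// addeNy.
by rewrite lneM// in_itv/= leey andbT.
Qed.

Lemma grad_functional_sub D g : subdensity D g -> grad_functional [set` D] g.
Proof. by move=> [mg g0 _]; exact: grad_functional_gradT. Qed.

Lemma gint_ge0 (s : seq I) (g : cfg -> \bar R) : nn_measurable g -> 0 <= gint s g.
Proof. by move=> mg; have [_] := iter_int_nn lam (behead s) mg; apply. Qed.

Lemma perm_fsetU L M : [disjoint L & M]%fset -> perm_eq (L `|` M)%fset (L ++ M : seq I).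
Proof.
move=> LM; apply: uniq_perm.
- exact: fset_uniq.
- rewrite cat_uniq !fset_uniq/= andbT; apply/hasPn => x xM /=.
  by apply: contraL xM => xL; move/fdisjointP : LM; apply.
- by move=> x; rewrite mem_cat in_fsetU.
Qed.

Lemma gint_fsetU L M x y (F H : cfg -> \bar R) (g : E -> \bar R) :
  [disjoint L & M]%fset -> x \in L -> y \in M ->
  grad_functional [set` L] F -> grad_functional [set` M] H ->
  measurable_fun setT g -> (forall t, 0 <= g t) ->
  grad_functional [set` (L `|` M)%fset] (fun f => F f * (g (hs_sub (f y) (f x)) * H f)) /\
  gint (L `|` M)%fset (fun f => F f * (g (hs_sub (f y) (f x)) * H f)) =
  gint L F * (\int[lam]_t g t * gint M H).
Proof.
move=> LM xL yM FL HM mg g0.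
have GLM : grad_functional [set` (L `|` M)%fset] (fun f => F f * (g (hs_sub (f y) (f x)) * H f)).
  split.
    split => [|f]; last by rewrite mule_ge0 ?mule_ge0 ?FL.1.2 ?HM.1.2.
    apply: emeasurable_funM; first exact: FL.1.1.
    apply: emeasurable_funM; last exact: HM.1.1.
    by apply: (measurableT_comp mg); apply: measurable_hs_sub; exact: measurable_coord.
  move=> f f' ff'; rewrite (FL.2 f f'); last first.
    by move=> a b /= aL bL; apply: ff'; rewrite /= in_fsetU ?aL ?bL.
  rewrite (HM.2 f f'); last first.
    by move=> a b /= aL bL; apply: ff'; rewrite /= in_fsetU ?aL ?bL orbT.
  by rewrite (ff' x y)//= in_fsetU ?xL ?yM ?orbT.
split => //; rewrite (gint_perm (fset_uniq _) (perm_fsetU LM) GLM).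
apply: gint_prod => //.
by rewrite -(perm_uniq (perm_fsetU LM)) fset_uniq.
Qed.

Lemma subdensity_prod L M x y F H (g : E -> \bar R) :
  [disjoint L & M]%fset -> x \in L -> y \in M -> subdensity L F -> subdensity M H ->
  measurable_fun setT g -> (forall t, 0 <= g t) -> \int[lam]_t g t <= 1 ->
  subdensity (L `|` M)%fset (fun f => F f * (g (hs_sub (f y) (f x)) * H f)).
Proof.
move=> LM xL yM FL HM mg g0 g1.
have [mF F0 F1] := FL; have [mH H0 H1] := HM.
split.
- apply: emeasurable_funM.
    by apply: measurable_fun_gradT_incl mF => z /= zL; rewrite in_fsetU zL.
  apply: emeasurable_funM; last first.
    by apply: measurable_fun_gradT_incl mH => z /= zL; rewrite in_fsetU zL orbT.
  apply: (measurableT_comp mg); apply: measurable_hs_sub_gradT => /=;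
    by rewrite in_fsetU ?xL ?yM ?orbT.
- by move=> f; rewrite !mule_ge0.
- have [_ ->] := gint_fsetU LM xL yM (grad_functional_sub FL) (grad_functional_sub HM) mg g0.
  have [nF _] := grad_functional_sub FL; have [nH _] := grad_functional_sub HM.
  rewrite -[leRHS](mul1e 1) lee_pmul//.
  + exact: gint_ge0.
  + by rewrite mule_ge0 ?integral_ge0// gint_ge0.
  + by rewrite -[leRHS](mul1e 1) lee_pmul// ?integral_ge0// gint_ge0.
Qed.

Lemma subdensity1 v : subdensity [fset v]%fset (cst 1).
Proof.
split => //; rewrite /gint.
have /perm_small_eq -> // : perm_eq [fset v]%fset [:: v].
by apply: uniq_perm => // x; rewrite !inE.
Qed.

Lemma lne_cst1 : (fun f : gradT E [set: I] => lne (cst (1 : \bar R) f)) = cst 0%:E.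
Proof. by apply/funext => f; rewrite /cst lne_EFin// ln1. Qed.

Lemma tame1 v mu : tame [fset v]%fset mu.
Proof.
exists (cst 1); first exact: subdensity1.
by rewrite lne_cst1; exact: lower_integrable_cst.
Qed.

Lemma ent1_ge0 v mu : 0 <= ent [fset v]%fset mu.
Proof.
have := @ent_ge [fset v]%fset mu (cst 1) (subdensity1 v).
rewrite lne_cst1.
by rewrite quasi_integral_cst; apply; exact: lower_integrable_cst.
Qed.

(** The constant [2 * K + 1] bounds the reference mass of [-K, K] for both kinds of heights: the
    length is [2 * K], and there are at most [2 * K + 1] integers. For a subdensity an upper bound
    on the mass is enough. *)
Definition uniform_density (K : R) (t : E) : \bar R :=
  ((2 * K + 1)^-1)%R%:E * (\1_[set t : E | (`|hs_incl t| <= K)%R] t)%:E.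

Lemma measurable_hs_bounded (K : R) : measurable [set t : E | (`|hs_incl t| <= K)%R].
Proof.
rewrite (_ : [set _ | _] = setT `&` (@hs_incl R E) @^-1` `[(- K)%R, K]%classic).
  by apply: measurable_hs_incl.
by rewrite setTI; apply/seteqP; split => t /=; rewrite in_itv/= ler_norml.
Qed.

Lemma hs_ref_bounded (K : R) : (0 <= K)%R ->
  lam [set t | (`|hs_incl t| <= K)%R] <= (2 * K + 1)%R%:E.
Proof.
move=> K0; case: k => /=; last first.
  rewrite (_ : [set _ | _] = `[(- K)%R, K]%classic); last first.
    by apply/seteqP; split => t /=; rewrite in_itv/= ler_norml.
  rewrite lebesgue_measure_itv/= lte_fin; case: ifP => _.
    by rewrite -EFinB lee_fin; lra.
  by rewrite lee_fin; lra.
pose N := Num.truncn K.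
have sub : [set t : int | (`|t%:~R : R| <= K)%R] `<=`
    [set` [fset (i%:Z - N%:Z)%R | i in iota 0 (N + N).+1]%fset].
  move=> t /=; rewrite -intr_norm => tK.
  have tN : (`|t| <= N)%N.
    by rewrite /N truncn_ge_nat// natr_absz.
  apply/imfsetP => /=; exists (absz (t + N%:Z)%R).
    by rewrite inE mem_iota; lia.
  lia.
rewrite /counting asboolT; last exact: sub_finite_set sub (finite_fset _).
rewrite lee_fin; have NK : (N%:R <= K)%R by rewrite /N truncn_le.
apply: (@le_trans _ _ ((N + N).+1)%:R%R); last by rewrite -natr1 natrD; lra.
rewrite ler_nat; apply: (@leq_trans #|` [fset (i%:Z - N%:Z)%R | i in iota 0 (N + N).+1]%fset|).
  apply: fsubset_leq_card; apply/fsubsetP => t.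
  by rewrite in_fset_set ?inE; [exact: sub|exact: sub_finite_set sub (finite_fset _)].
rewrite -[X in (_ <= X)%N](size_iota 0).
rewrite (leq_trans (leq_imfset_card _ _ _))//.
apply: uniq_leq_size; first exact: enum_finmem_uniq.
by move=> z; rewrite enum_finmemE.
Qed.

Lemma measurable_uniform_density K : measurable_fun setT (uniform_density K).
Proof.
apply: measurable_funeM; apply/measurable_EFinP; apply: measurable_indic.
exact: measurable_hs_bounded.
Qed.

Lemma uniform_density_ge0 K t : (0 <= K)%R -> 0 <= uniform_density K t.
Proof. by move=> K0; rewrite mule_ge0// lee_fin invr_ge0; lra. Qed.

Lemma integral_uniform_density K : (0 <= K)%R -> \int[lam]_t uniform_density K t <= 1.
Proof.
move=> K0; have mK := measurable_hs_bounded K.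
have K1 : (0 < 2 * K + 1)%R by lra.
rewrite ge0_integralZl_EFin//; last 2 first.
- by apply/measurable_EFinP; exact: measurable_indic.
- by rewrite invr_ge0 ltW.
rewrite integral_indic// setIT.
apply: (@le_trans _ _ (((2 * K + 1)^-1)%:E * (2 * K + 1)%:E)).
  by rewrite lee_pmul2l ?lte_fin ?invr_gt0//; exact: hs_ref_bounded.
by rewrite -EFinM mulVf ?gt_eqF.
Qed.

Section superadditivity.
Variables (L M : {fset I}) (x y : I) (mu : gradient_measure R k d) (K : R).
Hypotheses (LM : [disjoint L & M]%fset) (xL : x \in L) (yM : y \in M) (K0 : (0 <= K)%R).
Hypothesis incK : {ae mu, forall f : gradT E [set: I], (`|increment f x y| <= K)%R}.
Let c := (- ln (2 * K + 1))%R.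

Let prodd F H (f : cfg) : \bar R := F f * (uniform_density K (hs_sub (f y) (f x)) * H f).

Let prodd_qi F H : subdensity L F -> subdensity M H ->
  lower_integrable mu (fun f => lne (F f)) -> lower_integrable mu (fun f => lne (H f)) ->
  [/\ subdensity (L `|` M)%fset (prodd F H), lower_integrable mu (fun f => lne (prodd F H f)) &
   quasi_integral mu (fun f => lne (prodd F H f)) =
   quasi_integral mu (fun f => lne (F f)) + quasi_integral mu (fun f => lne (H f)) + c%:E].
Proof.
move=> FL HM lF lH; have [mF F0 F1] := FL; have [mH H0 H1] := HM.
have K1 : (0 < 2 * K + 1)%R by rewrite ltr_wpDl// mulr_ge0.
have sd : subdensity (L `|` M)%fset (prodd F H).
  apply: subdensity_prod => //.
  - exact: measurable_uniform_density.
  - by move=> t; exact: uniform_density_ge0.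
  - exact: integral_uniform_density.
have [mp p0 _] := sd.
have mp' : measurable_fun setT (fun f : gradT E setT => lne (prodd F H f)).
  by apply: measurable_lne_comp; exact: measurable_fun_gradT_incl mp.
have ae : {ae mu, forall f : gradT E [set: I], lne (prodd F H f) =
    ((fun f => lne (F f)) \+ (fun f => lne (H f)) \+ cst c%:E) f}.
  have u0 := uniform_density_ge0 _ K0.
  apply: filterS incK => f fK; rewrite /prodd (lne_mul (F0 f) (mule_ge0 (u0 _) (H0 f))) (lne_mul (u0 _) (H0 f)).
  rewrite (_ : lne (uniform_density _ _) = c%:E); first by rewrite -addeA; congr (_ + _); rewrite addeC.
  rewrite /uniform_density indicE mem_set// mule1 lne_EFin ?invr_gt0//.
  by rewrite lnV// posrE.
have lc := lower_integrable_cst mu c.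
have lall := lower_integrableD (lower_integrableD lF lH) lc.
split => //.
  by apply: (lower_integrable_ge mp' lall); apply: filterS ae => f ->.
rewrite (eq_quasi_integral mp' lall.1 ae) quasi_integralD//; last exact: lower_integrableD.
by rewrite quasi_integralD// quasi_integral_cst.
Qed.

Lemma tame_fsetU : tame L mu -> tame M mu -> tame (L `|` M)%fset mu.
Proof. by move=> [F FL lF] [H HM lH]; have [? ? _] := prodd_qi FL HM lF lH; exists (prodd F H). Qed.

(* Gibbs' inequality for the product of the two densities with the uniform
   density on [-K, K] of the increment joining the two volumes. *)
Lemma ent_superadditive : tame L mu -> tame M mu ->
  ent L mu + ent M mu + c%:E <= ent (L `|` M)%fset mu.
Proof.
move=> tL tM.
have [dom|ndom] := pselect (marginal (L `|` M)%fset mu `<< gradient_reference E (L `|` M)%fset);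
  last by rewrite {3}/ent /relative_entropy asboolF// leey.
have indic_meas D (A : set (gradT E [set` D])) : measurable A ->
    measurable_fun [set: gradT E [set` D]] (EFin \o \1_A).
  by move=> mA; apply/measurable_EFinP; exact: measurable_indic.
have ref0 D (A : set (gradT E [set` D])) : measurable A ->
    gradient_reference E D A = gint D (EFin \o \1_A).
  move=> mA; rewrite -gradient_reference_gint.
  - by rewrite (integral_indic _ measurableT)// setIT.
  - exact: indic_meas.
  - by move=> f; rewrite lee_fin.
have grad_indic D (A : set (gradT E [set` D])) : measurable A ->
    grad_functional [set` D] (EFin \o \1_A).
  by move=> mA; apply: grad_functional_gradT; [exact: indic_meas|move=> f; rewrite lee_fin].
have mone : measurable_fun [set: E] (cst (1 : \bar R)) by exact: measurable_cst.
have one0 (t : E) : 0 <= (cst (1 : \bar R)) t by [].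
have gone D : grad_functional [set` D] (fun _ : cfg => 1 : \bar R).
  by apply: grad_functional_gradT => //; exact: measurable_cst.
(* A null event of [L] stays null for the union: by [gint_fsetU] with constant [g] and [H], its
   measure there is 0 * oo = 0. *)
have domL : marginal L mu `<< gradient_reference E L.
  apply/null_content_dominatesP => A mA A0.
  have mA' : measurable (A : set (gradT E [set` (L `|` M)%fset])).
    have := @measurable_gradT_incl [set` L] [set` (L `|` M)%fset] _ measurableT _ mA.
    by rewrite setTI preimage_id; apply => z /= zL; rewrite in_fsetU zL.
  move/null_content_dominatesP : dom => /(_ _ mA'); apply.
  apply: (etrans (ref0 _ _ mA')).
  have := (gint_fsetU LM xL yM (grad_indic _ _ mA) (gone M) mone one0).2.
  rewrite -(ref0 _ _ mA) A0 mul0e => <-.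
  by congr gint; apply/funext => f; rewrite /= !mule1.
have domM : marginal M mu `<< gradient_reference E M.
  apply/null_content_dominatesP => A mA A0.
  have mA' : measurable (A : set (gradT E [set` (L `|` M)%fset])).
    have := @measurable_gradT_incl [set` M] [set` (L `|` M)%fset] _ measurableT _ mA.
    by rewrite setTI preimage_id; apply => z /= zL; rewrite in_fsetU zL orbT.
  move/null_content_dominatesP : dom => /(_ _ mA'); apply.
  apply: (etrans (ref0 _ _ mA')).
  have := (gint_fsetU LM xL yM (gone L) (grad_indic _ _ mA) mone one0).2.
  rewrite -(ref0 _ _ mA) A0 !mule0 => <-.
  by congr gint; apply/funext => f; rewrite /= !mul1e.
have [F FL [lF ->]] := ent_density tL domL.
have [H HM [lH ->]] := ent_density tM domM.
have [sd lp <-] := prodd_qi FL HM lF lH.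
exact: ent_ge.
Qed.

End superadditivity.

Section translation.
Variables (l : I) (D : {fset I}) (mu : gradient_measure R k d).
Notation sh := (@Defs.shift R k d l).
Hypothesis mu_l : forall B : set (gradT E [set: I]), measurable B -> mu (sh @^-1` B) = mu B.

Lemma measurable_shift (D1 D2 : set I) : (forall x, D2 x -> D1 (x + l)%R) ->
  measurable_fun [set: gradT E D1] (sh : gradT E D1 -> gradT E D2).
Proof.
move=> D21.
apply: (@measurability _ _ (gradT E D1) (gradT E D2) setT sh (gradient_events D2) erefl).
move=> _ [_ [x [y [B [Dx Dy mB ->]]]] <-].
by apply: (@measurable_hs_sub_gradT D1 (x + l)%R (y + l)%R) => //; exact: D21.
Qed.

Lemma in_translate x : x \in D -> (x + l)%R \in translate l D.
Proof. by move=> xD; apply: in_imfset. Qed.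

Lemma ge0_integral_shift (F : cfg -> \bar R) :
  measurable_fun [set: gradT E setT] (F : gradT E setT -> \bar R) ->
  (forall f, 0 <= F f) -> \int[mu]_f F (sh f) = \int[mu]_f F f.
Proof.
move=> mF F0.
have msh : measurable_fun setT (sh : gradT E setT -> gradT E setT) by exact: measurable_shift.
have := @ge0_integral_pushforward _ _ _ _ _ _ msh mu setT F measurableT mF (fun y _ => F0 y).
rewrite preimage_setT => <-.
by apply: eq_measure_integral => A mA _; exact: (mu_l mA).
Qed.

Lemma quasi_integral_shift (F : cfg -> \bar R) :
  measurable_fun [set: gradT E setT] (F : gradT E setT -> \bar R) ->
  quasi_integral mu (fun f => F (sh f)) = quasi_integral mu F.
Proof.
move=> mF; rewrite /quasi_integral.
rewrite -[in RHS](ge0_integral_shift (measurable_funepos mF))//.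
rewrite -[in RHS](ge0_integral_shift (measurable_funeneg mF))//.
by congr (_ - _)%dE; apply: eq_integral => f _; rewrite ?funeposE ?funenegE.
Qed.

Lemma lower_integrable_shift (F : cfg -> \bar R) : lower_integrable mu F ->
  lower_integrable mu (fun f => F (sh f)).
Proof.
move=> [mF F0]; split.
  apply: (measurableT_comp mF); exact: measurable_shift.
apply: le_lt_trans F0; rewrite -(ge0_integral_shift (measurable_funeneg mF))//.
by apply: ge0_le_integral => //=;
  do ?[apply: measurable_funeneg; apply: (measurableT_comp mF); exact: measurable_shift
      |apply: (measurableT_comp (measurable_funeneg mF)); exact: measurable_shift];
  move=> f _; rewrite !funenegE.
Qed.

Lemma gint_translate F : grad_functional [set` D] F ->
  gint (translate l D) (fun f => F (sh f)) = gint D F.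
Proof.
move=> FD; have [nF FE] := FD.
have pm : perm_eq (translate l D) [seq (x + l)%R | x <- (D : seq I)].
  apply: uniq_perm; rewrite ?fset_uniq//.
    by rewrite map_inj_uniq ?fset_uniq//; exact: addIr.
  by move=> x; apply/imfsetP/mapP => -[y yD ->]; exists y.
rewrite (gint_perm (fset_uniq _) pm); last first.
  split => [|f g fg].
    split => [|f]; last exact: nF.2.
    apply: (measurableT_comp nF.1); apply: measurable_to_field => x.
    exact: measurable_coord.
  by apply: FE => x y xD yD; apply: fg; exact: in_translate.
by rewrite /gint behead_map (@iter_int_reindex _ _ _ _ _ _ (fun x => x + l)%R)//; exact: addIr.
Qed.

Lemma subdensity_translate g : subdensity D g -> subdensity (translate l D) (fun f => g (sh f)).
Proof.
move=> gD; have [mg g0 g1] := gD; split => //.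
  apply: (measurableT_comp mg); apply: measurable_shift => x; exact: in_translate.
by rewrite gint_translate//; exact: grad_functional_sub.
Qed.

(** The density of the marginal on [D], evaluated at the shifted configuration, is a subdensity on
    the translate with the same mean logarithm, so [ent_ge] applies. This is the direction that the
    tiling by blocks uses. *)
Lemma ent_translate : tame D mu -> ent D mu <= ent (translate l D) mu.
Proof.
move=> tD.
have [dom|ndom] := pselect (marginal (translate l D) mu `<< gradient_reference E (translate l D));
  last by rewrite {2}/ent /relative_entropy asboolF// leey.
have domD : marginal D mu `<< gradient_reference E D.
  apply/null_content_dominatesP => A mA A0.
  have mi : measurable_fun [set: gradT E [set` D]] (EFin \o (\1_A : _ -> R)).
    by apply/measurable_EFinP; exact: measurable_indic.
  have gA : gint D (EFin \o \1_A) = 0.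
    rewrite -gradient_reference_gint//; last by move=> f; rewrite lee_fin.
    by rewrite (integral_indic _ measurableT)// setIT.
  have mA' : measurable (sh @^-1` A : set (gradT E [set` translate l D])).
    rewrite -[X in measurable X]setTI.
    by apply: (@measurable_shift [set` translate l D] [set` D]) => // x; exact: in_translate.
  have := mu_l (measurable_gradT_setT mA); rewrite -[mu A]/(marginal D mu A) => <-.
  move/null_content_dominatesP : dom => /(_ _ mA'); apply.
  apply: (@etrans _ _ (gint (translate l D) (fun f => (\1_A (sh f))%:E))).
    rewrite -gradient_reference_gint//.
    - by have /= := integral_indic (gradient_reference E (translate l D)) measurableT mA'; rewrite setIT => <-.
    - by apply: (measurableT_comp mi); apply: measurable_shift => x; exact: in_translate.
  rewrite (@gint_translate (EFin \o (\1_A : _ -> R)))//.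
  by apply: grad_functional_gradT => // f; rewrite lee_fin.
have [g gD [lg ->]] := ent_density tD domD.
rewrite -(quasi_integral_shift lg.1).
by apply: ent_ge; [exact: subdensity_translate|exact: lower_integrable_shift lg].
Qed.

End translation.

(** On two sites a test density is a density [g] of the single increment. The interesting choice of
    [g] is the one in [real_edge_entropy]. *)
Lemma ent_edge x y mu (g : E -> \bar R) : x != y ->
  measurable_fun setT g -> (forall t, 0 <= g t) -> \int[lam]_t g t <= 1 ->
  lower_integrable mu (fun f => lne (g (hs_sub (f y) (f x)))) ->
  tame [fset x; y]%fset mu /\
  quasi_integral mu (fun f => lne (g (hs_sub (f y) (f x)))) <= ent [fset x; y]%fset mu.
Proof.
move=> xy mg g0 g1.
have dis : [disjoint [fset x] & [fset y]]%fset by rewrite fdisjoint1X inE.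
have sd := subdensity_prod dis (fset11 x) (fset11 y) (subdensity1 x) (subdensity1 y) mg g0 g1.
have -> : (fun f : cfg => lne (g (hs_sub (f y) (f x)))) =
    (fun f : cfg => lne (cst 1 f * (g (hs_sub (f y) (f x)) * cst 1 f))).
  by apply/funext => f; rewrite /cst mul1e mule1.
move=> low; split; [by eexists; [exact: sd|exact: low]|exact: ent_ge].
Qed.

End marginal_entropy.

(** * Lipschitz constraints and slopes *)

Section boxes.
Context (d : nat).
Implicit Types (x y : site d).

Let of_ffun n (f : {ffun 'I_d -> 'I_n}) : site d := \row_i (f i)%:Z.

Let box_setE n : [set x : site d | forall i, 0 <= x 0 i < n%:Z] =
  [set` [fset of_ffun f | f in enum {: {ffun 'I_d -> 'I_n}}]%fset].
Proof.
apply/seteqP; split => x /=.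
  move=> xn; apply/imfsetP => /=.
  have lt i : (`|x 0%R i| < n)%N by have := xn i; lia.
  exists [ffun i => Ordinal (lt i)]; first by rewrite mem_enum.
  apply/rowP => i; rewrite mxE ffunE /=; have := xn i; lia.
by move=> /imfsetP[f _ ->] i; rewrite mxE lez_nat ltz_nat ltn_ord.
Qed.

Lemma mem_box n x : (x \in box d n) = [forall i, 0 <= x 0 i < n%:Z].
Proof.
have fin : finite_set [set x : site d | forall i, 0 <= x 0 i < n%:Z].
  by rewrite box_setE; exact: finite_fset.
apply/idP/forallP => [|xn]; rewrite in_fset_set//; first by rewrite inE.
by rewrite inE.
Qed.

Lemma card_box n : #|` box d n| = (n ^ d)%N.
Proof.
rewrite /box box_setE set_fsetK card_imfset/=; last first.
  by move=> f g /rowP fg; apply/ffunP => i; have := fg i; rewrite !mxE => -[] /val_inj.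
have -> : size (enum_finmem (mem_fin (fin_finpred (enum {: {ffun 'I_d -> 'I_n}})))) =
    size (enum {: {ffun 'I_d -> 'I_n}}).
  apply: perm_size; apply: uniq_perm; rewrite ?enum_finmem_uniq ?enum_uniq// => f.
  by rewrite enum_finmemE.
by rewrite -cardE card_ffun !card_ord.
Qed.

End boxes.

Section periodic.
Context (R : realType) (d : nat) (L : set (site d)) (m0 : nat).
Hypotheses (m0_gt0 : (0 < m0)%N) (L0 : L 0).
Hypotheses (LD : forall x y, L x -> L y -> L (x + y)) (LN : forall x, L x -> L (- x)).
Hypothesis Lm0 : forall x, L (x *+ m0).
Implicit Types (x y z : site d) (A : set {fset site d}).

(** As [m0] Z^d lies in [L], a site and its residue differ by an element of [L]; periodic quantities
    are thus controlled by finitely many values. *)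
Definition residue x : site d := \row_i (x 0%R i %% m0)%Z.

Lemma residue_box x : residue x \in box d m0.
Proof.
rewrite mem_box; apply/forallP => i; rewrite mxE modz_ge0 ?ltz_pmod//=; lia.
Qed.

Lemma sub_residue x : L (x - residue x).
Proof.
rewrite (_ : x - residue x = (\row_i (x 0%R i %/ m0)%Z) *+ m0)//.
apply/rowP => i; rewrite mulmxnE !mxE -mulr_natr natz.
by rewrite {1}(divz_eq (x 0 i) m0) addrK.
Qed.

Lemma L_muln x n : L x -> L (x *+ n).
Proof. by move=> Lx; elim: n => [|n IH]; rewrite ?mulr0n// mulrS; exact: LD. Qed.

Lemma periodic_bounded (h : site d -> R) :
  (forall l x, L l -> h (x + l) = h x) -> exists2 C, 0 <= C & forall x, h x <= C.
Proof.
move=> hL; exists (\big[Num.max/0]_(x <- box d m0) h x); first exact: bigmax_ge_id.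
move=> x; rewrite -[X in h X](subrK (residue x)) addrC hL; last exact: sub_residue.
by apply: le_bigmax_seq => //; exact: residue_box.
Qed.

Variable A : set {fset site d}.
Hypothesis admA : admissible_graph L A.

Lemma edge_neq x y : A [fset x; y]%fset -> x != y.
Proof.
have [A2 _ _ _] := admA; move=> /A2; apply: contraPneq => ->.
by rewrite fsetUid cardfs1.
Qed.

Lemma edge_translate x y l : L l -> A [fset x; y]%fset -> A [fset (x + l)%R; (y + l)%R]%fset.
Proof.
have [_ AL _ _] := admA; move=> Ll /(AL l _ Ll); congr A.
by rewrite /translate imfsetU !imfset_fset1.
Qed.

(** Up to a shift in [L] every edge starts in the box of side [m0], and a site has finitely many
    neighbours, so that [h] takes finitely many values on edges. *)
Lemma edge_bounded (h : site d -> site d -> R) :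
  (forall l x y, L l -> h (x + l) (y + l) = h x y) ->
  exists2 C, 0 <= C & forall x y, A [fset x; y]%fset -> h x y <= C.
Proof.
move=> hL; have [_ _ _ [n An]] := admA.
pose nb x := sval (cid2 (An x)).
have nbP x y : A [fset x; y]%fset -> y \in nb x by rewrite /nb; case: cid2 => /= N _; exact.
exists (\big[Num.max/0]_(x <- box d m0) \big[Num.max/0]_(y <- nb x) h x y).
  exact: bigmax_ge_id.
move=> x y Axy; have Lx := sub_residue x.
have Axy' : A [fset residue x; (y - (x - residue x))%R]%fset.
  by have := edge_translate (LN Lx) Axy; rewrite opprB addrCA subrr addr0.
rewrite -(hL (- (x - residue x))); last exact: LN.
rewrite opprB addrCA subrr addr0 -[_ - x]opprB.
apply: (@le_trans _ _ (\big[Num.max/0]_(z <- nb (residue x)) h (residue x) z)).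
  by apply: le_bigmax_seq => //; exact: nbP.
pose F w := \big[Num.max/0]_(z <- nb w) h w z.
rewrite -[leLHS]/(F (residue x)); apply: le_bigmax_seq => //; exact: residue_box.
Qed.

Lemma edge_positive (h : site d -> site d -> R) :
  (forall l x y, L l -> h (x + l) (y + l) = h x y) ->
  (forall x y, A [fset x; y]%fset -> 0 < h x y) ->
  exists2 c, 0 < c & forall x y, A [fset x; y]%fset -> c <= h x y.
Proof.
move=> hL h0; have [|C C0 hC] := @edge_bounded (fun x y => (h x y)^-1).
  by move=> l x y Ll; rewrite hL.
exists (C + 1)^-1; first by rewrite invr_gt0 ltr_wpDl.
move=> x y Axy; rewrite -[h x y]invrK lef_pV2 ?posrE ?invr_gt0 ?h0 ?ltr_wpDl//.
by rewrite (le_trans (hC _ _ Axy))// lerDl.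
Qed.

Section edge_class.
Variable c : site d -> site d -> R.
Hypothesis cL : forall l x y, L l -> c (x + l) (y + l) = c x y.

Definition edge_lipschitz (psi : site d -> R) :=
  forall x y, A [fset x; y]%fset -> psi y - psi x <= c x y.

(** The largest increment between two sites that the edge constraints [c] allow, finite because the
    graph is connected. It is the quasimetric that gets compared with [q], or with [q] lowered by
    some eps, through their maximality. *)
Definition lip_sup x y := sup [set psi y - psi x | psi in edge_lipschitz].

Lemma edge_lipschitz_bounded x y : exists C, forall psi, edge_lipschitz psi -> psi y - psi x <= C.
Proof.
have [_ _ conn _] := admA; have [s + <-] := conn x y.
elim: s x => [|z s IH] x /=; first by exists 0 => psi _; rewrite subrr.
move=> /andP[/asboolP Axz /IH[C hC]]; exists (c x z + C) => psi psiP.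
by have := psiP _ _ Axz; have := hC _ psiP; lra.
Qed.

Lemma le_lip_sup psi x y : edge_lipschitz psi -> psi y - psi x <= lip_sup x y.
Proof.
move=> psiP; apply: ub_le_sup; last by exists psi.
by have [C hC] := edge_lipschitz_bounded x y; exists C => _ [psi' /hC + <-].
Qed.

Lemma edge_lipschitz_translate psi l : L l -> edge_lipschitz psi ->
  edge_lipschitz (fun x => psi (x + l)).
Proof. by move=> Ll psiP x y /(edge_translate Ll) /psiP; rewrite cL. Qed.

Variable psi0 : site d -> R.
Hypothesis psi0P : edge_lipschitz psi0.

Lemma lip_sup_le x y C : (forall psi, edge_lipschitz psi -> psi y - psi x <= C) -> lip_sup x y <= C.
Proof. by move=> hC; apply: ge_sup => [|_ [psi /hC + <-]//]; exists (psi0 y - psi0 x), psi0. Qed.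

Lemma lip_sup_edge x y : A [fset x; y]%fset -> lip_sup x y <= c x y.
Proof. by move=> Axy; apply: lip_sup_le => psi; exact. Qed.

(** The hypothesis serves the strict inequality [0 < lip_sup x y + lip_sup y x]: one function bounds
    the first term from below and the other bounds the second. *)
Lemma lip_sup_admissible :
  (forall x y, x != y -> exists psi1 psi2, [/\ edge_lipschitz psi1, edge_lipschitz psi2 &
     psi2 y - psi2 x < psi1 y - psi1 x]) ->
  admissible_quasimetric L lip_sup.
Proof.
move=> pos; split.
- move=> x; apply/eqP; rewrite eq_le; apply/andP; split.
    by apply: lip_sup_le => psi _; rewrite subrr.
  by have := le_lip_sup x x psi0P; rewrite subrr.
- move=> x y /pos[psi1 [psi2 [h1 h2 h]]].
  have := le_lip_sup x y h1; have := le_lip_sup y x h2; lra.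
- move=> x y z; apply: lip_sup_le => psi h.
  have := le_lip_sup x y h; have := le_lip_sup y z h; lra.
- have le t x y : L t -> lip_sup (x + t) (y + t) <= lip_sup x y.
    move=> Lt; apply: lip_sup_le => psi h.
    exact: (le_lip_sup x y (edge_lipschitz_translate Lt h)).
  move=> t x y Lt; apply/eqP; rewrite eq_le le//=.
  by have := le (- t) (x + t) (y + t) (LN Lt); rewrite !addrK.
Qed.

End edge_class.

Variable q : site d -> site d -> R.
Hypothesis admq : admissible_quasimetric L q.
Hypothesis maxq : forall p, admissible_quasimetric L p ->
        (forall x y, A [fset x; y]%fset -> p x y <= q x y) ->
        forall x y, p x y <= q x y.

Let q0 x : q x x = 0. Proof. by have [] := admq. Qed.
Let qpos x y : x != y -> 0 < q x y + q y x. Proof. by case: admq => _ + _ _; apply. Qed.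
Let qtri x y z : q x z <= q x y + q y z. Proof. by case: admq => _ _ + _; apply. Qed.
Let qL t x y : L t -> q (x + t) (y + t) = q x y. Proof. by case: admq => _ _ _; apply. Qed.

(* The supremum of psi y - psi x over all edge-Lipschitz psi is an admissible
   quasimetric, so the maximality of q applies. *)
Lemma edge_lipschitz_q psi : edge_lipschitz q psi -> forall x y, psi y - psi x <= q x y.
Proof.
move=> psiP x y; apply: le_trans (le_lip_sup x y psiP) _.
apply: maxq; last by move=> a b; exact: lip_sup_edge psiP _ _.
apply: (lip_sup_admissible (fun l x y => @qL l x y) psiP) => a b ab.
(* The functions [q a] and [q b] have increments [q a b] and [- q b a] from a to b, which differ
   because [q a b + q b a] is positive. *)
have qlip z : edge_lipschitz q (q z) by move=> u v _; have := qtri z u v; lra.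
exists (q a), (q b); split; [exact: qlip|exact: qlip|].
by rewrite !q0; have := qpos ab; lra.
Qed.

(** The slack [eta - eps] of [g] leaves room for raising it at a single site, which gives the two
    functions with distinct increments that [lip_sup_admissible] asks for. Maximality of [qe] does
    the rest. *)
Lemma edge_lipschitz_q_eps eps qe g eta psi : is_q_eps L A q eps qe -> eps < eta ->
  edge_lipschitz (fun x y => q x y - eta) g ->
  edge_lipschitz (fun x y => q x y - eps) psi -> forall x y, psi y - psi x <= qe x y.
Proof.
move=> [_ qeP] eps_eta gP psiP x y.
pose c a b := q a b - eps.
have gP' : edge_lipschitz c g by move=> a b /gP; rewrite /c; lra.
apply: le_trans (le_lip_sup x y psiP) _; apply: qeP; split; last first.
  by move=> a b; exact: lip_sup_edge psiP _ _.
apply: (lip_sup_admissible _ psiP) => [l a b Ll|a b ab]; first by rewrite qL.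
exists (fun z => g z + if z == b then eta - eps else 0), g; split => //.
- by move=> u v /gP; do 2 case: ifP => _; lra.
- by rewrite eqxx (negbTE ab); lra.
Qed.

Definition lipschitz_slope (u : 'rV[R]_d) :=
  forall x y, L x -> L y -> pairing u y - pairing u x <= q x y.

Lemma pairingD (u : 'rV[R]_d) x y : pairing u (x + y) = pairing u x + pairing u y :> R.
Proof. by rewrite -big_split/=; apply: eq_bigr => i _; rewrite mxE intrD mulrDr. Qed.

Lemma pairing0 (u : 'rV[R]_d) : pairing u 0 = 0 :> R.
Proof. by rewrite /pairing big1// => i _; rewrite mxE mulr0. Qed.

Lemma pairingN (u : 'rV[R]_d) x : pairing u (- x) = - pairing u x :> R.
Proof. by apply/eqP; rewrite -addr_eq0 -pairingD addNr pairing0. Qed.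

Lemma pairingMn (u : 'rV[R]_d) x n : pairing u (x *+ n) = pairing u x *+ n :> R.
Proof. by elim: n => [|n IH]; rewrite ?mulr0n ?pairing0// !mulrS pairingD IH. Qed.

Lemma pairingDl (u v : 'rV[R]_d) x : pairing (u + v) x = pairing u x + pairing v x :> R.
Proof. by rewrite -big_split/=; apply: eq_bigr => i _; rewrite mxE mulrDl. Qed.

Lemma pairingZl a (u : 'rV[R]_d) x : pairing (a *: u) x = a * pairing u x :> R.
Proof. by rewrite mulr_sumr; apply: eq_bigr => i _; rewrite mxE mulrA. Qed.

(** A defect e at base point y would grow: going from 0 to y, n times along l, and back costs at
    most n * (u(l) - e) plus a constant, and this must be at least n * u(l) for every n. *)
Lemma lipschitz_slope_from u y l : lipschitz_slope u -> L l -> pairing u l <= q y (y + l).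
Proof.
move=> uP Ll; rewrite leNgt; apply/negP => lt.
have qn n : q y (y + l *+ n) <= n%:R * q y (y + l).
  elim: n => [|n IH]; first by rewrite mulr0n addr0 q0 mul0r.
  have := qtri y (y + l *+ n) (y + l *+ n.+1).
  rewrite {2}(mulrS l) addrA (qL y (y + l) (L_muln n Ll)) -natr1 mulrDl mul1r; lra.
have bound n : n%:R * (pairing u l - q y (y + l)) <= q 0 y + q y 0.
  have := uP _ _ L0 (L_muln n Ll); rewrite pairing0 subr0 pairingMn -mulr_natl => h1.
  have := qtri 0 y (l *+ n); have := qtri y (y + l *+ n) (l *+ n); have := qn n.
  have := qL y 0 (L_muln n Ll); rewrite add0r mulrBr; lra.
have e0 : 0 < pairing u l - q y (y + l) by rewrite subr_gt0.
have := bound (Num.bound `|(q 0 y + q y 0) / (pairing u l - q y (y + l))|).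
apply/negP; rewrite -ltNge -ltr_pdivrMr//.
apply: le_lt_trans (ler_norm _) _; exact: archi_boundP.
Qed.

Definition quasi_periodic (u : 'rV[R]_d) (g : site d -> R) :=
  forall x l, L l -> g (x + l) = g x + pairing u l.

Section extension.
Variable u : 'rV[R]_d.
Hypothesis uP : lipschitz_slope u.

(* McShane extension of u, from the coset y + L to all sites *)
Definition slope_ext y x := inf [set pairing u l + q (y + l) x | l in L].

Lemma slope_ext_lb y x l : L l -> - q x y <= pairing u l + q (y + l) x.
Proof.
move=> Ll; have := lipschitz_slope_from (y + l) uP (LN Ll).
by rewrite addrK pairingN; have := qtri (y + l) x y; lra.
Qed.

Lemma slope_ext_le y x l : L l -> slope_ext y x <= pairing u l + q (y + l) x.
Proof.
move=> Ll; apply: ge_inf; last by exists l.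
by exists (- q x y) => _ [l' Ll' <-]; exact: slope_ext_lb.
Qed.

Lemma slope_ext_ge y x C : (forall l, L l -> C <= pairing u l + q (y + l) x) -> C <= slope_ext y x.
Proof.
move=> hC; apply: lb_le_inf; last by move=> _ [l Ll <-]; exact: hC.
by exists (pairing u 0 + q (y + 0) x), 0.
Qed.

Lemma slope_ext_lip y x x' : slope_ext y x' - slope_ext y x <= q x x'.
Proof.
rewrite lerBlDr -lerBlDl; apply: slope_ext_ge => l Ll.
by have := slope_ext_le y x' Ll; have := qtri (y + l) x x'; lra.
Qed.

Lemma slope_ext_periodic y : quasi_periodic u (slope_ext y).
Proof.
have le x l : L l -> slope_ext y (x + l) <= slope_ext y x + pairing u l.
  move=> Ll; rewrite -lerBlDr; apply: slope_ext_ge => l' Ll'.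
  have := slope_ext_le y (x + l) (LD Ll' Ll); rewrite addrA qL// pairingD; lra.
move=> x l Ll; apply/eqP; rewrite eq_le le//=.
by have := le (x + l) (- l) (LN Ll); rewrite addrK pairingN; lra.
Qed.

Lemma slope_ext_base y : slope_ext y y <= 0.
Proof. by have := slope_ext_le y y L0; rewrite addr0 q0 pairing0 addr0. Qed.

End extension.

(* On an edge ending in z + L, the McShane extension from z + L has a gap,
   because u stays Lipschitz when perturbed in a coordinate direction.  Averaging
   the extensions over all residues z gives a gap on every edge. *)
Lemma interior_slope_gap (u : 'rV[R]_d) (delta : R) : 0 < delta ->
  (forall v : 'rV[R]_d, (forall i, `|v 0 i - u 0 i| <= delta) -> lipschitz_slope v) ->
  exists2 eta : R, 0 < eta & exists2 g,
    edge_lipschitz (fun x y => q x y - eta) g & quasi_periodic u g.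
Proof.
move=> d0 uP; have uK : lipschitz_slope u by apply: uP => i; rewrite subrr normr0 ltW.
(* Some coordinate of l is nonzero. Moving u by delta in that direction, with the sign of the
   coordinate, raises u(l) by at least delta, and the perturbed slope still obeys
   [lipschitz_slope_from]. *)
have gap y l : L l -> l != 0 -> pairing u l + delta <= q y (y + l).
  move=> Ll l0; have [i li] : exists i, l 0 i != 0.
    apply/existsP; apply: contraNT l0 => /existsPn h; apply/eqP/rowP => i.
    by have := h i; rewrite negbK mxE => /eqP.
  pose v := u + (delta * Num.sg (l 0 i)%:~R) *: delta_mx 0 i.
  have vK : lipschitz_slope v.
    apply: uP => j; rewrite !mxE [u 0 j + _]addrC addrK eqxx/=; have [_|_] := eqVneq j i.
      by rewrite mulr1 normrM (gtr0_norm d0) normr_sg intr_eq0 li mulr1.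
    by rewrite mulr0 normr0 ltW.
  apply: le_trans (lipschitz_slope_from y vK Ll).
  rewrite pairingDl pairingZl lerD2l.
  have -> : pairing (delta_mx 0 i) l = (l 0 i)%:~R :> R.
    rewrite /pairing (bigD1 i)//= big1 ?addr0; first by rewrite mxE !eqxx mul1r.
    by move=> j ji; rewrite mxE eqxx/= (negbTE ji) mul0r.
  rewrite -mulrA -normrEsg ler_peMr// ?(ltW d0)//.
  rewrite -intr_norm ler1z; lia.
have [|x y Axy|c0 c00 c0P] := @edge_positive (fun x y => q x y + q y x).
- by move=> l x y Ll; rewrite !qL.
- exact/qpos/edge_neq.
pose m := Num.min delta c0; have m_gt0 : 0 < m by rewrite lt_min d0 c00.
pose B := box d m0; pose N : R := #|` B|%:R.
have N0 : 0 < N.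
  by rewrite ltr0n cardfs_gt0; apply/fset0Pn; exists (residue 0); exact: residue_box.
pose g x := N^-1 * \sum_(z <- B) slope_ext u z x.
exists (N^-1 * m); first by rewrite mulr_gt0 ?invr_gt0.
exists g; last first.
  move=> x l Ll; rewrite /g (eq_bigr (fun z => slope_ext u z x + pairing u l)); last first.
    by move=> z _; exact: slope_ext_periodic.
  rewrite big_split/= big_const_seq count_predT iter_addr_0 mulrDr; congr (_ + _).
  by rewrite -mulr_natl mulrA mulVf ?mul1r// gt_eqF.
move=> x y Axy; rewrite /g -mulrBr -sumrB ler_pdivrMl// mulrBr mulrA divff ?gt_eqF// mul1r.
set z := residue y; have zB : z \in B by exact: residue_box.
rewrite (big_fsetD1 z)//= /N (cardfsD1 z) zB /=.
have le : \sum_(i <- (B `\ z)%fset) (slope_ext u i y - slope_ext u i x) <=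
    #|` (B `\ z)%fset|%:R * q x y.
  apply: (@le_trans _ _ (\sum_(i <- (B `\ z)%fset) q x y)); first apply: ler_sum.
    by move=> i _; exact: slope_ext_lip.
  by rewrite big_const_seq count_predT iter_addr_0 mulr_natl.
rewrite natrD mulrDl mul1r.
suff : slope_ext u z y - slope_ext u z x <= q x y - m by lra.
pose l := y - z; have Ll : L l by exact: sub_residue.
have -> : slope_ext u z y = slope_ext u z z + pairing u l.
  by rewrite -slope_ext_periodic// /l addrC subrK.
have -> : slope_ext u z x = slope_ext u z (x - l) + pairing u l.
  by rewrite -slope_ext_periodic// subrK.
have base := slope_ext_base uK z.
suff : - q (x - l) z + m <= slope_ext u z (x - l).
  have -> : q (x - l) z = q x y by rewrite -(qL (x - l) z Ll) subrK /l addrC subrK.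
  lra.
apply: slope_ext_ge => l' Ll'.
(* The term l' = 0 of the infimum has a gap because [q x y + q y x] is at least [c0] on edges; every
   other term has the gap [delta] of a nonzero vector of [L]. This is why [m] is their minimum. *)
have [->|l'0] := eqVneq l' 0.
  rewrite pairing0 add0r addr0.
  have := c0P _ _ Axy; have -> : q x y = q (x - l) z by rewrite -(qL (x - l) z Ll) subrK /l addrC subrK.
  have -> : q y x = q z (x - l) by rewrite -(qL z (x - l) Ll) subrK /l addrC subrK.
  have : m <= c0 by rewrite ge_min lexx orbT.
  lra.
have := gap (z + l') (- l') (LN Ll'); rewrite oppr_eq0 addrK pairingN => /(_ l'0).
have : m <= delta by rewrite ge_min lexx.
have := qtri (z + l') (x - l) z; lra.
Qed.

Lemma pairing_norm_le (w : 'rV[R]_d) z (rho : R) : (forall i, `|w 0 i| <= rho) ->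
  `|pairing w z| <= rho * \sum_i `|(z 0 i)%:~R|.
Proof.
move=> wr; rewrite mulr_sumr; apply: le_trans (ler_norm_sum _ _ _) _.
by apply: ler_sum => i _; rewrite normrM ler_wpM2r.
Qed.

(** Tilting [g] by v - u changes an edge increment by at most rho times the length of the edge,
    which a gap eta absorbs. The radius depends on eta alone, and this uniformity in u is what the
    boundary behaviour rests on. *)
Lemma gap_slope_ball (eta : R) : 0 < eta ->
  exists2 rho : R, 0 < rho & forall (u : 'rV[R]_d) g (v : 'rV[R]_d),
  edge_lipschitz (fun x y => q x y - eta) g -> quasi_periodic u g ->
  (forall i, `|v 0 i - u 0 i| <= rho) -> lipschitz_slope v.
Proof.
move=> e0; have [|C C0 CP] := @edge_bounded (fun x y => \sum_i `|((y - x) 0 i)%:~R|).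
  by move=> l x y _; rewrite [x + l]addrC addrKA.
exists (eta / (C + 1)); first by rewrite divr_gt0// ltr_wpDl.
move=> u g v gP gu vu.
have C1 : 0 < C + 1 by rewrite ltr_wpDl.
pose psi x := g x + pairing (v - u) x.
have psiP : edge_lipschitz q psi.
  move=> x y Axy; have := gP _ _ Axy; have := CP _ _ Axy => CA.
  have : pairing (v - u) (y - x) <= eta.
    apply: le_trans (ler_norm _) _; apply: le_trans (pairing_norm_le _ (rho := eta / (C + 1)) _) _.
      by move=> i; rewrite !mxE; exact: vu.
    rewrite mulrAC ler_pdivrMr// ler_pM2l//; lra.
  rewrite pairingD pairingN /psi; lra.
move=> x y Lx Ly; have := edge_lipschitz_q psiP x y.
have E z : L z -> psi z = g 0 + pairing v z.
  move=> Lz; rewrite /psi -[in g z](add0r z) gu// -addrA -pairingDl; congr (_ + pairing _ _).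
  by rewrite addrCA subrr addr0.
by rewrite !E//; lra.
Qed.

(** This gives the constant [K1] of the later sections. Increments across a block of side m are then
    at most m * K1, and joining blocks costs only the logarithm of that. *)
Lemma unit_step_bounded : exists2 K : R, 0 <= K &
  forall x (i : 'I_d), q x (x + delta_mx 0 i) <= K /\ q (x + delta_mx 0 i) x <= K.
Proof.
have bd (h : 'I_d -> site d -> R) : (forall i l x, L l -> h i (x + l) = h i x) ->
    exists2 K, 0 <= K & forall i x, h i x <= K.
  move=> hL; have h' i : exists C, 0 <= C /\ forall x, h i x <= C.
    by have [C ? ?] := periodic_bounded (hL i); exists C.
  have [C CP] := choice h'.
  exists (\sum_i C i); first by apply: sumr_ge0 => i _; have [] := CP i.
  move=> i x; rewrite (bigD1 i)//= (le_trans ((CP i).2 x))// lerDl.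
  by apply: sumr_ge0 => j _; have [] := CP j.
have [|K K0 KP] := bd (fun i x => q x (x + delta_mx 0 i)).
  by move=> i l x Ll; rewrite addrAC qL.
have [|K' K'0 KP'] := bd (fun i x => q (x + delta_mx 0 i) x).
  by move=> i l x Ll; rewrite addrAC qL.
exists (K + K'); first exact: addr_ge0.
by move=> x i; split; [have := KP i x|have := KP' i x]; lra.
Qed.

Lemma steps_bounded (K : R) x (i : 'I_d) m :
  (forall x, q x (x + delta_mx 0 i) <= K /\ q (x + delta_mx 0 i) x <= K) ->
  q x (x + delta_mx 0 i *+ m) <= m%:R * K /\ q (x + delta_mx 0 i *+ m) x <= m%:R * K.
Proof.
move=> hK; elim: m => [|m [IH1 IH2]]; first by rewrite mulr0n addr0 mul0r q0.
rewrite mulrSr addrA -natr1 mulrDl mul1r.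
have [h1 h2] := hK (x + delta_mx 0 i *+ m).
have := qtri x (x + delta_mx 0 i *+ m) (x + delta_mx 0 i *+ m + delta_mx 0 i).
have := qtri (x + delta_mx 0 i *+ m + delta_mx 0 i) (x + delta_mx 0 i *+ m) x.
lra.
Qed.

End periodic.

(** * Finite-volume Hamiltonians *)

Section esum_lemmas.
Local Open Scope ereal_scope.
Context (R : realType) (T : choiceType).
Implicit Types (A B : set T) (a b : T -> \bar R).

Lemma subset_esum A B a : A `<=` B -> \esum_(i in A) a i <= \esum_(i in B) a i.
Proof.
move=> AB; apply: ereal_sup_le => _ [F [fF FA] <-].
by exists F => //; split => //; exact: subset_trans AB.
Qed.

Lemma esum_setU_le A B a : (forall i, 0 <= a i) ->
  \esum_(i in A `|` B) a i <= \esum_(i in A) a i + \esum_(i in B) a i.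
Proof.
move=> a0; rewrite (esumID A)//; apply: leeD; apply: subset_esum => x.
  by move=> [].
by move=> [[]].
Qed.

Lemma esum_setU_ge A B C a : (forall i, 0 <= a i) -> A `<=` C -> B `<=` C -> A `&` B = set0 ->
  \esum_(i in A) a i + \esum_(i in B) a i <= \esum_(i in C) a i.
Proof.
move=> a0 AC BC AB; rewrite (esumID A C)//; apply: leeD; apply: subset_esum => x.
  by move=> Ax; split => //; exact: AC.
move=> Bx; split; first exact: BC.
by move=> Ax; have : (A `&` B) x by []; rewrite AB.
Qed.

End esum_lemmas.

Section finite_volume_hamiltonian.
Local Open Scope ereal_scope.
Context (R : realType) (k : height_kind) (d : nat).
Notation E := (heights R k).
Notation I := (site d).
Notation cfg := (config E d).
Implicit Types (D L M G : {fset I}) (phi : cfg).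

Lemma esum_cover (s : seq I) (J : set {fset I}) (a : {fset I} -> \bar R) :
  (forall G, 0 <= a G) -> (forall G, J G -> exists2 x, x \in s & x \in G) ->
  \esum_(G in J) a G <= \sum_(x <- s) \esum_(G in [set G : {fset I} | x \in G]) a G.
Proof.
move=> a0; elim: s J => [|x s IH] J Js.
  by rewrite big_nil (_ : J = set0) ?esum_set0//; apply/seteqP; split => // G /Js [].
rewrite big_cons (esumID [set G : {fset I} | x \in G])//; apply: leeD.
  by apply: subset_esum => G [].
apply: IH => G [JG xG]; have [y] := Js _ JG; rewrite inE => /predU1P[->//|ys yG].
by exists y.
Qed.

Context (L : set I) (A : set {fset I}) (q : I -> I -> R).
Variables (Phi Psi Xi : potential R k d).
Hypothesis pgPsi : periodic_gradient_potential L Psi.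
Hypothesis pgXi : periodic_gradient_potential L Xi.
Hypothesis Psi0 : forall G phi, 0 <= Psi G phi.
Hypothesis PhiE : forall G phi, Phi G phi = Psi G phi + Xi G phi.
Variable nrm : R.
Hypothesis nrm0 : (0 <= nrm)%R.
Hypothesis XiN : forall x phi, \esum_(G in [set G : {fset I} | x \in G]) `|Xi G phi| <= nrm%:E.

Lemma Xi_fin G phi : Xi G phi \is a fin_num.
Proof.
have [->|/fset0Pn[x xG]] := eqVneq G fset0.
  by have [_ _ X1 _] := pgXi; rewrite X1 ?cardfs0.
have : `|Xi G phi| <= nrm%:E.
  apply: le_trans (XiN x phi); rewrite -(@esum_set1 _ _ G (fun G => `|Xi G phi|))//.
  by apply: subset_esum => _ ->.
by move=> h; rewrite fin_num_abs (le_lt_trans h)// ltry.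
Qed.

Definition meeting D := [set G : {fset I} | [set` G] `<=` [set` D] /\ (G `&` D)%fset != fset0].

Definition ham D phi := hamiltonian Phi D [set` D] phi.

Let pos D phi := \esum_(G in meeting D) ((Phi ^~ phi)^\+ G).
Let neg D phi := \esum_(G in meeting D) ((Phi ^~ phi)^\- G).

Lemma hamE D phi : ham D phi = pos D phi - neg D phi.
Proof. by []. Qed.

Lemma finite_meeting D : finite_set (meeting D).
Proof.
apply: (@sub_finite_set _ _ [set` fpowerset D]); last exact: finite_fset.
by move=> G [GD _] /=; rewrite fpowersetE; apply/fsubsetP => x; exact: GD.
Qed.

Lemma Phi_neg_le G phi : (Phi ^~ phi)^\- G <= `|Xi G phi|.
Proof.
rewrite funenegE PhiE ge_max abse_ge0 andbT.
have := Xi_fin G phi; move: (Psi0 G phi); case: (Psi G phi) => [p| |]//; case: (Xi G phi) => [x| |]//.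
  by rewrite lee_fin => p0 _ /=; rewrite lee_fin; have := ler_norm (- x)%R; rewrite normrN; lra.
by move=> _ _; rewrite addye// leNye.
Qed.

Lemma Phi_pos_le G phi : (Phi ^~ phi)^\+ G <= Psi G phi + `|Xi G phi|.
Proof.
rewrite funeposE PhiE ge_max leeD2l ?lee_abs//=.
by rewrite adde_ge0.
Qed.

Lemma meeting_point D G : meeting D G -> exists2 x, x \in (D : seq I) & x \in G.
Proof. by move=> [_ /fset0Pn[x]]; rewrite inE => /andP[xG xD]; exists x. Qed.

Lemma esum_Xi_le D phi (J : set {fset I}) : (forall G, J G -> exists2 x, x \in (D : seq I) & x \in G) ->
  \esum_(G in J) `|Xi G phi| <= (nrm *+ #|` D|)%:E.
Proof.
move=> JD; apply: le_trans (esum_cover _ JD) _ => //.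
apply: (@le_trans _ _ (\sum_(x <- (D : seq I)) nrm%:E)); first by apply: lee_sum.
by rewrite sumEFin big_const_seq count_predT iter_addr_0.
Qed.

Lemma neg_le D phi : neg D phi <= (nrm *+ #|` D|)%:E.
Proof.
apply: le_trans (esum_Xi_le phi (@meeting_point D)).
by apply: le_esum => G _; exact: Phi_neg_le.
Qed.

Let pos0 D phi : 0 <= pos D phi. Proof. exact: esum_ge0. Qed.
Let neg0 D phi : 0 <= neg D phi. Proof. exact: esum_ge0. Qed.

Let neg_fin D phi : neg D phi \is a fin_num.
Proof. by rewrite ge0_fin_numE// (le_lt_trans (neg_le D phi))// ltry. Qed.

Lemma ham_ge D phi : (- (nrm *+ #|` D|))%:E <= ham D phi.
Proof.
rewrite hamE; have := neg_le D phi; have := neg_fin D phi; have := pos0 D phi.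
case: (pos D phi) => [p| |]//; case: (neg D phi) => [n| |]// ; rewrite ?leey//.
by rewrite !lee_fin; lra.
Qed.

Lemma measurable_Phi D G : [set` G] `<=` [set` D] ->
  measurable_fun [set: gradT E [set` D]] (Phi G : gradT E [set` D] -> \bar R).
Proof.
move=> GD; apply: measurable_fun_gradT_incl GD _.
rewrite (_ : Phi G = fun phi => Psi G phi + Xi G phi); last by apply/funext => phi.
by have [m1 _ _ _] := pgPsi; have [m2 _ _ _] := pgXi; exact: emeasurable_funD.
Qed.

Lemma measurable_ham D : measurable_fun [set: gradT E [set` D]] (ham D : gradT E [set` D] -> \bar R).
Proof.
have msum (h : {fset I} -> cfg -> \bar R) :
    (forall G, [set` G] `<=` [set` D] -> measurable_fun [set: gradT E [set` D]] (h G : gradT E [set` D] -> \bar R)) ->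
    (forall G phi, 0 <= h G phi) ->
    measurable_fun [set: gradT E [set` D]] (fun phi : gradT E [set` D] => \esum_(G in meeting D) h G phi).
  move=> mh h0.
  pose h' G (phi : gradT E [set` D]) := if `[< [set` G] `<=` [set` D] >] then h G phi else 0.
  rewrite (_ : (fun phi => _) = fun phi => \sum_(G \in meeting D) h' G phi).
    apply: emeasurable_fsum; first exact: finite_meeting.
    by move=> G; rewrite /h'; case: asboolP => [/mh//|_]; exact: measurable_cst.
  apply/funext => phi; rewrite esum_fset//; last exact: finite_meeting.
  by apply: eq_fsbigr => G; rewrite inE => -[GD _]; rewrite /h' asboolT.
apply: emeasurable_funB; apply: msum.
- move=> G GD; rewrite (_ : (fun phi => _) = (Phi G)^\+); last by apply/funext => phi; rewrite !funeposE.
  by apply: measurable_funepos; exact: measurable_Phi.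
- by move=> G phi; exact: funepos_ge0.
- move=> G GD; rewrite (_ : (fun phi => _) = (Phi G)^\-); last by apply/funext => phi; rewrite !funenegE.
  by apply: measurable_funeneg; exact: measurable_Phi.
- by move=> G phi; exact: funeneg_ge0.
Qed.

Lemma exterior_le M : lower_exterior_bound Xi M <= (nrm *+ #|` M|)%:E.
Proof.
apply: ge_ereal_sup => _ [phi ->]; apply: esum_Xi_le => G [+ _].
by move=> /fset0Pn[x]; rewrite inE => /andP[xG xM]; exists x.
Qed.

Definition crossing M := [set G : {fset I} | (G `&` M)%fset != fset0 /\ ~~ (G `<=` M)%fset].

Lemma esum_crossing_le M phi : \esum_(G in crossing M) `|Xi G phi| <= lower_exterior_bound Xi M.
Proof. by apply: ereal_sup_ubound; exists phi. Qed.

Lemma exterior_ge0 M : 0 <= lower_exterior_bound Xi M.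
Proof.
apply: le_trans (esum_crossing_le M (fun=> hs_zero E)).
by apply: esum_ge0.
Qed.

Lemma exterior_fin M : lower_exterior_bound Xi M \is a fin_num.
Proof. by rewrite ge0_fin_numE ?exterior_ge0// (le_lt_trans (exterior_le M))// ltry. Qed.

(** The positive parts add up over disjoint families of sets. A set inside the union that is
    contained in neither [D] nor [M] crosses [M]; its negative part comes from [Xi] alone, [Psi]
    being nonnegative, and all such parts are covered by the exterior bound. *)
Lemma ham_superadditive D M phi : [disjoint D & M]%fset ->
  ham D phi + ham M phi - lower_exterior_bound Xi M <= ham (D `|` M)%fset phi.
Proof.
move=> DM.
have subU : meeting D `<=` meeting (D `|` M)%fset /\ meeting M `<=` meeting (D `|` M)%fset.
  split=> G [GD /fset0Pn[x]]; rewrite inE => /andP[xG xD]; split.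
  - by move=> y /GD /= yD; rewrite in_fsetU yD.
  - by apply/fset0Pn; exists x; rewrite !inE xG xD.
  - by move=> y /GD /= yD; rewrite in_fsetU yD orbT.
  - by apply/fset0Pn; exists x; rewrite !inE xG xD orbT.
have dis : meeting D `&` meeting M = set0.
  apply/seteqP; split => // G [[GD /fset0Pn[x]]]; rewrite inE => /andP[xG xD] [GM _].
  by move/fdisjointP : DM => /(_ x xD) /negP; apply; exact: GM.
have hpos : pos D phi + pos M phi <= pos (D `|` M)%fset phi.
  by apply: esum_setU_ge => //; case: subU.
have hneg : neg (D `|` M)%fset phi <= neg D phi + neg M phi + lower_exterior_bound Xi M.
  apply: (@le_trans _ _ (neg D phi + neg M phi + \esum_(G in crossing M) (Phi ^~ phi)^\- G)).
    apply: (@le_trans _ _ (\esum_(G in (meeting D `|` meeting M) `|` crossing M) (Phi ^~ phi)^\- G)).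
      apply: subset_esum => G [GDM GDM0].
      have [GM|GM0] := eqVneq (G `&` M)%fset fset0.
        left; left.
        have GD x : x \in G -> x \in D.
          move=> xG; have := GDM x xG; rewrite /= in_fsetU => /orP[//|xM].
          by have : x \in (G `&` M)%fset by [rewrite inE xG xM]; rewrite GM inE.
        split; first by move=> x; exact: GD.
        by case/fset0Pn : GDM0 => x; rewrite !inE => /andP[xG _]; apply/fset0Pn; exists x; rewrite inE xG GD.
      have [/fsubsetP GM|GM] := boolP (G `<=` M)%fset; last by right.
      by left; right; split.
    apply: le_trans (esum_setU_le _ _ _) _ => //.
    by rewrite leeD2r//; exact: esum_setU_le.
  rewrite leeD2l//; apply: le_trans (esum_crossing_le M phi).
  by apply: le_esum => G _; exact: Phi_neg_le.
rewrite !hamE; move: hpos hneg (pos0 D phi) (pos0 M phi) (pos0 (D `|` M)%fset phi).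
case: (lower_exterior_bound Xi M) (exterior_fin M) => // e _.
case: (neg D phi) (neg_fin D phi) => // n1 _.
case: (neg M phi) (neg_fin M phi) => // n2 _.
case: (neg (D `|` M)%fset phi) (neg_fin (D `|` M)%fset phi) => // n _.
case: (pos (D `|` M)%fset phi) => [p| |] //=; rewrite ?leey//.
case: (pos D phi) => [p1| |] //=; case: (pos M phi) => [p2| |] //=.
by rewrite !lee_fin; lra.
Qed.

Lemma ham_le D phi C : (0 <= C)%R -> (forall G phi, Psi G phi <= +oo) ->
  (forall x, x \in D -> hamiltonian Psi [fset x]%fset setT phi <= C%:E) ->
  ham D phi <= ((C + nrm) *+ #|` D|)%:E.
Proof.
move=> C0 _ hC.
have PsiC x : x \in D -> \esum_(G in [set G : {fset I} | x \in G]) Psi G phi <= C%:E.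
  move=> /hC; apply: le_trans; rewrite /hamiltonian.
  rewrite (@esum1 _ _ _ (fun G => (Psi^~ phi)^\- G)); last first.
    by move=> G _; rewrite funenegE; apply/max_idPr; rewrite oppe_le0.
  rewrite sube0.
  apply: (@le_trans _ _ (\esum_(G in [set G : {fset I} | x \in G]) (Psi^~ phi)^\+ G)).
    by apply: le_esum => G _; rewrite funeposE le_max lexx.
  apply: subset_esum => G /= xG; split => //.
  by apply/fset0Pn; exists x; rewrite !inE xG eqxx.
have posle : pos D phi <= ((C + nrm) *+ #|` D|)%:E.
  apply: (@le_trans _ _ (\esum_(G in meeting D) (Psi G phi + `|Xi G phi|))).
    by apply: le_esum => G _; exact: Phi_pos_le.
  rewrite esumD//; rewrite mulrnDl EFinD; apply: leeD; last exact: esum_Xi_le (@meeting_point D).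
  apply: le_trans (esum_cover (fun G => Psi0 G phi) (@meeting_point D)) _.
  apply: (@le_trans _ _ (\sum_(x <- (D : seq I)) C%:E)).
    rewrite big_seq [leRHS]big_seq; apply: lee_sum => x xD; exact: PsiC.
  by rewrite sumEFin big_const_seq count_predT iter_addr_0.
rewrite hamE; move: posle (neg_fin D phi) (neg0 D phi); case: (pos D phi) => [p| |]//; case: (neg D phi) => [n| |]//.
by rewrite !lee_fin; lra.
Qed.

Lemma ham_violated x y D phi : lipschitz_potential A q Psi -> A [fset x; y]%fset ->
  x \in D -> y \in D -> (q x y < increment phi x y)%R -> ham D phi = +oo.
Proof.
move=> lip Axy xD yD viol.
have PsiE : Psi [fset x; y]%fset phi = +oo by apply/lip; exists x, y.
have PhiE' : (Phi^~ phi)^\+ [fset x; y]%fset = +oo.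
  rewrite funeposE PhiE PsiE; have := Xi_fin [fset x; y]%fset phi.
  by case: (Xi _ phi) => // r _; rewrite addye// /maxe ltNge leey.
have -> : ham D phi = +oo - neg D phi.
  rewrite hamE; congr (_ - _); apply/eqP; rewrite -leye_eq -PhiE'.
  rewrite -(@esum_set1 _ _ [fset x; y]%fset (fun G => (Phi^~ phi)^\+ G))//.
  apply: subset_esum => _ ->; split.
    by move=> z; rewrite /= !inE => /orP[]/eqP ->.
  by apply/fset0Pn; exists x; rewrite !inE eqxx xD.
by have := neg_fin D phi; case: (neg D phi).
Qed.

Lemma ham_translate D l phi : L l -> ham (translate l D) phi = ham D (Defs.shift l phi).
Proof.
move=> Ll.
have tr G x : (x + l)%R \in translate l G = (x \in G).
  by apply/imfsetP/idP => [[y /= yG /addIr ->]//|xG]; exists x.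
have trP G x : (x \in translate l G) = ((x - l)%R \in G) by rewrite -[x in LHS](subrK l) tr.
have PhiT G : Phi (translate l G) phi = Phi G (Defs.shift l phi).
  have [_ _ _ h1] := pgPsi; have [_ _ _ h2] := pgXi.
  by rewrite !PhiE h1// h2.
have bij : set_bij (meeting D) (meeting (translate l D)) (translate l).
  split.
  - move=> G [GD /fset0Pn[x]]; rewrite inE => /andP[xG xD]; split.
      by move=> y /=; rewrite !trP => /GD.
    by apply/fset0Pn; exists (x + l)%R; rewrite inE !tr xG xD.
  - by move=> G G' _ _ GG'; apply/fsetP => x; rewrite -tr GG' tr.
  - move=> G [GD /fset0Pn[x]]; rewrite inE => /andP[xG xD].
    have trK : translate l (translate (- l)%R G) = G.
      apply/fsetP => y; rewrite trP; apply/imfsetP/idP => /=.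
        by move=> [z zG] /eqP; rewrite subr_eq addrNK => /eqP ->.
      by move=> yG; exists y.
    exists (translate (- l)%R G) => //; split.
      move=> y; rewrite /= -tr trK => /GD; rewrite /= tr//.
    apply/fset0Pn; exists (x - l)%R; rewrite inE -!trP trK xG.
    by move: xD; rewrite trP.
rewrite !hamE /pos /neg; congr (_ - _).
  rewrite (reindex_esum _ _ _ _ bij)//; apply: eq_esum => G _; by rewrite !funeposE PhiT.
rewrite (reindex_esum _ _ _ _ bij)//; apply: eq_esum => G _; by rewrite !funenegE PhiT.
Qed.

Lemma lower_integrable_ham D (mu : gradient_measure R k d) : lower_integrable mu (ham D).
Proof.
apply: (lower_integrable_ge _ (lower_integrable_cst mu (- (nrm *+ #|` D|))%R)).
  by apply: (measurable_fun_gradT_incl _ (@measurable_ham D)).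
by apply: aeW => phi; exact: ham_ge.
Qed.

End finite_volume_hamiltonian.

(** * Superadditive functions of boxes *)

Section growth.
Context (d : nat).
Implicit Types (v : site d) (S T D : {fset site d}).

Definition weight v : nat := (\sum_i `|v 0%R i|)%N.

(** Every nonzero site of the set has a neighbour in the set that is closer to the origin. Following
    these parents from a missing site leads to a missing site adjacent to any given subset that
    contains 0. *)
Definition parent_closed S := forall v, v \in S -> v != 0 ->
  exists i : 'I_d, v - delta_mx 0 i \in S /\ (weight (v - delta_mx 0 i)%R < weight v)%N.

(* Any parent-closed set is filled site by site, each new site being adjacent
   to one of the sites already present. *)
Lemma growth_ind (P : {fset site d} -> Prop) S T0 :
  parent_closed S -> (T0 `<=` S)%fset -> 0 \in T0 -> P T0 ->
  (forall T v (i : 'I_d), (T `<=` S)%fset -> v \in S -> v \notin T ->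
     v - delta_mx 0 i \in T -> P T -> P (v |` T)%fset) -> P S.
Proof.
move=> pS T0S zT0 PT0 step.
have pick T : (T `<=` S)%fset -> 0 \in T -> (exists2 v, v \in S & v \notin T) ->
    exists v (i : 'I_d), [/\ v \in S, v \notin T & v - delta_mx 0 i \in T].
  move=> TS zT [v vS vT]; have [n] := ubnP (weight v).
  elim: n v vS vT => // n IH v vS vT; rewrite ltnS => wn.
  have v0 : v != 0 by apply: contraNneq vT => ->.
  have [i [pvS wlt]] := pS v vS v0.
  have [pT|pT] := boolP (v - delta_mx 0 i \in T); first by exists v, i.
  exact: IH pvS pT (leq_trans wlt wn).
have main n T : (#|` (S `\` T)%fset| <= n)%N -> (T `<=` S)%fset -> 0 \in T -> P T -> P S.
  elim: n T => [|n IH] T cn TS zT PT.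
    have : (S `\` T)%fset = fset0 by apply/eqP; rewrite -cardfs_eq0 -leqn0.
    move=> /eqP; rewrite fsetD_eq0 => ST.
    by have -> : S = T by apply/eqP; rewrite eqEfsubset ST TS.
  have [/fsubsetP ST|] := boolP (S `<=` T)%fset.
    by have -> : S = T by apply/eqP; rewrite eqEfsubset TS andbT; apply/fsubsetP.
  move=> /fsubsetPn ST; have [v [i [vS vT pT]]] := pick T TS zT ST.
  apply: (IH (v |` T)%fset).
  - rewrite -ltnS (leq_trans _ cn)//; apply: fproper_ltn_card; rewrite fproperE; apply/andP; split.
      by apply/fsubsetP => x; rewrite !inE negb_or -andbA => /and3P[_ -> ->].
    by apply/fsubsetPn; exists v; rewrite !inE ?eqxx ?vS ?vT.
  - by rewrite fsubUset fsub1set vS TS.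
  - by rewrite !inE zT orbT.
  - exact: (step T v i).
exact: (main _ T0 (leqnn _)).
Qed.

Lemma box_parent_closed n : parent_closed (box d n).
Proof.
move=> v; rewrite mem_box => /forallP vn v0.
have [i vi] : exists i, v 0 i != 0.
  by apply/existsP; apply: contraNT v0 => /existsPn h; apply/eqP/rowP => i; have := h i; rewrite negbK mxE => /eqP.
exists i; split.
  rewrite mem_box; apply/forallP => j; rewrite !mxE eqxx/=.
  have := vn j; have := vn i; have [->|_] := eqVneq j i; move: vi; lia.
rewrite /weight (bigD1 i)//= [X in (_ < X)%N](bigD1 i)//= !mxE !eqxx/=.
rewrite (eq_bigr (fun j => `|v 0%R j|%N)); first by have := vn i; move: vi; lia.
by move=> j ji; rewrite !mxE eqxx (negbTE ji)/= subr0.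
Qed.

Lemma box0 n : (0 < n)%N -> 0 \in box d n.
Proof. by move=> n0; rewrite mem_box; apply/forallP => i; rewrite mxE; lia. Qed.

Lemma box_sub m n : (m <= n)%N -> (box d m `<=` box d n)%fset.
Proof.
move=> mn; apply/fsubsetP => x; rewrite !mem_box => /forallP xm; apply/forallP => i.
by have := xm i; lia.
Qed.

Definition block m v : {fset site d} := translate (v *+ m) (box d m).

Lemma mem_block m v x : (x \in block m v) = (x - v *+ m \in box d m).
Proof.
apply/imfsetP/idP => [[y /= yb ->]|xb]; first by rewrite addrK.
by exists (x - v *+ m) => //; rewrite subrK.
Qed.

Definition blocks m T : {fset site d} :=
  [fset (y + v *+ m)%R | v in T, y in box d m]%fset.

Lemma mem_blocks m T x : reflect (exists2 v, v \in T & x \in block m v) (x \in blocks m T).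
Proof.
apply: (iffP (imfset2P _ _ _ _ _)) => /= [[v vT [y yb ->]]|[v vT]].
  by exists v => //; rewrite mem_block addrK.
by rewrite mem_block => xv; exists v => //; exists (x - v *+ m) => //; rewrite subrK.
Qed.

Lemma blocksU1 m v T : blocks m (v |` T)%fset = (blocks m T `|` block m v)%fset.
Proof.
apply/fsetP => x; rewrite in_fsetU; apply/mem_blocks/orP.
  move=> [w]; rewrite !inE => /predU1P[->|wT] xw; first by right.
  by left; apply/mem_blocks; exists w.
move=> [/mem_blocks[w wT xw]|xv]; first by exists w => //; rewrite !inE wT orbT.
by exists v => //; rewrite !inE eqxx.
Qed.

Lemma block_div m v x : (0 < m)%N -> x \in block m v -> forall i, v 0 i = (x 0%R i %/ m)%Z.
Proof.
move=> m0; rewrite mem_block mem_box => /forallP xm i.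
have := xm i; rewrite 2!mxE mulmxnE -mulr_natr natz => /andP[h1 h2].
have -> : x 0 i = v 0 i * m%:Z + (x 0 i - v 0 i * m%:Z) by ring.
rewrite divzMDl; last by lia.
rewrite divz_small ?addr0//; move: (x 0 i) (v 0 i) h1 h2 => a b h1 h2.
by apply/andP; split => //; rewrite absz_nat.
Qed.

Lemma blocks_disjoint m v T : (0 < m)%N -> v \notin T -> [disjoint blocks m T & block m v]%fset.
Proof.
move=> m0 vT; apply/fdisjointP => x /mem_blocks[w wT xw]; apply: contra vT => xv.
suff -> : v = w by [].
by apply/rowP => i; rewrite (block_div m0 xv) (block_div m0 xw).
Qed.

Lemma blocks_box m n : (0 < m)%N -> blocks m (box d n) = box d (n * m).
Proof.
move=> m0; apply/fsetP => x; apply/mem_blocks/idP.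
  move=> [v]; rewrite mem_block !mem_box => /forallP vn /forallP xv; apply/forallP => i.
  have := vn i; have := xv i; rewrite 2!mxE mulmxnE -mulr_natr natz.
  by move: (x 0 i) (v 0 i) => a b; nia.
rewrite mem_box => /forallP xn.
exists (\row_i (x 0%R i %/ m)%Z).
  rewrite mem_box; apply/forallP => i; rewrite mxE; have := xn i.
  by rewrite divz_ge0 ?ltz_divLR ?PoszM//; lia.
rewrite mem_block mem_box; apply/forallP => i; rewrite 2!mxE mulmxnE mxE -mulr_natr natz.
rewrite {1 3}(divz_eq (x 0 i) m) addrAC subrr add0r.
by rewrite modz_ge0 ?ltz_pmod//; lia.
Qed.

Lemma block0 m : block m 0 = box d m.
Proof. by apply/fsetP => x; rewrite mem_block mul0rn subr0. Qed.

Lemma block_corner m v : (0 < m)%N -> v *+ m \in block m v.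
Proof. by move=> m0; rewrite mem_block subrr box0. Qed.

End growth.

Lemma ereal_cvg_pinch (R : realType) (u : nat -> \bar R) (l : \bar R) :
  (forall b : R, (b%:E < l)%E -> \forall n \near \oo, (b%:E <= u n)%E) ->
  (forall b : R, (l < b%:E)%E -> \forall n \near \oo, (u n <= b%:E)%E) ->
  u n @[n --> \oo] --> l.
Proof.
case: l => [r| |] lo up.
- have fin : \forall n \near \oo, u n \is a fin_num.
    near=> n; have : ((r - 1)%:E <= u n)%E by near: n; apply: lo; rewrite lte_fin; lra.
    have : (u n <= (r + 1)%:E)%E by near: n; apply: up; rewrite lte_fin; lra.
    by case: (u n).
  apply/fine_cvgP; split => //; apply/cvgrPdist_le => e e0.
  near=> n; have un : u n \is a fin_num by near: n.
  have : ((r - e)%:E <= u n)%E by near: n; apply: lo; rewrite lte_fin; lra.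
  have : (u n <= (r + e)%:E)%E by near: n; apply: up; rewrite lte_fin; lra.
  rewrite -(fineK un) !lee_fin => h1 h2 /=; rewrite ler_norml; lra.
- by apply/cvgeyPge => b; apply: lo; rewrite ltry.
- by apply/cvgeNyPle => b; apply: up; rewrite ltNyr.
Unshelve. all: by end_near. Qed.

(** * Fekete's lemma for almost superadditive functions of boxes *)

Section fekete.
Context (R : realType) (d : nat) (L : set (site d)) (m0 : nat).
Hypotheses (d0 : (0 < d)%N) (m0_gt0 : (0 < m0)%N).
Variables (f : {fset site d} -> \bar R) (err : nat -> R) (c1 : R).
Hypothesis c1_ge0 : 0 <= c1.
Hypothesis err_ge0 : forall m, 0 <= err m.
Hypothesis err_small : err m / m%:R ^+ d @[m --> \oo] --> 0.
Hypothesis f_site : forall D v (i : 'I_d), v \notin D -> v - delta_mx 0 i \in D ->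
  (f D - c1%:E <= f (v |` D)%fset)%E.
Hypothesis f_block : forall m D v (i : 'I_d), (0 < m)%N -> (m0 %| m)%N ->
  [disjoint D & block m v]%fset -> (v - delta_mx 0 i) *+ m \in D ->
  (f D + f (box d m) - (err m)%:E <= f (D `|` block m v)%fset)%E.

Lemma f_grow (S T : {fset site d}) (r : R) : parent_closed S -> (T `<=` S)%fset -> 0 \in T ->
  (r%:E <= f T)%E -> ((r - c1 * (#|` S|%:R - #|` T|%:R))%:E <= f S)%E.
Proof.
move=> pS TS zT rT.
apply: (@growth_ind d (fun D => ((r - c1 * (#|` D|%:R - #|` T|%:R))%:E <= f D)%E) S T) => //.
  by rewrite subrr mulr0 subr0.
move=> D v i DS vS vD pD IH; rewrite cardfsU1 vD.
have := f_site vD pD; apply: le_trans.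
move: IH; case: (f D) => [s| |] //=; rewrite ?leey//.
by rewrite !lee_fin natrD; lra.
Qed.

Lemma f_blocks m k (r : R) : (0 < m)%N -> (m0 %| m)%N -> (0 < k)%N -> (r%:E <= f (box d m))%E ->
  (((k ^ d)%:R * (r - err m))%:E <= f (box d (k * m)))%E.
Proof.
move=> m_gt0 mm0 k0 rm.
have := @growth_ind d (fun D => ((#|` D|%:R * (r - err m))%:E <= f (blocks m D))%E)
  (box d k) [fset 0]%fset (@box_parent_closed d k).
rewrite card_box blocks_box//; apply.
- by rewrite fsub1set box0.
- by rewrite inE.
- have -> : blocks m [fset 0]%fset = box d m.
    by apply/fsetP => x; apply/mem_blocks/idP => [[v]|xm]; [rewrite inE => /eqP ->; rewrite block0|exists 0; rewrite ?inE// block0].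
  rewrite cardfs1 mul1r (le_trans _ rm)// lee_fin; have := err_ge0 m; lra.
move=> T v i TS vS vT pT IH; rewrite blocksU1 cardfsU1 vT natrD.
have := @f_block m (blocks m T) v i m_gt0 mm0 (blocks_disjoint m_gt0 vT).
have pB : (v - delta_mx 0 i) *+ m \in blocks m T.
  by apply/mem_blocks; exists (v - delta_mx 0 i) => //; exact: block_corner.
move=> /(_ pB); apply: le_trans.
move: IH rm; case: (f (blocks m T)) => [s| |] //=; case: (f (box d m)) => [t| |] //=; rewrite ?leey//.
by rewrite !lee_fin; lra.
Qed.

Definition ratio (m n : nat) : R := ((n %/ m) * m)%:R / n%:R.

Lemma f_lower m n (r : R) : (0 < m)%N -> (m0 %| m)%N -> (m <= n)%N -> (r%:E <= f (box d m))%E ->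
  (((n%:R ^+ d) * (ratio m n ^+ d * ((r - err m) / m%:R ^+ d) - c1 * (1 - ratio m n ^+ d)))%:E
    <= f (box d n))%E.
Proof.
move=> m_gt0 mm0 mn rm.
have k0 : (0 < n %/ m)%N by rewrite divn_gt0.
have kmn : (n %/ m * m <= n)%N := leq_trunc_div n m.
have km0 : (0 < n %/ m * m)%N by rewrite muln_gt0 k0.
have n0 : (n%:R : R) != 0 by rewrite pnatr_eq0 -lt0n (leq_trans m_gt0).
have mR : (m%:R : R) != 0 by rewrite pnatr_eq0 -lt0n.
have := @f_grow (box d n) (box d (n %/ m * m)) _ (@box_parent_closed d n) (@box_sub d _ _ kmn)
  (@box0 d _ km0) (f_blocks m_gt0 mm0 k0 rm).
apply: le_trans; rewrite lee_fin !card_box.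
rewrite le_eqVlt; apply/orP; left; apply/eqP.
rewrite /ratio expr_div_n !natrX natrM exprMn.
have nd : (n%:R ^+ d : R) != 0 by rewrite expf_neq0.
have md : (m%:R ^+ d : R) != 0 by rewrite expf_neq0.
by field; rewrite nd md.
Qed.

Lemma cvg_invn : (n%:R : R)^-1 @[n --> \oo] --> (0 : R).
Proof.
apply/gtr0_cvgV0; last exact: cvgr_idn.
by near=> n; rewrite ltr0n; near: n; exact: nbhs_infty_gt.
Unshelve. all: by end_near. Qed.

Lemma ratio_cvg m : (0 < m)%N -> ratio m n @[n --> \oo] --> (1 : R).
Proof.
move=> m_gt0; apply: (@squeeze_cvgr _ _ _ _ (fun n => 1 - m%:R * (n%:R : R)^-1) (cst 1)).
- near=> n; have n0 : (0 < n)%N by near: n; exact: nbhs_infty_gt.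
  have nR : 0 < (n%:R : R) by rewrite ltr0n.
  have e : (n = n %/ m * m + n %% m)%N := divn_eq n m.
  have lt : (n %% m < m)%N by rewrite ltn_mod.
  rewrite /ratio /cst; apply/andP; split.
    rewrite ler_pdivlMr// mulrBl mul1r -mulrA mulVf ?gt_eqF// mulr1 lerBlDr -natrD ler_nat.
    by rewrite {1}e leq_add2l ltnW.
  by rewrite ler_pdivrMr// mul1r ler_nat leq_trunc_div.
- rewrite -[X in _ --> X]subr0; apply: cvgB; first exact: cvg_cst.
  by rewrite -(mulr0 (m%:R : R)); apply: cvgMr; exact: cvg_invn.
- exact: cvg_cst.
Unshelve. all: by end_near. Qed.

(** A multiple of [m0] that is at least n and asymptotic to n: superadditivity over blocks is
    available for these sides. *)
Definition round_up (n : nat) : nat := ((n %/ m0).+1 * m0)%N.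

Lemma round_up_cvg : (round_up n)%:R / n%:R @[n --> \oo] --> (1 : R).
Proof.
rewrite (_ : (fun n => _) = fun n => ratio m0 n + m0%:R * (n%:R : R)^-1); last first.
  by apply/funext => n; rewrite /ratio /round_up mulSn natrD mulrDl addrC.
rewrite -[X in _ --> X]addr0; apply: cvgD; first exact: ratio_cvg.
by rewrite -(mulr0 (m0%:R : R)); apply: cvgMr; exact: cvg_invn.
Qed.

Lemma round_up_ge n : (n <= round_up n)%N.
Proof. by rewrite /round_up ltnW// ltn_ceil. Qed.

Lemma round_up_infty : round_up n @[n --> \oo] --> \oo.
Proof.
apply/cvgnyPge => A; near=> n; apply: leq_trans (round_up_ge n).
by near: n; exact: nbhs_infty_ge.
Unshelve. all: by end_near. Qed.

(** Real lower bounds [r] stand in for the value of [f] on the box, which may be infinite. *)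
Let S := [set x | exists m (r : R), [/\ (0 < m)%N, (m0 %| m)%N, (r%:E <= f (box d m))%E &
   x = ((r - err m) / m%:R ^+ d)%:E]].

(** The limit is the supremum of the corrected densities (f - err) / m^d. From below, a large box is
    tiled by blocks of one good side m and completed site by site. From above, a box is enlarged to
    an admissible side, where the supremum bounds the value, and the enlargement costs [c1] per
    added site. *)
Lemma fekete : exists l : \bar R, (((n%:R ^+ d)^-1)%:E * f (box d n))%E @[n --> \oo] --> l /\
  forall m (r : R), (0 < m)%N -> (m0 %| m)%N -> (r%:E <= f (box d m))%E ->
    (((r - err m) / m%:R ^+ d)%:E <= l)%E.
Proof.
exists (ereal_sup S); split; last first.
  by move=> m r m_gt0 mm0 rm; apply: ereal_sup_ubound; exists m, r.
have cvgX (u : nat -> R) (a : R) : u n @[n --> \oo] --> a -> u n ^+ d @[n --> \oo] --> a ^+ d.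
  by move=> ua; apply: (cvg_comp u (fun x => x ^+ d)) ua _; exact: exprn_continuous.
apply: ereal_cvg_pinch => b.
- move=> /ereal_sup_gt[_ [m [r [m_gt0 mm0 rm ->]]]]; rewrite lte_fin => bc.
  set c := (r - err m) / m%:R ^+ d in bc.
  have gc : ratio m n ^+ d * c - c1 * (1 - ratio m n ^+ d) @[n --> \oo] --> c.
    have rd : ratio m n ^+ d @[n --> \oo] --> (1 : R).
      by rewrite -[X in _ --> X](expr1n R d); apply: cvgX; exact: ratio_cvg.
    rewrite -[X in _ --> X]subr0; apply: cvgB.
      by rewrite -[X in _ --> X]mul1r; apply: cvgMl.
    rewrite -(mulr0 c1); apply: cvgMr; rewrite -[X in _ --> X](subrr 1).
    by apply: cvgB => //; exact: cvg_cst.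
  near=> n.
  have n0 : (0 < n)%N by near: n; exact: nbhs_infty_gt.
  have nd : 0 < (n%:R ^+ d : R) by rewrite exprn_gt0// ltr0n.
  have bg : b <= ratio m n ^+ d * c - c1 * (1 - ratio m n ^+ d) by near: n; exact: cvgr_ge gc _ bc.
  have mn : (m <= n)%N by near: n; exact: nbhs_infty_ge.
  have := f_lower m_gt0 mm0 mn rm; rewrite -/c.
  move=> h; apply: (@le_trans _ _ (((n%:R ^+ d)^-1)%:E * (n%:R ^+ d * b)%:E)%E).
    by rewrite -EFinM mulrA mulVf ?gt_eqF// mul1r.
  rewrite lee_pmul2l ?lte_fin ?invr_gt0//; apply: le_trans h.
  by rewrite lee_fin ler_pM2l.
- move=> Sb; have [c Sc cb] : exists2 c : R, (ereal_sup S <= c%:E)%E & c < b.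
    case: (ereal_sup S) Sb => [s| |]//; first by rewrite lte_fin; exists s.
    by exists (b - 1); rewrite ?leNye//; lra.
  (* Solving for the value on the box of side n: on the enlarged box it is at most c per site plus
     err, and growing there lost at most c1 per added site. All this is divided by n^d. *)
  pose h n := ((round_up n)%:R / n%:R) ^+ d * (c + err (round_up n) / (round_up n)%:R ^+ d + c1) - c1.
  have hc : h n @[n --> \oo] --> c.
    have -> : c = 1 ^+ d * (c + 0 + c1) - c1 by rewrite expr1n; ring.
    apply: cvgB; last exact: cvg_cst.
    apply: cvgM; first by apply: cvgX; exact: round_up_cvg.
    apply: cvgD; last exact: cvg_cst.
    apply: cvgD; first exact: cvg_cst.
    exact: (cvg_comp round_up (fun m => err m / m%:R ^+ d) round_up_infty err_small).
  near=> n.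
  have n0 : (0 < n)%N by near: n; exact: nbhs_infty_gt.
  have nd : 0 < (n%:R ^+ d : R) by rewrite exprn_gt0// ltr0n.
  have hb : h n <= b by near: n; exact: cvgr_le hc _ cb.
  have N0 : (0 < round_up n)%N := leq_trans n0 (round_up_ge n).
  have Nd : 0 < ((round_up n)%:R ^+ d : R) by rewrite exprn_gt0// ltr0n.
  have key (r : R) : (r%:E <= f (box d n))%E -> r <= n%:R ^+ d * b.
    move=> rn; have := f_grow (@box_parent_closed d (round_up n)) (@box_sub d _ _ (round_up_ge n)) (@box0 d _ n0) rn.
    rewrite !card_box !natrX => rN.
    have SN : S (((r - c1 * ((round_up n)%:R ^+ d - n%:R ^+ d) - err (round_up n)) / (round_up n)%:R ^+ d)%:E).
      by exists (round_up n), (r - c1 * ((round_up n)%:R ^+ d - n%:R ^+ d)); split => //; rewrite /round_up dvdn_mull.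
    have := le_trans (ereal_sup_ubound SN) Sc; rewrite lee_fin ler_pdivrMr// => rc.
    apply: (@le_trans _ _ (n%:R ^+ d * h n)); last by rewrite ler_pM2l.
    rewrite /h expr_div_n mulrBr mulrA mulrCA divff ?gt_eqF// mulr1.
    have -> : (round_up n)%:R ^+ d * (c + err (round_up n) / (round_up n)%:R ^+ d + c1) =
      (round_up n)%:R ^+ d * (c + c1) + err (round_up n).
      by field; rewrite gt_eqF.
    lra.
  suff : (f (box d n) <= (n%:R ^+ d * b)%:E)%E.
    move=> le; apply: (@le_trans _ _ (((n%:R ^+ d)^-1)%:E * (n%:R ^+ d * b)%:E)%E).
      by rewrite lee_pmul2l ?lte_fin ?invr_gt0.
    by rewrite -EFinM mulrA mulVf ?gt_eqF// mul1r.
  move: key; case: (f (box d n)) => [s| |] key; rewrite ?leNye//.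
    by rewrite lee_fin; exact: key.
  by exfalso; have := key (n%:R ^+ d * b + 1) (leey _); lra.
Unshelve. all: by end_near. Qed.

End fekete.

(** * Free energies *)

Section finite_volume_free_energy.
Context (R : realType) (k : height_kind) (d : nat).
Notation E := (heights R k).
Notation I := (site d).
Notation cfg := (config E d).
Implicit Types (D M : {fset I}) (phi : cfg).
Context (L : set I) (m0 : nat) (A : set {fset I}) (q : I -> I -> R).
Variables (Phi Psi Xi : potential R k d).
Hypothesis pgPsi : periodic_gradient_potential L Psi.
Hypothesis pgXi : periodic_gradient_potential L Xi.
Hypothesis Psi0 : forall G phi, (0 <= Psi G phi)%E.
Hypothesis PhiE : forall G phi, Phi G phi = (Psi G phi + Xi G phi)%E.
Variable nrm : R.
Hypothesis nrm0 : 0 <= nrm.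
Hypothesis XiN : forall x phi, (\esum_(G in [set G : {fset I} | x \in G]) `|Xi G phi| <= nrm%:E)%E.

Variable mu : gradient_measure R k d.
Hypothesis mu_inv : shift_invariant L mu.
Hypothesis incP : forall x y, exists2 K : R, 0 <= K &
  {ae mu, forall phi : gradT E [set: I], `|increment phi x y| <= K}.

(** Almost surely bounded increments make a product of uniform densities positive and bounded below
    almost surely; the sites are joined one at a time. *)
Lemma tame_nonempty D : D != fset0 -> tame D mu.
Proof.
have [n] := ubnP #|` D|; elim: n D => // n IH D; rewrite ltnS => Dn D0.
have [x xD] := fset0Pn _ D0; rewrite -(fsetD1K xD).
have [->|D'0] := eqVneq (D `\ x)%fset fset0; first by rewrite fsetU0; exact: tame1.
have [y yD'] := fset0Pn _ D'0; have [K K0 xyK] := incP x y.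
apply: (@tame_fsetU R k d [fset x]%fset (D `\ x)%fset x y mu K) => //.
- by rewrite fdisjoint1X !inE eqxx.
- by rewrite inE.
- exact: tame1.
- by apply: IH => //; rewrite (leq_trans _ Dn)// [X in (_ < X)%N](cardfsD1 x) xD.
Qed.

Local Notation H D := (ham Phi D).
Local Notation fe D := (free_energy Phi D mu).

Let low D : lower_integrable mu (ham Phi D).
Proof. exact: (@lower_integrable_ham R k d L Phi Psi Xi pgPsi pgXi Psi0 PhiE nrm XiN). Qed.

Lemma free_energyE D : D != fset0 -> fe D = (ent D mu + quasi_integral mu (H D))%E.
Proof.
move=> D0; rewrite /free_energy -/(ent D mu) -/(ham Phi D).
have := ent_gtNy (tame_nonempty D0); have := quasi_integral_gtNy (low D).
by case: (ent D mu) => [e| |]; case: (quasi_integral mu _) => [h| |].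
Qed.

Lemma free_energy_superadditive D M x y (K : R) : [disjoint D & M]%fset -> x \in D -> y \in M ->
  0 <= K -> {ae mu, forall phi : gradT E [set: I], `|increment phi x y| <= K} ->
  (fe D + fe M - (ln (2 * K + 1))%:E - lower_exterior_bound Xi M <= fe (D `|` M)%fset)%E.
Proof.
move=> DM xD yM K0 xyK.
have D0 : D != fset0 by apply/fset0Pn; exists x.
have M0 : M != fset0 by apply/fset0Pn; exists y.
have DM0 : (D `|` M)%fset != fset0 by apply/fset0Pn; exists x; rewrite inE xD.
rewrite !free_energyE//.
have entS := ent_superadditive DM xD yM K0 xyK (tame_nonempty D0) (tame_nonempty M0).
have eF := exterior_fin XiN M.
pose c := (- fine (lower_exterior_bound Xi M))%R.
have hamS : (quasi_integral mu (H D) + quasi_integral mu (H M) + c%:E <= quasi_integral mu (H (D `|` M)%fset))%E.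
  have lc := lower_integrable_cst mu c.
  have lDM := lower_integrableD (low D) (low M).
  rewrite -quasi_integralD// -(quasi_integral_cst mu c) -quasi_integralD//.
  apply: le_quasi_integral.
  - exact: (lower_integrableD lDM lc).1.
  - exact: (low _).1.
  apply: aeW => phi /=; rewrite /c EFinN fineK//.
  exact: (ham_superadditive pgXi Psi0 PhiE XiN).
have <- : c%:E = (- lower_exterior_bound Xi M)%E by rewrite /c EFinN fineK.
by rewrite addeACA [X in (X + _ <= _)%E]addeAC -addeA; exact: leeD.
Qed.

Lemma free_energy_translate D l : L l -> D != fset0 -> (fe D <= fe (translate l D))%E.
Proof.
move=> Ll D0.
have mul (B : set (gradT E [set: I])) : measurable B -> mu (Defs.shift l @^-1` B) = mu B by move=> mB; exact: mu_inv.
have tD0 : translate l D != fset0.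
  by have [x xD] := fset0Pn _ D0; apply/fset0Pn; exists (x + l); exact: in_translate.
rewrite (free_energyE D0) (free_energyE tD0); apply: leeD.
  exact: (@ent_translate R k d l D mu mul (tame_nonempty D0)).
rewrite (_ : ham Phi (translate l D) = fun phi => ham Phi D (Defs.shift l phi)); last first.
  by apply/funext => phi; exact: (ham_translate pgPsi pgXi PhiE).
by rewrite (@quasi_integral_shift R k d l mu mul (ham Phi D) (low D).1).
Qed.

Lemma free_energy1_ge v : ((- nrm)%:E <= fe [fset v]%fset)%E.
Proof.
have v0 : [fset v]%fset != fset0 by apply/fset0Pn; exists v; rewrite inE.
rewrite free_energyE//; rewrite -[leLHS]add0e; apply: leeD; first exact: ent1_ge0.
rewrite -(quasi_integral_cst mu); apply: le_quasi_integral => //.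
  exact: (low _).1.
apply: aeW => phi /=; apply: le_trans (ham_ge pgXi Psi0 PhiE XiN _ _).
by rewrite cardfs1 mulr1n.
Qed.

Lemma free_energy_gtNy D : D != fset0 -> (-oo < fe D)%E.
Proof.
move=> D0; rewrite free_energyE//.
have := ent_gtNy (tame_nonempty D0); have := quasi_integral_gtNy (low D).
by case: (ent D mu) => [e| |]; case: (quasi_integral mu _) => [h| |] //= _ _; rewrite ?ltNyr.
Qed.

End finite_volume_free_energy.

(** The modulus [m0] is the absolute value of the determinant of a basis matrix: by the adjugate
    formula, det B times any integer vector is an integer combination of the rows of B. *)
Lemma sublattice_props d (L : set (site d)) : full_rank_sublattice L ->
  [/\ L 0, (forall x y, L x -> L y -> L (x + y)), (forall x, L x -> L (- x)) &
      exists2 m0, (0 < m0)%N & forall x, L (x *+ m0)].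
Proof.
move=> [B detB ->]; split.
- by exists 0 => //; rewrite mul0mx.
- by move=> _ _ [x _ <-] [y _ <-]; exists (x + y) => //; rewrite mulmxDl.
- by move=> _ [x _ <-]; exists (- x) => //; rewrite mulNmx.
exists `|\det B|%N; first by rewrite absz_gt0.
move=> x; have E : (x *m \adj B) *m B = (\det B) *: x by rewrite -mulmxA mul_adj_mx mul_mx_scalar.
move: E; move: (\det B) => [n|n] E /=.
  by exists (x *m \adj B) => //; rewrite E -[Posz n]natz scaler_nat.
exists (- (x *m \adj B)) => //.
by rewrite mulNmx E NegzE scaleNr opprK -[Posz n.+1]natz scaler_nat.
Qed.

Lemma cvg_natX (R : realType) (d : nat) : (0 < d)%N -> (n ^ d)%N @[n --> \oo] --> \oo.
Proof.
move=> d0; apply/cvgnyPge => N; near=> n; apply: (@leq_trans n).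
  by near: n; exact: nbhs_infty_ge.
by rewrite -[X in (X <= _)%N]expn1 leq_pexp2l//; near: n; exact: nbhs_infty_gt.
Unshelve. all: by end_near. Qed.

Lemma ae_countable dT (T : measurableType dT) (R : realType) (mu : {measure set T -> \bar R})
    (J : countType) (P : J -> T -> Prop) :
  (forall j, {ae mu, forall t, P j t}) -> {ae mu, forall t, forall j, P j t}.
Proof.
move=> H; have H' : {ae mu, forall t, forall n, forall j, @choice.unpickle J n = Some j -> P j t}.
  apply: ae_foralln => n; case: (@choice.unpickle J n) => [j|]; last exact: aeW.
  by apply: filterS (H j) => t ? _ [<-].
by apply: filterS H' => t Ht j; apply: Ht (choice.pickleK j).
Qed.

Section van_hove_boxes.
Context (R : realType) (d : nat).
Hypothesis d0 : (0 < d)%N.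

Lemma boundary_box n : (#|` boundary (box d n)| + n ^ d <= (n + 2) ^ d)%N.
Proof.
pose one : site d := const_mx 1.
pose B := translate (- one) (box d (n + 2)).
have memB x : (x \in B) = (x + one \in box d (n + 2)).
  by apply/imfsetP/idP => [[y /= yB ->]|xB]; [rewrite subrK|exists (x + one) => //; rewrite addrK].
have bB x : x \in box d n -> x \in B.
  rewrite memB !mem_box => /forallP xn; apply/forallP => i; have := xn i; rewrite !mxE; move: (x 0%R i) => a; lia.
have sub : [set y : site d | y \notin box d n /\ exists2 x, x \in box d n & d1 x y = 1%N]
    `<=` [set` (B `\` box d n)%fset].
  move=> y [yn [x xn xy]] /=; rewrite inE yn memB mem_box; apply/forallP => i.
  move: xn; rewrite mem_box => /forallP/(_ i) xn; rewrite !mxE.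
  have : (`|x 0%R i - y 0%R i| <= d1 x y)%N by rewrite /d1 (bigD1 i)//= leq_addr.
  rewrite xy.
  move: (x 0%R i) (y 0%R i) xn => a b; lia.
have cB : #|` B| = ((n + 2) ^ d)%N.
  by rewrite -card_box /B /translate card_imfset//; exact: addIr.
have : (boundary (box d n) `<=` B `\` box d n)%fset.
  apply/fsubsetP => y; rewrite in_fset_set; first by rewrite inE; exact: sub.
  exact: sub_finite_set sub (finite_fset _).
move=> /fsubset_leq_card le; apply: leq_trans (leq_add le (leqnn _)) _.
have -> : (n ^ d)%N = #|` (B `&` box d n)%fset|.
  rewrite -card_box; congr (#|` _|); apply/fsetP => x; rewrite inE.
  by case: (boolP (x \in box d n)) => [/bB ->|]; rewrite ?andbF.
by rewrite -cB cardfsD subnK// fsubset_leq_card// fsubsetIl.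
Qed.

Lemma van_hove_box : van_hove R (box d).
Proof.
split.
  rewrite (_ : (fun n => _) = fun n => (n ^ d)%N); first exact: cvg_natX.
  by apply/funext => n; rewrite card_box.
apply: (@squeeze_cvgr _ _ _ _ (cst 0) (fun n => (1 + 2 * (n%:R : R)^-1) ^+ d - 1)).
- near=> n; have n0 : (0 < n)%N by near: n; exact: nbhs_infty_gt.
  have nd : 0 < (n%:R ^+ d : R) by rewrite exprn_gt0// ltr0n.
  rewrite /cst divr_ge0//= card_box natrX ler_pdivrMr// mulrBl mul1r -exprMn.
  rewrite mulrDl mul1r -mulrA mulVf ?mulr1 ?pnatr_eq0 -?lt0n//.
  rewrite lerBrDr -natrX -natrD -[2]/(2%:R) -natrD -natrX ler_nat; exact: boundary_box.
- exact: cvg_cst.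
- have -> : (0 : R) = (1 + 2 * 0) ^+ d - 1 by rewrite mulr0 addr0 expr1n subrr.
  apply: cvgB; last exact: cvg_cst.
  apply: (cvg_comp (fun n : nat => 1 + 2 * (n%:R : R)^-1) (fun x : R => x ^+ d)); last exact: exprn_continuous.
  apply: cvgD; first exact: cvg_cst.
  by apply: cvgMr; exact: cvg_invn.
Unshelve. all: by end_near. Qed.

End van_hove_boxes.

Lemma ler_term_sum (R : numDomainType) (T : eqType) (s : seq T) (F : T -> R) x :
  x \in s -> (forall y, 0 <= F y) -> F x <= \sum_(y <- s) F y.
Proof.
move=> + F0; elim: s => // y s IH; rewrite inE big_cons => /predU1P[->|xs].
  by rewrite lerDl sumr_ge0.
by apply: le_trans (IH xs) _; rewrite lerDr.
Qed.

(** Here e is a coordinate of one end of an edge, r its residue and a that of the other end. Moving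
    the edge so that e becomes r and then by N * m0 keeps it inside a box of side m0 * (2 * N +
    1). *)
Lemma coordinate_in_box (a e r : int) (N m0 : nat) : (0 < m0)%N -> (`|a - e| <= N)%N ->
  0 <= r < m0%:Z -> 0 <= a + (r - e + (N * m0)%N%:Z) < (m0 * (2 * N + 1))%N%:Z.
Proof.
move=> m0_gt0; have -> : (m0 * (2 * N + 1) = 2 * (N * m0) + m0)%N by ring.
have : (N <= N * m0)%N by rewrite leq_pmulr.
by move: (N * m0)%N => p; lia.
Qed.

Lemma quasi_integral_integrable dT (T : measurableType dT) (R : realType) (P : probability T R) (f : T -> \bar R) :
  P.-integrable setT f -> lower_integrable P f /\ quasi_integral P f = (\int[P]_t f t)%E.
Proof.
move=> intf; have /integrableP[mf fin] := intf.
have lf : lower_integrable P f.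
  split => //; apply: le_lt_trans fin; apply: ge0_le_integral => //.
  - exact: measurable_funeneg.
  - exact: measurableT_comp.
  - move=> t _; rewrite funenegE ge_max abse_ge0 andbT -abseN; exact: lee_abs.
by split => //; rewrite [RHS]integralE quasi_integralE.
Qed.

Section specific_free_energy.
Context (R : realType) (k : height_kind) (d : nat).
Notation E := (heights R k).
Notation I := (site d).
Notation cfg := (config E d).
Implicit Types (D M : {fset I}) (phi : cfg).
Context (L : set I) (A : set {fset I}) (q : I -> I -> R).
Variables (Phi Psi Xi : potential R k d).
Hypothesis d2 : (2 <= d)%N.
Variable m0 : nat.
Hypotheses (m0_gt0 : (0 < m0)%N) (L0 : L 0).
Hypotheses (LD : forall x y, L x -> L y -> L (x + y)) (LN : forall x, L x -> L (- x)).
Hypothesis Lm0 : forall x, L (x *+ m0).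
Hypothesis admA : admissible_graph L A.
Hypothesis admq : admissible_quasimetric L q.
Hypothesis maxq : forall p, admissible_quasimetric L p ->
        (forall x y, A [fset x; y]%fset -> p x y <= q x y) ->
        forall x y, p x y <= q x y.
Hypothesis pgPsi : periodic_gradient_potential L Psi.
Hypothesis pgXi : periodic_gradient_potential L Xi.
Hypothesis Psi0 : forall G phi, (0 <= Psi G phi)%E.
Hypothesis PhiE : forall G phi, Phi G phi = (Psi G phi + Xi G phi)%E.
Variable nrm : R.
Hypothesis nrm0 : 0 <= nrm.
Hypothesis XiN : forall x phi, (\esum_(G in [set G : {fset I} | x \in G]) `|Xi G phi| <= nrm%:E)%E.
Hypothesis amXi : amenable L (lower_exterior_bound Xi).
Hypothesis lipPsi : lipschitz_potential A q Psi.
Variable K1 : R.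
Hypothesis K1_ge0 : 0 <= K1.
Hypothesis K1P : forall x (i : 'I_d), q x (x + delta_mx 0 i) <= K1 /\ q (x + delta_mx 0 i) x <= K1.

Let d0 : (0 < d)%N. Proof. exact: ltn_trans d2. Qed.

(** The cost of attaching a block of side m: the entropy of the increment that joins the corners of
    neighbouring blocks, bounded by m * K1, and the interaction across the boundary of the block. *)
Definition err (m : nat) : R :=
  ln (2 * (m%:R * K1) + 1) + fine (lower_exterior_bound Xi (box d m)).

Lemma err_ge0 m : 0 <= err m.
Proof.
apply: addr_ge0; first by rewrite ln_ge0// lerDr !mulr_ge0.
by rewrite fine_ge0// exterior_ge0.
Qed.

Lemma err_small : err m / m%:R ^+ d @[m --> \oo] --> 0.
Proof.
rewrite (_ : (fun m => _) = fun m => ln (2 * (m%:R * K1) + 1) / m%:R ^+ d +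
    fine (lower_exterior_bound Xi (box d m)) / m%:R ^+ d); last first.
  by apply/funext => m; rewrite mulrDl.
rewrite -[X in _ --> X]addr0; apply: cvgD.
  apply: (@squeeze_cvgr _ _ _ _ (cst 0) (fun m => (2 * K1) * (m%:R : R)^-1)).
  - near=> m; have mp : (0 < m)%N by near: m; exact: nbhs_infty_gt.
    have mR : 1 <= (m%:R : R) by rewrite ler1n.
    have md : 0 < (m%:R ^+ d : R) by rewrite exprn_gt0// ltr0n.
    rewrite /cst divr_ge0 ?(ltW md) ?ln_ge0// ?lerDr ?mulr_ge0//=.
    (* This linear bound on the logarithm is small compared with m^d because d is at least 2. *)
    have h : ln (2 * (m%:R * K1) + 1) <= 2 * (m%:R * K1).
      by rewrite addrC le_ln1Dx// (lt_le_trans (ltrN10 _))// !mulr_ge0.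
    rewrite ler_pdivrMr//; apply: (le_trans h).
    have -> : 2 * (m%:R * K1) = 2 * K1 / m%:R * m%:R ^+ 2 by field; rewrite gt_eqF// (lt_le_trans ltr01).
    by rewrite ler_wpM2l ?ler_weXn2l// mulr_ge0 ?mulr_ge0 ?invr_ge0 ?ler0n.
  - exact: cvg_cst.
  - by rewrite -(mulr0 (2 * K1)); apply: cvgMr; exact: cvg_invn.
have [_ _ _ /(_ _ (@van_hove_box R d d0))] := amXi.
move=> /fine_cvgP[_]; apply: cvg_trans; apply: near_eq_cvg; near=> m.
by rewrite /= fineM ?(exterior_fin XiN)// card_box natrX.
Unshelve. all: by end_near. Qed.

Definition ae_lipschitz (mu : gradient_measure R k d) :=
  {ae mu, forall phi : gradT E [set: I], forall x y, increment phi x y <= q x y}.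

Lemma incrementN phi x y : increment phi y x = - increment phi x y.
Proof. by rewrite /increment !hs_inclB opprB. Qed.

Lemma ae_lipschitz_bounded mu x y : ae_lipschitz mu -> 
  {ae mu, forall phi : gradT E [set: I], `|increment phi x y| <= Num.max (q x y) (q y x)}.
Proof.
apply: filterS => phi H.
by rewrite ler_norml lerNl -incrementN !le_max !H orbT.
Qed.

Lemma ae_lipschitz_incP mu : ae_lipschitz mu -> forall x y, exists2 K : R, 0 <= K &
  {ae mu, forall phi : gradT E [set: I], `|increment phi x y| <= K}.
Proof.
move=> mul x y; exists `|Num.max (q x y) (q y x)| => //.
by apply: filterS (ae_lipschitz_bounded x y mul) => phi /le_trans; apply; exact: ler_norm.
Qed.

(** The second claim bounds the specific free energy from below by means of a single box. All lower
    bounds on the surface tension come from it, as does the passage to limits of measures. *)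
Lemma specific_free_energyP mu : shift_invariant L mu -> ae_lipschitz mu ->
  ((n%:R ^- d)%:E * free_energy Phi (box d n) mu)%E @[n --> \oo] --> specific_free_energy Phi mu /\
  forall m r, (0 < m)%N -> (m0 %| m)%N -> (r%:E <= free_energy Phi (box d m) mu)%E ->
    (((r - err m) / m%:R ^+ d)%:E <= specific_free_energy Phi mu)%E.
Proof.
move=> mu_inv mul; have incP := ae_lipschitz_incP mul.
have stepP m (v : I) (i : 'I_d) : {ae mu, forall phi : gradT E [set: I],
    `|increment phi ((v - delta_mx 0 i) *+ m) (v *+ m)| <= m%:R * K1}.
  apply: filterS (ae_lipschitz_bounded ((v - delta_mx 0 i) *+ m) (v *+ m) mul) => phi /le_trans; apply.
  have := steps_bounded admq ((v - delta_mx 0 i) *+ m) m (fun x => K1P x i).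
  by rewrite mulrnBl subrK ge_max => -[-> ->].
have gtNy := free_energy_gtNy pgPsi pgXi Psi0 PhiE XiN incP.
have sup := free_energy_superadditive pgPsi pgXi Psi0 PhiE XiN incP.
(* Adding one site loses at most nrm for the free energy of the site, ln (2 * K1 + 1) for the
   joining unit step, and nrm for the exterior bound of the site. *)
have [||l [cvl lP]] := @fekete R d m0 m0_gt0 (fun D => free_energy Phi D mu) err (nrm + ln (2 * K1 + 1) + nrm) err_ge0 err_small.
- suff H (D : {fset I}) (v : I) (i : 'I_d) : v \notin D -> v - delta_mx 0 i \in D ->
      (free_energy Phi D mu - (nrm + ln (2 * K1 + 1) + nrm)%:E <= free_energy Phi (v |` D)%fset mu)%E.
    by move=> D v i; exact: H.
  move=> vD viD; have Dv : [disjoint D & [fset v]]%fset by rewrite fdisjointX1.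
  have := stepP 1%N v i; rewrite !mulr1n mul1r => st.
  rewrite fsetUC; apply: le_trans (sup _ _ _ _ _ Dv viD (fset11 v) K1_ge0 st).
  have D0 : D != fset0 by apply/fset0Pn; exists (v - delta_mx 0 i).
  have [e1 e2] := (exterior_le XiN [fset v]%fset, exterior_fin XiN [fset v]%fset).
  have := free_energy1_ge pgPsi pgXi Psi0 PhiE XiN incP v.
  rewrite cardfs1 mulr1n in e1; move: e1; rewrite -(fineK e2).
  have := gtNy _ D0.
  case: (free_energy Phi D mu) => [a| |] // _; case: (free_energy Phi [fset v]%fset mu) => [b| |] //=; rewrite ?lee_fin => h1 h2; rewrite ?leey//.
  lra.
- move=> m D v i mp mm Db vD.
  have Lv : L (v *+ m) by rewrite -(divnK mm) mulrnA; exact: Lm0.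
  have vb : v *+ m \in block m v by exact: block_corner.
  have mK : 0 <= m%:R * K1 by rewrite mulr_ge0.
  apply: le_trans (sup _ _ _ _ _ Db vD vb mK (stepP m v i)).
  have D0 : D != fset0 by apply/fset0Pn; exists ((v - delta_mx 0 i) *+ m).
  have b0 : box d m != fset0 by apply/fset0Pn; exists 0; exact: box0.
  have -> : lower_exterior_bound Xi (block m v) = lower_exterior_bound Xi (box d m).
    by have [_ inv _ _] := amXi; rewrite /block inv.
  rewrite /err -(fineK (exterior_fin XiN (box d m))).
  have := free_energy_translate pgPsi pgXi Psi0 PhiE XiN mu_inv incP Lv b0.
  rewrite -/(block m v); have := gtNy _ D0; have := gtNy _ b0.
  case: (free_energy Phi D mu) => [a| |] //; case: (free_energy Phi (box d m) mu) => [b| |] //;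
    case: (free_energy Phi (block m v) mu) => [c| |] //= _ _ h; rewrite ?leey//.
  by rewrite -!EFinD lee_fin; move: h; rewrite !lee_fin; lra.
have -> : specific_free_energy Phi mu = l by exact: cvg_lim.
by [].
Qed.

Lemma quasi_integral_pinfty dT (T : measurableType dT) (mu : probability T R) (f : T -> \bar R) :
  lower_integrable mu f -> ~ {ae mu, forall t, f t != +oo%E} -> quasi_integral mu f = +oo%E.
Proof.
move=> lf; apply: contra_notP => qi; have [mf _] := lf.
have : (\int[mu]_t f^\+ t < +oo)%E.
  rewrite ltey; apply: contra_notN qi => /eqP foo; rewrite quasi_integralE// foo.
  by have := lf.2; case: (\int[mu]_x (f^\- x))%E.
move=> foo; have : mu.-integrable setT (f^\+)%E.
  apply/integrableP; split; first exact: measurable_funepos.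
  by under eq_integral do rewrite gee0_abs//.
move=> /(integrable_ae measurableT); apply: filterS => t /(_ Logic.I); apply: contraTneq => ft.
by rewrite funeposE ft.
Qed.

(** There are countably many edges, so a single one is violated with positive probability; a
    translate of it lies in every large box and makes the mean energy there infinite. *)
Lemma not_lipschitz_specific mu : shift_invariant L mu -> ~ ae_lipschitz mu ->
  specific_free_energy Phi mu = +oo%E.
Proof.
move=> mu_inv nlip.
have [x [y [xyA xyN]]] : exists x y, A [fset x; y]%fset /\
    ~ {ae mu, forall phi : gradT E [set: I], increment phi x y <= q x y}.
  apply: contra_notP nlip => H.
  have {}H : {ae mu, forall phi : gradT E [set: I], forall e : I * I,
      A [fset e.1; e.2]%fset -> increment phi e.1 e.2 <= q e.1 e.2}.
    apply: ae_countable => -[x y] /=; have [xy|nxy] := pselect (A [fset x; y]%fset); last exact: aeW.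
    by apply: filterS (contrapT (fun n => H (ex_intro _ x (ex_intro _ y (conj xy n))))).
  apply: filterS H => phi H x y; rewrite /increment hs_inclB.
  apply: (edge_lipschitz_q LN admA admq maxq (psi := fun x => hs_incl (phi x))) => x' y' xy.
  by rewrite -hs_inclB; exact: (H (x', y')).
pose N := (\sum_i (`|x 0%R i| + `|y 0%R i|))%N.
(* A shift in [m0] Z^d, hence in [L], that makes the coordinates of both ends nonnegative. *)
pose l : I := const_mx N%:Z *+ m0.
have Ll : L l by exact: Lm0.
pose b := (N.+1 + N * m0)%N.
have inb n (z : I) : (forall i, `|z 0%R i| <= N)%N -> (b <= n)%N -> z + l \in box d n.
  move=> zN bn; rewrite mem_box; apply/forallP => i; have := zN i.
  rewrite mxE /l mulmxnE mxE -mulr_natr natz; move: (z 0%R i) => a; move: bn m0_gt0; rewrite /b; nia.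
have xN i : (`|x 0%R i| <= N)%N /\ (`|y 0%R i| <= N)%N by rewrite /N (bigD1 i)//=; lia.
have xyN' : ~ {ae mu, forall phi : gradT E [set: I], increment phi (x + l) (y + l) <= q x y}.
  move=> H; apply: xyN; have {H}[B [mB B0 BP]] := H.
  exists (Defs.shift (- l) @^-1` B); split.
  - rewrite -[X in measurable X]setTI; exact: measurable_shift.
  - by rewrite -B0; apply: mu_inv => //; exact: LN.
  - move=> phi; apply: contra_notP => nB /=; apply: contrapT => nle; apply: nB.
    by apply: BP => /=; rewrite /increment /Defs.shift !addrK.
have foo n : (b <= n)%N -> free_energy Phi (box d n) mu = +oo%E.
  (* Whatever the entropy is, the sum is infinite, by the convention -oo + oo = oo. *)
  move=> bn; rewrite /free_energy (_ : quasi_integral _ _ = +oo%E); first by case: relative_entropy.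
  apply: quasi_integral_pinfty; first exact: (lower_integrable_ham pgPsi pgXi Psi0 PhiE XiN).
  apply: contra_not xyN'; apply: filterS => phi; apply: contra_neqT; rewrite -ltNge => lt.
  apply: (ham_violated pgXi Psi0 PhiE XiN (x := x + l) (y := y + l) lipPsi).
  - exact: (edge_translate admA).
  - by apply: inb => // i; have [] := xN i.
  - by apply: inb => // i; have [] := xN i.
  - by have [_ _ _ ->] := admq.
apply: cvg_lim => //; apply: cvg_near_cst; near=> n.
have bn : (b <= n)%N by near: n; exact: nbhs_infty_ge.
rewrite foo// gt0_muley// lte_fin invr_gt0 exprn_gt0// ltr0n.
by apply: leq_trans bn.
Unshelve. all: by end_near. Qed.

Lemma lipschitz_slope_of mu u : has_slope L mu u -> ae_lipschitz mu -> lipschitz_slope L q u.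
Proof.
move=> [intg sl] mul x y Lx Ly.
have Lyx : L (y - x) by apply: LD => //; exact: LN.
have [_ _ _ inv] := admq.
rewrite -(inv (- x) x y (LN Lx)) subrr -lee_fin EFinB.
have -> : ((pairing u y)%:E - (pairing u x)%:E = (pairing u (y - x))%:E :> \bar R)%E.
  by rewrite -EFinB pairingD pairingN.
rewrite -(sl _ Lyx).
have li : lower_integrable mu (fun phi : gradT E [set: I] => (increment phi 0 (y - x))%:E).
  split; first by have /integrableP[] := intg 0 (y - x).
  have /integrableP[mf] := intg 0 (y - x); apply: le_lt_trans; apply: ge0_le_integral => //.
  - exact: measurable_funeneg.
  - exact: measurableT_comp.
  - by move=> phi _; rewrite funenegE ge_max abse_ge0 andbT lee_fin -normrN ler_norm.
have -> : (\int[mu]_phi (increment phi 0 (y - x))%:E)%E =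
    quasi_integral mu (fun phi : gradT E [set: I] => (increment phi 0 (y - x))%:E).
  by rewrite [LHS]integralE quasi_integralE.
rewrite -(quasi_integral_cst mu); apply: le_quasi_integral.
- exact: li.1.
- exact: measurable_cst.
- by apply: filterS mul => phi H; rewrite lee_fin.
Qed.

Lemma free_energy_le (mu : gradient_measure R k d) D (c Ch : R) :
  ae_lipschitz mu -> D != fset0 -> 1 <= c ->
  (forall B : set cfg, @measurable _ (gradT E [set` D]) B ->
     (mu B <= c%:E * gradient_reference E D B)%E) ->
  {ae mu, forall phi : gradT E [set: I], (ham Phi D phi <= Ch%:E)%E} ->
  (free_energy Phi D mu <= (ln c + Ch)%:E)%E.
Proof.
move=> mul D0 c1 muc hC.
rewrite (free_energyE pgPsi pgXi Psi0 PhiE XiN (ae_lipschitz_incP mul) D0) EFinD.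
apply: leeD; first exact: relative_entropy_le.
rewrite -(quasi_integral_cst mu); apply: le_quasi_integral => //.
exact: (lower_integrable_ham pgPsi pgXi Psi0 PhiE XiN D mu).1.
Qed.

Lemma specific_free_energy_le (mu : gradient_measure R k d) (C : R) :
  shift_invariant L mu -> ae_lipschitz mu ->
  (forall D, D != fset0 -> (free_energy Phi D mu <= (C *+ #|` D|)%:E)%E) ->
  (specific_free_energy Phi mu <= C%:E)%E.
Proof.
move=> mu_inv mul H.
have [cv _] := specific_free_energyP mu_inv mul.
apply: lime_le; first by apply/cvg_ex; eexists; exact: cv.
near=> n; have n0 : (0 < n)%N by near: n; exact: nbhs_infty_gt.
have nd : 0 < (n%:R ^+ d : R) by rewrite exprn_gt0// ltr0n.
have /H : box d n != fset0 by rewrite -cardfs_gt0 card_box expn_gt0 n0.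
rewrite card_box => h; rewrite muleC lee_pdivrMr//; apply: le_trans h _.
by rewrite -EFinM lee_fin -natrX mulr_natr.
Unshelve. all: by end_near. Qed.

(** As increments are bounded by [K] throughout [M], the missing sites may be attached in any order,
    each to one fixed site of [D]. It carries a lower bound from a small set to a box. *)
Lemma free_energy_grow (mu : gradient_measure R k d) D M (K : R) : ae_lipschitz mu ->
  D != fset0 -> (D `<=` M)%fset -> 0 <= K ->
  (forall x y, x \in M -> y \in M -> {ae mu, forall phi : gradT E [set: I], `|increment phi x y| <= K}) ->
  (free_energy Phi D mu - ((ln (2 * K + 1) + nrm + nrm) *+ #|` M|)%:E <= free_energy Phi M mu)%E.
Proof.
move=> mul D0 DM K0 MK; have incP := ae_lipschitz_incP mul.
have c0 : 0 <= ln (2 * K + 1) + nrm + nrm by rewrite !addr_ge0// ln_ge0// lerDr mulr_ge0.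
suff H (s : seq I) (S : {fset I}) : S =i s -> uniq s -> {subset s <= M} -> [disjoint D & S]%fset ->
    (free_energy Phi D mu - ((ln (2 * K + 1) + nrm + nrm) *+ size s)%:E <=
     free_energy Phi (D `|` S)%fset mu)%E.
  have := H (M `\` D)%fset (M `\` D)%fset.
  have -> : (D `|` M `\` D)%fset = M.
    by apply/fsetP => x; rewrite !inE; case: (boolP (x \in D)) => //= /(fsubsetP DM).
  move=> h; apply: le_trans (h _ _ _ _) => //.
  - apply: leeD2l; rewrite leeN2 lee_fin; apply: ler_wpMn2l => //.
    by rewrite -[size _]/(#|` (M `\` D)%fset|) fsubset_leq_card// fsubsetDl.
  - exact: fset_uniq.
  - by move=> x; rewrite inE => /andP[].
  - by apply/fdisjointP => x xD; rewrite inE xD.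
elim: s S => [|v s IH] S Ss us sM dis.
  by rewrite mulr0n sube0 (_ : S = fset0) ?fsetU0//; apply/fsetP => x; rewrite Ss.
have /andP[vs us'] := us.
have vM : v \in M by apply: sM; rewrite inE eqxx.
have sM' : {subset s <= M} by move=> x xs; apply: sM; rewrite inE xs orbT.
pose S' := (S `\ v)%fset.
have S's : S' =i s.
  by move=> x; rewrite !inE Ss inE; case: eqP => //= ->; rewrite (negbTE vs).
have dis' : [disjoint D & S']%fset.
  by apply/fdisjointP => x xD; have /fdisjointP/(_ x xD) := dis; rewrite !inE => /negbTE ->; rewrite andbF.
have {}IH := IH S' S's us' sM' dis'.
have -> : (D `|` S = (D `|` S') `|` [fset v])%fset.
  by apply/fsetP => x; rewrite !in_fsetU S's Ss !inE orbAC orbA.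
have dv : [disjoint (D `|` S') & [fset v]]%fset.
  rewrite fdisjointX1 !inE eqxx /= orbF; apply/negP => vD.
  by have /fdisjointP/(_ v vD) := dis; rewrite Ss inE eqxx.
have [x xD] := fset0Pn _ D0.
have xM : x \in M by exact: (fsubsetP DM).
have xDs : x \in (D `|` S')%fset by rewrite inE xD.
apply: le_trans (free_energy_superadditive pgPsi pgXi Psi0 PhiE XiN incP dv xDs (fset11 v) K0 (MK x v xM vM)).
have [e1 e2] := (exterior_le XiN [fset v]%fset, exterior_fin XiN [fset v]%fset).
have := free_energy1_ge pgPsi pgXi Psi0 PhiE XiN incP v.
have Ds0 : (D `|` S')%fset != fset0 by apply/fset0Pn; exists x.
have := free_energy_gtNy pgPsi pgXi Psi0 PhiE XiN incP Ds0.
rewrite cardfs1 mulr1n in e1; move: e1; rewrite -(fineK e2).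
move: IH; rewrite /= mulrS.
case: (free_energy Phi D mu) => [a| |]; case: (free_energy Phi (D `|` S')%fset mu) => [b| |] //;
  case: (free_energy Phi [fset v]%fset mu) => [c| |] //=; rewrite ?lee_fin => h1 h2 _ h3; rewrite ?leey// ?leNye//.
lra.
Qed.

Lemma near_minimizer u (a : \bar R) : (surface_tension L Phi u < a)%E ->
  exists mu : gradient_measure R k d, [/\ shift_invariant L mu, ae_lipschitz mu, has_slope L mu u &
    (specific_free_energy Phi mu < a)%E].
Proof.
move=> /ereal_inf_lt[_ [mu [inv sl ->]] lt]; exists mu; split => //.
apply: contrapT => nlip; move: lt.
have -> := not_lipschitz_specific inv nlip.
by rewrite ltNge leey.
Qed.

Lemma surface_tension_lt_slope u : (surface_tension L Phi u < +oo)%E -> lipschitz_slope L q u.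
Proof. by move=> /near_minimizer[mu [_ mul sl _]]; exact: (lipschitz_slope_of sl). Qed.

End specific_free_energy.

(** * Independent uniform variables *)

Section uniform.
Context (R : realType).
Notation lam := (@lebesgue_measure R).
Notation RR := (measurableTypeR R).

Lemma ge0_integral_affine (a b : R) (f : RR -> \bar R) : 0 < a ->
  measurable_fun setT f -> (forall t, (0 <= f t)%E) ->
  (\int[lam]_t f ((a * t + b)%R : RR) = (a^-1)%:E * \int[lam]_t f t)%E.
Proof.
move=> a0 mf f0.
have mh : measurable_fun [set: RR] (fun t : RR => (a * t + b)%R : RR).
  by apply: measurable_funD => //; apply: measurable_funM.
pose m1 := measure_function_pushforward__canonical__measure_function_Measure (@lebesgue_measure R) mh.
pose m2 := mscale (NngNum (ltW a0)) m1.
have E : forall A, measurable A -> lam A = m2 A.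
  apply: lebesgue_measure_unique => _ [[x y]] _ <-.
  rewrite [RHS](_ : _ = a%:E * lam ((fun t : R => (a * t + b)%R) @^-1` `]x, y]%classic))%E//.
  have -> : (fun t : R => (a * t + b)%R) @^-1` `]x, y]%classic = `]((x - b) / a), ((y - b) / a)]%classic.
    apply/seteqP; split => t /=; rewrite !in_itv/= ltr_pdivrMr// ler_pdivlMr// [t * a]mulrC ltrBlDr lerBrDr//.
  rewrite !lebesgue_measure_itv/= !lte_fin ltr_pM2r ?invr_gt0// ltrD2r; case: ifP => _; last by rewrite mule0.
  by rewrite -!EFinB -EFinM; congr EFin; field; rewrite gt_eqF.
rewrite -[LHS]/(\int[lam]_t (f \o (fun t : RR => (a * t + b)%R : RR)) t)%E.
rewrite -[X in integral _ X _](preimage_setT (fun t : RR => (a * t + b)%R : RR)).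
rewrite -(ge0_integral_pushforward mh)//.
have <- : (\int[mscale (NngNum (ltW a0)) m1]_t f t = \int[lam]_t f t)%E.
  by apply: eq_measure_integral => A mA _; apply/esym; exact: E.
rewrite ge0_integral_mscale//= muleA -EFinM mulVf ?mul1e// gt_eqF//.
Qed.

Definition unif : probability RR R := uniform_prob (@ltr01 R).

Lemma unifE (f : RR -> \bar R) : measurable_fun setT f -> (forall t, (0 <= f t)%E) ->
  (\int[unif]_t f t = \int[lam]_(t in `[0%R, 1%R[) f t)%E.
Proof.
move=> mf f0; rewrite integral_uniform// subr0 invr1 mul1e -integral_itv_bndo_bndc//.
exact: measurable_funTS.
Qed.

Lemma integral_affine_itv (a b x y : R) (f : RR -> \bar R) : 0 < a ->
  measurable_fun setT f -> (forall t, (0 <= f t)%E) ->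
  (\int[lam]_(t in `[x, y[) f ((a * t + b)%R : RR) =
   (a^-1)%:E * \int[lam]_(t in `[(a * x + b)%R, (a * y + b)%R[) f t)%E.
Proof.
move=> a0 mf f0.
rewrite integral_mkcond [in RHS]integral_mkcond -(ge0_integral_affine b a0); last 2 first.
- by apply/(measurable_restrictT f) => //; exact: measurable_funTS.
- by move=> t; rewrite patchE; case: ifP.
apply: eq_integral => t _; rewrite !patchE; congr (if _ then _ else _).
by apply/idP/idP; rewrite !inE/= !in_itv/= lerD2r ltrD2r ler_pM2l// ltr_pM2l.
Qed.

Lemma unif_halves (f : RR -> \bar R) : measurable_fun setT f -> (forall t, (0 <= f t)%E) ->
  (\int[unif]_t f t = (2^-1)%:E * (\int[lam]_(t in `[0%R, 1%R[) f ((t / 2)%R : RR) +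
     \int[lam]_(t in `[0%R, 1%R[) f (((1 + t) / 2)%R : RR)))%E.
Proof.
move=> mf f0; rewrite unifE//.
have h0 : (0 : R) < 2^-1 by rewrite invr_gt0.
have := integral_affine_itv 0 0 1 h0 mf f0; have := integral_affine_itv (2^-1) 0 1 h0 mf f0.
rewrite !mulr0 !mulr1 !add0r addr0 invrK => e2 e1.
have -> : (\int[lam]_(t in `[0%R, 1%R[) f ((t / 2)%R : RR) = 2%:E * \int[lam]_(t in `[0%R, (2^-1)%R[) f t)%E.
  by rewrite -e1; apply: eq_integral => t _; rewrite addr0 mulrC.
have -> : (\int[lam]_(t in `[0%R, 1%R[) f (((1 + t) / 2)%R : RR) = 2%:E * \int[lam]_(t in `[(2^-1)%R, 1%R[) f t)%E.
  have e : (2^-1 + 2^-1 : R) = 1 by field.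
  by rewrite e in e2; rewrite -e2; apply: eq_integral => t _; congr f; field.
rewrite -muleDr// ?ge0_adde_def ?inE ?integral_ge0// muleA -EFinM mulVf// mul1e -ge0_integral_setU//=.
- congr (integral _ _ _); rewrite -itv_bndbnd_setU//= bnd_simp//; lra.
- exact: measurable_funTS.
- apply/disj_setPS => t /= []; rewrite !in_itv/=; lra.
Qed.

Definition bit1 (t : R) : R := (2^-1 <= t)%R%:R.

(* digits n t interleaves: its two components are the binary numbers formed by
   the digits of t in odd and in even position, among the first n. *)
Fixpoint digits (n : nat) (t : R) : R * R :=
  if n is m.+1 then let p := digits m (2 * t - bit1 t) in ((bit1 t + p.2) / 2, p.1) else (0, 0).

Lemma bit1_itv t : 0 <= bit1 t <= 1.
Proof. by rewrite /bit1; case: (_ <= t); rewrite ?lexx ler01. Qed.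

Lemma digits_itv n t : (0 <= (digits n t).1 <= 1) && (0 <= (digits n t).2 <= 1).
Proof.
elim: n t => [|n IH] t /=; first by rewrite lexx ler01.
have /andP[-> /andP[h1 h2]] := IH (2 * t - bit1 t); rewrite andbT.
have /andP[b1 b2] := bit1_itv t; apply/andP; split; lra.
Qed.

Lemma digits_le n t : (digits n t).1 <= (digits n.+1 t).1 /\ (digits n t).2 <= (digits n.+1 t).2.
Proof.
elim: n t => [|n IH] t; first by have /andP[/andP[-> _] /andP[-> _]] := digits_itv 1 t.
have [h1 h2] := IH (2 * t - bit1 t).
rewrite [digits n.+2 t]/= [digits n.+1 t]/=; split => //=.
by rewrite ler_pM2r ?invr_gt0// lerD2l.
Qed.

Lemma digits_cvg t : cvgn (fun n => (digits n t).1) /\ cvgn (fun n => (digits n t).2).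
Proof.
split; apply: nondecreasing_is_cvgn.
- by apply/nondecreasing_seqP => n; case: (digits_le n t).
- by exists 1 => _ [n _ <-]; case/andP: (digits_itv n t) => /andP[].
- by apply/nondecreasing_seqP => n; case: (digits_le n t).
- by exists 1 => _ [n _ <-]; case/andP: (digits_itv n t) => _ /andP[].
Qed.

Definition even_bits (t : R) : R := limn (fun n => (digits n t).1).
Definition odd_bits (t : R) : R := limn (fun n => (digits n t).2).

Lemma odd_bitsE t : odd_bits t = even_bits (2 * t - bit1 t).
Proof.
apply: cvg_lim => //; rewrite -(cvg_shiftS (fun n => (digits n t).2)).
exact: (digits_cvg _).1.
Qed.

Lemma even_bitsE t : even_bits t = (bit1 t + odd_bits (2 * t - bit1 t)) / 2.
Proof.
apply: cvg_lim => //; rewrite -(cvg_shiftS (fun n => (digits n t).1)) /=.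
apply: cvgMl; apply: cvgD; first exact: cvg_cst.
exact: (digits_cvg _).2.
Qed.

Lemma even_bits_itv t : 0 <= even_bits t <= 1.
Proof.
have c := (digits_cvg t).1; apply/andP; split.
  by apply: limr_ge => //; apply: nearW => n; case/andP: (digits_itv n t) => /andP[].
by apply: limr_le => //; apply: nearW => n; case/andP: (digits_itv n t) => /andP[].
Qed.

Lemma odd_bits_itv t : 0 <= odd_bits t <= 1.
Proof. by rewrite odd_bitsE even_bits_itv. Qed.

Lemma measurable_bit1 : measurable_fun [set: RR] (bit1 : RR -> R).
Proof.
rewrite /bit1; apply: (measurableT_comp (f := fun b : bool => (b%:R : R))) => //.
exact: measurable_fun_ler.
Qed.

Lemma measurable_digits n : measurable_fun [set: RR] (fun t : RR => (digits n t).1 : R) /\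
  measurable_fun [set: RR] (fun t : RR => (digits n t).2 : R).
Proof.
have mS : measurable_fun [set: RR] (fun t : RR => (2 * t - bit1 t)%R : RR).
  by apply: measurable_funB; [exact: measurable_funM|exact: measurable_bit1].
elim: n => [|n [IH1 IH2]] /=; first by split; exact: measurable_cst.
split; last exact: (measurableT_comp IH1 mS).
apply: measurable_funM => //; apply: measurable_funD; first exact: measurable_bit1.
exact: (measurableT_comp IH2 mS).
Qed.

Lemma measurable_even_bits : measurable_fun [set: RR] (even_bits : RR -> RR).
Proof.
apply: (measurable_fun_cvg (h := fun n t => (digits n t).1)) => [n|t _]; first by case: (measurable_digits n).
exact: (digits_cvg t).1.
Qed.

Lemma measurable_odd_bits : measurable_fun [set: RR] (odd_bits : RR -> RR).
Proof.
apply: (measurable_fun_cvg (h := fun n t => (digits n t).2)) => [n|t _]; first by case: (measurable_digits n).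
exact: (digits_cvg t).2.
Qed.

Let cdf2 (x y : R) : \bar R := unif [set t | even_bits t <= x /\ odd_bits t <= y].

Lemma measurable_cdf2 x y : measurable [set t : RR | even_bits t <= x /\ odd_bits t <= y].
Proof.
rewrite (_ : [set t : RR | _] = (even_bits @^-1` `]-oo, x]) `&` (odd_bits @^-1` `]-oo, y])).
  by apply: measurableI; rewrite -[X in measurable X]setTI; [exact: measurable_even_bits|exact: measurable_odd_bits].
by apply/seteqP; split => t /=; rewrite !in_itv.
Qed.

(** Condition on the first binary digit of t. Deleting this digit exchanges the two interleaved
    numbers, so that one of them becomes the other and the second becomes half of the first, with or
    without an added 1/2. *)
Lemma cdf2E x y : cdf2 x y = ((2^-1)%:E * (cdf2 y (2 * x) + cdf2 y (2 * x - 1)))%E.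
Proof.
have mi x' y' : measurable_fun [set: RR] (fun t : RR => (\1_[set t : RR | even_bits t <= x' /\ odd_bits t <= y'] t)%:E : \bar R).
  by apply/measurable_EFinP; apply: measurable_indic; exact: measurable_cdf2.
have iE x' y' : cdf2 x' y' = (\int[unif]_t (\1_[set t : RR | even_bits t <= x' /\ odd_bits t <= y'] t)%:E)%E.
  by rewrite integral_indic ?setIT//; exact: measurable_cdf2.
have i0 x' y' t : (0 <= (\1_[set t : RR | even_bits t <= x' /\ odd_bits t <= y'] t)%:E :> \bar R)%E by rewrite lee_fin.
rewrite !iE unif_halves//; congr (_ * (_ + _))%E; rewrite unifE//.
- apply: eq_integral => t; rewrite inE/= in_itv/= => /andP[t0 t1].
  have b0 : bit1 (t / 2) = 0 by rewrite /bit1 leNgt (_ : t / 2 < 2^-1)//; lra.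
  congr (_%:E); rewrite !indicE; congr (nat_of_bool _)%:R.
  have e : 2 * (t / 2) - 0 = t by field.
  have e1 : even_bits (t / 2) = odd_bits t / 2 by rewrite even_bitsE b0 e add0r.
  have e2 : odd_bits (t / 2) = even_bits t by rewrite odd_bitsE b0 e.
  by apply/idP/idP; rewrite !inE/= e1 e2 => -[h1 h2]; split => //; lra.
- apply: eq_integral => t; rewrite inE/= in_itv/= => /andP[t0 t1].
  have b1 : bit1 ((1 + t) / 2) = 1 by rewrite /bit1 (_ : 2^-1 <= (1 + t) / 2)//; lra.
  congr (_%:E); rewrite !indicE; congr (nat_of_bool _)%:R.
  have e : 2 * ((1 + t) / 2) - 1 = t by field.
  have e1 : even_bits ((1 + t) / 2) = (1 + odd_bits t) / 2 by rewrite even_bitsE b1 e.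
  have e2 : odd_bits ((1 + t) / 2) = even_bits t by rewrite odd_bitsE b1 e.
  by apply/idP/idP; rewrite !inE/= e1 e2 => -[h1 h2]; split => //; lra.
Qed.

Let clamp (x : R) : R := Num.max 0 (Num.min x 1).

(* Both sides satisfy the functional equation cdf2E, which halves their
   difference at each step. *)
Lemma cdf2_clamp x y : cdf2 x y = (clamp x * clamp y)%:E.
Proof.
pose D (x y : R) : R := `|fine (cdf2 x y) - clamp x * clamp y|.
have fin x' y' : cdf2 x' y' \is a fin_num by exact: fin_num_measure (measurable_cdf2 _ _).
have clampE x' : clamp x' = (clamp (2 * x') + clamp (2 * x' - 1)) / 2.
  rewrite /clamp /Num.max /Num.min; repeat case: ifPn; rewrite -?leNgt; lra.
have DE x' y' : D x' y' <= (D y' (2 * x') + D y' (2 * x' - 1)) / 2.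
  rewrite /D.
  have -> : fine (cdf2 x' y') = 2^-1 * (fine (cdf2 y' (2 * x')) + fine (cdf2 y' (2 * x' - 1))).
    rewrite cdf2E; have := fin y' (2 * x'); have := fin y' (2 * x' - 1).
    by case: (cdf2 y' (2 * x')) => // a; case: (cdf2 y' (2 * x' - 1)).
  rewrite [clamp x']clampE.
  set a := fine _; set b := fine _; set c1 := clamp (2 * x'); set c2 := clamp (_ - 1); set c := clamp y'.
  have -> : 2^-1 * (a + b) - (c1 + c2) / 2 * c = ((a - c * c1) + (b - c * c2)) / 2 by field.
  by rewrite normrM [X in _ * X]ger0_norm// ler_pM2r//; exact: ler_normD.
have c0 x' : x' <= 0 -> clamp x' = 0 by rewrite /clamp /Num.max /Num.min; repeat case: ifPn; rewrite -?leNgt; lra.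
have c1 x' : 1 <= x' -> clamp x' = 1 by rewrite /clamp /Num.max /Num.min; repeat case: ifPn; rewrite -?leNgt; lra.
have DneR (x' y' : R) : y' < 0 -> D x' y' = 0.
  move=> y0; rewrite /D [clamp y']c0 ?(ltW y0)// mulr0 subr0 /cdf2.
  rewrite (_ : [set t | _] = set0) ?measure0 ?normr0//.
  by apply/seteqP; split => t //= [_ h]; have /andP[] := odd_bits_itv t; lra.
have DneL (x' y' : R) : x' < 0 -> D x' y' = 0.
  move=> y0; rewrite /D [clamp x']c0 ?(ltW y0)// mul0r subr0 /cdf2.
  rewrite (_ : [set t | _] = set0) ?measure0 ?normr0//.
  by apply/seteqP; split => t //= [h _]; have /andP[] := even_bits_itv t; lra.
have Dbig (x' y' : R) : 1 <= y' -> D x' y' = D x' 1.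
  move=> y1; rewrite /D [clamp y']c1// [clamp 1]c1//; suff -> : cdf2 x' y' = cdf2 x' 1 by [].
  congr (unif _); apply/seteqP; split => t /= [h _]; split => //; have /andP[] := odd_bits_itv t; lra.
have Dbig' (x' y' : R) : 1 <= x' -> D x' y' = D 1 y'.
  move=> y1; rewrite /D [clamp x']c1// [clamp 1]c1//; suff -> : cdf2 x' y' = cdf2 1 y' by [].
  congr (unif _); apply/seteqP; split => t /= [_ h]; split => //; have /andP[] := even_bits_itv t; lra.
have D11 : D 1 1 = 0.
  rewrite /D !c1// mulr1 /cdf2 (_ : [set t | _] = setT) ?probability_setT ?subrr ?normr0//.
  by apply/seteqP; split => t //= _; have /andP[_ ->] := even_bits_itv t; have /andP[_ ->] := odd_bits_itv t.
have D1 x' y' : D x' y' <= 1.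
  rewrite /D ler_norml.
  have : 0 <= fine (cdf2 x' y') <= 1.
    by rewrite fine_ge0//= -lee_fin fineK//; exact: probability_le1 (measurable_cdf2 _ _).
  have cc z : 0 <= clamp z <= 1 by rewrite /clamp /Num.max /Num.min; repeat case: ifPn; rewrite -?leNgt; lra.
  have : 0 <= clamp x' * clamp y' <= 1.
    have /andP[a0 a1] := cc x'; have /andP[b0 b1] := cc y'.
    by rewrite mulr_ge0//= -[leRHS]mulr1 ler_pM.
  lra.
(* In the inequality for [D], one of the two terms vanishes when x is below 1/2, and otherwise one
   of them has an argument equal to 1. Such marginal terms are therefore shown to vanish before the
   general case. *)
have marg n z : D z 1 <= 2^-1 ^+ n.
  elim: n z => [|n IH] z; first by rewrite expr0.
  have h0 : (0 : R) <= 2^-1 ^+ n.+1 by rewrite exprn_ge0// invr_ge0.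
  have [z1|z1] := leP 1 z; first by rewrite Dbig'// D11.
  have D1z w : D 1 w <= D w 1.
    by apply: le_trans (DE 1 w) _; rewrite mulr1 (_ : 2 - 1 = 1 :> R); [rewrite (Dbig w 2); lra|ring].
  apply: le_trans (DE z 1) _; rewrite exprS mulrC ler_pM2l ?invr_gt0//.
  have [z2|z2] := ltP z 2^-1.
    rewrite [D 1 (2 * z - 1)]DneR ?addr0; last lra.
    by apply: le_trans (IH (2 * z)); exact: D1z.
  rewrite (Dbig 1 (2 * z)) ?D11 ?add0r; last lra.
  by apply: le_trans (IH (2 * z - 1)); exact: D1z.
have D0 x' y' : 0 <= D x' y' by exact: normr_ge0.
have small (a : R) : 0 <= a -> (forall n, a <= 2^-1 ^+ n) -> a = 0.
  move=> a0 an; apply/eqP; rewrite eq_le a0 andbT.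
  have c : (fun n : nat => 2^-1 ^+ n : R) @ \oo --> 0 by apply: cvg_expr; rewrite ger0_norm// invf_lt1//; lra.
  by rewrite -(cvg_lim _ c)//; apply: limr_ge; [apply/cvg_ex; exists 0|apply: nearW].
have marg0 z : D z 1 = 0 by apply: small => // n; exact: marg.
have all n x' y' : D x' y' <= 2^-1 ^+ n.
  elim: n x' y' => [|n IH] x' y'; first by rewrite expr0.
  apply: le_trans (DE x' y') _; rewrite exprS mulrC ler_pM2l ?invr_gt0//.
  have [z2|z2] := ltP x' 2^-1.
    by rewrite [D y' (2 * x' - 1)]DneR ?addr0; [exact: IH|lra].
  by rewrite (Dbig y' (2 * x')) ?marg0 ?add0r; [exact: IH|lra].
have : D x y = 0 by apply: small => // n; exact: all.
by move=> /eqP; rewrite /D normr_eq0 subr_eq0 => /eqP <-; rewrite fineK.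
Qed.

Lemma finite_measure_unique (m1 m2 : {measure set RR -> \bar R}) :
  (m1 setT < +oo)%E -> (forall x : R, m1 `]-oo, x]%classic = m2 `]-oo, x]%classic) ->
  forall A, measurable A -> m1 A = m2 A.
Proof.
move=> m1T m12.
have m1fin (A : set RR) : measurable A -> (m1 A < +oo)%E.
  by move=> mA; apply: le_lt_trans m1T; apply: le_measure; rewrite ?inE.
apply: (@measure_unique _ R RR (@ocitv R) (fun k => `](- k%:R)%R, k%:R]%classic) erefl (@ocitvI R)).
- by move=> n; exists (- n%:R, n%:R).
- apply/seteqP; split => // x _; exists (Num.truncn `|x|).+1 => //=.
  by have := truncnS_gt `|x|; rewrite in_itv/= real_ltr_norml ?num_real// => /andP[-> /ltW].
- move=> _ [[a b] _ <-] /=; have [ab|ba] := leP a b; last first.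
    by rewrite set_itv_ge ?measure0// bnd_simp -leNgt ltW.
  have -> : `]a, b]%classic = `]-oo, b]%classic `\` `]-oo, a]%classic :> set R.
    apply/seteqP; split => x /=; rewrite !in_itv/=.
      by move=> /andP[h1 ->]; split => //; apply/negP; rewrite -ltNge.
    by move=> [h1 /negP]; rewrite -ltNge h1 => ->.
  have sub : (`]-oo, a]%classic : set R) `<=` `]-oo, b]%classic.
    by move=> x /=; rewrite !in_itv/= => /le_trans; apply.
  rewrite measureD//; last exact: m1fin.
  have m2fin x : (m2 `]-oo, x]%classic < +oo)%E by rewrite -m12; exact: m1fin.
  rewrite [RHS]measureD//; last exact: m2fin.
  rewrite (setIidr sub); congr (_ - _)%E; exact: m12.
- by move=> n; exact: m1fin.
Qed.

Lemma unif_half_line (x : R) : unif `]-oo, x]%classic = (clamp x)%:E.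
Proof.
have mx : measurable (`]-oo, x]%classic : set RR) by [].
rewrite -[X in unif X]setIT -integral_indic// unifE//; last by apply/measurable_EFinP; exact: measurable_indic.
rewrite integral_indic// /clamp.
have [x0|x0] := ltP x 0.
  rewrite (_ : _ `&` _ = set0) ?measure0.
    by congr EFin; rewrite /Num.max /Num.min; repeat case: ifPn; rewrite -?leNgt; lra.
  by apply/seteqP; split => t //=; rewrite !in_itv/=; lra.
have [x1|x1] := ltP x 1.
  rewrite (_ : _ `&` _ = `[0, x]%classic).
    rewrite -[LHS]/(lebesgue_measure `[0, x]%classic) lebesgue_measure_itv/= lte_fin; case: ifP => h; congr EFin;
     move: h; rewrite /Num.max /Num.min; repeat case: ifPn; rewrite -?leNgt; lra.
  by apply/seteqP; split => t /=; rewrite !in_itv/=; lra.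
rewrite (_ : _ `&` _ = `[0, 1[%classic).
  rewrite -[LHS]/(lebesgue_measure `[0, 1[%classic) lebesgue_measure_itv/= lte_fin ltr01; congr EFin.
  by rewrite /Num.max /Num.min; repeat case: ifPn; rewrite -?leNgt; lra.
by apply/seteqP; split => t /=; rewrite !in_itv/=; lra.
Qed.

(** For a half-line in place of [B], both sides are finite measures in [A] that agree on half-lines.
    With [A] then arbitrary and fixed, the same argument applies to [B]. *)
Lemma split_rectangle (A B : set RR) : measurable A -> measurable B ->
  unif [set t | A (even_bits t) /\ B (odd_bits t)] = (unif A * unif B)%E.
Proof.
move=> mA mB.
have ms1 (C : set RR) : measurable C -> measurable (even_bits @^-1` C : set RR).
  by move=> mC; rewrite -[X in measurable X]setTI; exact: measurable_even_bits.
have ms2 (C : set RR) : measurable C -> measurable (odd_bits @^-1` C : set RR).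
  by move=> mC; rewrite -[X in measurable X]setTI; exact: measurable_odd_bits.
have clamp_ge0 y : 0 <= clamp y by rewrite /clamp le_max lexx.
have mult (C : set RR) (y : R) : measurable C -> unif (even_bits @^-1` C `&` odd_bits @^-1` `]-oo, y]%classic) = ((clamp y)%:E * unif C)%E.
  move=> mC; have my : measurable (`]-oo, y]%classic : set RR) by [].
  pose m1 := measure_function_pushforward__canonical__measure_function_Measure (mrestr unif (ms2 _ my)) measurable_even_bits.
  apply: (@finite_measure_unique m1 (mscale (NngNum (clamp_ge0 y)) unif)) => // [|x].
    by apply: le_lt_trans (ltry 1%R); exact: probability_le1 (measurableI _ _ (ms1 _ measurableT) (ms2 _ my)).
  transitivity (unif [set t | even_bits t <= x /\ odd_bits t <= y]).
    by congr (unif _); apply/seteqP; split => t /=; rewrite !in_itv.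
  rewrite -/(cdf2 x y) cdf2_clamp mulrC EFinM -(unif_half_line x)//.
pose m1 := measure_function_pushforward__canonical__measure_function_Measure (mrestr unif (ms1 _ mA)) measurable_odd_bits.
have fA : unif A \is a fin_num by exact: fin_num_measure.
have gA : 0 <= fine (unif A) by rewrite fine_ge0.
transitivity (m1 B); first by congr (unif _); apply/seteqP; split => t /= [].
transitivity (mscale (NngNum gA) unif B); last by rewrite /mscale/= fineK.
apply: finite_measure_unique => // [|y].
  by apply: le_lt_trans (ltry 1%R); exact: probability_le1 (measurableI _ _ (ms2 _ measurableT) (ms1 _ mA)).
rewrite [RHS](_ : _ = (unif A * unif `]-oo, y]%classic)%E); last by rewrite -[in RHS](fineK fA).
by rewrite unif_half_line muleC -mult//; congr (unif _); rewrite setIC.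
Qed.

Lemma ge0_integral_split (F : RR * RR -> \bar R) : measurable_fun setT F ->
  (forall p, (0 <= F p)%E) ->
  (\int[unif]_t F ((even_bits t : RR), (odd_bits t : RR)) = \int[unif]_s \int[unif]_t F (s, t))%E.
Proof.
move=> mF F0.
have mh : measurable_fun [set: RR] (fun t : RR => ((even_bits t : RR), (odd_bits t : RR))).
  exact: measurable_fun_pair measurable_even_bits measurable_odd_bits.
pose m' := measure_function_pushforward__canonical__measure_function_Measure unif mh.
rewrite -[LHS]/(\int[unif]_t (F \o (fun t : RR => ((even_bits t : RR), (odd_bits t : RR)))) t)%E.
rewrite -[X in integral _ X _](preimage_setT (fun t : RR => ((even_bits t : RR), (odd_bits t : RR)))).
rewrite -(ge0_integral_pushforward mh)//.
transitivity (\int[unif \x unif]_p F p)%E.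
  apply: (@eq_measure_integral _ _ _ _ _ m') => C mC _.
  apply/esym; apply: product_measure_unique => // A B mA mB.
  by rewrite -split_rectangle.
by rewrite fubini_tonelli1.
Qed.

End uniform.

Section iid.
Context (R : realType).
Notation RR := (measurableTypeR R).
Local Open Scope ereal_scope.

(** At each stage one half of the remaining digits becomes the next variable and the other half is
    split further. This plays the part of an infinite product of uniform measures. *)
Fixpoint iid (n : nat) (t : RR) : RR := if n is m.+1 then iid m (odd_bits t) else even_bits t.

Lemma iid_itv n t : (0 <= iid n t <= 1)%R.
Proof. by elim: n t => [|n IH] t /=; [exact: even_bits_itv|exact: IH]. Qed.

Lemma measurable_iid n : measurable_fun setT (iid n).
Proof.
elim: n => [|n IH]; first exact: measurable_even_bits.
exact: measurableT_comp IH (@measurable_odd_bits R).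
Qed.

Let seqs := fieldT nat RR.

Definition iid_seq (t : RR) : nat -> RR := fun n => iid n t.

Definition scons (s : RR) (f : nat -> RR) : nat -> RR := fun n => if n is m.+1 then f m else s.

Lemma measurable_scons : measurable_fun setT (fun p : RR * seqs => scons p.1 p.2 : seqs).
Proof.
apply: measurable_to_field => -[|n] /=; first exact: measurable_fst.
exact: measurableT_comp (measurable_coord n) measurable_snd.
Qed.

Lemma iid_seqE t : iid_seq t = scons (even_bits t) (iid_seq (odd_bits t)).
Proof. by apply/funext => -[]. Qed.

Lemma ge0_integral_iid_cons (F : (nat -> RR) -> \bar R) : nn_measurable F ->
  \int[unif R]_t F (iid_seq t) = \int[unif R]_s \int[unif R]_t F (scons s (iid_seq t)).
Proof.
move=> [mF F0]; under eq_integral do rewrite iid_seqE.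
rewrite -(@ge0_integral_split R (fun p => F (scons p.1 (iid_seq p.2))))//.
have m1 : measurable_fun [set: RR * RR] (fun p : RR * RR => scons p.1 (iid_seq p.2) : seqs).
  apply: measurable_to_field => -[|n] /=; first exact: measurable_fst.
  exact: measurableT_comp (measurable_iid n) measurable_snd.
exact: (measurableT_comp mF m1).
Qed.

(** This is the form in which independence is used: replacing one variable by a fresh uniform one
    does not change the law. *)
Lemma resample (i : nat) (F : (nat -> RR) -> \bar R) : nn_measurable F ->
  \int[unif R]_t F (iid_seq t) = \int[unif R]_s \int[unif R]_t F (upd (iid_seq t) i s).
Proof.
have nnc (F' : (nat -> RR) -> \bar R) s : nn_measurable F' -> nn_measurable (fun f => F' (scons s f)).
  move=> [mF F0]; split => // ; apply: (measurableT_comp mF).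
  exact: (measurableT_comp measurable_scons (measurable_pair1 s)).
have nnu (F' : (nat -> RR) -> \bar R) j s : nn_measurable F' -> nn_measurable (fun f : nat -> RR => F' (upd f j s)).
  move=> [mF F0]; split => //.
  have m1 : measurable_fun [set: seqs] (fun f : seqs => upd f j s : seqs).
    apply: measurable_to_field => n; rewrite /upd; case: eqP => _; [exact: measurable_cst|exact: measurable_coord].
  exact: (measurableT_comp mF m1).
elim: i F => [|i IH] F mF; have [mF0 F0] := mF.
  rewrite (ge0_integral_iid_cons mF); apply: eq_integral => s _.
  rewrite [RHS](ge0_integral_iid_cons (nnu _ 0%N s mF)).
  have -> : (fun r : RR => \int[unif R]_t F (upd (scons r (iid_seq t)) 0%N s)) =
      cst (\int[unif R]_t F (scons s (iid_seq t))).
    by apply/funext => r; apply: eq_integral => t _; congr F; apply/funext => -[].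
  rewrite [RHS]integral_cst// -[LHS]mule1; congr (_ * _); apply/esym.
  exact: probability_setT.
rewrite (ge0_integral_iid_cons mF).
under eq_integral do rewrite (IH _ (nnc _ _ mF)).
pose G (p : RR * RR) := \int[unif R]_t F (scons p.1 (upd (iid_seq t) i p.2)).
have mG3 : measurable_fun setT (fun p : (RR * RR) * RR => F (scons p.1.1 (upd (iid_seq p.2) i p.1.2))).
  have m1 : measurable_fun setT (fun p : (RR * RR) * RR => scons p.1.1 (upd (iid_seq p.2) i p.1.2) : seqs).
    apply: measurable_to_field => -[|n] /=.
      exact: measurableT_comp measurable_fst measurable_fst.
    rewrite /upd; case: eqP => _; first exact: measurableT_comp measurable_snd measurable_fst.
    exact: measurableT_comp (measurable_iid n) measurable_snd.
  exact: (measurableT_comp mF0 m1).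
have mG : measurable_fun setT G.
  apply: (measurable_fun_fubini_tonelli_F (m2 := unif R) (fun p : (RR * RR) * RR => F (scons p.1.1 (upd (iid_seq p.2) i p.1.2)))) => //.
have G0 p : 0 <= G p by exact: integral_ge0.
have /= -> := @fubini_tonelli _ _ _ _ R (unif R) (unif R) G mG G0.
apply: eq_integral => s _.
rewrite [RHS](ge0_integral_iid_cons (nnu _ i.+1 s mF)); apply: eq_integral => r _.
by apply: eq_integral => t _; congr F; apply/funext => -[|n].
Qed.

End iid.

Section noise.
Context (R : realType) (I : countType).
Notation RR := (measurableTypeR R).
Local Open Scope ereal_scope.

(* Independent uniform variables indexed by I. *)
Definition noise (t : RR) : I -> RR := fun x => iid (choice.pickle x) t.

Lemma noise_itv t x : (0 <= noise t x <= 1)%R.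
Proof. exact: iid_itv. Qed.

Lemma resample_noise x (G : (I -> RR) -> \bar R) : nn_measurable G ->
  \int[unif R]_t G (noise t) = \int[unif R]_s \int[unif R]_t G (upd (noise t) x s).
Proof.
move=> [mG G0]; pose F (f : nat -> RR) := G (fun y => f (choice.pickle y)).
have nF : nn_measurable F.
  have m1 : measurable_fun [set: fieldT nat RR] (fun f : fieldT nat RR => (fun y => f (choice.pickle y)) : fieldT I RR).
    by apply: measurable_to_field => y; exact: measurable_coord.
  by split => [|f]; [exact: (measurableT_comp mG m1)|exact: G0].
rewrite [LHS](resample (choice.pickle x) nF); apply: eq_integral => s _.
apply: eq_integral => t _; congr G; apply/funext => y; rewrite /upd.
by rewrite (inj_eq (pcan_inj choice.pickleK)).
Qed.

Lemma noise_iter_int (s : seq I) (G : (I -> RR) -> \bar R) : nn_measurable G ->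
  \int[unif R]_t G (noise t) = \int[unif R]_t iter_int (unif R) s G (noise t).
Proof.
move=> nG; elim: s => [//|x s IH]; have nI := iter_int_nn (unif R) s nG.
rewrite IH (resample_noise x nI) /=.
apply: (fubini_tonelli (m1 := unif R) (m2 := unif R) (fun p : RR * RR => iter_int (unif R) s G (upd (noise p.2) x p.1))).
  have m1 : measurable_fun [set: RR * RR] (fun p : RR * RR => upd (noise p.2) x p.1 : fieldT I RR).
    apply: measurable_to_field => y; rewrite /upd; case: eqP => _; first exact: measurable_fst.
    exact: measurableT_comp (measurable_iid _) measurable_snd.
  exact: (measurableT_comp nI.1 m1).
by move=> p; exact: nI.2.
Qed.

(** Once every site that [G] reads has been resampled, nothing of the original noise is left, so any
    starting configuration [f0] gives the same value. The right-hand side does not mention the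
    enumeration of the sites. *)
Lemma noise_law (s : seq I) (G : (I -> RR) -> \bar R) f0 : nn_measurable G ->
  (forall f g, {in s, f =1 g} -> G f = G g) ->
  \int[unif R]_t G (noise t) = iter_int (unif R) s G f0.
Proof.
move=> nG Gs; rewrite (noise_iter_int s nG).
have E f : iter_int (unif R) s G f = iter_int (unif R) s G f0.
  by apply: (@eq_iter_int _ _ _ _ _ s G f f0 (mem s)) => [g g' gg'|y ys /negP//]; exact: Gs.
under eq_integral do rewrite E.
rewrite [LHS]integral_cst// -[RHS]mule1; congr (_ * _); exact: probability_setT.
Qed.

End noise.

(** * Laws of random height functions *)

Section gradient_laws.
Context (R : realType) (k : height_kind) (d : nat).
Notation E := (heights R k).
Notation I := (site d).
Notation cfg := (config E d).
Notation full := (gradT E [set: I]).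

Lemma measurable_gradT_sub (D D' : set I) (A : set cfg) : D `<=` D' ->
  @measurable _ (gradT E D) A -> @measurable _ (gradT E D') A.
Proof.
move=> DD' mA; have := @measurable_gradT_incl R k d D D' DD' measurableT A mA.
by rewrite setTI.
Qed.

(** Events of finite volumes are stable under intersection, since two of them live in the union of
    their volumes, and they generate all gradient events. *)
Lemma gradient_measure_unique (m1 m2 : {measure set full -> \bar R}) :
  (m1 setT < +oo)%E ->
  (forall (D : {fset I}) (A : set cfg), @measurable _ (gradT E [set` D]) A -> m1 A = m2 A) ->
  forall A, measurable A -> m1 A = m2 A.
Proof.
move=> m1T H.
pose G : set (set full) := [set A : set full | exists D : {fset I}, @measurable _ (gradT E [set` D]) A].
have GT : G setT by exists fset0; exact: measurableT.
apply: (@measure_unique _ R full G (fun=> setT)) => //.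
- apply/seteqP; split.
    apply: smallest_sub; first exact: smallest_sigma_algebra.
    move=> _ [x [y [B [_ _ mB ->]]]]; apply: sub_sigma_algebra; exists [fset x; y]%fset.
    by apply: sub_sigma_algebra; exists x, y, B; rewrite /= !inE !eqxx orbT.
  apply: smallest_sub; first exact: sigma_algebra_measurable.
  by move=> A [D mA]; apply: measurable_gradT_sub mA.
- move=> A B [D mA] [M mB]; exists (D `|` M)%fset; apply: measurableI.
  + by apply: measurable_gradT_sub mA => x /= xD; rewrite inE xD.
  + by apply: measurable_gradT_sub mB => x /= xD; rewrite inE xD orbT.
- by apply/seteqP; split => // x _; exists 0%N.
- by move=> A [D mA]; exact: H mA.
Qed.

Context dT (T : measurableType dT) (P : probability T R).
Variable f : T -> cfg.
Hypothesis mf : forall x, measurable_fun [set: T] (fun t => f t x).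

Lemma measurable_to_gradT (D : set I) : measurable_fun [set: T] (f : T -> gradT E D).
Proof.
have mf' : measurable_fun [set: T] (f : T -> fieldT I E) by exact: measurable_to_field.
move=> _ B mB; apply: mf' => //.
by have := @measurable_field_grad R k d D measurableT B mB; rewrite setTI.
Qed.

Definition gradient_law : gradient_measure R k d :=
  distribution P (mfun_Sub (mem_set (@measurable_to_gradT setT))).

Lemma gradient_lawE A : gradient_law A = P (f @^-1` A).
Proof. by []. Qed.

Lemma gradient_law_shift_invariant (L : set I) :
  (forall l (D : {fset I}) (A : set cfg), L l -> @measurable _ (gradT E [set` D]) A ->
    P (f @^-1` (Defs.shift l @^-1` A)) = P (f @^-1` A)) ->
  shift_invariant L gradient_law.
Proof.
move=> H l B Ll mB.
have ml : measurable_fun [set: full] (Defs.shift l : full -> full) by exact: measurable_shift.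
pose m1 := measure_function_pushforward__canonical__measure_function_Measure gradient_law ml.
apply: (@gradient_measure_unique m1 gradient_law) => //.
  exact: le_lt_trans (probability_le1 gradient_law measurableT) (ltry _).
by move=> D A mA; rewrite /m1/= /pushforward !gradient_lawE; exact: H mA.
Qed.

End gradient_laws.

Section noisy_law.
Context (R : realType) (d : nat).
Notation E := (heights R RealHeights).
Notation RR := (measurableTypeR R).
Notation I := (site d).
Notation cfg := (config E d).
Notation lam := (@lebesgue_measure R).
Variables (g : I -> R) (h : R).
Hypothesis h0 : 0 < h.

Definition affine (f : I -> RR) : I -> RR := fun x => g x + h * f x.

Lemma measurable_affine : measurable_fun setT (affine : fieldT I RR -> fieldT I RR).
Proof.
apply: measurable_to_field => x; apply: measurable_funD => //.
by apply: measurable_funM => //; exact: measurable_coord.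
Qed.

Lemma nn_measurable_affine (F : (I -> RR) -> \bar R) : nn_measurable F -> nn_measurable (F \o affine).
Proof.
by move=> [mF F0]; split => [|f]; [exact: (measurableT_comp mF measurable_affine)|exact: F0].
Qed.

Lemma affine_upd f x t : affine (upd f x t) = upd (affine f) x (h * t + g x).
Proof. by apply/funext => y; rewrite /affine /upd; case: eqP => [->|//]; rewrite addrC. Qed.

Lemma unif_le (F : RR -> \bar R) : measurable_fun setT F -> (forall t, (0 <= F t)%E) ->
  (\int[unif R]_t F t <= \int[lam]_t F t)%E.
Proof.
move=> mF F0; rewrite unifE//; apply: ge0_subset_integral => //; exact: measurable_funTS.
Qed.

(** At each site the substitution by h costs a factor [h^-1], after which the uniform law is bounded
    by Lebesgue measure on the whole line. *)
Lemma iter_int_affine (s : seq I) (F : (I -> RR) -> \bar R) f : nn_measurable F ->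
  (iter_int (unif R) s (F \o affine) f <= (h^-1 ^+ size s)%:E * iter_int lam s F (affine f))%E.
Proof.
move=> nF; elim: s f => [|x s IH] f /=; first by rewrite expr0 mul1e.
have [mI I0] := iter_int_nn lam s nF.
have mu := measurable_iter_int_upd lam s x (affine f) nF.
have hs : 0 <= h^-1 ^+ size s by rewrite exprn_ge0// invr_ge0 ltW.
have mh : measurable_fun [set: RR] (fun t : RR => (h * t + g x)%R : RR).
  by apply: measurable_funD => //; apply: measurable_funM.
have muh : measurable_fun [set: RR] (fun t : RR => iter_int lam s F (upd (affine f) x ((h * t + g x)%R : RR))).
  exact: (measurableT_comp mu mh).
apply: (@le_trans _ _ (\int[unif R]_t ((h^-1 ^+ size s)%:E * iter_int lam s F (upd (affine f) x ((h * t + g x)%R : RR))))%E).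
  apply: ge0_le_integral => //.
  - by move=> t _; apply: (iter_int_nn _ _ (nn_measurable_affine nF)).2.
  - exact: (measurable_iter_int_upd _ _ _ _ (nn_measurable_affine nF)).
  - exact: measurable_funeM.
  - by move=> t _; rewrite -affine_upd.
rewrite ge0_integralZl//.
rewrite exprSr EFinM -muleA; apply: lee_wpmul2l; first by rewrite lee_fin.
apply: le_trans (unif_le muh _) _ => //.
by rewrite (ge0_integral_affine (g x) h0 mu)// => t; exact: I0.
Qed.

Lemma noisy_law_le (D : {fset I}) (A : set cfg) : D != fset0 ->
  @measurable _ (gradT E [set` D]) A ->
  (unif R [set t | A (affine (noise t))] <= (h^-1 ^+ (#|` D|).-1)%:E * gradient_reference E D A)%E.
Proof.
move=> D0 mA.
have gF : grad_functional [set` D] (fun phi : cfg => (\1_A phi)%:E : \bar R).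
  apply: grad_functional_gradT => [|phi]; last by rewrite lee_fin.
  by apply/measurable_EFinP; exact: measurable_indic.
have [nF FD] := gF.
have -> : gradient_reference E D A = gint D (fun phi : cfg => (\1_A phi)%:E).
  rewrite -gradient_referenceE//; first by rewrite integral_indic// setIT.
  by apply/measurable_EFinP; exact: measurable_indic.
have -> : unif R [set t | A (affine (noise t))] = (\int[unif R]_t (((fun phi : cfg => (\1_A phi)%:E) \o affine) (noise t)))%E.
  have mB : measurable [set t : RR | A (affine (noise t))].
    have mfx x : measurable_fun [set: RR] (fun t : RR => (affine (noise t) x : E)).
      by apply: measurable_funD => //; apply: measurable_funM => //; exact: measurable_iid.
    by have := @measurable_to_gradT R RealHeights d _ _ _ mfx [set` D] measurableT A mA; rewrite setTI.
  rewrite -[X in unif R X]setIT -(integral_indic _ measurableT mB); apply: eq_integral => t _ /=.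
  by rewrite !indicE; congr (_%:R%:E); congr nat_of_bool; apply/idP/idP; rewrite !inE.
have Gs (f f' : I -> RR) : {in (D : seq I), f =1 f'} ->
    ((fun phi : cfg => (\1_A phi)%:E : \bar R) \o affine) f = ((fun phi : cfg => (\1_A phi)%:E) \o affine) f'.
  move=> ff' /=; apply: FD => x y /= xD yD; rewrite /affine ff' ?ff'//.
rewrite (noise_law (s := D) (fun=> 0) (nn_measurable_affine nF) Gs).
have uD : uniq (D : seq I) by exact: fset_uniq.
have gF2 : grad_functional [set` (D : seq I)] (fun phi : cfg => (\1_A phi)%:E : \bar R) by exact: gF.
have D0' : (0 < size (D : seq I))%N by rewrite -[size _]/(#|` D|) cardfs_gt0.
move: gF2 uD D0'; rewrite /= -[#|` D|]/(size (D : seq I)).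
case: (D : seq I) => [//|x s] gF' _ _; rewrite [iter_int _ _ _ _]/= [(size _).-1]/=.
have hs : (0 <= (h^-1 ^+ size s)%:E :> \bar R)%E by rewrite lee_fin exprn_ge0// invr_ge0 ltW.
(* The base point contributes no factor [h^-1]: its height is averaged against a probability
   measure, and the bound does not depend on it. This explains the exponent, one less than the
   number of sites. *)
apply: (@le_trans _ _ (\int[unif R]_t ((h^-1 ^+ size s)%:E * gint (x :: s) (fun phi : cfg => (\1_A phi)%:E)))%E).
  apply: ge0_le_integral => //.
  - by move=> t _; apply: (iter_int_nn _ _ (nn_measurable_affine nF)).2.
  - exact: (measurable_iter_int_upd _ _ _ _ (nn_measurable_affine nF)).
  - by move=> t _; rewrite (@gint_cons R RealHeights d x s _ (affine (@upd _ _ RR (fun=> (0 : R)%R : RR) x t)) gF'); exact: iter_int_affine.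
rewrite [leLHS]integral_cst// -[leRHS]mule1; apply: lee_wpmul2l; last exact: probability_le1.
by rewrite mule_ge0//; exact: gint_ge0.
Qed.

End noisy_law.

Section gradient_law_integrals.
Context (R : realType) (k : height_kind) (d : nat).
Notation E := (heights R k).
Notation I := (site d).
Notation cfg := (config E d).
Notation full := (gradT E [set: I]).
Context dT (T : measurableType dT) (P : probability T R).
Variable f : T -> cfg.
Hypothesis mf : forall x, measurable_fun [set: T] (fun t => f t x).

Lemma measurable_increment x y :
  measurable_fun [set: full] (fun phi : full => increment phi x y).
Proof.
by apply: (measurableT_comp (@measurable_hs_incl R k)); exact: measurable_hs_sub_gradT.
Qed.

Lemma gradient_law_ae (B : set full) : measurable B -> (forall t, B (f t)) ->
  {ae gradient_law P mf, forall phi, B phi}.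
Proof.
move=> mB Bf; exists (~` B); split => //; first exact: measurableC.
have -> : gradient_law P mf (~` B) = P set0; last exact: measure0.
by congr (P _); apply/seteqP; split => t //= /(_ (Bf t)).
Qed.

Lemma gradient_law_ae_lipschitz (q : I -> I -> R) :
  (forall t x y, increment (f t) x y <= q x y) -> ae_lipschitz q (gradient_law P mf).
Proof.
move=> fq; apply: (@ae_countable _ _ _ _ I (fun x (phi : full) => forall y, increment phi x y <= q x y)) => x.
apply: (@ae_countable _ _ _ _ I (fun y (phi : full) => increment phi x y <= q x y)) => y.
apply: (@gradient_law_ae [set phi : full | increment phi x y <= q x y]) => [|t]; last exact: fq.
rewrite -[X in measurable X]setTI (_ : [set phi : full | _] = (fun phi : full => increment phi x y) @^-1` `]-oo, (q x y)]%classic); last first.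
  by apply/seteqP; split => phi /=; rewrite in_itv.
exact: measurable_increment.
Qed.

Lemma gradient_law_has_slope (L : set I) (u : 'rV[R]_d) (K : I -> I -> R) :
  (forall t x y, `|increment (f t) x y| <= K x y) ->
  (forall l, L l -> (\int[P]_t (increment (f t) 0 l)%:E = (pairing u l)%:E)%E) ->
  has_slope L (gradient_law P mf) u.
Proof.
move=> fK slope.
have mg := @measurable_to_gradT R k d _ _ _ mf setT.
have mi x y : measurable_fun [set: T] (fun t => increment (f t) x y).
  exact: (measurableT_comp (measurable_increment x y) mg).
have intP x y : P.-integrable setT (fun t => (increment (f t) x y)%:E).
  apply: measurable_bounded_integrable => //.
    exact: le_lt_trans (probability_le1 P measurableT) (ltry _).
  exists (K x y); split; first exact: num_real.
  by move=> r Kr t _; apply: ltW; exact: le_lt_trans Kr.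
have mI x y : measurable_fun [set: full] (fun phi : full => (increment phi x y)%:E).
  by apply/measurable_EFinP; exact: measurable_increment.
have intl x y : (gradient_law P mf).-integrable setT (fun phi : full => (increment phi x y)%:E).
  exact: (@integrable_pushforward _ _ _ _ R _ mg P setT _ (mI x y) (intP x y) measurableT).
split => // l Ll; rewrite -(slope l Ll).
exact: (@integral_pushforward _ _ _ _ R _ mg P setT _ (mI 0 l) (intP 0 l) measurableT).
Qed.

End gradient_law_integrals.

Section noise_field.
Context (R : realType) (d : nat).
Notation E := (heights R RealHeights).
Notation RR := (measurableTypeR R).
Notation I := (site d).
Notation cfg := (config E d).
Variables (L : set I) (q : I -> I -> R).
Variables (g : I -> R) (h eta : R) (u : 'rV[R]_d).
Hypotheses (L0 : L 0) (h0 : 0 < h) (h_eta : 2 * h <= eta).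
Hypothesis gu : quasi_periodic L u g.

Definition noise_config (t : RR) : cfg := affine g h (noise t).

Lemma measurable_noise_config x : measurable_fun [set: RR] (fun t => noise_config t x).
Proof.
apply: measurable_funD => //; apply: measurable_funM => //; exact: measurable_iid.
Qed.

Definition noise_measure : gradient_measure R RealHeights d :=
  gradient_law (unif R) measurable_noise_config.

Lemma noise_config_increment t x y : increment (noise_config t) x y =
  g y - g x + h * (noise t y - noise t x).
Proof. by rewrite /increment /= /noise_config /affine; ring. Qed.

(** The noise changes an increment by at most h, so that a gap of size h survives from the gap eta,
    which is at least 2 * h. *)
Lemma noise_config_edge (A : set {fset I}) t x y : edge_lipschitz A (fun x y => q x y - eta) g ->
  A [fset x; y]%fset -> increment (noise_config t) x y <= q x y - h.
Proof.
move=> gP xy; have := gP _ _ xy; rewrite noise_config_increment.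
have /andP[h1 h2] := noise_itv t x; have /andP[h3 h4] := noise_itv t y.
have : h * (noise t y - noise t x) <= h * 1 by rewrite ler_pM2l//; lra.
rewrite mulr1; move: (h * _) => w wh /= gh; apply: le_trans (lerD gh wh) _; rewrite -addrA lerD2l; have := h_eta; rewrite mulr_natl mulr2n; lra.
Qed.

(** What matters is that the mean does not depend on x, so that noise adds nothing to the slope. The
    absolute value makes the integrand nonnegative at all configurations, as [resample_noise]
    requires. *)
Lemma noise_integral (x : I) : (\int[unif R]_t (noise t x)%:E = \int[unif R]_t (`|t|)%:E)%E.
Proof.
pose G (f : I -> RR) : \bar R := (`|f x|%R)%:E.
have nG : nn_measurable G.
  split => [|f]; last by rewrite lee_fin.
  by apply/measurable_EFinP; apply: measurableT_comp => //; exact: measurable_coord.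
transitivity (\int[unif R]_t G (noise t))%E.
  by apply: eq_integral => t _; rewrite /G ger0_norm//; case/andP: (noise_itv t x).
rewrite (resample_noise x nG); apply: eq_integral => s _.
have -> : (fun t => G (upd (noise t) x s)) = cst (`|s|%:E).
  by apply/funext => t; rewrite /G /upd eqxx.
rewrite integral_cst// -[RHS]mule1; congr (_ * _)%E; exact: probability_setT.
Qed.

(** The enumeration of the sites is not translation invariant, but by [noise_law] both sides are the
    same iterated integral up to the names of the sites. *)
Lemma noise_shift (l : I) (D : {fset I}) (G : (I -> RR) -> \bar R) : nn_measurable G ->
  (forall f f', {in (D : seq I), f =1 f'} -> G f = G f') ->
  (\int[unif R]_t G (fun x => noise t (x + l)%R) = \int[unif R]_t G (noise t))%E.
Proof.
move=> nG GD; have [mG G0] := nG.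
pose G' (f : I -> RR) := G (fun x => f (x + l)).
have nG' : nn_measurable G'.
  split => [|f]; last exact: G0.
  have m1 : measurable_fun [set: fieldT I RR] (fun f : fieldT I RR => (fun x => f (x + l)) : fieldT I RR).
    by apply: measurable_to_field => y; exact: measurable_coord.
  exact: (measurableT_comp mG m1).
rewrite (noise_law (s := D) (fun=> (0 : R) : RR) nG GD).
rewrite -[LHS]/(\int[unif R]_t G' (noise t))%E.
rewrite (@noise_law R I [seq (x + l)%R | x <- (D : seq I)] G' (fun=> (0 : R) : RR) nG').
  exact: (iter_int_reindex (unif R) (D : seq I) G (fun=> (0 : R) : RR) (addIr l)).
by move=> f f' ff'; apply: GD => x xD; apply: ff'; apply: map_f.
Qed.

Lemma noise_measure_shift_invariant : shift_invariant L noise_measure.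
Proof.
apply: gradient_law_shift_invariant => l D A Ll mA.
have gF : grad_functional [set` D] (fun phi : cfg => (\1_A phi)%:E : \bar R).
  apply: grad_functional_gradT => [|phi]; last by rewrite lee_fin.
  by apply/measurable_EFinP; exact: measurable_indic.
have [nF FD] := gF.
have nG := nn_measurable_affine g h nF.
have GD (f f' : I -> RR) : {in (D : seq I), f =1 f'} ->
    ((fun phi : cfg => (\1_A phi)%:E : \bar R) \o affine g h) f = ((fun phi : cfg => (\1_A phi)%:E) \o affine g h) f'.
  by move=> ff' /=; apply: FD => x y /= xD yD; rewrite /affine ff' ?ff'.
have mB (f : RR -> cfg) : (forall x, measurable_fun [set: RR] (fun t : RR => f t x)) -> measurable [set t : RR | A (f t)].
  by move=> mfx; have := @measurable_to_gradT R RealHeights d _ _ _ mfx [set` D] measurableT A mA; rewrite setTI.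
have intE (f : RR -> cfg) : (forall x, measurable_fun [set: RR] (fun t : RR => f t x)) ->
    unif R [set t | A (f t)] = (\int[unif R]_t (\1_A (f t))%:E)%E.
  move=> mfx; rewrite -[X in unif R X]setIT -(integral_indic _ measurableT (mB _ mfx)); apply: eq_integral => t _ /=.
  by rewrite !indicE; congr (_%:R%:E); congr nat_of_bool; apply/idP/idP; rewrite !inE.
rewrite -[RHS]/(unif R [set t | A (noise_config t)]) (intE _ measurable_noise_config).
rewrite -[RHS](noise_shift l nG GD).
rewrite -[LHS]/(unif R [set t | A (Defs.shift l (noise_config t))]) intE; last first.
  by move=> x; exact: measurable_noise_config.
apply: eq_integral => t _ /=; apply: FD => x y xD yD.
by rewrite /= /Defs.shift /noise_config /affine !gu//; ring.
Qed.

Lemma noise_measure_has_slope : has_slope L noise_measure u.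
Proof.
apply: (@gradient_law_has_slope _ _ _ _ _ _ _ _ L u (fun x y => `|g y - g x| + h)).
  move=> t x y; rewrite noise_config_increment; apply: le_trans (ler_normD _ _) _.
  rewrite lerD2l normrM gtr0_norm// -[leRHS]mulr1 ler_pM2l// ler_norml.
  have /andP[h1 h2] := noise_itv t x; have /andP[h3 h4] := noise_itv t y; lra.
move=> l Ll.
have intn (x : I) : (unif R).-integrable setT (fun t : RR => (noise t x)%:E).
  apply: measurable_bounded_integrable => //.
  - exact: le_lt_trans (probability_le1 (unif R) measurableT) (ltry _).
  - exact: measurable_iid.
  - exists 1; split; first exact: num_real.
    move=> r r1 t _; have /andP[h1 h2] := noise_itv t x.
    by rewrite /= ger0_norm//; apply: le_trans h2 _; exact: ltW.
transitivity (\int[unif R]_t ((pairing u l)%:E + h%:E * ((noise t l)%:E - (noise t (0 : I))%:E)))%E.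
  apply: eq_integral => t _; rewrite noise_config_increment -EFinB -EFinM -EFinD.
  by congr EFin; have := gu 0 Ll; rewrite add0r => ->; ring.
rewrite integralD//; last 2 first.
- exact: finite_measure_integrable_cst.
- by apply: integrableZl => //; apply: integrableB.
rewrite integralZl//; last exact: integrableB.
rewrite integralB// !noise_integral subee ?mule0 ?adde0.
  rewrite integral_cst// -[RHS]mule1; congr (_ * _)%E; exact: probability_setT.
by rewrite -(noise_integral 0); exact: integral_fune_fin_num.
Qed.

Lemma noise_measure_le (D : {fset I}) (A : set cfg) : D != fset0 ->
  @measurable _ (gradT E [set` D]) A ->
  (noise_measure A <= (h^-1 ^+ (#|` D|).-1)%:E * gradient_reference E D A)%E.
Proof. exact: noisy_law_le. Qed.

End noise_field.

(** * Real heights *)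

Section real_heights.
Context (R : realType) (d : nat).
Notation E := (heights R RealHeights).
Notation I := (site d).
Notation cfg := (config E d).
Implicit Types (D M : {fset I}) (phi : cfg).
Context (L : set I) (A : set {fset I}) (q : I -> I -> R).
Variables (Phi Psi Xi : potential R RealHeights d).
Hypothesis d2 : (2 <= d)%N.
Variable m0 : nat.
Hypotheses (m0_gt0 : (0 < m0)%N) (L0 : L 0).
Hypotheses (LD : forall x y, L x -> L y -> L (x + y)) (LN : forall x, L x -> L (- x)).
Hypothesis Lm0 : forall x, L (x *+ m0).
Hypothesis admA : admissible_graph L A.
Hypothesis admq : admissible_quasimetric L q.
Hypothesis maxq : forall p, admissible_quasimetric L p ->
        (forall x y, A [fset x; y]%fset -> p x y <= q x y) ->
        forall x y, p x y <= q x y.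
Hypothesis pgPsi : periodic_gradient_potential L Psi.
Hypothesis pgXi : periodic_gradient_potential L Xi.
Hypothesis Psi0 : forall G phi, (0 <= Psi G phi)%E.
Hypothesis PhiE : forall G phi, Phi G phi = (Psi G phi + Xi G phi)%E.
Variable nrm : R.
Hypothesis nrm0 : 0 <= nrm.
Hypothesis XiN : forall x phi, (\esum_(G in [set G : {fset I} | x \in G]) `|Xi G phi| <= nrm%:E)%E.
Hypothesis amXi : amenable L (lower_exterior_bound Xi).
Hypothesis lipPsi : lipschitz_potential A q Psi.
Hypothesis lbPsi : locally_bounded L A q Psi.
Variable K1 : R.
Hypothesis K1_ge0 : 0 <= K1.
Hypothesis K1P : forall x (i : 'I_d), q x (x + delta_mx 0 i) <= K1 /\ q (x + delta_mx 0 i) x <= K1.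

Lemma real_surface_tension_lt (u : 'rV[R]_d) (delta : R) : 0 < delta ->
  (forall v : 'rV[R]_d, (forall i, `|v 0 i - u 0 i| <= delta) -> lipschitz_slope L q v) ->
  (surface_tension L Phi u < +oo)%E.
Proof.
move=> d0 uP.
have [eta eta0 [g gP gu]] := interior_slope_gap m0_gt0 L0 LD LN Lm0 admA admq d0 uP.
(* The bound by eta / 2 leaves a gap h after adding noise; the bound by 1 makes the density bound
   [h^-1] at least 1 and its logarithm nonnegative. *)
pose h := Num.min 1 (eta / 2).
have h0 : 0 < h by rewrite lt_min ltr01 divr_gt0.
have h1 : h <= 1 by rewrite ge_min lexx.
have h_eta : 2 * h <= eta by rewrite -ler_pdivlMl// mulrC ge_min lexx orbT.
have [eps0 eps0P lb] := lbPsi.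
(* Below [eps0] for local boundedness, and strictly below the gap h so that [edge_lipschitz_q_eps]
   applies. *)
pose eps := Num.min eps0 h / 2.
have min0 : 0 < Num.min eps0 h by rewrite lt_min eps0P h0.
have epsP : 0 < eps < eps0.
  rewrite divr_gt0//= ltr_pdivrMr//; apply: le_lt_trans (_ : eps0 < _); first by rewrite ge_min lexx.
  by rewrite ltr_pMr// ltr1n.
have eps_h : eps < h.
  rewrite ltr_pdivrMr//; apply: le_lt_trans (_ : h < _); first by rewrite ge_min lexx orbT.
  by rewrite ltr_pMr// ltr1n.
have [qe qeP [C CP]] := lb _ epsP.
have edge t x y : A [fset x; y]%fset -> increment (noise_config g h t) x y <= q x y - h.
  by move=> xy; exact: (noise_config_edge h0 h_eta t gP xy).
have edgeh t : edge_lipschitz A (fun x y => q x y - h) (noise_config g h t).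
  by move=> x y; exact: edge.
have edgee t : edge_lipschitz A (fun x y => q x y - eps) (noise_config g h t).
  by move=> x y /edge /le_trans; apply; rewrite lerD2l lerN2 ltW.
have lipq t x y : increment (noise_config g h t) x y <= q x y.
  apply: (edge_lipschitz_q LN admA admq maxq (psi := noise_config g h t)) => a b /edge /le_trans; apply.
  by rewrite gerBl ltW.
have lipqe t z : q_lipschitz_at A qe (noise_config g h t) z.
  move=> x y _ _; exact: (edge_lipschitz_q_eps LN admA admq qeP eps_h (edgeh t) (edgee t)).
pose mu := noise_measure g h.
have mul : ae_lipschitz q mu by exact: gradient_law_ae_lipschitz.
have mu_inv : shift_invariant L mu by exact: (noise_measure_shift_invariant h gu).
have hslope : has_slope L mu u by exact: (noise_measure_has_slope h0 gu).
pose C' := ln h^-1 + (Num.max 0 C + nrm).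
apply: le_lt_trans (ltry C'); apply: le_trans (_ : (specific_free_energy Phi mu <= _)%E).
  by apply: ereal_inf_lbound; exists mu.
have hV : 1 <= h^-1 by rewrite invf_ge1.
apply: (specific_free_energy_le d2 m0_gt0 Lm0 admq pgPsi pgXi Psi0 PhiE XiN amXi K1_ge0 K1P mu_inv mul).
move=> D D0.
apply: le_trans (free_energy_le pgPsi pgXi Psi0 PhiE XiN mul D0 (c := h^-1 ^+ (#|` D|).-1) (Ch := (Num.max 0 C + nrm) *+ #|` D|) _ _ _) _.
- exact: exprn_ege1.
- by move=> B mB; exact: noise_measure_le.
- have mB : measurable [set phi : gradT E [set: I] | (ham Phi D phi <= ((Num.max 0 C + nrm) *+ #|` D|)%:E)%E].
    rewrite -[X in measurable X]setTI; apply: emeasurable_fun_infty_c => //.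
    exact: (lower_integrable_ham pgPsi pgXi Psi0 PhiE XiN D mu).1.
  have ae := @gradient_law_ae R RealHeights d _ _ (unif R) _ (measurable_noise_config g h) _ mB; apply: ae => t /=.
  apply: (ham_le pgXi Psi0 PhiE XiN) => //; first by rewrite le_max lexx.
    by move=> G phi; rewrite leey.
  move=> x xD; apply: le_trans (CP x _ (lipqe t x)) _.
  by rewrite lee_fin le_max lexx orbT.
rewrite lee_fin lnXn ?invr_gt0// /C' [X in _ <= X]mulrnDl lerD2r.
by apply: ler_wpMn2l; [exact: ln_ge0|exact: leq_pred].
Qed.

(** The slack [q x y - increment phi x y] is almost surely nonnegative and has mean at most eta.
    Testing with the exponential density of rate 1 / eta in this slack gives the mean logarithm ln
    (1 / eta) minus mean slack over eta, hence the -1. *)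
Lemma real_edge_entropy (mu : gradient_measure R RealHeights d) x y (eta : R) :
  ae_lipschitz q mu -> x != y -> 0 < eta ->
  mu.-integrable setT (fun phi : gradT E [set: I] => (increment phi x y)%:E) ->
  ((q x y - eta)%:E <= \int[mu]_phi (increment phi x y)%:E)%E ->
  ((ln eta^-1 - 1)%:E <= ent [fset x; y]%fset mu)%E.
Proof.
move=> mul xy eta0 intg mean; have etaV : 0 < eta^-1 by rewrite invr_gt0.
pose g (t : E) : \bar R := (exponential_pdf eta^-1 (q x y - t))%:E.
have mexp : measurable_fun [set: measurableTypeR R] (fun t : measurableTypeR R => (exponential_pdf eta^-1 t)%:E : \bar R).
  by apply/measurable_EFinP; exact: measurable_exponential_pdf.
have exp0 (t : R) : (0 <= (exponential_pdf eta^-1 t)%:E :> \bar R)%E by rewrite lee_fin exponential_pdf_ge0// ltW.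
have mg : measurable_fun [set: E] g.
  apply: (measurableT_comp (f := fun t : measurableTypeR R => (exponential_pdf eta^-1 t)%:E : \bar R) mexp).
  by apply: measurable_funB.
have g1 : (\int[hs_ref E]_t g t <= 1)%E.
  rewrite -(integral_exponential_pdf etaV).
  rewrite -(@ge0_integral_hs_opp R RealHeights (fun t => (exponential_pdf eta^-1 t)%:E) mexp exp0).
  have m2 : measurable_fun [set: E] (fun t : E => (exponential_pdf eta^-1 (hs_sub (hs_zero E) t))%:E : \bar R).
    apply: (measurableT_comp (f := fun t : measurableTypeR R => (exponential_pdf eta^-1 t)%:E : \bar R) mexp).
    by apply: measurable_funB.
  rewrite -(@ge0_integral_hs_sub R RealHeights (q x y : E) _ m2)//.
  rewrite le_eqVlt; apply/orP; left; apply/eqP; apply: eq_integral => t _.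
  by rewrite /g /= sub0r opprB.
pose f (phi : gradT E [set: I]) : \bar R := ((ln eta^-1 - eta^-1 * q x y)%:E + (eta^-1)%:E * (increment phi x y)%:E)%E.
have intf : mu.-integrable setT f.
  by apply: integrableD => //; [exact: finite_measure_integrable_cst|exact: integrableZl].
have [lf qf] := quasi_integral_integrable intf.
have fg : {ae mu, forall phi : gradT E [set: I], (f phi <= lne (g (hs_sub (phi y) (phi x))))%E}.
  apply: filterS mul => phi /(_ x y) h.
  rewrite /g /f exponential_pdfE ?subr_ge0// lne_EFin ?mulr_gt0 ?expR_gt0//.
  rewrite lnM ?posrE ?expR_gt0// expRK -EFinM -EFinD lee_fin /increment /=.
  have E2 (w z e l : R) : l - e * z + e * w <= l + - e * (z - w).
    by rewrite le_eqVlt; apply/orP; left; apply/eqP; ring.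
  exact: E2.
have mlg : measurable_fun setT (fun phi : gradT E [set: I] => lne (g (hs_sub (phi y) (phi x)))).
  apply: measurableT_comp; first exact: measurable_lne.
  apply: (measurableT_comp mg); exact: measurable_hs_sub_gradT.
have lg := lower_integrable_ge mlg lf fg.
have [_] := ent_edge xy mg (fun t => exp0 (q x y - t)) g1 lg.
apply: le_trans; apply: le_trans (le_quasi_integral lf.1 lg.1 fg).
rewrite qf integralD//; last 2 first.
- exact: finite_measure_integrable_cst.
- exact: integrableZl.
rewrite integralZl// [X in (_ <= X + _)%E](_ : _ = (ln eta^-1 - eta^-1 * q x y)%:E); last first.
  rewrite integral_cst// -[RHS]mule1; congr (_ * _)%E; exact: probability_setT.
have : ((eta^-1)%:E * (q x y - eta)%:E <= (eta^-1)%:E * \int[mu]_phi (increment phi x y)%:E)%E.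
  by apply: lee_wpmul2l => //; rewrite lee_fin ltW.
rewrite -EFinM mulrBr mulVf ?gt_eqF// => h.
apply: le_trans (leeD2l _ h); rewrite -EFinD lee_fin; lra.
Qed.

(* If every edge had mean increment below q - eta, a ball around u of radius
   independent of u would consist of Lipschitz slopes.  Near b some edge thus has
   its increment within eta of its upper bound on average, which costs an entropy
   of order ln (1 / eta). *)
Lemma real_surface_tension_boundary (b : 'rV[R]_d) :
  (forall rho : R, 0 < rho -> exists2 v : 'rV[R]_d, (forall i, `|v 0 i - b 0 i| <= rho) & ~ lipschitz_slope L q v) ->
  surface_tension L Phi u @[u --> b] --> +oo%E.
Proof.
move=> bP; apply/(@cvgeyPge _ _ (nbhs b)) => M.
have [|C C0 CP] := @edge_bounded _ _ _ _ m0_gt0 LN Lm0 _ admA (fun x y => \sum_i `|((y - x) 0 i)%:~R| : R).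
  by move=> l x y _; rewrite [x + l]addrC addrKA.
pose N := (Num.truncn C).+1.
have NP (x y : I) i : A [fset x; y]%fset -> (`|y 0%R i - x 0%R i| <= N)%N.
  move=> /CP; rewrite (bigD1 i)//= => h.
  have : `|((y - x) 0 i)%:~R| < (N%:R : R).
    apply: le_lt_trans (truncnS_gt C); apply: le_trans h; rewrite lerDl sumr_ge0//.
  rewrite 2!mxE -intr_norm [N%:R]pmulrn ltr_int; move: (y 0 i) (x 0 i) => a e; lia.
(* A fixed side, divisible by [m0], such that some shift in [L] carries any given edge into the
   box. *)
pose m := (m0 * (2 * N + 1))%N.
have m_gt0 : (0 < m)%N by rewrite muln_gt0 m0_gt0 addn1.
have md : (0 : R) < m%:R ^+ d by rewrite exprn_gt0// ltr0n.
pose K : R := \sum_(x <- box d m) \sum_(y <- box d m) (`|q x y| + `|q y x|).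
have K0 : 0 <= K by rewrite sumr_ge0// => x _; rewrite sumr_ge0// => y _; rewrite addr_ge0.
have KP x y : x \in box d m -> y \in box d m -> Num.max (q x y) (q y x) <= K.
  move=> xm ym; apply: (@le_trans _ _ (`|q x y| + `|q y x|)).
    by rewrite ge_max; apply/andP; split; apply: le_trans (ler_norm _) _; rewrite ?lerDl ?lerDr.
  apply: le_trans (ler_term_sum ym (fun z => addr_ge0 (normr_ge0 (q x z)) (normr_ge0 (q z x)))) _.
  by apply: (ler_term_sum xm) => z; rewrite sumr_ge0// => z' _; rewrite addr_ge0.
pose c := (ln (2 * K + 1) + nrm + nrm) *+ #|` box d m|.
(* Chosen backwards so that the final bound is exactly M. The terms compensate [err], the -1 of the
   entropy bound, the energy of the two sites of an edge, and the growth from an edge to the box;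
   the entropy of the edge is about ln (1 / eta) = B. *)
pose B : R := M * m%:R ^+ d + err Xi K1 m + 1 + (nrm *+ 2) + c.
pose eta : R := expR (- B).
have eta0 : 0 < eta by exact: expR_gt0.
have [rho rho0 ball] := gap_slope_ball m0_gt0 LN Lm0 admA admq maxq eta0.
near=> u; have ub i : `|u 0 i - b 0 i| <= rho / 2.
  move: i; near: u; apply: filter_forall => i; rewrite near_simpl.
  have := @coord_continuous R 1 d 0 i b; move/cvgrPdist_le => /(_ _ (divr_gt0 rho0 (ltr0n _ 2))).
  by apply: filterS => u; rewrite distrC.
(* As b is not interior, a slope v that is not Lipschitz lies within rho / 2 of b, hence within rho
   of u. *)
have [v vb vK] := bP _ (divr_gt0 rho0 (ltr0n _ 2)).
have uv i : `|v 0 i - u 0 i| <= rho.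
  have := ub i; have := vb i; rewrite !ler_norml; lra.
apply: le_ereal_inf_tmp => _ [mu [mu_inv slope ->]].
have [mul|nmul] := pselect (ae_lipschitz q mu); last first.
  by rewrite (not_lipschitz_specific d2 m0_gt0 LN Lm0 admA admq maxq pgPsi pgXi Psi0 PhiE nrm0 XiN lipPsi K1_ge0 mu_inv nmul) ?leey.
have incP := ae_lipschitz_incP mul.
have [intg sl] := slope.
(* The mean height, normalised to vanish at the origin. Shift invariance and the slope of mu make it
   quasi-periodic with slope u. *)
pose g (x : I) := fine (\int[mu]_phi (increment phi 0 x)%:E).
have fing x y : (\int[mu]_phi (increment phi x y)%:E)%E \is a fin_num by exact: integral_fune_fin_num.
have gE x : (g x)%:E = (\int[mu]_phi (increment phi 0 x)%:E)%E by rewrite fineK.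
have ginc x y : (g y - g x)%:E = (\int[mu]_phi (increment phi x y)%:E)%E.
  rewrite EFinB !gE -integralB//; apply: eq_integral => phi _.
  by rewrite -EFinB; congr EFin; rewrite /increment !hs_inclB; ring.
have gu : quasi_periodic L u g.
  move=> x l Ll; apply: EFin_inj; rewrite EFinD -(sl l Ll) !gE.
  have <- : (\int[mu]_phi (increment phi l (x + l))%:E = \int[mu]_phi (increment phi 0 x)%:E)%E.
    have [_ <-] := quasi_integral_integrable (intg l (x + l)).
    have [_ <-] := quasi_integral_integrable (intg 0 x).
    have mS (S : set (gradT E [set: I])) : measurable S -> mu (Defs.shift l @^-1` S) = mu S by exact: mu_inv.
    rewrite -[RHS](quasi_integral_shift mS).
      by congr quasi_integral; apply/funext => phi; rewrite /increment /Defs.shift add0r.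
    by apply/measurable_EFinP; exact: measurable_increment.
  rewrite addeC -integralD//; apply: eq_integral => phi _.
  by rewrite -EFinD; congr EFin; rewrite /increment !hs_inclB; ring.
have [x [y [xyA xyM]]] : exists x y, A [fset x; y]%fset /\ q x y - eta <= g y - g x.
  apply: contrapT => H; apply: vK; apply: (ball u g v _ gu uv) => x y xyA.
  by rewrite leNgt; apply/negP => lt; apply: H; exists x, y; split => //; exact: ltW.
have xy : x != y by exact: (edge_neq admA xyA).
pose z : I := const_mx (N * m0)%:Z.
pose l := residue m0 x - x + z.
have Ll : L l.
  apply: LD; first by rewrite -opprB; apply: LN; exact: sub_residue.
  rewrite (_ : z = (const_mx N%:Z : I) *+ m0) //; apply/rowP => i.
  by rewrite mulmxnE !mxE -mulr_natr natz PoszM.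
have sub : (translate l [fset x; y] `<=` box d m)%fset.
  have rb := residue_box m0_gt0 x.
  apply/fsubsetP => _ /imfsetP[w /= wxy ->]; rewrite mem_box; apply/forallP => i.
  have wN : (`|w 0%R i - x 0%R i| <= N)%N.
    by move: wxy; rewrite !inE => /orP[|] /eqP ->; [rewrite subrr|exact: NP].
  move: rb; rewrite mem_box => /forallP/(_ i).
  rewrite /l [(w + _) 0 i]mxE [(_ + z) 0 i]mxE [(residue m0 x - x) 0 i]mxE [(- x) 0 i]mxE [z 0 i]mxE.
  move: wN; move: (w 0 i) (x 0 i) (residue m0 x 0 i) => a e r.
  by move=> aN rm; exact: coordinate_in_box.
have xy0 : [fset x; y]%fset != fset0 by apply/fset0Pn; exists x; rewrite !inE eqxx.
have txy0 : translate l [fset x; y]%fset != fset0.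
  by apply/fset0Pn; exists (x + l); apply: in_translate; rewrite !inE eqxx.
have fxy : ((B - 1 - nrm *+ 2)%:E <= free_energy Phi [fset x; y]%fset mu)%E.
  rewrite (free_energyE pgPsi pgXi Psi0 PhiE XiN incP xy0) EFinB; apply: leeD.
    have := real_edge_entropy mul xy eta0 (intg x y); rewrite -ginc lee_fin => /(_ xyM).
    by rewrite /eta -expRN opprK expRK.
  rewrite -EFinN -(quasi_integral_cst mu); apply: le_quasi_integral.
  - exact: measurable_cst.
  - exact: (lower_integrable_ham pgPsi pgXi Psi0 PhiE XiN _ mu).1.
  - apply: aeW => phi; apply: le_trans (ham_ge pgXi Psi0 PhiE XiN _ _).
    by rewrite cardfs2 xy.
have := free_energy_translate pgPsi pgXi Psi0 PhiE XiN mu_inv incP Ll xy0.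
move=> /(le_trans fxy) h1.
have := free_energy_grow pgPsi pgXi Psi0 PhiE nrm0 XiN mul txy0 sub K0.
move=> h2.
have h3 : ((B - 1 - nrm *+ 2 - c)%:E <= free_energy Phi (box d m) mu)%E.
  rewrite EFinB; apply: le_trans (h2 _); last first.
    move=> x' y' x'm y'm; apply: filterS (ae_lipschitz_bounded x' y' mul) => phi /le_trans; apply.
    exact: KP.
  by apply: leeB.
have [_ low] := specific_free_energyP d2 m0_gt0 Lm0 admq pgPsi pgXi Psi0 PhiE XiN amXi K1_ge0 K1P mu_inv mul.
apply: le_trans (low m _ m_gt0 (dvdn_mulr _ (dvdnn _)) h3).
by rewrite lee_fin ler_pdivlMr// /B; lra.
Unshelve. all: by end_near. Qed.

End real_heights.

(** * Integer heights: patterns and entropy sums *)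

Section counting_reference.
Context (R : realType) (d : nat).
Notation E := (heights R IntegerHeights).
Notation I := (site d).
Notation cfg := (config E d).
Notation count := (@counting int R).
Local Open Scope ereal_scope.

Lemma counting1 (a : int) : count [set a] = 1.
Proof. by rewrite /counting asboolT// fset_set1 cardfs1. Qed.

Lemma integral_counting1 (F : int -> \bar R) a : 0 <= F a ->
  \int[count]_(t in [set a]) F t = F a.
Proof.
move=> F0; rewrite (eq_integral (cst (F a))); last by move=> t; rewrite inE => ->.
rewrite integral_cst// -[RHS]mule1; congr (_ * _); exact: counting1.
Qed.

Lemma iter_int_ge (s : seq I) (F : cfg -> \bar R) f : nn_measurable F ->
  F f <= iter_int (hs_ref E) s F f.
Proof.
move=> nF; elim: s f => [//|x s IH] f /=; have [_ I0] := iter_int_nn (hs_ref E) s nF.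
apply: (@le_trans _ _ (iter_int (hs_ref E) s F (upd f x (f x)))).
  apply: le_trans (IH _); rewrite (_ : upd f x (f x) = f)//.
  by apply/funext => y; rewrite /upd; case: eqP => // ->.
rewrite -[leLHS](@integral_counting1 (fun t => iter_int (hs_ref E) s F (upd f x t)))//.
by apply: ge0_subset_integral => //.
Qed.

Lemma iter_int_le1 (s : seq I) x0 (F : cfg -> \bar R) (c : cfg) f : nn_measurable F -> uniq s ->
  x0 \notin s -> f x0 = c x0 -> (forall f, F f <= 1) ->
  (forall f x, f x0 = c x0 -> x \in s -> f x <> c x -> F f = 0) ->
  iter_int (hs_ref E) s F f <= 1.
Proof.
move=> nF + + + F1; elim: s f => [|x s IH] f //= /andP[xs us] xs0 fx0 Fc.
have [x0x xs0'] : x0 != x /\ x0 \notin s by apply/andP; rewrite -negb_or -in_cons.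
have [_ I0] := iter_int_nn (hs_ref E) s nF.
have Fs f' y : f' x0 = c x0 -> y \in s -> f' y <> c y -> F f' = 0 by move=> fx ys; apply: Fc; rewrite // inE ys orbT.
have zero t : t <> c x -> iter_int (hs_ref E) s F (upd f x t) = 0.
  move=> tc; have : upd f x t x <> c x by rewrite /upd eqxx.
  have : upd f x t x0 = c x0 by rewrite /upd (negbTE x0x).
  move: (upd f x t); clear IH f t tc Fs us I0 fx0 xs0; move: xs xs0' Fc.
  elim: s => [|y s IH] /= xs xs0 Fc f fx0 fx; first by apply: Fc fx0 _ fx; rewrite inE eqxx.
  move: xs xs0; rewrite !inE !negb_or => /andP[xy xs] /andP[x0y xs0].
  rewrite (eq_integral (cst 0)) ?integral0// => t _; apply: IH => //.
  - by move=> f' z fz zs; apply: Fc fz _; move: zs; rewrite !inE => /orP[->//|->]; rewrite !orbT.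
  - by rewrite /upd (negbTE x0y).
  - by rewrite /upd (negbTE xy).
apply: (@le_trans _ _ (\int[count]_(t in [set c x]) iter_int (hs_ref E) s F (upd f x t))).
  rewrite le_eqVlt; apply/orP; left; apply/eqP.
  rewrite [in RHS]integral_mkcond /=; apply: eq_integral => t _; rewrite !patchE /=.
  by case: ifPn => // /negP; rewrite inE => /zero.
rewrite integral_counting1//; apply: IH => //.
by rewrite /upd (negbTE x0x).
Qed.

Lemma reference_gint (D : {fset I}) (A : set cfg) : @measurable _ (gradT E [set` D]) A ->
  gradient_reference E D A = gint D (fun phi : cfg => (\1_A phi)%:E : \bar R).
Proof.
move=> mA; rewrite -gradient_referenceE//; last first.
  by apply/measurable_EFinP; exact: measurable_indic.
by rewrite integral_indic// setIT.
Qed.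

Lemma grad_functional_indic (D : {fset I}) (A : set cfg) : @measurable _ (gradT E [set` D]) A ->
  grad_functional [set` D] (fun phi : cfg => (\1_A phi)%:E : \bar R).
Proof.
move=> mA; apply: grad_functional_gradT => [|phi]; last by rewrite lee_fin.
by apply/measurable_EFinP; exact: measurable_indic.
Qed.

Lemma fset_split (D : {fset I}) : D != fset0 -> exists x s, (D : seq I) = x :: s.
Proof.
rewrite -cardfs_gt0 -[#|` D|]/(size (D : seq I)); case: (D : seq I) => [//|x s] _.
by exists x, s.
Qed.

(** A sum against counting measure dominates its term at [phi]. Every probability is thus at most
    the reference measure of a nonempty event, and integer entropies are nonpositive. *)
Lemma reference_ge1 (D : {fset I}) (A : set cfg) phi : D != fset0 ->
  @measurable _ (gradT E [set` D]) A -> A phi -> 1 <= gradient_reference E D A.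
Proof.
move=> D0 mA Aphi; have gF := grad_functional_indic mA.
have [x [s Ds]] := fset_split D0.
have gF' : grad_functional [set` x :: s] (fun phi : cfg => (\1_A phi)%:E : \bar R).
  by rewrite -Ds.
rewrite (reference_gint mA) Ds (gint_cons phi gF').
by apply: le_trans (iter_int_ge s phi gF'.1); rewrite indicE mem_set.
Qed.

Lemma reference_le1 (D : {fset I}) (A : set cfg) c x0 : x0 \in D ->
  @measurable _ (gradT E [set` D]) A -> (forall phi, A phi -> same_grad [set` D] phi c) ->
  gradient_reference E D A <= 1.
Proof.
move=> xD mA Ac; have gF := grad_functional_indic mA.
have D0 : D != fset0 by apply/fset0Pn; exists x0.
have [x [s Ds]] := fset_split D0.
have gF' : grad_functional [set` x :: s] (fun phi : cfg => (\1_A phi)%:E : \bar R).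
  by rewrite -Ds.
have inD y : y \in x :: s -> y \in D by rewrite -Ds.
have us : uniq (x :: s) by rewrite -Ds; exact: fset_uniq.
rewrite (reference_gint mA) Ds.
rewrite (gint_cons c gF').
move: us; rewrite cons_uniq => /andP[xs us].
apply: (@iter_int_le1 s x) => //; first exact: gF'.1.
  by move=> f; rewrite lee_fin indicE; case: (_ \in _).
move=> f y fx ys fy; rewrite indicE; case: (boolP (f \in A)) => //; rewrite inE => /Ac sg.
exfalso; apply: fy; have := sg x y (inD _ (mem_head _ _)) (inD y _).
by rewrite inE ys orbT => /(_ isT) /=; rewrite fx; lia.
Qed.

Lemma measurable_same_grad (D : {fset I}) c :
  @measurable _ (gradT E [set` D]) [set phi : cfg | same_grad [set` D] phi c].
Proof.
rewrite (_ : [set phi : cfg | _] = \bigcap_(e in [set` D] `*` [set` D])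
   [set phi : cfg | hs_sub (phi e.2) (phi e.1) = hs_sub (c e.2) (c e.1)]); last first.
  apply/seteqP; split => phi /= H; first by move=> [x y] /= [xD' yD']; exact: H.
  by move=> x y xD' yD'; exact: (H (x, y)).
apply: (@fin_bigcap_measurable _ (gradT E [set` D])); first by apply: finite_setX; exact: finite_fset.
move=> [x y] [/= xD' yD']; apply: sub_sigma_algebra.
by exists x, y, [set hs_sub (c y) (c x)].
Qed.

End counting_reference.

Lemma mem_translate d (l : site d) (D : {fset site d}) x : (x \in translate l D) = (x - l \in D).
Proof.
apply/imfsetP/idP => [[y /= yD ->]|xD]; first by rewrite addrK.
by exists (x - l) => //; rewrite subrK.
Qed.

Section patterns.
Context (R : realType) (d : nat).
Notation E := (heights R IntegerHeights).
Notation I := (site d).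
Notation cfg := (config E d).
Variables (D : {fset I}) (N : nat).

(** Heights between -N and N, stored with offset N so that they form a finite type. *)
Definition pattern := {ffun D -> 'I_(2 * N).+1}.

Definition pattern_config (w : pattern) : cfg :=
  fun x => if insub x is Some x' then (w x' : nat)%:Z - N%:Z else 0.

Lemma pattern_configE (w : pattern) (x : D) : pattern_config w (val x) = (w x : nat)%:Z - N%:Z.
Proof. by rewrite /pattern_config valK. Qed.

Lemma pattern_exists (phi : cfg) x0 : x0 \in D ->
  (forall x, x \in D -> `|increment phi x0 x| <= N%:R) ->
  exists w : pattern, pattern_config w x0 = 0 /\ same_grad [set` D] phi (pattern_config w).
Proof.
move=> x0D phiN.
pose f (x : I) : int := phi x.
have {}phiN x : x \in D -> (`|f x - f x0|%N <= N)%N.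
  by move=> /phiN; rewrite /increment /= -intr_norm [N%:R]pmulrn ler_int -/(f x) -/(f x0); lia.
have bnd (x : D) : (absz (f (val x) - f x0 + N%:Z)%R < (2 * N).+1)%N.
  by have := phiN _ (valP x); move: (f _) (f _) => a b; lia.
exists [ffun x => Ordinal (bnd x)].
have cE x : x \in D -> pattern_config [ffun x => Ordinal (bnd x)] x = f x - f x0.
  move=> xD; have := pattern_configE [ffun x => Ordinal (bnd x)] [` xD]%fset.
  by rewrite ffunE /= => ->; have := phiN _ xD; move: (f _) (f _) => a b; lia.
split; first by rewrite cE// subrr.
move=> x y xD yD; rewrite /= !cE// -/(f x) -/(f y).
by move: (f x) (f y) (f x0) => a b e; lia.
Qed.

End patterns.

Section entropy_sums.
Context (R : realType) (W : finType).
Implicit Types (p h : W -> R).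

(* Used with z close to x, it gives the lower semicontinuity of x ln x at x = 0
   without its continuity. *)
Lemma xlnx_tangent (x z : R) : 0 <= x -> 0 < z -> x * ln z + x - z <= x * ln x.
Proof.
rewrite le_eqVlt => /predU1P[<-|x0] z0; first by rewrite !mul0r; lra.
have xz0 : 0 < z / x by rewrite divr_gt0.
have : ln (z / x) <= z / x - 1.
  have -> : z / x = 1 + (z / x - 1) by lra.
  by rewrite addrAC subrr add0r le_ln1Dx//; lra.
rewrite lnM ?posrE ?invr_gt0// lnV ?posrE//.
move=> /(ler_wpM2l (ltW x0)); rewrite !mulrDr mulrCA divff ?gt_eqF// !mulrN !mulr1; lra.
Qed.

Definition entropy_sum p h : R := \sum_w (p w * ln (p w) + p w * h w).

Lemma entropy_sum_convex p1 p2 h (t : R) : 0 < t < 1 ->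
  (forall w, 0 <= p1 w) -> (forall w, 0 <= p2 w) ->
  entropy_sum (fun w => (1 - t) * p1 w + t * p2 w) h <=
  (1 - t) * entropy_sum p1 h + t * entropy_sum p2 h.
Proof.
move=> t01 p10 p20; rewrite /entropy_sum !mulr_sumr -big_split/=; apply: ler_sum => w _.
move: (p1 w) (p2 w) (p10 w) (p20 w) => a b a0 b0.
have t1 : 0 < 1 - t by lra.
have t0 : 0 < t by lra.
have [e|z0] := eqVneq ((1 - t) * a + t * b) 0.
  have [a1 b1] : a = 0 /\ b = 0 by split; nra.
  by rewrite a1 b1 !(mul0r, mulr0, addr0).
have {}z0 : 0 < (1 - t) * a + t * b by rewrite lt_def z0 addr_ge0// mulr_ge0// ltW.
(* Both tangents are taken at the mixture z of a and b; in the weighted sum the linear terms cancel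
   and leave z * ln z. *)
have := ler_wpM2l (ltW t1) (xlnx_tangent a0 z0).
have := ler_wpM2l (ltW t0) (xlnx_tangent b0 z0).
move: (ln (_ + _)) (ln a) (ln b) => lz la lb; lra.
Qed.

Lemma entropy_sum_lsc (U : Type) (F : set_system U) (FF : ProperFilter F)
    (P : U -> W -> R) p h (c : R) :
  (forall u w, 0 <= P u w) -> (forall w, P u w @[u --> F] --> p w) ->
  (\forall u \near F, entropy_sum (P u) h <= c) -> entropy_sum p h <= c.
Proof.
move=> P0 Pp Pc.
have p0 w : 0 <= p w.
  by apply: (cvgr_to_ge (Pp w)); apply: filterE => u; exact: P0.
suff H e : 0 < e -> entropy_sum p h <= c + e *+ #|W|.
  apply/ler_addgt0Pr => e e0; have e1 : 0 < e / (#|W|.+1)%:R by rewrite divr_gt0.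
  apply: le_trans (H _ e1) _; rewrite lerD2l -[_ *+ _]mulr_natr mulrAC ler_pdivrMr ?ltr0n//.
  by rewrite ler_pM2l// ler_nat.
(* Each x ln x is replaced by its tangent at the limit p w, or at e where this limit is zero and has
   no tangent. The second case loses e, hence an error of at most e for each element of [W]. *)
move=> e0; pose z w := if p w == 0 then e else p w.
have z0 w : 0 < z w by rewrite /z; case: eqVneq => // pw; rewrite lt_def pw p0.
have lim : \sum_w (P u w * ln (z w) + P u w - z w + P u w * h w) @[u --> F] -->
    \sum_w (p w * ln (z w) + p w - z w + p w * h w).
  apply: cvg_big => [|w _]; first exact: add_continuous.
  apply: cvgD; last by apply: cvgMl; exact: Pp.
  apply: cvgB; last exact: cvg_cst.
  by apply: cvgD; [apply: cvgMl; exact: Pp|exact: Pp].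
have le1 : \sum_w (p w * ln (z w) + p w - z w + p w * h w) <= c.
  apply: (cvgr_to_le lim); apply: filterS Pc => u; apply: le_trans.
  by apply: ler_sum => w _; rewrite lerD2r; exact: xlnx_tangent.
apply: le_trans (_ : \sum_w (p w * ln (z w) + p w - z w + p w * h w + e) <= _); last first.
  by rewrite big_split/= sumr_const lerD2r.
apply: ler_sum => w _; rewrite /z; case: eqVneq => [->|_]; first by rewrite !mul0r; lra.
by have := ltW e0; lra.
Unshelve. all: by end_near. Qed.

End entropy_sums.

Section atoms.
Context dT (T : measurableType dT) (R : realType) (P : probability T R).
Context (W : finType) (B : W -> set T).
Hypothesis mB : forall w, measurable (B w).
Hypothesis B_disj : forall w w' t, B w t -> B w' t -> w = w'.
Hypothesis B_cover : {ae P, forall t, exists w, B w t}.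

(** Values are prescribed on atoms of positive probability alone, because the energy of a pattern of
    probability zero may be infinite. *)
Lemma atoms_integral (c : W -> R) (F : T -> \bar R) : measurable_fun setT F ->
  (forall w, (0 < P (B w))%E -> forall t, B w t -> F t = (c w)%:E) ->
  P.-integrable setT F /\ (\int[P]_t F t)%E = (\sum_w fine (P (B w)) * c w)%:E.
Proof.
move=> mF Fc; pose G t := (\sum_w (c w)%:E * (\1_(B w) t)%:E)%E.
have intB w : P.-integrable setT (fun t => ((c w)%:E * (\1_(B w) t)%:E)%E).
  by apply: integrableZl => //; exact: integrable_indic.
have intG : P.-integrable setT G by apply: (integrable_sum measurableT) => w _; exact: intB.
have mG : measurable_fun setT G by have /integrableP[] := intG.
have GF : ae_eq P setT G F.
  have nullB : {ae P, forall t, forall w, B w t -> (0 < P (B w))%E}.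
    apply: ae_countable => w; have [Bw|] := boolP (0 < P (B w))%E; first exact: aeW.
    rewrite -leNgt measure_le0 => /eqP B0; exists (B w); split => // t /=.
    by apply: contra_notP => nBw Bw; exfalso; exact: nBw.
  apply: filterS2 B_cover nullB => t [w wt] h _.
  rewrite (Fc w (h w wt) t wt) /G (bigD1 w)//= big1 => [|w' w'w]; last first.
    by rewrite indicE memNset ?mule0// => w't; move: w'w; rewrite (B_disj w't wt) eqxx.
  by rewrite indicE mem_set// mule1 adde0.
have intF : P.-integrable setT F.
  apply/integrableP; split => //; have /integrableP[_] := intG.
  rewrite (ae_eq_integral (fun t => `|F t|)%E)//; [exact: measurableT_comp|exact: measurableT_comp|].
  by apply: filterS GF => t H /H ->.
split => //.
rewrite -(ae_eq_integral F G measurableT mG mF GF) /G integral_sum// -sumEFin; apply: eq_bigr => w _.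
rewrite integralZl//; last exact: integrable_indic.
rewrite integral_indic// setIT EFinM fineK ?fin_num_measure// muleC; reflexivity.
Qed.

Lemma atoms_quasi_integral (c : W -> R) (F : T -> \bar R) : measurable_fun setT F ->
  (forall w, (0 < P (B w))%E -> forall t, B w t -> F t = (c w)%:E) ->
  quasi_integral P F = (\sum_w fine (P (B w)) * c w)%:E.
Proof.
move=> mF Fc; have [intF <-] := atoms_integral mF Fc.
by have [_ ->] := quasi_integral_integrable intF.
Qed.

End atoms.

(** * Integer heights: mixtures, slopes and limits *)

Section mixtures.
Local Open Scope ereal_scope.
Context dT (T : measurableType dT) (R : realType).
Variables (P1 P2 : probability T R) (t : R).
Hypothesis t01 : (0 <= t <= 1)%R.

Let t0 : (0 <= t)%R. Proof. by case/andP: t01. Qed.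
Let t1 : (0 <= 1 - t)%R. Proof. by case/andP: t01 => _; rewrite subr_ge0. Qed.

Definition mixture : set T -> \bar R :=
  measure_add (mscale (NngNum t1) P1) (mscale (NngNum t0) P2).

HB.instance Definition _ := Measure.on mixture.

Lemma mixtureE B : mixture B = (1 - t)%:E * P1 B + t%:E * P2 B.
Proof. by rewrite /mixture measure_addE. Qed.

Let mixtureT : mixture setT = 1.
Proof. by rewrite mixtureE !probability_setT !mule1 -EFinD subrK. Qed.

HB.instance Definition _ := Measure_isProbability.Build _ _ _ mixture mixtureT.

Lemma ae_mixture (Q : set T) : {ae P1, forall x, Q x} -> {ae P2, forall x, Q x} ->
  {ae mixture, forall x, Q x}.
Proof.
move=> [B1 [m1 z1 h1]] [B2 [m2 z2 h2]]; exists (B1 `&` B2); split.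
- exact: measurableI.
- rewrite mixtureE.
  have -> : P1 (B1 `&` B2) = 0.
    by apply/eqP; rewrite -measure_le0 -z1; apply: le_measure; rewrite ?inE//; exact: measurableI.
  have -> : P2 (B1 `&` B2) = 0.
    by apply/eqP; rewrite -measure_le0 -z2; apply: le_measure; rewrite ?inE//; exact: measurableI.
  by rewrite !mule0 adde0.
- by move=> x nQ; split; [exact: h1|exact: h2].
Qed.

End mixtures.

(** * Lipschitz slopes as a polyhedron *)

Section polyhedron.
Context (R : realType) (d : nat).
Variable m0 : nat.
Hypothesis m0_gt0 : (0 < m0)%N.
Notation I := (site d).
Context (L : set I) (A : set {fset I}) (q : I -> I -> R).
Hypotheses (LD : forall x y, L x -> L y -> L (x + y)) (LN : forall x, L x -> L (- x)).
Hypothesis Lm0 : forall x, L (x *+ m0).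
Hypothesis admA : admissible_graph L A.
Hypothesis admq : admissible_quasimetric L q.
Hypothesis maxq : forall p, admissible_quasimetric L p ->
        (forall x y, A [fset x; y]%fset -> p x y <= q x y) ->
        forall x y, p x y <= q x y.

Let q0 x : q x x = 0. Proof. by have [] := admq. Qed.
Let qtri x y z : q x z <= q x y + q y z. Proof. by case: admq => _ _ + _; apply. Qed.
Let qL t x y : L t -> q (x + t) (y + t) = q x y. Proof. by case: admq => _ _ _; apply. Qed.

Notation edge := (fun a b => `[< A [fset a; b]%fset >]).

Fixpoint path_cost (x : I) (s : seq I) : R :=
  if s is y :: s' then q x y + path_cost y s' else 0.

Lemma path_cost_cat x s1 s2 : path_cost x (s1 ++ s2) = path_cost x s1 + path_cost (last x s1) s2.
Proof. by elim: s1 x => [|y s1 IH] x /=; rewrite ?add0r// IH addrA. Qed.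

Lemma path_cost_ge x s : q x (last x s) <= path_cost x s.
Proof.
by elim: s x => [|y s IH] x /=; rewrite ?q0//; apply: le_trans (qtri x y _) _; rewrite lerD2l.
Qed.

Lemma path_cost_translate x s l : L l -> path_cost (x + l) [seq y + l | y <- s] = path_cost x s.
Proof. by move=> Ll; elim: s x => //= y s IH x; rewrite qL// IH. Qed.

Lemma path_translate x s l : L l -> path edge x s -> path edge (x + l) [seq y + l | y <- s].
Proof.
move=> Ll; elim: s x => //= y s IH x /andP[/asboolP xy /IH ->]; rewrite andbT.
by apply/asboolP; exact: (edge_translate admA).
Qed.

Lemma path_drift : exists C : nat, forall x s, path edge x s ->
  forall i, (`|last x s 0%R i - x 0%R i| <= size s * C)%N.
Proof.
have [|K K0 KP] := edge_bounded m0_gt0 LN Lm0 admA (h := fun x y : I => (d1 x y)%:R : R).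
  move=> l x y _; congr (_%:R); apply: eq_bigr => i _.
  by rewrite !mxE opprD addrACA subrr addr0.
exists (Num.truncn K).+1 => x s; elim: s x => [|y s IH] x /=; first by move=> _ i; rewrite subrr.
move=> /andP[/asboolP xy /IH {}IH] i.
have /KP h := xy; have : (d1 x y < (Num.truncn K).+1)%N.
  by rewrite -(ltr_nat R); apply: le_lt_trans h (truncnS_gt K).
have : (`|x 0%R i - y 0%R i| <= d1 x y)%N by rewrite /d1 (bigD1 i)//= leq_addr.
move: (IH i) => {IH}; move: (last y s 0 i : int) (x 0%R i : int) (y 0%R i : int) (d1 x y) (Num.truncn K).+1 => a b e f g.
by rewrite mulSn; move: (size s * g)%N => p; clear; move: a b e => a b e; lia.
Qed.

(* Longer paths are cut at two sites of the same residue; the cycle in between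
   is covered by a shorter path. *)
Lemma slope_le_path_cost (C : nat) (u : 'rV[R]_d) :
  (forall x s, path edge x s -> forall i, (`|last x s 0%R i - x 0%R i| <= size s * C)%N) ->
  (forall x l, x \in box d m0 -> L l -> (forall i, (`|l 0%R i| <= m0 ^ d * C)%N) ->
     pairing u l <= q x (x + l)) ->
  forall x s, path edge x s -> L (last x s - x) -> pairing u (last x s - x) <= path_cost x s.
Proof.
move=> drift small x s; have [n] := ubnP (size s); elim: n x s => // n IH x s; rewrite ltnS => sn ps Ls.
have [sM|Ms] := leqP (size s) (m0 ^ d).
  apply: le_trans (path_cost_ge x s).
  have Lr := sub_residue Lm0 x.
  rewrite -(qL _ _ (LN Lr)) opprB addrCA subrr addr0.
  have -> : last x s + (residue m0 x - x) = residue m0 x + (last x s - x) by rewrite addrCA addrA.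
  apply: small => //; first exact: residue_box.
  by move=> i; rewrite !mxE (leq_trans (drift _ _ ps i))// leq_mul2r sM orbT.
(* There are more than m0^d sites before the last one and only m0^d residues, so two of these sites
   share a residue. The last site is left out so that the part after the cycle is nonempty and the
   cycle is strictly shorter than the path. *)
pose t := [seq residue m0 y | y <- belast x s].
have /uniqPn : ~~ uniq t.
  apply/negP => ut; have : (size t <= #|` box d m0|)%N.
    by apply: uniq_leq_size => // _ /mapP[y _ ->]; exact: residue_box.
  by rewrite size_map size_belast card_box leqNgt Ms.
move=> /(_ 0)[i [j [ij]]]; rewrite size_map size_belast => js.
rewrite !(nth_map 0) ?size_belast ?(ltn_trans ij)// => rij.
pose s1 := take i s; pose s2 := drop i (take j s); pose s3 := drop j s.
have s12 : take j s = s1 ++ s2.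
  by rewrite -(cat_take_drop i (take j s)) take_takel// ltnW.
have es : s = s1 ++ s2 ++ s3 by rewrite catA -s12 cat_take_drop.
pose a := last x s1; pose b := last a s2.
have size1 : size s1 = i by rewrite size_take (ltn_trans ij js).
have size12 : (size s1 + size s2)%N = j by rewrite -size_cat -s12 size_take js.
have nthE m : (m < size s)%N -> nth 0 (belast x s) m = last x (take m s).
  move=> ms; have -> : nth 0 (belast x s) m = nth 0 (x :: s) m.
    by rewrite lastI nth_rcons size_belast ms.
  have : (m <= size s)%N by exact: ltnW.
  by clear; elim: s x m => [|y s IH] x [|m] //= /IH ->.
have ab : residue m0 a = residue m0 b.
  move: rij; rewrite !nthE ?(ltn_trans ij)// => ->.
  by rewrite s12 last_cat.
have Lab : L (b - a).
  have -> : b - a = (b - residue m0 b) - (a - residue m0 a) by rewrite ab opprB addrA subrK.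
  by apply: LD; [exact: sub_residue|apply: LN; exact: sub_residue].
have size_s : size s = (i + size s2 + size s3)%N by rewrite {1}es !size_cat size1 addnA.
have size_s3 : (0 < size s3)%N by rewrite size_drop subn_gt0.
move: ps; rewrite es !cat_path -/a -/b => /and3P[p1 p2 p3].
have cycle : pairing u (b - a) <= path_cost a s2 by apply: IH => //; lia.
(* The tail is moved back by the displacement of the cycle, an element of [L], so that it starts
   from a at the same cost. Cutting out the cycle leaves a shorter path, to which the induction
   hypothesis applies. *)
pose s3' := [seq y - (b - a) | y <- s3].
have ba : b - (b - a) = a by rewrite opprB addrC subrK.
have p3' : path edge a s3' by rewrite -ba; apply: path_translate => //; exact: LN.
have cost3 : path_cost a s3' = path_cost b s3.
  by rewrite -(path_cost_translate b s3 (LN Lab)) ba.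
have last3 : last x (s1 ++ s3') = last x s - (b - a).
  have e3 : last a s3' = last b s3 - (b - a) by rewrite -(last_map (fun y => y - (b - a))) ba.
  by rewrite last_cat -/a e3 es !last_cat.
have Ls' : L (last x (s1 ++ s3') - x).
  by rewrite last3 addrAC; apply: LD => //; exact: LN.
have rest : pairing u (last x (s1 ++ s3') - x) <= path_cost x (s1 ++ s3').
  apply: IH => //; last by rewrite cat_path p1.
  have size_s3' : size s3' = size s3 by rewrite size_map.
  by rewrite size_cat size_s3' size1; move: size12 size_s sn ij; rewrite size1; move: (size s) (size s2) (size s3); lia.
have -> : path_cost x (s1 ++ s2 ++ s3) = path_cost x s1 + (path_cost a s2 + path_cost b s3).
  by rewrite !path_cost_cat.
rewrite -es (_ : last x s - x = last x s - (b - a) - x + (b - a)); last by rewrite addrAC subrK.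
rewrite pairingD; move: rest cycle; rewrite last3 path_cost_cat -/a cost3.
move: (pairing u _) (pairing u _) (path_cost x s1) (path_cost a s2) (path_cost b s3) => ? ? ? ? ?; lra.
Qed.

(** The constraints kept are those with base point among the residues and with displacement at most
    that of a path of m0^d edges. By [slope_le_path_cost] they bound u by the cost of every path.
    The least path cost from x is edge-Lipschitz, so maximality of [q] bounds it by [q x], and u
    along with it. *)
Lemma finite_constraints : exists S : seq (I * I), (forall p, p \in S -> L p.2) /\
  forall u : 'rV[R]_d, (forall p, p \in S -> pairing u p.2 <= q p.1 (p.1 + p.2)) ->
    lipschitz_slope L q u.
Proof.
have [C drift] := path_drift.
pose N := (m0 ^ d * C)%N.
pose cube := translate (- const_mx N%:Z : I) (box d (2 * N).+1).
exists [seq (x, l) | x <- (box d m0 : seq I), l <- [seq l <- (cube : seq I) | `[< L l >]]].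
split=> [p /allpairsP[[x l] [/= _ + ->]]|u Su].
  by rewrite mem_filter => /andP[/asboolP].
have main := slope_le_path_cost (C := C) (u := u) drift.
have {}main x s : path edge x s -> L (last x s - x) -> pairing u (last x s - x) <= path_cost x s.
  apply: main => {}x l xb Ll lN; apply: (Su (x, l)); apply/allpairsP; exists (x, l); split => //=.
  rewrite mem_filter; apply/andP; split; first exact/asboolP.
  apply/imfsetP; exists (l + const_mx N%:Z); last by rewrite addrK.
  rewrite /= mem_box; apply/forallP => i; have := lN i; rewrite -/N !mxE.
  by move: (l 0 i) => a; lia.
have inv_x x l : L l -> pairing u l <= q x (x + l).
  move=> Ll; pose S y := [set c : R | exists2 s, path edge x s & last x s = y /\ path_cost x s = c].
  have lbS y : lbound (S y) (q x y) by move=> _ [s _ [<- <-]]; exact: path_cost_ge.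
  have neS y : S y !=set0.
    have [_ _ conn _] := admA; have [s ps sy] := conn x y.
    by exists (path_cost x s), s.
  pose psi y := inf (S y).
  have psiP y c : S y c -> psi y <= c by move=> Sc; apply: ge_inf => //; exists (q x y).
  have psi_edge : edge_lipschitz A q psi.
    move=> y z yz; rewrite lerBlDr -lerBlDl; apply: lb_le_inf => // c [s ps [sy <-]].
    rewrite lerBlDl addrC; apply: psiP; exists (rcons s z).
      by rewrite rcons_path ps sy; exact/asboolP.
    by rewrite last_rcons -cats1 path_cost_cat /= sy addr0.
  have := edge_lipschitz_q LN admA admq maxq psi_edge x (x + l); apply: le_trans.
  have psix : psi x <= 0 by apply: psiP; exists [::].
  have psil : pairing u l <= psi (x + l).
    apply: lb_le_inf => // c [s ps [sl <-]].
    by have := main x s ps; rewrite sl addrAC subrr add0r; apply.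
  by rewrite (le_trans psil)// lerDl oppr_ge0.
move=> x y Lx Ly; have := inv_x x (y - x); rewrite pairingD pairingN addrCA subrr addr0; apply.
by apply: LD => //; exact: LN.
Qed.

End polyhedron.

Lemma positive_min (R : realFieldType) (T : eqType) (s : seq T) (Q : T -> R -> Prop) :
  (forall p, p \in s -> exists2 r, 0 < r & forall r', r' <= r -> Q p r') ->
  exists2 r, 0 < r & forall p, p \in s -> Q p r.
Proof.
move=> H; suff [r r0 rP] : exists2 r, 0 < r & forall p, p \in s -> forall r', r' <= r -> Q p r'.
  by exists r => // p ps; exact: rP.
elim: s H => [|p s IH] H; first by exists 1.
have [|r r0 rP] := IH; first by move=> x xs; apply: H; rewrite inE xs orbT.
have [r1 r10 r1P] := H p (mem_head _ _).
exists (Num.min r r1) => [|x]; first by rewrite lt_min r0.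
rewrite inE => /predU1P[->|xs] r'; rewrite le_min => /andP[h1 h2]; [exact: r1P|exact: rP].
Qed.

Lemma fmap_ultra (T U : Type) (f : T -> U) (F : set_system T) : UltraFilter F -> UltraFilter (f @ F).
Proof.
move=> FU; split; first exact: fmap_proper_filter.
move=> G GG FG; apply/seteqP; split => // B GB.
have [//|nB] := in_ultra_setVsetC (f @^-1` B) FU.
have GnB : G (~` B) by apply: FG.
by have [x [Bx nBx]] := filter_ex (filterI GB GnB).
Qed.

Lemma ultra_cvg_itv (R : realType) (T : Type) (F : set_system T) (f : T -> R) : UltraFilter F ->
  (forall t, 0 <= f t <= 1) -> exists l : R, f t @[t --> F] --> l.
Proof.
move=> FU f01; have := @segment_compact R 0 1; rewrite compact_ultra => /(_ (f @ F)).
case=> [||l [_ Fl]]; [exact: fmap_ultra| |by exists l].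
by apply: (filterE (F:=F)) => t; rewrite /= in_itv/=.
Qed.

Lemma ae_measure_eq dT (T : measurableType dT) (R : realType) (P : {measure set T -> \bar R}) (B C : set T) :
  measurable B -> measurable C -> {ae P, forall t, B t <-> C t} -> P B = P C.
Proof.
move=> mB mC BC; rewrite -[B]setIT -[C]setIT -!integral_indic//.
apply: ae_eq_integral => //; try by apply/measurable_EFinP; exact: measurable_indic.
apply: filterS BC => t BC _; rewrite !indicE; congr (_%:R%:E); congr nat_of_bool.
by apply/idP/idP; rewrite !inE => /BC.
Qed.

Section finite_code.
Context dT (T : measurableType dT) (R : realType) (P : probability T R).
Context (W : finType) (X : T -> W).
Hypothesis mX : forall w, measurable (X @^-1` [set w]).

Lemma finite_code_measurable (V : pred W) : measurable [set t | V (X t)].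
Proof.
rewrite (_ : [set t | V (X t)] = \bigcup_(w in [set w | V w]) X @^-1` [set w]).
  by apply: fin_bigcup_measurable => [|w _]; [exact: finite_finset|exact: mX].
by apply/seteqP; split => t /=; [move=> Vt; exists (X t)|case=> w Vw ->].
Qed.

Lemma finite_code_measure (V : pred W) :
  fine (P [set t | V (X t)]) = \sum_(w | V w) fine (P (X @^-1` [set w])).
Proof.
have mV := finite_code_measurable V.
have [||||_] := @atoms_integral _ _ _ P _ (fun w => X @^-1` [set w]) mX _ _ (fun w => (V w)%:R)
  (fun t => (\1_[set t | V (X t)] t)%:E).
- by move=> w w' t /= <-.
- by apply: aeW => t; exists (X t).
- by apply/measurable_EFinP; exact: measurable_indic.
- by move=> w _ t /= <-; rewrite indicE; congr (_%:R%:E); congr nat_of_bool; apply/idP/idP; rewrite inE.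
rewrite integral_indic// setIT => ->; rewrite [RHS]big_mkcond /fine; apply: eq_bigr => w _.
by case: (V w); rewrite ?mulr1 ?mulr0.
Qed.

End finite_code.

(** * A law on bit sequences read off one uniform variable *)

Section bit_tree.
Context (R : realType).
Notation RR := (measurableTypeR R).
Variable p : seq bool -> R.
Hypotheses (p_ge0 : forall w, 0 <= p w) (p_nil : p [::] = 1).
Hypothesis p_split : forall w, p (false :: w) + p (true :: w) = p w.

(* Words are read from right to left: the head is the last bit.  The cell of
   the word w is the interval of length p w that starts at left_end w. *)
Fixpoint left_end (w : seq bool) : R :=
  if w is b :: w' then left_end w' + (if b then p (false :: w') else 0) else 0.

Fixpoint bits (n : nat) (t : R) : seq bool :=
  if n is m.+1 then (left_end (bits m t) + p (false :: bits m t) <= t) :: bits m t else [::].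

Definition bit (i : nat) (t : R) : bool := left_end (bits i t) + p (false :: bits i t) <= t.

Lemma bitsE n t : bits n t = rev (mkseq (bit ^~ t) n).
Proof. by elim: n => [//|n IH]; rewrite mkseqS rev_rcons -IH. Qed.

(** The cell of w is cut at [left_end w + p (false :: w)], which is the threshold of the next bit.
    By [p_split] the two pieces have exactly the lengths of the extended words. *)
Lemma bits_cell w t : 0 <= t < 1 ->
  (bits (size w) t == w) = (left_end w <= t < left_end w + p w).
Proof.
move=> t01; elim: w => [|b w IH] /=; first by rewrite add0r p_nil t01.
rewrite eqseq_cons; have pw := p_split w; have [p0 p1] := (p_ge0 (false :: w), p_ge0 (true :: w)).
have [tw|nw] := eqVneq (bits (size w) t) w.
  rewrite tw eqxx in IH; have /esym/andP[h1 h2] := IH; rewrite tw andbT.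
  case: b; rewrite ?addr0; last first.
    by rewrite h1/= ltNge; case: (_ <= t).
  by rewrite -addrA pw h2 andbT eqb_id.
rewrite andbF; apply/esym/negbTE; move: nw; rewrite IH; apply: contra => /andP[].
by case: b => h1 h2; apply/andP; split; lra.
Qed.

Lemma measurable_bits n w : measurable [set t : RR | bits n t = w].
Proof.
elim: n w => [|n IH] w /=.
  have [->|wn] := eqVneq w [::]; first by rewrite (_ : [set _ | _] = setT)//; apply/seteqP; split.
  rewrite (_ : [set _ | _] = set0)//; apply/seteqP; split => // t /= h.
  by rewrite -h in wn.
case: w => [|b w]; first by rewrite (_ : [set _ | _] = set0)//; apply/seteqP; split.
rewrite (_ : [set _ | _] = [set t | bits n t = w] `&` [set t : RR | (left_end w + p (false :: w) <= t) = b]).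
  apply: measurableI => //; case: b.
    by rewrite (_ : [set _ | _] = `[left_end w + p (false :: w), +oo[%classic)//; apply/seteqP; split => t /=; rewrite in_itv/= andbT.
  rewrite (_ : [set _ | _] = `]-oo, (left_end w + p (false :: w))[%classic)//.
  by apply/seteqP; split => t /=; rewrite in_itv/= ltNge; [move=> ->|move=> /negbTE].
apply/seteqP; split => t /=.
  by move=> [+ tw]; rewrite tw => <-.
by move=> [-> ->].
Qed.

Lemma left_end_itv w : 0 <= left_end w /\ left_end w + p w <= 1.
Proof.
elim: w => [|b w [h1 h2]] /=; first by rewrite p_nil add0r.
by have := p_split w; have := p_ge0 (false :: w); have := p_ge0 (true :: w); case: b; split; lra.
Qed.

Lemma bits_law w : unif R [set t : RR | bits (size w) t = w] = (p w)%:E.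
Proof.
have mw := measurable_bits (size w) w.
rewrite -[X in unif R X]setIT -integral_indic// unifE//; last by apply/measurable_EFinP; exact: measurable_indic.
rewrite integral_indic//.
have [h1 h2] := left_end_itv w.
rewrite (_ : _ `&` _ = `[left_end w, (left_end w + p w)[%classic).
  rewrite -[LHS]/(lebesgue_measure `[left_end w, (left_end w + p w)[%classic) lebesgue_measure_itv/= lte_fin ltrDl lt_def p_ge0 andbT; case: eqVneq => [->//|_].
  by rewrite /= -EFinB addrAC subrr add0r.
apply/seteqP; split => t /=; rewrite !in_itv/=.
  by move=> [/eqP + t01]; rewrite bits_cell.
move=> h; have t01 : 0 <= t < 1 by case/andP: h => ? ?; apply/andP; split; lra.
by split => //; apply/eqP; rewrite bits_cell.
Qed.

End bit_tree.

Section gradient_measure_limit.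
Context (R : realType) (d : nat).
Notation E := (heights R IntegerHeights).
Notation RR := (measurableTypeR R).
Notation I := (site d).
Notation cfg := (config E d).
Notation full := (gradT E [set: I]).
Variable N : I -> nat.

Definition bounded_heights (phi : cfg) := forall v, (absz ((phi v : int) - (phi 0 : int))%R <= N v)%N.

(* A gradient configuration is encoded by the bits telling whether
   phi(v) - phi(0) = a, for all pairs (v, a). *)
Definition code (phi : cfg) (i : nat) : bool :=
  if @choice.unpickle (I * int)%type i is Some va then (phi va.1 : int) - (phi 0 : int) == va.2 else false.

(** For the code of a bounded configuration exactly one candidate height has its bit set. As a sum
    it makes sense for arbitrary bit sequences, and it reads finitely many bits at each site. *)
Definition decode (b : nat -> bool) : cfg := fun v =>
  \sum_(j < (2 * N v).+1) if b (choice.pickle (v, j%:Z - (N v)%:Z)) then j%:Z - (N v)%:Z else 0.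

Lemma decode_code phi v : bounded_heights phi -> decode (code phi) v = (phi v : int) - (phi 0 : int).
Proof.
move=> /(_ v); move e : ((phi v : int) - (phi 0 : int)) => a aN.
have lt : (absz (a + (N v)%:Z)%R < (2 * N v).+1)%N by lia.
have ea : (Ordinal lt : nat)%:Z - (N v)%:Z = a by rewrite /=; lia.
rewrite /decode (bigD1 (Ordinal lt))//= big1 ?addr0 => [|j jn].
  by rewrite /code choice.pickleK /= e ea eqxx.
rewrite /code choice.pickleK /= e; case: eqP => // aj; exfalso; move/eqP: jn; apply.
by apply/val_inj => /=; lia.
Qed.

Lemma decode_local (D : {fset I}) : exists n, forall b b' : nat -> bool,
  (forall i, (i < n)%N -> b i = b' i) -> forall v, v \in D -> decode b v = decode b' v.
Proof.
pose F (v : I) := (\sum_(j < (2 * N v).+1) choice.pickle (v, (j%:Z - (N v)%:Z)%R))%N.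
exists (\sum_(v <- D) F v).+1 => b b' bb v vD; rewrite /decode; apply: eq_bigr => j _.
rewrite bb// ltnS (big_rem v)//=; apply: leq_trans (leq_addr _ _).
by rewrite /F (bigD1 j)//= leq_addr.
Qed.

Definition prefix (n : nat) (b : nat -> bool) : n.-tuple bool :=
  @Tuple n bool (mkseq b n) (introT eqP (size_mkseq b n)).

Definition extend (w : seq bool) (i : nat) : bool := nth false w i.

Lemma extend_prefix n b i : (i < n)%N -> extend (prefix n b) i = b i.
Proof. by move=> ni; rewrite /extend nth_mkseq. Qed.

Lemma measurable_code i b : measurable [set phi : full | code phi i = b].
Proof.
rewrite /code; case: (choice.unpickle i) => [[v a]|]; last first.
  by case: b; [rewrite (_ : [set _ | _] = set0)//|rewrite (_ : [set _ | _] = setT)//]; apply/seteqP; split.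
have mva : measurable [set phi : full | hs_sub (phi v) (phi 0) = a :> E].
  by apply: sub_sigma_algebra; exists 0, v, [set a].
case: b.
  by rewrite (_ : [set _ | _] = [set phi : full | hs_sub (phi v) (phi 0) = a :> E])//; apply/seteqP; split => phi /= /eqP.
rewrite (_ : [set _ | _] = ~` [set phi : full | hs_sub (phi v) (phi 0) = a :> E]); first exact: measurableC.
apply/seteqP; split => phi /=; first by move=> /negbT/negP h e; apply: h; exact/eqP.
by move=> h; apply/negbTE/negP => /eqP.
Qed.

Lemma measurable_prefix_code n (w : seq bool) : measurable [set phi : full | mkseq (code phi) n = w].
Proof.
elim: n w => [|n IH] w.
  have [->|wn] := eqVneq w [::]; first by rewrite (_ : [set _ | _] = setT)//; apply/seteqP; split.
  rewrite (_ : [set _ | _] = set0)//; apply/seteqP; split => // t /= h.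
  by rewrite -h in wn.
case/lastP: w => [|w b].
  by rewrite (_ : [set _ | _] = set0)//; apply/seteqP; split => // phi /= /(congr1 size); rewrite size_mkseq.
rewrite (_ : [set _ | _] = [set phi : full | mkseq (code phi) n = w] `&` [set phi : full | code phi n = b]).
  by apply: measurableI => //; exact: measurable_code.
apply/seteqP; split => phi /=; rewrite mkseqS.
  by move=> /eqP; rewrite eqseq_rcons => /andP[/eqP -> /eqP ->].
by move=> [-> ->].
Qed.

Section limit.
Variable mu : nat -> gradient_measure R IntegerHeights d.
Hypothesis muN : forall n, {ae mu n, forall phi : full, bounded_heights phi}.
Variable F : set_system nat.
Hypothesis FU : UltraFilter F.

Definition code_law m (w : seq bool) : R :=
  fine (mu m [set phi : full | mkseq (code phi) (size w) = rev w]).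

Lemma code_law_itv m w : 0 <= code_law m w <= 1.
Proof.
have mw := measurable_prefix_code (size w) (rev w).
rewrite fine_ge0//= -lee_fin fineK ?fin_num_measure//; exact: probability_le1.
Qed.

Lemma code_law_split m w : code_law m (false :: w) + code_law m (true :: w) = code_law m w.
Proof.
have mw b := measurable_prefix_code (size w).+1 (rev (b :: w)).
rewrite /code_law /= -fineD ?fin_num_measure//; try exact: mw.
have [mf mt] := (mw false, mw true).
rewrite -measureU//.
  congr (fine (mu m _)); apply/seteqP; split => phi /=; rewrite !rev_cons !mkseqS.
    by case=> /eqP; rewrite eqseq_rcons => /andP[/eqP -> _].
  by move=> ->; case: (code phi _); [right|left].
apply/seteqP; split => // phi /= [-> /eqP].
by rewrite !rev_cons eqseq_rcons andbF.
Qed.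

(** Along the ultrafilter the probabilities of all finite words of the code converge, and the limits
    still satisfy [p_split]. Decoding the bits drawn with these limits gives [nu]; an event in a
    finite volume depends on finitely many bits, so its probability is a finite sum of word
    probabilities. *)
Lemma gradient_measure_limit : exists nu : gradient_measure R IntegerHeights d,
  forall (D : {fset I}) (B : set cfg), @measurable _ (gradT E [set` D]) B ->
    fine (mu m B) @[m --> F] --> fine (nu B).
Proof.
have /choice[p pP] : forall w, exists l : R, code_law m w @[m --> F] --> l.
  by move=> w; apply: ultra_cvg_itv => m; exact: code_law_itv.
have p_ge0 w : 0 <= p w.
  apply: (cvgr_to_ge (pP w)); apply: (filterE (F:=F)) => m; by case/andP: (code_law_itv m w).
have p_nil : p [::] = 1.
  apply: (cvg_unique _ (pP [::])) => //; apply: cvg_near_cst; apply: (filterE (F:=F)) => m.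
  rewrite /code_law (_ : [set _ | _] = setT); first by rewrite probability_setT.
  by apply/seteqP; split.
have p_split w : p (false :: w) + p (true :: w) = p w.
  apply: (cvg_unique _ _ (pP w)) => //.
  rewrite (_ : code_law^~ w = fun m => code_law m (false :: w) + code_law m (true :: w)).
    by apply: cvgD; exact: pP.
  by apply/funext => m; rewrite code_law_split.
pose X t := decode (bit p ^~ t).
have mX n : forall w : n.-tuple bool, measurable ((fun t : RR => prefix n (bit p ^~ t)) @^-1` [set w]).
  move=> w; rewrite (_ : _ @^-1` _ = [set t : RR | bits p n t = rev w]); first exact: measurable_bits.
  apply/seteqP; split => t /=; first by move=> <-; rewrite bitsE.
  by rewrite bitsE => /(congr1 rev); rewrite !revK => h; exact: val_inj.
have mXv v : measurable_fun [set: RR] (fun t => X t v : E).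
  move=> _ Y mY; rewrite setTI.
  have [n nP] := decode_local [fset v]%fset.
  rewrite (_ : _ @^-1` _ = [set t | (fun w : n.-tuple bool => `[< Y (decode (extend w) v) >]) (prefix n (bit p ^~ t))]).
    exact: (finite_code_measurable (mX n) (fun w : n.-tuple bool => `[< Y (decode (extend w) v) >])).
  apply/seteqP; split => t /=; rewrite (_ : decode (extend _) v = X t v) ?asboolE//;
    by apply: nP (fset11 v) => i; exact: extend_prefix.
exists (gradient_law (unif R) mXv) => D B mB; rewrite gradient_lawE.
have [n nP] := decode_local D.
pose V := [pred w : n.-tuple bool | `[< B (decode (extend w)) >]].
have BV b : B (decode b) = V (prefix n b).
  apply/propext; rewrite /V/= asboolE; have sg : same_grad [set` D] (decode b) (decode (extend (prefix n b))).
    by move=> x y xD yD; rewrite !(nP b (extend (prefix n b)))// => i /extend_prefix ->.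
  split; apply: (measurable_gradT_same mB) => //.
  by move=> x y xD yD; rewrite sg.
have -> : X @^-1` B = [set t | V (prefix n (bit p ^~ t))] by apply/funext => t; exact: (BV (bit p ^~ t)).
rewrite (finite_code_measure _ (mX n)).
have muE m : fine (mu m B) = \sum_(w | V w) code_law m (rev w).
  have mC : forall w : n.-tuple bool, measurable ((fun phi : full => prefix n (code phi)) @^-1` [set w]).
    move=> w; rewrite (_ : _ @^-1` _ = [set phi : full | mkseq (code phi) n = w]); first exact: measurable_prefix_code.
    by apply/seteqP; split => phi /= => [<-//|h]; exact: val_inj.
  transitivity (fine (mu m [set phi : full | V (prefix n (code phi))])).
    congr fine; apply: ae_measure_eq.
    - exact: measurable_gradT_setT mB.
    - exact: (finite_code_measurable mC V).
    - have [M [mM M0 MP]] := muN m; exists M; split => // phi; apply: contra_notP => nM.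
      have phiN : bounded_heights phi by apply: contrapT => h; apply: nM; exact: MP.
      suff : B phi <-> B (decode (code phi)) by rewrite BV.
      have sg : same_grad [set` D] phi (decode (code phi)).
        move=> x y xD yD; rewrite /= !decode_code//.
        by move: (phi x : int) (phi y : int) (phi 0 : int) => a b c; lia.
      split; apply: (measurable_gradT_same mB) => //.
      by move=> x y xD yD; rewrite sg.
  rewrite (finite_code_measure _ mC); apply: eq_bigr => w _; congr (fine (mu m _)).
  rewrite /code_law size_rev size_tuple revK.
  by apply/seteqP; split => phi /= => [<-//|h]; exact: val_inj.
rewrite (_ : (fun m => fine (mu m B)) = fun m => \sum_(w | V w) code_law m (rev w)); last exact/funext.
apply: cvg_big => [|w _]; first exact: add_continuous.
rewrite (_ : fine _ = p (rev w)); first exact: pP.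
rewrite (_ : _ @^-1` _ = [set t : RR | bits p (size (rev w)) t = rev w]) ?bits_law//.
rewrite size_rev size_tuple; apply/seteqP; split => t /=; first by move=> <-; rewrite bitsE.
by rewrite bitsE => /(congr1 rev); rewrite !revK => h; exact: val_inj.
Qed.

End limit.
End gradient_measure_limit.

(** * Integer heights: the surface tension *)

Section integer_heights.
Context (R : realType) (d : nat).
Notation E := (heights R IntegerHeights).
Notation RR := (measurableTypeR R).
Notation I := (site d).
Notation cfg := (config E d).
Implicit Types (D M : {fset I}) (phi : cfg).
Context (L : set I) (A : set {fset I}) (q : I -> I -> R).
Variables (Phi Psi Xi : potential R IntegerHeights d).
Hypothesis d2 : (2 <= d)%N.
Variable m0 : nat.
Hypotheses (m0_gt0 : (0 < m0)%N) (L0 : L 0).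
Hypotheses (LD : forall x y, L x -> L y -> L (x + y)) (LN : forall x, L x -> L (- x)).
Hypothesis Lm0 : forall x, L (x *+ m0).
Hypothesis admA : admissible_graph L A.
Hypothesis admq : admissible_quasimetric L q.
Hypothesis maxq : forall p, admissible_quasimetric L p ->
        (forall x y, A [fset x; y]%fset -> p x y <= q x y) ->
        forall x y, p x y <= q x y.
Hypothesis pgPsi : periodic_gradient_potential L Psi.
Hypothesis pgXi : periodic_gradient_potential L Xi.
Hypothesis Psi0 : forall G phi, (0 <= Psi G phi)%E.
Hypothesis PhiE : forall G phi, Phi G phi = (Psi G phi + Xi G phi)%E.
Variable nrm : R.
Hypothesis nrm0 : 0 <= nrm.
Hypothesis XiN : forall x phi, (\esum_(G in [set G : {fset I} | x \in G]) `|Xi G phi| <= nrm%:E)%E.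
Hypothesis amXi : amenable L (lower_exterior_bound Xi).
Hypothesis lipPsi : lipschitz_potential A q Psi.
Hypothesis rangePsi : finite_range Psi.
Hypothesis q_int : forall x y, q x y \is a Num.int.
Variable K1 : R.
Hypothesis K1_ge0 : 0 <= K1.
Hypothesis K1P : forall x (i : 'I_d), q x (x + delta_mx 0 i) <= K1 /\ q (x + delta_mx 0 i) x <= K1.

Definition lipschitz_config phi := forall x y, increment phi x y <= q x y.

Lemma q_bounded D : exists N : nat, forall x y, x \in D -> y \in D -> `|q x y| <= N%:R.
Proof.
pose K : R := \sum_(x <- D) \sum_(y <- D) `|q x y|.
exists (Num.truncn K).+1 => x y xD yD; apply: ltW; apply: le_lt_trans (truncnS_gt K).
apply: le_trans (ler_term_sum yD (fun z => normr_ge0 (q x z))) _.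
by apply: (ler_term_sum xD) => z; rewrite sumr_ge0.
Qed.

Lemma lipschitz_increment phi x y (N : R) : lipschitz_config phi -> `|q x y| <= N -> `|q y x| <= N ->
  `|increment phi x y| <= N.
Proof.
move=> phiq; rewrite !ler_norml => /andP[_ h1] /andP[_ h2].
by rewrite (le_trans (phiq x y))// andbT lerNl -incrementN (le_trans (phiq y x)).
Qed.

(** Lipschitz configurations show finitely many patterns on G, and the energy of each is finite
    because no edge is violated. *)
Lemma Psi_bounded_at G : exists2 c : R, 0 <= c & forall phi, lipschitz_config phi -> (Psi G phi <= c%:E)%E.
Proof.
have [G0|G0] := leqP #|` G| 1.
  by exists 0 => // phi _; have [_ _ -> //] := pgPsi.
have /fset0Pn[x0 x0G] : G != fset0 by rewrite -cardfs_gt0; apply: leq_trans G0.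
have [N qN] := q_bounded G.
pose c := \sum_(w : pattern G N) `|fine (Psi G (pattern_config R w))|.
exists c => [|phi phiq]; first by rewrite sumr_ge0.
have [|w [_ sg]] := @pattern_exists R d G N phi x0 x0G.
  by move=> x xG; apply: (lipschitz_increment phiq); exact: qN.
have [mPsi _ _ _] := pgPsi.
have e : Psi G phi = Psi G (pattern_config R w) by exact: (measurable_fun_gradT_same (mPsi G) sg).
have fin : Psi G (pattern_config R w) \is a fin_num.
  rewrite -e ge0_fin_numE// ltey; apply/eqP => /lipPsi [x [y [_ _]]].
  by rewrite ltNge phiq.
rewrite e -(fineK fin) lee_fin; apply: le_trans (ler_norm _) _.
by rewrite /c (bigD1 w)//= lerDl sumr_ge0.
Qed.

Lemma lipschitz_shift l phi : L l -> lipschitz_config phi -> lipschitz_config (Defs.shift l phi).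
Proof.
move=> Ll phiq x y; have [_ _ _ inv] := admq; rewrite -(inv l)//; exact: phiq.
Qed.

(** The integer counterpart of local boundedness. By finite range the sets of nonzero energy have
    bounded diameter, and up to shifts in [L] there are finitely many of them. *)
Lemma Psi_bounded : exists C : R, 0 <= C /\ forall x phi, lipschitz_config phi ->
  (hamiltonian Psi [fset x]%fset setT phi <= C%:E)%E.
Proof.
have [r rP] := rangePsi.
pose ball x := translate (x - const_mx r%:Z) (box d (2 * r).+1).
have inball x y : (d1 x y <= r)%N -> y \in ball x.
  move=> xy; rewrite mem_translate mem_box; apply/forallP => i.
  have : (`|x 0%R i - y 0%R i| <= r)%N by apply: leq_trans xy; rewrite /d1 (bigD1 i)//= leq_addr.
  by rewrite !mxE; move: (x 0 i) (y 0 i) => a b; lia.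
pose B0 : {fset {fset I}} := (\bigcup_(x <- box d m0) fpowerset (ball x))%fset.
pose c G := sval (cid2 (Psi_bounded_at G)).
have c0 G : 0 <= c G by rewrite /c; case: cid2.
have cP G phi : lipschitz_config phi -> (Psi G phi <= (c G)%:E)%E.
  by rewrite /c; case: cid2 => /= c' _; apply.
pose cs := \sum_(G <- B0) c G.
have cs0 : 0 <= cs by rewrite sumr_ge0.
have Psi_cs G phi : lipschitz_config phi -> (Psi G phi <= cs%:E)%E.
  move=> phiq; have [->|/fset0Pn[x xG]] := eqVneq G fset0.
    by have [_ _ ->] := pgPsi; rewrite ?cardfs0.
  have [[y [z [yG zG yz]]]|H] := pselect (exists y z, [/\ y \in G, z \in G & (r < d1 y z)%N]).
    by rewrite rP//; exists y, z.
  pose l := x - residue m0 x; have Ll : L l by exact: sub_residue.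
  pose G' := translate (- l) G.
  have GE : G = translate l G'.
    by apply/fsetP => y; rewrite !mem_translate opprK subrK.
  have -> : Psi G phi = Psi G' (Defs.shift l phi) by rewrite GE; have [_ _ _ ->] := pgPsi.
  apply: le_trans (cP _ _ (lipschitz_shift Ll phiq)) _; rewrite lee_fin.
  apply: (ler_term_sum _ c0); apply/bigfcupP; exists (residue m0 x); first by rewrite residue_box.
  rewrite fpowersetE; apply/fsubsetP => y; rewrite mem_translate opprK => yG; apply: inball.
  rewrite leqNgt; apply/negP => rlt; apply: H; exists x, (y + l); split => //.
  apply: leq_trans rlt _; rewrite /d1 leq_eqVlt; apply/orP; left; apply/eqP; apply: eq_bigr => i _.
  by congr absz; rewrite /l [(y + _) 0 i]mxE [(x - _) 0 i]mxE [(- residue m0 x) 0 i]mxE; ring.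
(* The number of subsets of a ball around x; every set through x with nonzero energy is one of
   them. *)
pose n := (2 ^ ((2 * r).+1 ^ d))%N.
exists (cs *+ n); split; first by rewrite mulrn_wge0.
move=> x phi phiq; rewrite /hamiltonian.
rewrite (@esum1 _ _ _ (fun G => ((Psi^~ phi)^\- G)%E)); last first.
  by move=> G _; rewrite funenegE; apply/max_idPr; rewrite oppe_le0.
rewrite sube0.
have card : #|` fpowerset (ball x)| = n.
  by rewrite card_fpowerset /ball /translate card_imfset ?card_box//; exact: addIr.
apply: (@le_trans _ _ (\esum_(G in [set` fpowerset (ball x)]) cs%:E)%E).
  rewrite esum_mkcond [leRHS]esum_mkcond; apply: le_esum => G _.
  case: ifPn; last by case: ifPn => // _ _; rewrite lee_fin.
  rewrite inE/= => -[_ /fset0Pn[z]]; rewrite !inE => /andP[xG /eqP zx]; rewrite {}zx in xG.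
  rewrite funeposE; case: ifPn => [_|]; first by rewrite ge_max Psi_cs// lee_fin.
  move=> /negP nG; suff -> : Psi G phi = 0%E by rewrite maxxx.
  apply: rP; apply: contrapT => H; apply: nG; rewrite inE /= fpowersetE.
  apply/fsubsetP => y yG; apply: inball; rewrite leqNgt; apply/negP => rlt.
  by apply: H; exists x, y.
rewrite esum_fset// fsbig_finite//= set_fsetK sumEFin lee_fin.
by rewrite big_const_seq count_predT iter_addr_0 -card.
Qed.

(** The integrality of [q] acts here: the floor is monotone and commutes with adding the integer
    [q x y]. *)
Lemma floor_lipschitz (g : I -> R) (t : R) x y : g y - g x <= q x y ->
  (Num.floor (g y + t) - Num.floor (g x + t))%:~R <= q x y.
Proof.
have /intrP[m qm] := q_int x y; rewrite qm => h.
have : Num.floor (g y + t) <= Num.floor (g x + t + m%:~R) by apply: le_floor; lra.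
by rewrite (@floorDrz R (g x + t) m%:~R) ?intr_int// intrKfloor ler_int lerBlDl.
Qed.

(** * Rounding a quasi-periodic function with a uniform offset *)

Section rounding.
Variables (g : I -> R) (u : 'rV[R]_d).
Hypothesis gq : forall x y, g y - g x <= q x y.
Hypothesis gu : quasi_periodic L u g.

Definition rounding (t : RR) : cfg := fun x => Num.floor (g x + t).

Lemma measurable_rounding x : measurable_fun [set: RR] (fun t => rounding t x : E).
Proof.
move=> _ Y _; rewrite setTI.
rewrite (_ : _ @^-1` Y = \bigcup_(z in Y) `[(z%:~R - g x), (z%:~R + 1 - g x)[%classic); last first.
  apply/seteqP; split => [t Yt|t [z Yz]] /=.
    exists (Num.floor (g x + t)) => //=; rewrite in_itv /=.
    by have := floor_itv (g x + t); rewrite intrD; lra.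
  rewrite in_itv /= => h; rewrite /rounding (@floor_def _ _ z)// intrD; lra.
rewrite bigcup_mkcond; apply: countable_bigcupT_measurable => [|z]; first exact: countableP.
by case: ifP => _; [exact: measurable_itv|exact: measurable0].
Qed.

Definition rounding_measure : gradient_measure R IntegerHeights d :=
  gradient_law (unif R) measurable_rounding.

Lemma rounding_lipschitz t : lipschitz_config (rounding t).
Proof. by move=> x y; exact: floor_lipschitz. Qed.

(** By periodicity the offset may be taken in [0, 1). The shifted unit interval is then cut at 1 and
    its right piece moved back by one period. *)
Lemma integral_periodic (f : RR -> \bar R) (c : R) : measurable_fun setT f ->
  (forall t, (0 <= f t)%E) -> (forall t, f (t + 1) = f t) ->
  (\int[unif R]_t f ((t + c)%R : RR) = \int[unif R]_t f t)%E.
Proof.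
move=> mf f0 f1.
have fn (n : nat) t : f (t + n%:R) = f t.
  by elim: n t => [|n IH] t; rewrite ?addr0// -natr1 addrA f1.
have fz (z : int) t : f (t + z%:~R) = f t.
  by case: z => n; [exact: fn|rewrite NegzE mulrNz -(fn n.+1) subrK].
pose e := c - (Num.floor c)%:~R.
have /andP[e0 e1] : 0 <= e < 1 by have := floor_itv c; rewrite /e intrD; lra.
have mfe : measurable_fun [set: RR] (fun t : RR => f ((t + e)%R : RR)).
  by apply: (measurableT_comp mf); apply: measurable_funD.
have -> : (\int[unif R]_t f ((t + c)%R : RR) = \int[unif R]_t f ((t + e)%R : RR))%E.
  by apply: eq_integral => t _; rewrite -(fz (Num.floor c) (t + e)) /e addrA subrK.
rewrite !unifE//.
have := integral_affine_itv e 0 1 (@ltr01 R) mf f0.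
rewrite invr1 mul1e mulr0 mulr1 add0r => h.
transitivity (\int[@lebesgue_measure R]_(t in `[e, (1 + e)%R[) f t)%E.
  by rewrite -h; apply: eq_integral => t _; rewrite mul1r.
have e1' : e <= 1 by exact: ltW.
have sp (a b c' : R) : a <= b -> b <= c' ->
    (\int[@lebesgue_measure R]_(t in `[a, c'[) f t = \int[@lebesgue_measure R]_(t in `[a, b[) f t + \int[@lebesgue_measure R]_(t in `[b, c'[) f t)%E.
  move=> ab bc; rewrite -ge0_integral_setU//=.
  - by congr (integral _ _ _); rewrite -itv_bndbnd_setU//= bnd_simp.
  - exact: measurable_funTS.
  - apply/disj_setPS => t /= []; rewrite !in_itv/=; lra.
rewrite (sp e 1 (1 + e))//; last by rewrite lerDl.
rewrite (sp 0 e 1)// addeC; congr (_ + _)%E.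
have := integral_affine_itv 1 0 e (@ltr01 R) mf f0.
rewrite invr1 mul1e mulr0 mul1r add0r addrC => <-.
by apply: eq_integral => t _; rewrite mul1r f1.
Qed.

(** Shifting by l adds the constant u(l) to the offset, and raising the offset by 1 raises all
    heights by 1. A gradient event is therefore a periodic function of the offset. *)
Lemma rounding_shift_invariant : shift_invariant L rounding_measure.
Proof.
apply: gradient_law_shift_invariant => l D B Ll mB.
have mBt : measurable [set t : RR | B (rounding t)].
  by have := @measurable_to_gradT R IntegerHeights d _ _ _ measurable_rounding [set` D] measurableT B mB; rewrite setTI.
pose f (t : RR) : \bar R := (\1_[set t : RR | B (rounding t)] t)%:E.
have mf : measurable_fun [set: RR] f by apply/measurable_EFinP; exact: measurable_indic.
have same t t' c : (forall x, rounding t' x = rounding t x + c :> int) -> B (rounding t') <-> B (rounding t).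
  move=> tt'; split; apply: (measurable_gradT_same mB) => x y _ _ /=; rewrite !tt'; lia.
have shiftE t : Defs.shift l (rounding t) = rounding (t + pairing u l).
  by apply/funext => x; rewrite /Defs.shift /rounding gu// addrAC addrA.
have f1 t : f (t + 1) = f t.
  rewrite /f !indicE; congr (_%:R%:E); congr nat_of_bool.
  have s1 : B (rounding (t + 1)) <-> B (rounding t).
    by apply: (same t (t + 1) 1) => x; rewrite /rounding addrA floorDrz ?floor1// int_num1.
  by apply/idP/idP; rewrite !inE /= => /s1.
transitivity (\int[unif R]_t f ((t + pairing u l)%R : RR))%E; last first.
  rewrite (integral_periodic (pairing u l) mf _ f1); last by move=> t; rewrite lee_fin.
  by rewrite /f integral_indic// setIT.
rewrite -[LHS]/(unif R [set t | B (Defs.shift l (rounding t))]).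
have mBs : measurable [set t : RR | B (Defs.shift l (rounding t))].
  rewrite (_ : [set t | _] = (fun t : RR => (t + pairing u l)%R : RR) @^-1` [set t : RR | B (rounding t)]).
    by rewrite -[X in measurable X]setTI; apply: measurable_funD.
  by apply/seteqP; split => t /=; rewrite shiftE.
rewrite -[X in unif R X]setIT -(integral_indic _ measurableT mBs); apply: eq_integral => t _.
rewrite /f !indicE; congr (_%:R%:E); congr nat_of_bool.
by apply/idP/idP; rewrite !inE /= shiftE.
Qed.

Lemma unif_ae : {ae unif R, forall t : RR, 0 <= t < 1}.
Proof.
have m1 : measurable (~` `[0%R, 1%R[%classic : set RR) by apply: measurableC.
exists (~` `[0%R, 1%R[%classic); split => //.
rewrite -[X in unif R X]setIT -integral_indic// unifE//; last first.
  by apply/measurable_EFinP; exact: measurable_indic.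
by rewrite integral0_eq// => t h; rewrite indicE memNset//=; apply.
Qed.

Let frac_part (a : R) : R := a - (Num.floor a)%:~R.
Let high (a : R) : set RR := `[(1 - frac_part a)%R, +oo[%classic.

Lemma frac_part_itv a : 0 <= frac_part a < 1.
Proof. by have := floor_itv a; rewrite /frac_part intrD; lra. Qed.

Lemma measurable_high a : measurable (high a). Proof. exact: measurable_itv. Qed.

Lemma unif_high (a : R) : unif R (high a) = (frac_part a)%:E.
Proof.
have /andP[e0 e1] := frac_part_itv a; have mh := measurable_high a.
rewrite -[X in unif R X]setIT -(integral_indic _ measurableT mh) unifE//; last first.
  by apply/measurable_EFinP; exact: measurable_indic.
rewrite integral_indic// (_ : _ `&` _ = `[1 - frac_part a, 1[%classic).
  rewrite -[LHS]/(lebesgue_measure `[1 - frac_part a, 1[%classic) lebesgue_measure_itv/= lte_fin.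
  by case: ifP => h; rewrite -?EFinB; congr EFin; move: h; lra.
by apply/seteqP; split => t; rewrite /high /= !in_itv/= ?andbT; lra.
Qed.

(** The set [high a] has probability equal to the fractional part of a, so the rounding of a + t has
    mean exactly a. Rounding thus preserves the slope. *)
Lemma floor_high (a t : R) : 0 <= t < 1 ->
  (Num.floor (a + t))%:~R = (Num.floor a)%:~R + \1_(high a) t :> R.
Proof.
have /andP[e0 e1] := frac_part_itv a.
move=> t01; rewrite indicE; case: (boolP (_ \in _)); rewrite ?notin_setE ?inE /high /= in_itv /= andbT.
  move=> h; rewrite (@floor_def _ _ (Num.floor a + 1)) ?intrD//.
  by rewrite /frac_part in e0 e1 h; lra.
move=> /negP; rewrite -ltNge addr0 => h; congr (_%:~R); apply: floor_def; rewrite intrD.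
by rewrite /frac_part in e0 e1 h; lra.
Qed.

Lemma rounding_measure_has_slope : has_slope L rounding_measure u.
Proof.
apply: (@gradient_law_has_slope _ _ _ _ _ _ _ _ L u (fun x y => Num.max (q x y) (q y x))).
  move=> t x y; rewrite ler_norml lerNl -incrementN !le_max !rounding_lipschitz orbT//.
move=> l Ll.
have mi : measurable_fun [set: RR] (fun t => increment (rounding t) 0 l).
  have mg := @measurable_to_gradT R IntegerHeights d _ _ _ measurable_rounding setT.
  exact: (measurableT_comp (measurable_increment 0 l) mg).
have ind a : (unif R).-integrable setT (fun t : RR => (\1_(high a) t)%:E).
  apply: measurable_bounded_integrable => //.
  - exact: le_lt_trans (probability_le1 (unif R) measurableT) (ltry _).
  - by apply: measurable_indic; exact: measurable_high.
  - exists 1; split; first exact: num_real.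
    by move=> r r1 t _; rewrite /= indicE ger0_norm//; apply: le_trans (ltW r1); case: (_ \in _).
transitivity (\int[unif R]_t (((Num.floor (g l))%:~R - (Num.floor (g 0))%:~R)%:E +
    ((\1_(high (g l)) t)%:E - (\1_(high (g 0)) t)%:E)))%E.
  apply: ae_eq_integral => //.
  - exact/measurable_EFinP.
  - apply: emeasurable_funD; first exact: measurable_cst.
    by apply: emeasurable_funB; apply/measurable_EFinP; apply: measurable_indic; exact: measurable_high.
  - apply: filterS unif_ae => t t01 _; rewrite -EFinB -EFinD; congr EFin.
    by rewrite /increment /= /rounding intrB !floor_high//; lra.
rewrite integralD//; last 2 first.
- exact: finite_measure_integrable_cst.
- exact: integrableB.
rewrite integralB// !integral_indic ?setIT//; do ?exact: measurable_high.
rewrite [X in (_ + X)%E](_ : _ = (frac_part (g l))%:E - (frac_part (g 0))%:E)%E; last by congr (_ - _)%E; exact: unif_high.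
rewrite [X in (X + _)%E](_ : _ = ((Num.floor (g l))%:~R - (Num.floor (g 0))%:~R)%:E); last first.
  rewrite integral_cst// -[RHS]mule1; congr (_ * _)%E; exact: probability_setT.
rewrite -EFinB -EFinD /frac_part; congr EFin.
by have := gu 0 Ll; rewrite add0r => ->; lra.
Qed.

End rounding.

Lemma integer_free_energy_bound : exists C : R, 0 <= C /\
  forall u, lipschitz_slope L q u -> (surface_tension L Phi u <= C%:E)%E.
Proof.
have [C0 [C00 C0P]] := Psi_bounded.
exists (C0 + nrm); split; first exact: addr_ge0.
move=> u uP; pose g := slope_ext L q u 0.
have gq x y : g y - g x <= q x y by exact: slope_ext_lip.
have gu : quasi_periodic L u g by exact: slope_ext_periodic.
pose mu := rounding_measure g.
have mul : ae_lipschitz q mu by apply: gradient_law_ae_lipschitz => t; exact: rounding_lipschitz.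
have mu_inv : shift_invariant L mu by exact: rounding_shift_invariant gu.
have hslope : has_slope L mu u by exact: rounding_measure_has_slope.
apply: le_trans (_ : (specific_free_energy Phi mu <= _)%E).
  by apply: ereal_inf_lbound; exists mu.
apply: (specific_free_energy_le d2 m0_gt0 Lm0 admq pgPsi pgXi Psi0 PhiE XiN amXi K1_ge0 K1P mu_inv mul).
move=> D D0.
(* The entropy is bounded by ln 1 = 0, since the law is dominated by the reference measure with
   constant 1. *)
rewrite -[X in (_ <= X%:E)%E]add0r -(ln1 R).
apply: (free_energy_le pgPsi pgXi Psi0 PhiE XiN mul D0) => //.
- move=> B mB; rewrite mul1e.
  have [->|/set0P[phi Bphi]] := eqVneq B set0; first by rewrite measure0.
  apply: le_trans (reference_ge1 D0 mB Bphi); apply: probability_le1.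
  exact: measurable_gradT_sub mB.
- have mB : measurable [set phi : gradT E [set: I] | (ham Phi D phi <= ((C0 + nrm) *+ #|` D|)%:E)%E].
    rewrite -[X in measurable X]setTI; apply: emeasurable_fun_infty_c => //.
    exact: (lower_integrable_ham pgPsi pgXi Psi0 PhiE XiN D mu).1.
  have ae := @gradient_law_ae R IntegerHeights d _ _ (unif R) _ (measurable_rounding g) _ mB; apply: ae => t /=.
  apply: (ham_le pgXi Psi0 PhiE XiN) => //.
    by move=> G phi; rewrite leey.
  by move=> x xD; apply: C0P; exact: rounding_lipschitz.
Qed.

(** * The free energy of a box as a finite entropy sum *)

Section pattern_formula.
Variables (D : {fset I}) (x0 : I) (N : nat).
Hypotheses (x0D : x0 \in D) (qN : forall x y, x \in D -> y \in D -> `|q x y| <= N%:R).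
Notation conf := (@pattern_config R d D N).

(** Patterns that differ by a constant have the same increments; asking for height zero at [x0]
    selects one of them, so that the atoms are disjoint. *)
Definition atom (w : pattern D N) : set cfg :=
  [set phi | conf w x0 = 0 /\ same_grad [set` D] phi (conf w)].

Definition weight_of (mu : gradient_measure R IntegerHeights d) w : R := fine (mu (atom w)).

Lemma measurable_atom w : @measurable _ (gradT E [set` D]) (atom w).
Proof.
have [c0|c0] := pselect (conf w x0 = 0); last first.
  by rewrite (_ : atom w = set0)//; apply/seteqP; split => phi // -[].
rewrite (_ : atom w = [set phi | same_grad [set` D] phi (conf w)]); first exact: measurable_same_grad.
by apply/seteqP; split => phi //= -[].
Qed.

Lemma atom_disjoint w w' phi : atom w phi -> atom w' phi -> w = w'.
Proof.
move=> [w0 sw] [w'0 sw']; apply/ffunP => x; apply/val_inj => /=.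
have := pattern_configE R w x; have := pattern_configE R w' x.
have := sw _ _ x0D (valP x); have := sw' _ _ x0D (valP x); rewrite /= w0 w'0.
by move: (phi _) (phi x0) (conf w _) (conf w' _) => a b c e; lia.
Qed.

Lemma atom_cover phi : lipschitz_config phi -> exists w, atom w phi.
Proof.
move=> phiq; apply: (@pattern_exists R d D N phi x0 x0D) => x xD.
by apply: (lipschitz_increment phiq); exact: qN.
Qed.

Section measure.
Variable mu : gradient_measure R IntegerHeights d.
Hypothesis mul : ae_lipschitz q mu.

Lemma measurable_atomT w : @measurable _ (gradT E setT) (atom w).
Proof. exact: measurable_gradT_setT (measurable_atom w). Qed.

Lemma atom_ae_cover : {ae mu, forall phi : gradT E [set: I], exists w, atom w phi}.
Proof. by apply: filterS mul => phi; exact: atom_cover. Qed.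

Lemma atom_lipschitz w : (0 < mu (atom w))%E -> exists2 phi, atom w phi & lipschitz_config phi.
Proof.
move=> w0; apply: contrapT => H.
have [M [mM M0 MP]] := mul.
have : (mu (atom w) <= mu M)%E.
  apply: le_measure; rewrite ?inE//; first exact: measurable_atomT.
  by move=> phi wphi; apply: MP => /= phiq; apply: H; exists phi.
by rewrite M0 leNgt w0.
Qed.

Lemma weight_ge0 w : 0 <= weight_of mu w. Proof. exact: fine_ge0. Qed.

Lemma integral_increment x : x \in D ->
  mu.-integrable setT (fun phi : gradT E [set: I] => (increment phi x0 x)%:E) /\
  (\int[mu]_phi (increment phi x0 x)%:E)%E =
  (\sum_w weight_of mu w * (conf w x)%:~R)%:E.
Proof.
move=> xD.
apply: (atoms_integral measurable_atomT atom_disjoint atom_ae_cover).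
  by apply/measurable_EFinP; exact: (@measurable_increment R IntegerHeights d x0 x).
move=> w _ phi [w0 sw]; have := sw _ _ x0D xD; rewrite /increment /= w0 subr0 => ->.
by [].
Qed.

Lemma ham_pattern w : (0 < mu (atom w))%E -> ham Phi D (conf w) \is a fin_num.
Proof.
move=> w0; have [phi [_ sw] phiq] := atom_lipschitz w0.
have <- : ham Phi D phi = ham Phi D (conf w).
  exact: (measurable_fun_gradT_same (measurable_ham pgPsi pgXi PhiE (D:=D)) sw).
have [C [C0 CP]] := Psi_bounded.
have h1 := ham_ge pgXi Psi0 PhiE XiN D phi.
have h2 : (ham Phi D phi <= ((C + nrm) *+ #|` D|)%:E)%E.
  by apply: (ham_le pgXi Psi0 PhiE XiN) => //; [move=> *; exact: leey|move=> x _; exact: CP].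
by rewrite fin_numElt (lt_le_trans (ltNyr _) h1) (le_lt_trans h2 (ltry _)).
Qed.

Lemma free_energy_pattern : free_energy Phi D mu =
  (entropy_sum (weight_of mu) (fun w => fine (ham Phi D (conf w))))%:E.
Proof.
have D0 : D != fset0 by apply/fset0Pn; exists x0.
rewrite (free_energyE pgPsi pgXi Psi0 PhiE XiN (ae_lipschitz_incP mul) D0) /entropy_sum big_split/= EFinD.
congr (_ + _)%E; last first.
  apply: (atoms_quasi_integral measurable_atomT atom_disjoint atom_ae_cover).
    apply: (@measurable_fun_gradT_incl _ _ _ [set` D]) => //.
    exact: measurable_ham pgPsi pgXi PhiE D.
  move=> w w0 phi [_ sw]; rewrite fineK ?ham_pattern//.
  exact: (measurable_fun_gradT_same (measurable_ham pgPsi pgXi PhiE (D:=D)) sw).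
have le_ref (B : set cfg) : @measurable _ (gradT E [set` D]) B ->
    (marginal D mu B <= 1%:E * gradient_reference E D B)%E.
  move=> mB; rewrite mul1e; have [->|/set0P[phi Bphi]] := eqVneq B set0; first by rewrite measure0.
  by apply: le_trans (reference_ge1 D0 mB Bphi); apply: probability_le1.
have dom : marginal D mu `<< gradient_reference E D by exact: (@bounded_dominates _ _ R (marginal D mu) (gradient_reference E D) 1 le_ref).
rewrite /ent relative_entropyE//.
set s := Radon_Nikodym_SigmaFinite.f _ _.
have ms : measurable_fun [set: gradT E [set` D]] s.
  exact: measurable_int (Radon_Nikodym_SigmaFinite.f_integrable dom).
(* The density is constant on an atom, and the atom has reference mass one, so the density equals
   the probability of the atom. *)
have sE w phi : atom w phi -> s phi = mu (atom w).
  move=> wphi; have mw := measurable_atom w.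
  have ref1 : gradient_reference E D (atom w) = 1%E.
    apply/eqP; rewrite eq_le (reference_ge1 D0 mw wphi) andbT.
    by apply: (reference_le1 (c := conf w) x0D mw) => ? [].
  rewrite -(@marginalE R IntegerHeights d D) (Radon_Nikodym_SigmaFinite.f_integral dom)//.
  rewrite (eq_integral (cst (s phi))).
    have mw' : measurable (atom w : set (gradT E [set` D])) := mw.
    rewrite integral_cst// -[LHS]mule1; congr (_ * _)%E; exact: esym ref1.
  move=> psi; rewrite inE => -[_ sw].
  apply: (measurable_fun_gradT_same ms) => x y xD yD.
  by rewrite (sw x y xD yD) -((proj2 wphi) x y xD yD).
apply: (@atoms_quasi_integral _ _ _ (marginal D mu) _ atom measurable_atom atom_disjoint) => //.
- have mU : @measurable _ (gradT E [set` D]) (~` \bigcup_w atom w).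
    by apply: measurableC; apply: fin_bigcup_measurable => [|w _]; [exact: finite_finset|exact: measurable_atom].
  exists (~` \bigcup_w atom w); split => //; last first.
    by move=> phi /= H [w _ wphi]; apply: H; exists w.
  rewrite marginalE; apply: measure_negligible; first exact: measurable_gradT_setT mU.
  have := atom_ae_cover; apply: negligibleS => phi /= H [w wphi]; apply: H; by exists w.
- exact: measurable_lne_comp.
- move=> w; rewrite marginalE => w0 phi wphi; rewrite (sE w phi wphi) /weight_of.
  have := fin_num_measure mu _ (measurable_atomT w); move: w0.
  by move=> w0 fw; rewrite -[in LHS](fineK fw) lne_EFin// -lte_fin fineK.
Qed.

End measure.
End pattern_formula.

Let d0 : (0 < d)%N. Proof. exact: ltn_trans d2. Qed.

Lemma free_energy_fin (mu : gradient_measure R IntegerHeights d) D :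
  ae_lipschitz q mu -> D != fset0 -> free_energy Phi D mu \is a fin_num.
Proof.
move=> mul /fset0Pn[x0 x0D]; have [N qN] := q_bounded D.
by rewrite (free_energy_pattern x0D qN mul).
Qed.

Lemma specific_free_energy_gtNy (mu : gradient_measure R IntegerHeights d) :
  shift_invariant L mu -> ae_lipschitz q mu -> (-oo < specific_free_energy Phi mu)%E.
Proof.
move=> inv mul; have b0 : box d m0 != fset0 by apply/fset0Pn; exists 0; exact: box0.
have fe := free_energy_fin mul b0.
have [_ h] := specific_free_energyP d2 m0_gt0 Lm0 admq pgPsi pgXi Psi0 PhiE XiN amXi K1_ge0 K1P inv mul.
by apply: lt_le_trans (ltNyr _) (h m0 (fine (free_energy Phi (box d m0) mu)) m0_gt0 (dvdnn _) _); rewrite fineK.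
Qed.

(** * Convexity along mixtures *)

Section mixture_of_gradient_measures.
Variables (mu1 mu2 : gradient_measure R IntegerHeights d) (t : R).
Hypothesis t01 : 0 < t < 1.
Hypotheses (mul1 : ae_lipschitz q mu1) (mul2 : ae_lipschitz q mu2).
Hypotheses (inv1 : shift_invariant L mu1) (inv2 : shift_invariant L mu2).

Let t01' : 0 <= t <= 1. Proof. by case/andP: t01 => /ltW -> /ltW. Qed.

Let mix : gradient_measure R IntegerHeights d := mixture mu1 mu2 t01'.

Let mix_lipschitz : ae_lipschitz q mix.
Proof. exact: ae_mixture. Qed.

Let mix_inv : shift_invariant L mix.
Proof. by move=> x B Lx mB; rewrite /mix /= !mixtureE inv1// inv2. Qed.

Let mix_weight D x0 N (w : pattern D N) :
  weight_of x0 mix w = (1 - t) * weight_of x0 mu1 w + t * weight_of x0 mu2 w.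
Proof.
rewrite /weight_of /mix /= mixtureE.
have m := @measurable_atomT D x0 N w.
have := fin_num_measure mu1 _ m; have := fin_num_measure mu2 _ m.
by move=> f2 f1; rewrite fineD ?fineM// fin_numM.
Qed.

Let mix_free_energy D : D != fset0 ->
  (free_energy Phi D mix <= (1 - t)%:E * free_energy Phi D mu1 + t%:E * free_energy Phi D mu2)%E.
Proof.
move=> /fset0Pn[x0 x0D]; have [N qN] := q_bounded D.
have fe := free_energy_pattern x0D qN.
rewrite (fe _ mix_lipschitz) (fe _ mul1) (fe _ mul2) -!EFinM -EFinD lee_fin.
rewrite (_ : weight_of x0 mix = fun w => (1 - t) * weight_of x0 mu1 w + t * weight_of x0 mu2 w); last first.
  by apply/funext => w; exact: mix_weight.
by apply: entropy_sum_convex => // w; exact: weight_ge0.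
Qed.

Let mix_slope u1 u2 : has_slope L mu1 u1 -> has_slope L mu2 u2 ->
  has_slope L mix ((1 - t) *: u1 + t *: u2).
Proof.
move=> [_ s1] [_ s2].
split => [x y|x Lx].
  have [N qN] := q_bounded [fset x; y]%fset.
  by have [] := integral_increment (fset21 x y) qN mix_lipschitz (fset22 x y).
have [N qN] := q_bounded [fset 0; x]%fset.
have h mu mul := proj2 (@integral_increment _ 0 N (fset21 0 x) qN mu mul x (fset22 0 x)).
rewrite h//; move: (s1 _ Lx) (s2 _ Lx); rewrite !h// => -[e1] -[e2].
rewrite pairingDl !pairingZl -e1 -e2 !mulr_sumr -big_split/=; congr EFin; apply: eq_bigr => w _.
by rewrite mix_weight; ring.
Qed.

Lemma specific_free_energy_convex u1 u2 : has_slope L mu1 u1 -> has_slope L mu2 u2 ->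
  (surface_tension L Phi ((1 - t) *: u1 + t *: u2) <=
   (1 - t)%:E * specific_free_energy Phi mu1 + t%:E * specific_free_energy Phi mu2)%E.
Proof.
move=> s1 s2; apply: le_trans (_ : (specific_free_energy Phi mix <= _)%E).
  by apply: ereal_inf_lbound; exists mix; split => //; exact: mix_slope.
have cv mu inv mul := proj1 (@specific_free_energyP R IntegerHeights d L q Phi Psi Xi d2 m0 m0_gt0 Lm0 admq pgPsi pgXi Psi0 PhiE nrm XiN amXi K1 K1_ge0 K1P mu inv mul).
have cm := cv mix mix_inv mix_lipschitz; have cm1 := cv mu1 inv1 mul1; have cm2 := cv mu2 inv2 mul2.
have cR : ((1 - t)%:E * (((n%:R : R) ^- d)%:E * free_energy Phi (box d n) mu1) +
    t%:E * (((n%:R : R) ^- d)%:E * free_energy Phi (box d n) mu2))%E @[n --> \oo] -->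
    ((1 - t)%:E * specific_free_energy Phi mu1 + t%:E * specific_free_energy Phi mu2)%E.
  apply: cvgeD; [|exact: cvgeZl cm1|exact: cvgeZl cm2].
  (* Neither specific free energy is -oo, so that the sum of the two limits is well defined. *)
  have := specific_free_energy_gtNy inv1 mul1; have := specific_free_energy_gtNy inv2 mul2.
  case/andP: t01 => t0 t1; have {}t1 : 0 < 1 - t by rewrite subr_gt0.
  by case: (specific_free_energy Phi mu1) => [a| |]; case: (specific_free_energy Phi mu2) => [b| |] // _ _;
    rewrite ?gt0_muley ?lte_fin// -?EFinM.
rewrite -(cvg_lim _ cm)// -(cvg_lim _ cR)//; apply: lee_lim; [by apply/cvg_ex; eexists; exact: cm|by apply/cvg_ex; eexists; exact: cR|].
near=> n; have n0 : (0 < n)%N by near: n; exact: nbhs_infty_gt.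
have nd : 0 <= (n%:R ^- d : R) by rewrite invr_ge0 exprn_ge0.
have b0 : box d n != fset0 by apply/fset0Pn; exists 0; exact: box0.
rewrite !(muleCA _ (n%:R ^- d)%:E) -muleDr//; first by rewrite lee_wpmul2l//; exact: mix_free_energy.
by rewrite fin_num_adde_defr// fin_numM// free_energy_fin.
Unshelve. all: by end_near. Qed.

End mixture_of_gradient_measures.

(* u = (1 - t) u0 + t v with t fixed and v still Lipschitz, since finitely many
   constraints define the Lipschitz slopes; the surface tension at v is bounded. *)
Lemma surface_tension_usc u0 (a : R) : lipschitz_slope L q u0 -> (surface_tension L Phi u0 < a%:E)%E ->
  exists2 r : R, 0 < r & forall u, lipschitz_slope L q u ->
    (forall i, `|u 0 i - u0 0 i| <= r) -> (surface_tension L Phi u <= a%:E)%E.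
Proof.
have nm := near_minimizer d2 m0_gt0 LN Lm0 admA admq maxq pgPsi pgXi Psi0 PhiE nrm0 XiN lipPsi K1_ge0.
move=> u0K /nm[mu [inv mul sl]].
have := specific_free_energy_gtNy inv mul.
case E1 : (specific_free_energy Phi mu) => [s| |] // _; rewrite lte_fin => sa.
have [C [C0 CP]] := integer_free_energy_bound.
(* The weight t is small enough for (1 - t) * s + t * (C + 1) to stay below a, and below 1; b is
   made positive by the added 1. *)
pose b := `|C + 1 - s| + 1.
have b0 : 0 < b by rewrite ltr_wpDl.
pose t := Num.min (2^-1) ((a - s) / b).
have t0 : 0 < t by rewrite /t lt_min invr_gt0 ltr0n divr_gt0// subr_gt0.
have t1 : t < 1 by rewrite /t gt_min invf_lt1 ?ltr1n.
have tb : t * (C + 1 - s) <= a - s.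
  apply: (@le_trans _ _ (t * b)); first by rewrite ler_pM2l// /b (le_trans (ler_norm _))// lerDl.
  by rewrite -ler_pdivlMr// /t ge_min lexx orbT.
have [S [SL SP]] := finite_constraints m0_gt0 LD LN Lm0 admA admq maxq.
pose nl (l : I) : R := \sum_i `|(l 0 i)%:~R|.
have nl0 l : 0 <= nl l by rewrite sumr_ge0.
(* A constraint tight at u0 holds at v because it holds at u, and v lies on the ray from u0 through
   u. A slack one tolerates the displacement of v, which is that of u divided by t; finiteness of
   [S] gives a common radius. *)
have [r r0 rP] : exists2 r, 0 < r & forall p, p \in S ->
    pairing u0 p.2 = q p.1 (p.1 + p.2) \/ pairing u0 p.2 + t^-1 * (r * nl p.2) <= q p.1 (p.1 + p.2).
  apply: (@positive_min _ _ S (fun p r => pairing u0 p.2 = q p.1 (p.1 + p.2) \/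
     pairing u0 p.2 + t^-1 * (r * nl p.2) <= q p.1 (p.1 + p.2))) => p pS.
  have := lipschitz_slope_from L0 LD admq p.1 u0K (SL p pS).
  rewrite le_eqVlt => /predU1P[e|lt]; first by exists 1 => // r' _; left.
  have sp : 0 < q p.1 (p.1 + p.2) - pairing u0 p.2 by rewrite subr_gt0.
  have nl1 : 0 < nl p.2 + 1 by rewrite ltr_wpDl.
  exists (t * (q p.1 (p.1 + p.2) - pairing u0 p.2) / (nl p.2 + 1)); first by rewrite divr_gt0// mulr_gt0.
  move=> r'; rewrite ler_pdivlMr// => h; right; rewrite -lerBrDl ler_pdivrMl//.
  have [r'0|r'0] := leP 0 r'; first by apply: le_trans h; rewrite ler_wpM2l// lerDl.
  apply: (@le_trans _ _ 0); first by rewrite mulr_le0_ge0// ltW.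
  by rewrite mulr_ge0// ltW.
exists r => // u uK ur; pose v := u0 + t^-1 *: (u - u0).
have uv : u = (1 - t) *: u0 + t *: v.
  apply/rowP => i; rewrite /v !mxE mulrDr mulrA divff ?gt_eqF// mul1r; ring.
have vK : lipschitz_slope L q v.
  apply: SP => p pS; rewrite /v pairingDl pairingZl.
  have [e|] := rP p pS.
    have := lipschitz_slope_from L0 LD admq p.1 uK (SL p pS); rewrite -e => h.
    rewrite gerDl mulr_ge0_le0 ?invr_ge0 ?(ltW t0)//.
    have -> : u - u0 = u + (-1) *: u0 by rewrite scaleN1r.
    by rewrite pairingDl pairingZl mulN1r subr_le0.
  apply: le_trans; rewrite lerD2l ler_pM2l ?invr_gt0//.
  apply: le_trans (ler_norm _) _; apply: pairing_norm_le => i; rewrite !mxE; exact: ur.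
have sv : (surface_tension L Phi v < (C + 1)%:E)%E by apply: le_lt_trans (CP v vK) _; rewrite lte_fin ltrDl.
have [nu [invn nul sln]] := nm _ _ sv.
have := specific_free_energy_gtNy invn nul.
case E2 : (specific_free_energy Phi nu) => [s'| |] // _; rewrite lte_fin => s'C.
have t01 : 0 < t < 1 by rewrite t0.
rewrite uv; apply: le_trans (specific_free_energy_convex t01 mul nul inv invn sl sln) _.
rewrite E1 E2 -!EFinM -EFinD lee_fin; move: tb (ler_wpM2l (ltW t0) (ltW s'C)); rewrite !mulrDr mulrBl !mulrN; lra.
Qed.

Notation full := (gradT E [set: I]).

(** A single site has free energy at least -nrm; growing it to the box of side [m0] costs a
    constant, and this one box bounds all specific free energies from below. *)
Lemma surface_tension_ge : exists M : R, forall u, ((- M)%:E <= surface_tension L Phi u)%E.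
Proof.
have [N qN] := q_bounded (box d m0).
pose c := (ln (2 * N%:R + 1) + nrm + nrm) *+ #|` box d m0|.
exists (- ((- nrm - c - err Xi K1 m0) / m0%:R ^+ d)) => u; rewrite opprK.
apply: le_ereal_inf_tmp => _ [mu [inv _ ->]].
have [mul|nlip] := pselect (ae_lipschitz q mu); last first.
  have -> := not_lipschitz_specific d2 m0_gt0 LN Lm0 admA admq maxq pgPsi pgXi Psi0 PhiE nrm0 XiN lipPsi K1_ge0 inv nlip.
  exact: leey.
have [_ h] := specific_free_energyP d2 m0_gt0 Lm0 admq pgPsi pgXi Psi0 PhiE XiN amXi K1_ge0 K1P inv mul.
apply: h => //.
have b0 : 0 \in box d m0 by exact: box0.
have sub : ([fset (0 : I)]%fset `<=` box d m0)%fset by rewrite fsub1set.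
have n0 : [fset (0 : I)]%fset != fset0 by apply/fset0Pn; exists 0; rewrite inE.
have K0 : 0 <= (N%:R : R) by [].
have g := free_energy_grow pgPsi pgXi Psi0 PhiE nrm0 XiN mul n0 sub K0.
apply: le_trans (g _); last first.
  move=> x y xb yb; apply: filterS (ae_lipschitz_bounded x y mul) => phi /le_trans; apply.
  by rewrite ge_max !(le_trans (ler_norm _) (qN _ _ _ _)).
have := free_energy1_ge pgPsi pgXi Psi0 PhiE XiN (ae_lipschitz_incP mul) 0.
by rewrite EFinB -/c; move=> ?; apply: leeD2r.
Qed.

(** * Limits of shift-invariant Lipschitz laws *)

Section limits.
Variables (mu : nat -> gradient_measure R IntegerHeights d) (nu : gradient_measure R IntegerHeights d).
Variables (F : set_system nat) (FF : ProperFilter F).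
Hypothesis mu_nu : forall (D : {fset I}) (B : set cfg), @measurable _ (gradT E [set` D]) B ->
    fine (mu m B) @[m --> F] --> fine (nu B).
Hypothesis mu_inv : forall m, shift_invariant L (mu m).
Hypothesis mul : forall m, ae_lipschitz q (mu m).

Lemma limit_lipschitz : ae_lipschitz q nu.
Proof.
suff H : {ae nu, forall phi : full, forall e : I * I, increment phi e.1 e.2 <= q e.1 e.2}.
  by apply: filterS H => phi H x y; exact: (H (x, y)).
apply: ae_countable => -[x y] /=.
pose B := [set phi : cfg | increment phi x y <= q x y].
have mB : @measurable _ (gradT E [set` [fset x; y]%fset]) B.
  have mi : measurable_fun [set: gradT E [set` [fset x; y]%fset]] (fun phi : gradT E [set` [fset x; y]%fset] => increment phi x y).
    apply: (measurableT_comp (@measurable_hs_incl R IntegerHeights)).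
    by apply: measurable_hs_sub_gradT; rewrite /= !inE eqxx ?orbT.
  have := mi measurableT `]-oo, (q x y)]%classic (measurable_itv _); rewrite setTI.
  by rewrite (_ : _ @^-1` _ = B)//; apply/seteqP; split => phi /=; rewrite in_itv.
have mB' := measurable_gradT_setT mB.
have B1 m : mu m B = 1%E.
  rewrite -(@probability_setT _ _ _ (mu m)); apply: ae_measure_eq => //.
  have [M [mM M0 MP]] := mul m; exists M; split => // phi; apply: contra_notP => nM.
  have phiq : lipschitz_config phi by apply: contrapT => h; apply: nM; exact: MP.
  by have := phiq x y; split.
have nB : nu B = 1%E.
  have nufin := fin_num_measure nu _ mB'.
  rewrite -(fineK nufin); congr EFin; apply: (cvg_unique _ (mu_nu mB)) => //.
  by apply: cvg_near_cst; apply: filterE => m; rewrite B1.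
exists (~` B); split => //; first exact: measurableC.
by rewrite probability_setC// nB subee.
Qed.

Lemma limit_shift_invariant : shift_invariant L nu.
Proof.
move=> l B Ll mB.
have ml : measurable_fun [set: full] (Defs.shift l : full -> full) by exact: measurable_shift.
pose m1 := measure_function_pushforward__canonical__measure_function_Measure nu ml.
apply: (@gradient_measure_unique R IntegerHeights d m1 nu) => //.
  exact: le_lt_trans (probability_le1 nu measurableT) (ltry _).
move=> D C mC; rewrite /m1/= /pushforward.
have mC' : @measurable _ (gradT E [set` translate l D]) (Defs.shift l @^-1` C).
  have mls : measurable_fun [set: gradT E [set` translate l D]] (Defs.shift l : gradT E [set` translate l D] -> gradT E [set` D]).
    by apply: measurable_shift => x /= xD; exact: in_translate.
  by have := mls measurableT _ mC; rewrite setTI.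
have f1 := fin_num_measure nu _ (measurable_gradT_setT mC').
have f2 := fin_num_measure nu _ (measurable_gradT_setT mC).
rewrite -(fineK f1) -(fineK f2); congr EFin; apply: (cvg_unique _ (mu_nu mC')) => //.
rewrite (_ : (fun m => fine (mu m _)) = fun m => fine (mu m C)); first exact: (mu_nu mC).
by apply/funext => m; rewrite mu_inv//; exact: measurable_gradT_setT mC.
Qed.

(** A mean increment is a finite sum over atoms with bounded heights, so it converges along with the
    probabilities. *)
Lemma limit_slope (u : nat -> 'rV[R]_d) (u0 : 'rV[R]_d) : (forall m, has_slope L (mu m) (u m)) ->
  (forall i, u m 0 i @[m --> F] --> u0 0 i) -> has_slope L nu u0.
Proof.
move=> sl uu0; have nul := limit_lipschitz.
split => [x y|x Lx].
  have [N qN] := q_bounded [fset x; y]%fset.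
  by have [] := integral_increment (fset21 x y) qN nul (fset22 x y).
have [N qN] := q_bounded [fset 0; x]%fset.
have h mu' mul' := proj2 (@integral_increment _ 0 N (fset21 0 x) qN mu' mul' x (fset22 0 x)).
rewrite h//; congr EFin.
have c1 : pairing (u m) x @[m --> F] --> (pairing u0 x : R).
  apply: cvg_big => [|i _]; first exact: add_continuous.
  by apply: cvgMl; exact: uu0.
apply: (cvg_unique _ _ c1) => //.
rewrite (_ : (fun m => pairing (u m) x) = fun m => \sum_w weight_of 0 (mu m) w * (pattern_config R (D := [fset 0; x]%fset) (N := N) w x)%:~R).
  apply: cvg_big => [|w _]; first exact: add_continuous.
  by apply: cvgMl; apply: mu_nu; exact: measurable_atom.
apply/funext => m; have [_ /(_ x Lx)] := sl m; rewrite h//.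
by move=> -[].
Qed.

(** By [specific_free_energyP] each [mu m] has free energy at most c * n^d + err n on the box of
    side n, with an error that does not depend on m. In a fixed box this bound passes to [nu] by
    [entropy_sum_lsc]; only then does n tend to infinity. *)
Lemma limit_specific_free_energy (c : R) :
  (forall m, (specific_free_energy Phi (mu m) <= c%:E)%E) -> (specific_free_energy Phi nu <= c%:E)%E.
Proof.
move=> muc; have nul := limit_lipschitz; have nuinv := limit_shift_invariant.
have fe n : (0 < n)%N -> (m0 %| n)%N -> (free_energy Phi (box d n) nu <= (c * n%:R ^+ d + err Xi K1 n)%:E)%E.
  move=> n0 m0n; have b0 : 0 \in box d n by exact: box0.
  have [N qN] := q_bounded (box d n).
  have fe := free_energy_pattern b0 qN.
  rewrite fe// lee_fin; apply: (@entropy_sum_lsc R _ nat F FF (fun m => weight_of 0 (mu m))).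
  - by move=> m w; exact: weight_ge0.
  - by move=> w; apply: mu_nu; exact: measurable_atom.
  - apply: filterE => m.
    have [_ h] := specific_free_energyP d2 m0_gt0 Lm0 admq pgPsi pgXi Psi0 PhiE XiN amXi K1_ge0 K1P (mu_inv m) (mul m).
    have {h} := h n (entropy_sum (weight_of 0 (mu m)) (fun w => fine (ham Phi (box d n) (pattern_config R (D := box d n) (N := N) w)))) n0 m0n.
    rewrite (fe _ (mul m)) => /(_ (lexx _)) /le_trans /(_ (muc m)).
    by rewrite lee_fin ler_pdivrMr ?exprn_gt0 ?ltr0n// lerBlDr.
have [cv _] := specific_free_energyP d2 m0_gt0 Lm0 admq pgPsi pgXi Psi0 PhiE XiN amXi K1_ge0 K1P nuinv nul.
have km : (k * m0)%N @[k --> \oo] --> \oo.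
  by apply/cvgnyPge => B; near=> k; rewrite (@leq_trans k)// ?leq_pmulr//; near: k; exact: nbhs_infty_ge.
have cv' := cvg_comp _ _ km cv.
have er : (c + err Xi K1 (k * m0)%N / (k * m0)%:R ^+ d)%:E @[k --> \oo] --> c%:E.
  apply: cvg_EFin; first exact: nearW.
  rewrite -[X in _ --> X]addr0; apply: cvgD; first exact: cvg_cst.
  exact: (cvg_comp _ _ km (err_small d2 XiN amXi K1_ge0)).
rewrite -(cvg_lim _ cv')// -(cvg_lim _ er)//; apply: lee_lim.
- by apply/cvg_ex; eexists; exact: cv'.
- by apply/cvg_ex; eexists; exact: er.
near=> k; have k0 : (0 < k)%N by near: k; exact: nbhs_infty_gt.
have n0 : (0 < k * m0)%N by rewrite muln_gt0 k0.
have nd : 0 < ((k * m0)%:R ^+ d : R) by rewrite exprn_gt0// ltr0n.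
rewrite /= muleC lee_pdivrMr//; apply: le_trans (fe _ n0 (dvdn_mull _ (dvdnn _))) _.
by rewrite -EFinM lee_fin mulrDl divfK// gt_eqF.
Unshelve. all: by end_near. Qed.

End limits.

Lemma surface_tension_lsc (u0 : 'rV[R]_d) (c : R) :
  (forall r : R, 0 < r -> exists u : 'rV[R]_d, (forall i, `|u 0 i - u0 0 i| <= r) /\ (surface_tension L Phi u < c%:E)%E) ->
  (surface_tension L Phi u0 <= c%:E)%E.
Proof.
move=> H.
have /choice[umu umuP] : forall n : nat, exists umu : 'rV[R]_d * gradient_measure R IntegerHeights d,
    (forall i, `|umu.1 0 i - u0 0 i| <= n.+1%:R^-1) /\
    [/\ shift_invariant L umu.2, ae_lipschitz q umu.2, has_slope L umu.2 umu.1 &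
    (specific_free_energy Phi umu.2 < c%:E)%E].
  move=> n; have [|u [un uc]] := H n.+1%:R^-1; first by rewrite invr_gt0.
  have [mu muP] := near_minimizer d2 m0_gt0 LN Lm0 admA admq maxq pgPsi pgXi Psi0 PhiE nrm0 XiN lipPsi K1_ge0 uc.
  by exists (u, mu).
(* An ultrafilter finer than the filter of tails: bounded sequences converge along it, and the
   convergence of the slopes is kept. *)
have [F [FU oF]] := ultraFilterLemma (eventually_filter : ProperFilter \oo).
have /choice[N NP] : forall v : I, exists N : nat, forall x y, x \in [fset (0 : I); v]%fset ->
    y \in [fset (0 : I); v]%fset -> `|q x y| <= N%:R by move=> v; exact: q_bounded.
have muN n : {ae (umu n).2, forall phi : full, bounded_heights N phi}.
  have [_ [_ mul _ _]] := umuP n; apply: filterS mul => phi phiq v.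
  have := lipschitz_increment phiq (NP v _ _ (fset21 0 v) (fset22 0 v)) (NP v _ _ (fset22 0 v) (fset21 0 v)).
  by rewrite /increment /= -intr_norm [(N v)%:R]pmulrn ler_int; move: (phi v : int) (phi 0 : int) => a b; lia.
have [nu mu_nu] := gradient_measure_limit muN FU.
have inv n : shift_invariant L (umu n).2 by have [_ []] := umuP n.
have lip n : ae_lipschitz q (umu n).2 by have [_ []] := umuP n.
have sl n : has_slope L (umu n).2 (umu n).1 by have [_ []] := umuP n.
have FF : ProperFilter F by exact: ultra_proper.
apply: le_trans (_ : (specific_free_energy Phi nu <= _)%E).
  apply: ereal_inf_lbound; exists nu; split => //; first exact: (limit_shift_invariant FF mu_nu inv).
  apply: (limit_slope FF mu_nu lip sl) => i.
  apply: (cvg_trans (G := (umu m).1 0 i @[m --> \oo])); first by move=> B; exact: oF.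
  apply/cvgrPdist_le => e e0; near=> n; rewrite distrC; apply: le_trans ((umuP n).1 i) _.
  apply: ltW; near: n; exact: (near_infty_natSinv_lt (PosNum e0)).
apply: (limit_specific_free_energy FF mu_nu inv lip) => n.
by have [_ [_ _ _ /ltW]] := umuP n.
Unshelve. all: by end_near. Qed.

End integer_heights.

(** * Topology of slopes and conclusion *)

Section slope_topology.
Context (R : realType) (d : nat).
Implicit Types (b u v : 'rV[R]_d) (S : set 'rV[R]_d).

Lemma nbhs_rowP b S : nbhs b S <->
  exists2 r : R, 0 < r & forall u, (forall i, `|u 0 i - b 0 i| <= r) -> S u.
Proof.
split=> [/nbhs_ballP[e /= e0 eS]|[r r0 rS]].
  exists (e / 2) => [|u ub]; first by rewrite divr_gt0.
  apply: eS; split => // i j; rewrite (ord1 i) /ball /= distrC.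
  by apply: le_lt_trans (ub j) _; rewrite ltr_pdivrMr// ltr_pMr// ltr1n.
apply/nbhs_ballP; exists r => //= u [_ ub]; apply: rS => i.
by have := ub 0 i; rewrite /ball /= distrC => /ltW.
Qed.

Context (L : set (site d)) (q : site d -> site d -> R).

Lemma closed_lipschitz_slope : closed [set u | lipschitz_slope L q u].
Proof.
move=> u uK x y Lx Ly; rewrite -pairingN -pairingD; apply/ler_addgt0Pr => e e0.
pose n := \sum_i `|((y - x) 0 i)%:~R : R|; have n1 : 0 < n + 1 by rewrite ltr_wpDl// sumr_ge0.
have /uK[v [vK vu]] : nbhs u [set v : 'rV[R]_d | forall i, `|v 0 i - u 0 i| <= e / (n + 1)].
  by apply/nbhs_rowP; exists (e / (n + 1)); first exact: divr_gt0.
have h : `|pairing (u - v) (y - x)| <= e / (n + 1) * n.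
  by apply: pairing_norm_le => i; rewrite !mxE distrC; exact: vu.
have -> : u = v + (u - v) by rewrite addrC subrK.
rewrite pairingDl; apply: lerD; first by rewrite pairingD pairingN; exact: vK.
apply: le_trans (ler_norm _) (le_trans h _).
by rewrite mulrAC ler_pdivrMr// ler_pM2l// lerDl.
Qed.

End slope_topology.

Theorem theorem4p13 (R : realType) (d : nat) (k : height_kind)
    (L : set (site d)) (A : set {fset site d}) (q : site d -> site d -> R)
    (Phi Psi Xi : potential R k d) :
  (2 <= d)%N ->
  full_rank_sublattice L ->
  strong_interaction L A q Psi ->
  weak_interaction L Xi ->
  (forall Lambda phi, Phi Lambda phi = (Psi Lambda phi + Xi Lambda phi)%E) ->
  [/\ U_Phi L Phi = U_q L q,
      k = RealHeights ->
        forall b : 'rV[R]_d, (closure (U_Phi L Phi) `\` U_Phi L Phi) b ->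
          surface_tension L Phi u @[u --> b] --> +oo%E
    & k = IntegerHeights ->
        (exists M : R, forall u, closure (U_Phi L Phi) u ->
           (`|surface_tension L Phi u| <= M%:E)%E) /\
        {within closure (U_Phi L Phi), continuous (surface_tension L Phi)}].
Proof.
move=> d2 /sublattice_props[L0 LD LN [m0 m0_gt0 Lm0]] [pgPsi Psi0 rangePsi [[admA admq maxq] lipPsi] kPsi].
move=> [pgXi normXi amXi] PhiE.
pose nrm := fine (interaction_norm Xi).
pose phi0 : config (heights R k) d := fun=> hs_zero (heights R k).
have norm_phi0 : (\esum_(G in [set G : {fset site d} | (0 : site d)%R \in G]) `|Xi G phi0| <= interaction_norm Xi)%E.
  by apply: ereal_sup_ubound; exists 0, phi0.
have norm_ge0 : (0 <= interaction_norm Xi)%E by apply: le_trans norm_phi0; exact: esum_ge0.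
have nrm0 : 0 <= nrm by exact: fine_ge0.
have XiN x phi : (\esum_(G in [set G : {fset site d} | x \in G]) `|Xi G phi| <= nrm%:E)%E.
  by rewrite fineK ?ge0_fin_numE//; apply: ereal_sup_ubound; exists x, phi.
have [K1 K1_ge0 K1P] := unit_step_bounded m0_gt0 Lm0 admq.
have fin_slope := surface_tension_lt_slope d2 m0_gt0 LD LN Lm0 admA admq maxq pgPsi pgXi Psi0 PhiE nrm0 XiN lipPsi K1_ge0.
have UqE : U_q L q = [set u | lipschitz_slope L q u]° by [].
have closureK : closure (U_q L q) `<=` [set u | lipschitz_slope L q u].
  move=> u uU; apply: closed_lipschitz_slope; apply: closureS uU; exact: interior_subset.
(* Finite surface tension forces a Lipschitz slope, which gives one inclusion of interiors. As [U_q]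
   is open, the other reduces to finiteness on it. *)
have UE : U_q L q `<=` [set u | (surface_tension L Phi u < +oo)%E] -> U_Phi L Phi = U_q L q.
  move=> sub; apply/seteqP; split; first by apply: interiorS => u /fin_slope.
  by rewrite -open_subsetE//; exact: open_interior.
destruct k.
  have [C [C0 CP]] := integer_free_energy_bound d2 m0_gt0 L0 LD LN Lm0 admq pgPsi pgXi Psi0 PhiE nrm0 XiN amXi lipPsi rangePsi kPsi K1_ge0 K1P.
  have [M MP] := surface_tension_ge d2 m0_gt0 LN Lm0 admA admq maxq pgPsi pgXi Psi0 PhiE nrm0 XiN amXi lipPsi K1_ge0 K1P.
  have {}UE : U_Phi L Phi = U_q L q.
    by apply: UE => u /interior_subset /CP h; apply: le_lt_trans h (ltry _).
  have bound u : lipschitz_slope L q u -> (`|surface_tension L Phi u| <= (Num.max M C)%:E)%E.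
    move=> /CP h1; have h2 := MP u; move: h1 h2; case: (surface_tension L Phi u) => // s.
    by rewrite !lee_fin ler_norml => h1 h2; rewrite lerNl !le_max; apply/andP; split; apply/orP; [left; lra|right].
  rewrite UE; split => // _; split.
    by exists (Num.max M C) => u /closureK; exact: bound.
  apply/subspace_continuousP => u0 /closureK u0K.
  have [s sE] : exists s : R, surface_tension L Phi u0 = s%:E.
    by have := bound u0 u0K; case: (surface_tension L Phi u0) => // s _; exists s.
  have finK u : lipschitz_slope L q u -> surface_tension L Phi u \is a fin_num.
    by move=> /bound; case: (surface_tension L Phi u).
  rewrite /from_subspace sE; apply/fine_cvgP; split.
    by rewrite near_withinE; apply: nearW => u /closureK; exact: finK.
  apply/cvgrPdist_le => e e0.
  have [|r1 r10 r1P] := surface_tension_usc d2 m0_gt0 L0 LD LN Lm0 admA admq maxq pgPsi pgXi Psi0 PhiE nrm0 XiN amXi lipPsi rangePsi kPsi K1_ge0 K1P (u0 := u0) (a := s + e) u0K.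
    by rewrite sE lte_fin ltrDl.
  (* If no radius worked, slopes arbitrarily close to u0 would have surface tension below s - e, and
     [surface_tension_lsc] would carry this bound to u0 itself. *)
  have [r2 r20 r2P] : exists2 r : R, 0 < r & forall u : 'rV[R]_d, (forall i, `|u 0 i - u0 0 i| <= r) ->
      ((s - e)%:E <= surface_tension L Phi u)%E.
    apply: contrapT => H.
    have := surface_tension_lsc d2 m0_gt0 LN Lm0 admA admq maxq pgPsi pgXi Psi0 PhiE nrm0 XiN amXi lipPsi rangePsi K1_ge0 K1P (u0 := u0) (c := s - e).
    rewrite sE lee_fin; apply/not_implyP; split; last by apply/negP; rewrite -ltNge; lra.
    move=> r r0; apply: contrapT => H'; apply: H; exists r => // u ur; rewrite leNgt; apply/negP => lt.
    by apply: H'; exists u.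
  apply/nbhs_rowP; exists (Num.min r1 r2); first by rewrite lt_min r10.
  move=> u ur /closureK uK /=.
  have u1 i : `|u 0 i - u0 0 i| <= r1 by apply: le_trans (ur i) _; rewrite ge_min lexx.
  have u2 i : `|u 0 i - u0 0 i| <= r2 by apply: le_trans (ur i) _; rewrite ge_min lexx orbT.
  have := r1P u uK u1; have := r2P u u2; have := finK u uK.
  by case: (surface_tension L Phi u) => // t _; rewrite !lee_fin ler_norml/= => h1 h2; apply/andP; split; lra.
have {}UE : U_Phi L Phi = U_q L q.
  apply: UE => u; rewrite UqE => /nbhs_rowP[r r0 rK] /=.
  exact: (real_surface_tension_lt d2 m0_gt0 L0 LD LN Lm0 admA admq maxq pgPsi pgXi Psi0 PhiE XiN amXi kPsi K1_ge0 K1P r0 rK).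
rewrite UE; split => // _ b [_ bU].
apply: (real_surface_tension_boundary d2 m0_gt0 LD LN Lm0 admA admq maxq pgPsi pgXi Psi0 PhiE nrm0 XiN amXi lipPsi K1_ge0 K1P).
(* A ball around b consisting of Lipschitz slopes would put b into the interior [U_q]. *)
move=> rho rho0; apply: contrapT => H; apply: bU; rewrite UqE; apply/nbhs_rowP; exists rho => // v vb.
by apply: contrapT => nv; apply: H; exists v.
Qed.
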